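(* Let $(\Lambda,d)$ be an ordinal graph satisfying condition (C): for every $\alpha\in\mathrm{Ord}$, $f\in\Lambda^{\omega^\alpha}$ and $g\in\Lambda$ such that $r(f)$ is $\alpha$-regular, $gf=f$ implies $d(g)=0$. Then for each $\alpha\in\mathrm{Ord}$ the following hold: (1) the $*$-homomorphism $\rho_\alpha:\mathcal{O}(\Lambda_\alpha)\to\mathcal{O}(\Lambda)$ is injective; (2) $J_\alpha$ is the smallest (closed two-sided) ideal in $\mathcal{O}(\Lambda_\alpha)$ containing $\{T_v: v\in\Lambda_0,\ v\text{ is }\alpha\text{-regular}\}$; (3) $(\psi_\alpha,\rho_\alpha^{\alpha+1})$ is a covariant representation of $X_\alpha$ in $\mathcal{O}(\Lambda_{\alpha+1})$; (4) the induced $*$-homomorphism $\psi_\alpha\times\rho_\alpha^{\alpha+1}:\mathcal{O}(X_\alpha)\to\mathcal{O}(\Lambda_{\alpha+1})$ is an isomorphism.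
   Context: **Ordinal graphs.** $\mathrm{Ord}$ is the class of ordinals with usual ordinal arithmetic. A category is identified with its collection of morphisms; $r(e),s(e)$ are the identity morphisms at the codomain and domain of $e$, and $ef$ is defined iff $s(e)=r(f)$. An ordinal graph is a pair $(\Lambda,d)$ with $\Lambda$ a small category and $d:\Lambda\to\mathrm{Ord}$ a functor ($d(ef)=d(e)+d(f)$) such that for every $e\in\Lambda$ and $\alpha\le d(e)$ there are unique $f,g\in\Lambda$ with $d(f)=\alpha$ and $e=fg$; write $f=e(\alpha)$, $g=e(\alpha)^{-1}e=f^{-1}e$. Put $\Lambda^\alpha=\{f:d(f)=\alpha\}$ and $\Lambda_\alpha=\{f:d(f)<\omega^\alpha\}$ (again an ordinal graph). $\Lambda_0=\Lambda^0$ is the set of vertices (identity morphisms). For $S\subseteq\Lambda$ and a vertex $v$: $vS=\{f\in S:r(f)=v\}$, $Sv=\{f\in S:s(f)=v\}$; $eS=\{ef:f\in S,\ r(f)=s(e)\}$. **Regularity.** $v\in\Lambda_0$ is $\alpha$-source-regular if for every $e\in v\Lambda_\alpha$ there exists $f\in s(e)\Lambda^{\omega^\alpha}$; $\alpha$-row-finite if $v\Lambda^{\omega^\alpha}$ is finite; $\alpha$-regular if both. **Algebra.** $\mathcal{O}(\Lambda)$ is the universal $C^*$-algebra generated by partial isometries $T_e$, for $e\in\Lambda$ with $d(e)$ a power $\omega^\alpha$ or $e\in\Lambda_0$, subject to: (i) $T_e^*T_e=T_{s(e)}$; (ii) $T_eT_f=T_{ef}$ if $s(e)=r(f)$ and $d(e)<d(f)$;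 (iii) $T_e^*T_f=0$ if $e\Lambda\cap f\Lambda=\emptyset$; (iv) $T_v=\sum_{e\in v\Lambda^{\omega^\alpha}}T_eT_e^*$ if $v$ is $\alpha$-regular. For arbitrary $e\in\Lambda$, $e=e_1\cdots e_n$ with each $d(e_i)$ a power of $\omega$ (or $e$ is a vertex) and $T_e=T_{e_1}\cdots T_{e_n}$, so $T_eT_f=T_{ef}$ whenever $s(e)=r(f)$. The same notation $T_e$ is used for the generators of each $\mathcal{O}(\Lambda_\alpha)$. For $\alpha\le\beta$ there are $*$-homomorphisms $\rho_\alpha^\beta:\mathcal{O}(\Lambda_\alpha)\to\mathcal{O}(\Lambda_\beta)$ and $\rho_\alpha:\mathcal{O}(\Lambda_\alpha)\to\mathcal{O}(\Lambda)$ with $T_e\mapsto T_e$. **Correspondence $X_\alpha$.** $X_\alpha$ is the Hilbert $\mathcal{O}(\Lambda_\alpha)$-module completing $X_\alpha^\circ=\{x\in c_c(\Lambda^{\omega^\alpha},\mathcal{O}(\Lambda_\alpha)): T_{s(e)}x(e)=x(e)\ \forall e\}$ (finitely supported functions) with $(x\cdot a)(e)=x(e)a$ and $\langle x,y\rangle=\sum_{e}x(e)^*y(e)$. For $e\in\Lambda^{\omega^\alpha}$, $\delta_e\in X_\alpha^\circ$ takes the value $T_{s(e)}$ at $e$ and $0$ elsewhere. The left action $\varphi_\alpha:\mathcal{O}(\Lambda_\alpha)\to\mathcal{L}(X_\alpha)$ is the $*$-homomorphism with $\varphi_\alpha(T_g)\delta_e=\delta_{ge}$ if $s(g)=r(e)$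 and $0$ otherwise ($g\in\Lambda_\alpha$). $J_\alpha=(\ker\varphi_\alpha)^\perp\cap\varphi_\alpha^{-1}(\mathcal{K}(X_\alpha))$ is the Katsura ideal. $\psi_\alpha:X_\alpha\to\mathcal{O}(\Lambda_{\alpha+1})$ is the continuous linear map with $\psi_\alpha(x)=\sum_{e\in\Lambda^{\omega^\alpha}}T_e\,\rho_\alpha^{\alpha+1}(x(e))$ for $x\in X_\alpha^\circ$. **Representations.** A representation of a $C^*$-correspondence $(X,\varphi)$ over $A$ in $B$ is $(\psi,\pi)$ with $\psi:X\to B$ linear, $\pi:A\to B$ a $*$-homomorphism, $\psi(x)\pi(a)=\psi(x\cdot a)$, $\pi(a)\psi(x)=\psi(\varphi(a)x)$, $\psi(x)^*\psi(y)=\pi(\langle x,y\rangle)$. It induces $(\psi,\pi)^{(1)}:\mathcal{K}(X)\to B$, $\theta_{x,y}\mapsto\psi(x)\psi(y)^*$. It is covariant if $(\psi,\pi)^{(1)}(\varphi(a))=\pi(a)$ for all $a$ in the Katsura ideal $J_X=(\ker\varphi)^\perp\cap\varphi^{-1}(\mathcal{K}(X))$. $\mathcal{O}(X)$ is the Cuntz-Pimsner algebra, universal for covariant representations, and $\psi\times\pi:\mathcal{O}(X)\to B$ is the $*$-homomorphism induced by a covariant representation $(\psi,\pi)$. *)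

(* Defs.v *)
From HB Require Import structures.
From mathcomp Require Import all_boot all_order all_algebra.
From mathcomp Require Import complex.
From mathcomp Require Import all_classical all_reals all_analysis.

Set Implicit Arguments.
Unset Strict Implicit.
Unset Printing Implicit Defensive.

Import Order.TTheory GRing.Theory Num.Theory.
Import numFieldNormedType.Exports.

Local Open Scope classical_set_scope.
Local Open Scope ring_scope.
Local Open Scope complex_scope.

(* Ordinals are well-founded trees: [osup1 f] is the least ordinal strictly
   greater than every [f i].  Two trees denote the same ordinal when each is
   [<=] the other, so equality of ordinals is [oeq] and not Leibniz equality. *)

Inductive ord : Type := osup1 (I : Type) (f : I -> ord).

Definition oidx (a : ord) : Type := let: osup1 J _ := a in J.
Definition osub (a : ord) : oidx a -> ord :=
  match a return oidx a -> ord with osup1 _ f => f end.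

Fixpoint ole (a b : ord) {struct a} : Prop :=
  match a, b with osup1 K f, osup1 J g => forall i, exists j, ole (f i) (g j) end.
Definition olt (a b : ord) : Prop := exists j : oidx b, ole a (osub j).
Definition oeq (a b : ord) : Prop := ole a b /\ ole b a.

Definition ozero : ord := osup1 (fun i : void => match i with end).
Definition osucc (a : ord) : ord := osup1 (fun _ : unit => a).
Fixpoint onat (n : nat) : ord := if n is m.+1 then osucc (onat m) else ozero.
Definition oomega : ord := osup1 onat.

(* Least upper bound of a family. *)
Definition olub (I : Type) (F : I -> ord) : ord :=
  osup1 (fun p : {i : I & oidx (F i)} => osub (projT2 p)).

Fixpoint oadd (a b : ord) {struct b} : ord :=
  match b with osup1 J g =>
    osup1 (fun k : oidx a + J =>
      match k with inl i => osub i | inr j => oadd a (g j) end)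
  end.

Fixpoint omul (a b : ord) {struct b} : ord :=
  match b with osup1 J g => olub (fun j : J => oadd (omul a (g j)) a) end.

(* [opow b] is omega ^ b, i.e. max (1, sup_(c < b) omega ^ c * omega). *)
Fixpoint opow (b : ord) : ord :=
  match b with osup1 J g =>
    olub (fun k : option J =>
      if k is Some j then omul (opow (g j)) oomega else osucc ozero)
  end.

Lemma ole_refl a : ole a a.
Proof. by elim: a => I f IH /= i; exists i. Qed.

Lemma ole_trans b a c : ole a b -> ole b c -> ole a c.
Proof.
elim: a b c => I f IH [J g] [K h] /= ab bc i.
have [j fg] := ab i; have [k gh] := bc j; exists k; exact: IH fg gh.
Qed.

Lemma oleP a b : ole a b <-> forall x, olt x a -> olt x b.
Proof.
case: a b => [I f] [J g]; split=> [ab x [/= i xi]|ab /= i].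
  by have [j ij] := ab i; exists j; exact: ole_trans xi ij.
have [|j fj] := ab (f i); last by exists j.
by exists i; exact: ole_refl.
Qed.

Lemma olt_ole_trans b a c : olt a b -> ole b c -> olt a c.
Proof. by move=> ab /oleP; apply. Qed.

Lemma ole_olt_trans b a c : ole a b -> olt b c -> olt a c.
Proof. by move=> ab [j bj]; exists j; exact: ole_trans ab bj. Qed.

Lemma olt_sub a (i : oidx a) : olt (osub i) a.
Proof. by exists i; exact: ole_refl. Qed.

Lemma oltW a b : olt a b -> ole a b.
Proof.
elim: a b => I f IH b [j fj]; apply/oleP => x [/= i xi].
have: olt (f i) b.
  suff: ole (f i) (osub j) by move=> ?; exists j.
  by apply: IH; apply: olt_ole_trans fj; exact: (@olt_sub (osup1 f) i).
exact: ole_olt_trans.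
Qed.

Lemma olt_irr a : ~ olt a a.
Proof.
elim: a => I f IH [i fi]; apply: (IH i); apply: olt_ole_trans fi.
exact: (@olt_sub (osup1 f) i).
Qed.

Lemma ole_total a b : ole a b \/ olt b a.
Proof.
elim: a b => I f IH b; have [|/existsNP[i ni]] := pselect (forall i, olt (f i) b).
  by move=> h; left; apply/oleP => x [/= i xi]; exact: ole_olt_trans xi (h i).
right; exists i => /=; apply/oleP => x [j xj]; apply: ole_olt_trans xj _.
by have [h|//] := IH i (osub j); case: ni; exists j.
Qed.

Lemma ole0 a : ole ozero a.
Proof. by apply/oleP => x [[]]. Qed.

Lemma olt_lub (I : Type) (F : I -> ord) x :
  olt x (olub F) <-> exists i, olt x (F i).
Proof.
split=> [[[i k] /= xk]|[i [k xk]]]; first by exists i; exists k.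
by exists (existT _ i k).
Qed.

Lemma ole_add2l a b c : ole b c -> ole (oadd a b) (oadd a c).
Proof.
elim: b c => J g IH [K h] /= gh [i|j]; first by exists (inl i); exact: ole_refl.
by have [k gk] := gh j; exists (inr k); exact: IH.
Qed.

Lemma olt_add a b x :
  olt x (oadd a b) <-> olt x a \/ exists2 y, olt y b & ole x (oadd a y).
Proof.
case: b => J g; split=> [[[i|j] /= h]|[[i h]|[y [/= j yj] xy]]].
- by left; exists i.
- by right; exists (g j) => //; exact: (@olt_sub (osup1 g) j).
- by exists (inl i).
exists (inr j) => /=; apply: ole_trans xy _.
exact: ole_add2l.
Qed.

Arguments oadd : simpl never.
Arguments omul : simpl never.
Arguments opow : simpl never.

Lemma ole_addr a b : ole a (oadd a b).
Proof. by apply/oleP => x xa; apply/olt_add; left. Qed.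

Lemma ole_addl a b : ole b (oadd a b).
Proof.
elim: b => J g IH; apply/oleP => x [/= j xj]; apply/olt_add; right.
exists (g j); first exact: (@olt_sub (osup1 g) j).
exact: ole_trans xj (IH j).
Qed.

Lemma olt_add2l a b c : olt b c -> olt (oadd a b) (oadd a c).
Proof. by move=> bc; apply/olt_add; right; exists b => //; exact: ole_refl. Qed.

Lemma ole_add a a' b b' : ole a a' -> ole b b' -> ole (oadd a b) (oadd a' b').
Proof.
move=> aa'; elim: b b' => J g IH b' bb'; apply/oleP => x /olt_add[xa|].
  by apply/olt_add; left; exact: olt_ole_trans xa aa'.
move=> [y [/= j yj] xy]; apply/olt_add; right; exists (g j).
  by apply: olt_ole_trans bb'; exact: (@olt_sub (osup1 g) j).
apply: (ole_trans xy); apply: (@ole_trans (oadd a (g j))); last first.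
  exact: IH (ole_refl _).
exact: ole_add2l.
Qed.

Lemma oaddA a b c : ole (oadd a (oadd b c)) (oadd (oadd a b) c).
Proof.
elim: c => J g IH; apply/oleP => x /olt_add[xa|[y /olt_add[yb|]]].
- move=> *; apply/olt_add; left; apply: olt_ole_trans xa (ole_addr _ _).
- move=> xy; apply/olt_add; left; exact: ole_olt_trans xy (olt_add2l _ yb).
move=> [z [/= j zj] yz] xy; apply/olt_add; right.
exists (g j); first exact: (@olt_sub (osup1 g) j).
apply: ole_trans xy (ole_trans _ (IH j)).
apply: ole_add; first exact: ole_refl.
by apply: ole_trans yz _; apply: ole_add => //; exact: ole_refl.
Qed.

Lemma oadd_idem a : oeq a (oadd a a) -> oeq a ozero.
Proof.
move=> [_ aa]; split; last exact: ole0.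
apply/oleP => x xa; exfalso; apply: (@olt_irr (oadd a x)).
by apply: olt_ole_trans (olt_add2l a xa) (ole_trans aa (ole_addr _ _)).
Qed.

Lemma omulS a n : oeq (omul a (onat n.+1)) (oadd (omul a (onat n)) a).
Proof.
by split; apply/oleP => x; [move=> /olt_lub[]|move=> h; apply/olt_lub; exists tt].
Qed.

Lemma omulD c n m :
  ole (oadd (omul c (onat n)) (omul c (onat m))) (omul c (onat (n + m))).
Proof.
elim: m => [|m IH].
  rewrite addn0; apply/oleP => x /olt_add[//|[y]].
  by move=> /olt_lub[[]].
rewrite addnS.
have [h1 _] := omulS c m; have [_ h2] := omulS c (n + m).
apply: ole_trans h2; apply: (ole_trans (ole_add (ole_refl _) h1)).
apply: (ole_trans (oaddA _ _ _)).
exact: ole_add IH (ole_refl _).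
Qed.

Lemma olt_mul_omega c x :
  olt x (omul c oomega) <-> exists n, olt x (omul c (onat n)).
Proof.
split=> [/olt_lub[n xn]|[n xn]].
  by exists n.+1; apply: olt_ole_trans xn (proj2 (omulS c n)).
apply/olt_lub; exists n; apply: olt_ole_trans xn (ole_addr _ _).
Qed.

Lemma omul_omega_add c x y :
  olt x (omul c oomega) -> olt y (omul c oomega) ->
  olt (oadd x y) (omul c oomega).
Proof.
move=> /olt_mul_omega[n xn] /olt_mul_omega[m ym]; apply/olt_mul_omega.
exists (n + m)%N; apply: olt_ole_trans (omulD c n m).
apply: ole_olt_trans (olt_add2l _ ym).
by apply: ole_add (oltW xn) (ole_refl _).
Qed.

Lemma omul_omega_mono c c' : ole c c' -> ole (omul c oomega) (omul c' oomega).
Proof.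
move=> cc'; apply/oleP => x /olt_mul_omega[n xn]; apply/olt_mul_omega; exists n.
apply: olt_ole_trans xn _; elim: n => [|n IH].
  by apply/oleP => y /olt_lub[[]].
apply: (ole_trans (proj1 (omulS _ _))); apply: ole_trans (proj2 (omulS _ _)).
exact: ole_add.
Qed.

Lemma opow_gt0 a : olt ozero (opow a).
Proof.
by case: a => J g; apply/olt_lub; exists None; exists tt; exact: ole_refl.
Qed.

Lemma opow_add a x y : olt x (opow a) -> olt y (opow a) -> olt (oadd x y) (opow a).
Proof.
case: a => J g /olt_lub[kx xk] /olt_lub[ky yk]; apply/olt_lub.
have lt1 z : olt z (osucc ozero) -> ole z ozero by case.
have add0 z w : ole w ozero -> ole (oadd z w) z.
  move=> w0; apply: (ole_trans (ole_add (ole_refl _) w0)).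
  by apply/oleP => u /olt_add[//|[? [[]]]].
have add0l z w : ole z ozero -> ole (oadd z w) w.
  move=> z0; elim: w => K h IH; apply/oleP => u /olt_add[uz|].
    by have [[]] := olt_ole_trans uz z0.
  move=> [v [/= k vk] uv]; exists k => /=; apply: (ole_trans uv).
  exact: ole_trans (ole_add (ole_refl _) vk) (IH k).
case: ky yk => [j|] yk; last first.
  by exists kx; apply: ole_olt_trans xk; exact/add0/lt1.
case: kx xk => [i|] xk; last first.
  by exists (Some j); apply: ole_olt_trans yk; exact/add0l/lt1.
have [h|/oltW h] := ole_total (opow (g i)) (opow (g j)).
  exists (Some j); apply: omul_omega_add => //.
  exact: olt_ole_trans xk (omul_omega_mono h).
exists (Some i); apply: omul_omega_add => //.
exact: olt_ole_trans yk (omul_omega_mono h).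
Qed.

Lemma opow_succ a : olt (opow a) (opow (osucc a)).
Proof.
apply/olt_lub; exists (Some tt); apply/olt_mul_omega; exists 2%N.
apply: olt_ole_trans (proj2 (omulS _ _)); apply/olt_add; right.
exists ozero; first exact: opow_gt0.
apply: ole_trans (ole_addr _ _); apply: ole_trans (proj2 (omulS _ _)).
exact: ole_addl.
Qed.

Lemma oadd_absorb x a : olt x (opow a) -> oeq (oadd x (opow a)) (opow a).
Proof.
move=> xa; split; last exact: ole_addl.
apply/oleP => y /olt_add[yx|[z za yz]].
  exact: olt_ole_trans yx (oltW xa).
exact: ole_olt_trans yz (opow_add xa za).
Qed.

(* A small category given by its morphisms: objects are the identity
   morphisms, i.e. the fixed points of [rng] (equivalently of [src]).
   [comp e f] is meaningful only when [src e = rng f]. *)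

Record ograph := OGraph {
  mor :> choiceType;
  rng : mor -> mor;
  src : mor -> mor;
  comp : mor -> mor -> mor;
  deg : mor -> ord;
  rng_src : forall e, rng (src e) = src e;
  src_rng : forall e, src (rng e) = rng e;
  rng_comp : forall e f, src e = rng f -> rng (comp e f) = rng e;
  src_comp : forall e f, src e = rng f -> src (comp e f) = src f;
  comp_rng : forall e, comp (rng e) e = e;
  comp_src : forall e, comp e (src e) = e;
  compA : forall e f g, src e = rng f -> src f = rng g ->
    comp e (comp f g) = comp (comp e f) g;
  deg_comp : forall e f, src e = rng f ->
    oeq (deg (comp e f)) (oadd (deg e) (deg f));
  deg_factor : forall e a, ole a (deg e) ->
    exists! p : mor * mor,
      [/\ src p.1 = rng p.2, e = comp p.1 p.2 & oeq (deg p.1) a]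
}.

Section OrdinalGraph.
Variable L : ograph.
Implicit Types (e f g v : L) (a : ord).

Definition is_vertex v : Prop := rng v = v.

Definition pow_edges a : set L := [set f | oeq (deg f) (opow a)].

Definition below a : set L := [set f | olt (deg f) (opow a)].

Definition source_regular a v : Prop :=
  forall e, rng e = v -> below a e ->
  exists f, rng f = src e /\ pow_edges a f.

Definition row_finite a v : Prop :=
  finite_set [set f | rng f = v /\ pow_edges a f].

Definition regular a v : Prop :=
  [/\ is_vertex v, source_regular a v & row_finite a v].

Definition condition_C : Prop :=
  forall a f g, pow_edges a f -> regular a (rng f) ->
  src g = rng f -> comp g f = f -> oeq (deg g) ozero.

Definition extensions e : set L :=
  [set h | exists2 g, src e = rng g & h = comp e g].

Definition generator e : Prop := is_vertex e \/ exists a, pow_edges a e.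

Lemma deg_src e : oeq (deg (src e)) ozero.
Proof.
have ss : src (src e) = rng (src e) by rewrite -{1}(rng_src e) src_rng.
apply: oadd_idem; have := deg_comp ss.
by have -> : comp (src e) (src e) = src e by rewrite -{1}(rng_src e) comp_rng.
Qed.

Lemma src_below a e : src e \in below a.
Proof. by rewrite inE; exact: ole_olt_trans (deg_src e).1 (opow_gt0 a). Qed.

Lemma rng_below a e : rng e \in below a.
Proof. by rewrite -src_rng src_below. Qed.

Lemma comp_below a e f : src e = rng f ->
  e \in below a -> f \in below a -> comp e f \in below a.
Proof.
rewrite !inE => ef ea fa; apply: ole_olt_trans (deg_comp ef).1 _.
exact: opow_add.
Qed.

(* The full subgraph of morphisms of degree < omega ^ a.  The default value of
   [insubd] is reached only by [comp] on non-composable pairs. *)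
Section Lower.
Variable a : ord.

Let M := {e : L | e \in below a}.
Implicit Types x y z : M.

Let lrng x : M := insubd x (rng (val x)).
Let lsrc x : M := insubd x (src (val x)).
Let lcomp x y : M := insubd x (comp (val x) (val y)).
Let ldeg x : ord := deg (val x).

Let val_lrng x : val (lrng x) = rng (val x).
Proof. by rewrite val_insubd rng_below. Qed.

Let val_lsrc x : val (lsrc x) = src (val x).
Proof. by rewrite val_insubd src_below. Qed.

Let lower_composable x y : lsrc x = lrng y -> src (val x) = rng (val y).
Proof. by move/(congr1 val); rewrite val_lrng val_lsrc. Qed.

Let val_lcomp x y : lsrc x = lrng y -> val (lcomp x y) = comp (val x) (val y).
Proof.
move/lower_composable => xy; rewrite val_insubd comp_below//; exact: valP.
Qed.

Let lrng_src x : lrng (lsrc x) = lsrc x.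
Proof. by apply: val_inj; rewrite val_lrng !val_lsrc rng_src. Qed.

Let lsrc_rng x : lsrc (lrng x) = lrng x.
Proof. by apply: val_inj; rewrite val_lsrc !val_lrng src_rng. Qed.

Let lrng_comp x y : lsrc x = lrng y -> lrng (lcomp x y) = lrng x.
Proof.
move=> xy; apply: val_inj; rewrite !val_lrng val_lcomp// rng_comp//.
exact: lower_composable.
Qed.

Let lsrc_comp x y : lsrc x = lrng y -> lsrc (lcomp x y) = lsrc y.
Proof.
move=> xy; apply: val_inj; rewrite !val_lsrc val_lcomp// src_comp//.
exact: lower_composable.
Qed.

Let lcomp_rng x : lcomp (lrng x) x = x.
Proof. by apply: val_inj; rewrite val_lcomp// val_lrng comp_rng. Qed.

Let lcomp_src x : lcomp x (lsrc x) = x.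
Proof. by apply: val_inj; rewrite val_lcomp// val_lsrc comp_src. Qed.

Let lcompA x y z : lsrc x = lrng y -> lsrc y = lrng z ->
  lcomp x (lcomp y z) = lcomp (lcomp x y) z.
Proof.
move=> xy yz; apply: val_inj.
rewrite (@val_lcomp x (lcomp y z)) ?lrng_comp// val_lcomp//.
rewrite (@val_lcomp (lcomp x y) z) ?lsrc_comp// val_lcomp//.
by apply: compA; exact: lower_composable.
Qed.

Let ldeg_comp x y : lsrc x = lrng y ->
  oeq (ldeg (lcomp x y)) (oadd (ldeg x) (ldeg y)).
Proof.
move=> xy; rewrite /ldeg val_lcomp//; apply: deg_comp; exact: lower_composable.
Qed.

Let ldeg_factor x b : ole b (ldeg x) -> exists! p : M * M,
  [/\ lsrc p.1 = lrng p.2, x = lcomp p.1 p.2 & oeq (ldeg p.1) b].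
Proof.
move=> bx; have [[e f] [/= [ef xE eb] U]] := deg_factor bx.
have {}xE : val x = comp e f by [].
have xa : below a (val x) by have := valP x; rewrite inE.
have ea : e \in below a.
  by rewrite inE; apply: ole_olt_trans xa; exact: ole_trans eb.1 bx.
have fa : f \in below a.
  rewrite inE; apply: ole_olt_trans xa; rewrite xE.
  exact: ole_trans (ole_addl _ _) (deg_comp ef).2.
exists (exist _ e ea, exist _ f fa); split => /=.
  have ef' : lsrc (exist _ e ea) = lrng (exist _ f fa).
    by apply: val_inj; rewrite val_lsrc val_lrng.
  by split => //; apply: val_inj; rewrite val_lcomp.
case=> y z /= [yz xyz yb].
have h : [/\ src (val y) = rng (val z),
    val x = comp (val y) (val z) & oeq (deg (val y)) b].
  by split => //; [exact: lower_composable | rewrite xyz val_lcomp].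
by have [eE fE] := U (val y, val z) h; congr pair; exact: val_inj.
Qed.

Definition lower : ograph :=
  OGraph lrng_src lsrc_rng lrng_comp lsrc_comp lcomp_rng lcomp_src lcompA
    ldeg_comp ldeg_factor.

End Lower.
End OrdinalGraph.

Arguments pow_edges : clear implicits.
Arguments below : clear implicits.

Definition lval (L : ograph) (a : ord) (e : lower L a) : L := val e.

Definition edge (L : ograph) (a : ord) := {f : L | f \in pow_edges L a}.

Section Edge.
Variables (L : ograph) (a : ord).

Lemma edge_succ_below (f : edge L a) : val f \in below L (osucc a).
Proof.
rewrite inE; have := valP f; rewrite inE => -[fa _].
exact: ole_olt_trans fa (opow_succ a).
Qed.

Lemma edge_mul_subproof (g : lower L a) (f : edge L a) :
  src (lval g) = rng (val f) -> comp (lval g) (val f) \in pow_edges L a.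
Proof.
move=> gf; rewrite inE; have := valP f; rewrite inE => -[fa af].
have := valP g; rewrite inE => ga.
have [h1 h2] := deg_comp gf; have [k1 k2] := oadd_absorb ga; split.
  exact: ole_trans h1 (ole_trans (ole_add2l _ fa) k1).
exact: ole_trans k2 (ole_trans (ole_add2l _ af) h2).
Qed.

Definition edge_up (f : edge L a) : lower L (osucc a) :=
  exist _ (val f) (edge_succ_below f).

Definition edge_src (f : edge L a) : lower L a :=
  exist _ (src (val f)) (src_below a (val f)).

Definition edge_mul (g : lower L a) (f : edge L a)
    (gf : src (lval g) = rng (val f)) : edge L a :=
  exist _ (comp (lval g) (val f)) (edge_mul_subproof gf).

End Edge.

(* C*-algebras are complex and not necessarily unital. *)

Record cstar_alg (R : realType) := CStarAlg {
  calg :> completeNormedModType R[i];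
  cmul : calg -> calg -> calg;
  cadj : calg -> calg;
  cmulA : forall x y z, cmul x (cmul y z) = cmul (cmul x y) z;
  cmul_linl : forall (c : R[i]) x y z,
    cmul (c *: x + y) z = c *: cmul x z + cmul y z;
  cmul_linr : forall (c : R[i]) x y z,
    cmul z (c *: x + y) = c *: cmul z x + cmul z y;
  cadj_lin : forall (c : R[i]) x y,
    cadj (c *: x + y) = conjc c *: cadj x + cadj y;
  cadjM : forall x y, cadj (cmul x y) = cmul (cadj y) (cadj x);
  cadjK : forall x, cadj (cadj x) = x;
  cnormM : forall x y, `|cmul x y| <= `|x| * `|y|;
  cnorm_star : forall x, `|cmul (cadj x) x| = `|x| ^+ 2
}.

Notation "x ** y" := (cmul x y) (at level 40, left associativity) : ring_scope.
Notation "x ^#" := (cadj x) (at level 2, format "x ^#") : ring_scope.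

Record star_hom (R : realType) (A B : cstar_alg R) (f : A -> B) : Prop := {
  star_hom_lin : forall (c : R[i]) x y, f (c *: x + y) = c *: f x + f y;
  star_homM : forall x y, f (x ** y) = f x ** f y;
  star_hom_adj : forall x, f x^# = (f x)^#
}.

Record closed_ideal (R : realType) (A : cstar_alg R) (J : set A) : Prop := {
  ideal0 : J 0;
  ideal_lin : forall (c : R[i]) x y, J x -> J y -> J (c *: x + y);
  ideal_mull : forall a x, J x -> J (a ** x);
  ideal_mulr : forall a x, J x -> J (x ** a);
  ideal_closed : closed J
}.

Section GraphAlgebra.
Variable R : realType.

Record graph_family (L : ograph) (B : cstar_alg R) (T : L -> B) : Prop := {
  family_pisom : forall e, generator e -> T e ** (T e)^# ** T e = T e;
  family_src : forall e, generator e -> (T e)^# ** T e = T (src e);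
  family_comp : forall e f, generator e -> generator f ->
    src e = rng f -> olt (deg e) (deg f) -> T e ** T f = T (comp e f);
  family_orth : forall e f, generator e -> generator f ->
    extensions e `&` extensions f = set0 -> (T e)^# ** T f = 0;
  family_sum : forall a v, regular a v ->
    T v = \sum_(e \in [set f | rng f = v /\ pow_edges L a f]) T e ** (T e)^#
}.

(* The algebra O(L).  Only the values of [gen] at generators are specified;
   [path_value] gives the element T_e for an arbitrary morphism [e]. *)
Record graph_alg (L : ograph) := GraphAlg {
  galg :> cstar_alg R;
  gen : L -> galg;
  gen_family : graph_family gen;
  gen_universal : forall (B : cstar_alg R) (T : L -> B), graph_family T ->
    exists! h : galg -> B,
      star_hom h /\ forall e, generator e -> h (gen e) = T e
}.

Inductive path_value (L : ograph) (O : graph_alg L) : L -> O -> Prop :=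
| path_value1 e : generator e -> path_value e (gen O e)
| path_value_cons e f t : generator e -> src e = rng f -> path_value f t ->
    path_value (comp e f) (gen O e ** t).

Definition lower_hom (L : ograph) (a : ord)
    (A : graph_alg (lower L a)) (B : graph_alg L) (h : A -> B) : Prop :=
  star_hom h /\ forall e, generator e -> h (gen A e) = gen B (lval e).

Definition lower_hom2 (L : ograph) (a b : ord)
    (A : graph_alg (lower L a)) (B : graph_alg (lower L b)) (h : A -> B) : Prop :=
  star_hom h /\ forall e e', lval e = lval e' -> generator e ->
    h (gen A e) = gen B e'.

End GraphAlgebra.

Section Correspondence.
Variable R : realType.

Record hilbert_module (A : cstar_alg R) := HilbertModule {
  hmod :> completeNormedModType R[i];
  act : hmod -> A -> hmod;
  inner : hmod -> hmod -> A;
  act_linl : forall (c : R[i]) x y a, act (c *: x + y) a = c *: act x a + act y a;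
  act_linr : forall (c : R[i]) x a b, act x (c *: a + b) = c *: act x a + act x b;
  actM : forall x a b, act x (a ** b) = act (act x a) b;
  inner_lin : forall (c : R[i]) x y z,
    inner z (c *: x + y) = c *: inner z x + inner z y;
  inner_act : forall x y a, inner x (act y a) = inner x y ** a;
  inner_adj : forall x y, (inner x y)^# = inner y x;
  inner_ge0 : forall x, exists a, inner x x = a^# ** a;
  inner_norm : forall x, `|x| ^+ 2 = `|inner x x|
}.

(* [lact] is a *-homomorphism into the adjointable operators: the adjoint of
   [lact a] is [lact a^#], and linearity of [lact a] follows. *)
Record correspondence (A : cstar_alg R) := Correspondence {
  corr_mod :> hilbert_module A;
  lact : A -> corr_mod -> corr_mod;
  lact_lin : forall (c : R[i]) a b x, lact (c *: a + b) x = c *: lact a x + lact b x;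
  lactM : forall a b x, lact (a ** b) x = lact a (lact b x);
  lact_adj : forall a x y, inner (lact a x) y = inner x (lact a^# y)
}.

Definition theta (A : cstar_alg R) (X : hilbert_module A) (x y : X) : X -> X :=
  fun z => act x (inner y z).

(* Operator-norm closure of the span of the [theta x y]. *)
Definition compacts (A : cstar_alg R) (X : hilbert_module A) : set (X -> X) :=
  [set t | forall eps : R[i], 0 < eps -> exists s : seq (X * X),
    forall z, `|t z - \sum_(p <- s) theta p.1 p.2 z| <= eps * `|z|].

Definition katsura (A : cstar_alg R) (X : correspondence A) : set A :=
  [set a | (forall b, (forall x : X, lact b x = 0) -> a ** b = 0) /\
           compacts (@lact A X a)].

Section Representation.
Variables (A : cstar_alg R) (X : correspondence A) (B : cstar_alg R).
Variables (psi : X -> B) (pi : A -> B).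

Record representation : Prop := {
  rep_lin : forall (c : R[i]) x y, psi (c *: x + y) = c *: psi x + psi y;
  rep_hom : star_hom pi;
  rep_act : forall x a, psi x ** pi a = psi (act x a);
  rep_lact : forall a x, pi a ** psi x = psi (lact a x);
  rep_inner : forall x y, (psi x)^# ** psi y = pi (inner x y)
}.

(* [Phi] restricts to the *-homomorphism (psi, pi)^(1) on the compacts; its
   values at other operators are irrelevant. *)
Record compacts_hom (Phi : (X -> X) -> B) : Prop := {
  compacts_hom_theta : forall x y : X, Phi (theta x y) = psi x ** (psi y)^#;
  compacts_hom_lin : forall (c : R[i]) s t, compacts s -> compacts t ->
    Phi (fun x => c *: s x + t x) = c *: Phi s + Phi t;
  compacts_homM : forall s t, compacts s -> compacts t ->
    Phi (s \o t) = Phi s ** Phi t;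
  compacts_hom_adj : forall s t, compacts s -> compacts t ->
    (forall x y, inner (s x) y = inner x (t y)) -> Phi t = (Phi s)^#
}.

Definition covariant : Prop :=
  exists Phi, compacts_hom Phi /\
    forall a, katsura X a -> Phi (lact a) = pi a.

Definition covariant_representation : Prop := representation /\ covariant.

End Representation.

Record cuntz_pimsner (A : cstar_alg R) (X : correspondence A) := CuntzPimsner {
  cp_alg :> cstar_alg R;
  cp_mod : X -> cp_alg;
  cp_coef : A -> cp_alg;
  cp_covariant : covariant_representation cp_mod cp_coef;
  cp_universal : forall (B : cstar_alg R) (psi : X -> B) (pi : A -> B),
    covariant_representation psi pi ->
    exists! h : cp_alg -> B,
      [/\ star_hom h, forall x, h (cp_mod x) = psi x
        & forall a, h (cp_coef a) = pi a]
}.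

Definition induced_hom (A : cstar_alg R) (X : correspondence A)
    (O : cuntz_pimsner X) (B : cstar_alg R) (psi : X -> B) (pi : A -> B)
    (h : O -> B) : Prop :=
  [/\ star_hom h, forall x, h (cp_mod O x) = psi x
    & forall a, h (cp_coef O a) = pi a].

End Correspondence.

Section EdgeCorrespondence.
Variables (R : realType) (L : ograph) (a : ord) (A : graph_alg R (lower L a)).

Definition cc_edges : set (edge L a -> A) :=
  [set x | finite_set [set f | x f <> 0] /\
           forall f, gen A (edge_src f) ** x f = x f].

Definition delta (e : edge L a) : edge L a -> A :=
  fun f => if f == e then gen A (edge_src e) else 0.

(* [iota] exhibits the module as the completion of [cc_edges]. *)
Record edge_corr := EdgeCorr {
  edge_corr_val :> correspondence A;
  iota : (edge L a -> A) -> edge_corr_val;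
  iota_lin : forall (c : R[i]) x y, cc_edges x -> cc_edges y ->
    iota (fun f => c *: x f + y f) = c *: iota x + iota y;
  iota_act : forall x b, cc_edges x -> iota (fun f => x f ** b) = act (iota x) b;
  iota_inner : forall x y, cc_edges x -> cc_edges y ->
    inner (iota x) (iota y) =
      \sum_(f \in [set: edge L a]) (x f)^# ** y f;
  iota_dense : dense (iota @` cc_edges);
  edge_lact : forall g t (e : edge L a) (ge : src (lval g) = rng (val e)),
    path_value g t -> lact t (iota (delta e)) = iota (delta (edge_mul ge));
  edge_lact0 : forall g t (e : edge L a), src (lval g) <> rng (val e) ->
    path_value g t -> lact t (iota (delta e)) = 0
}.

(* The value of [iota] outside [cc_edges] is irrelevant; continuity and the
   values on [cc_edges] determine [psi]. *)
Definition is_psi (X : edge_corr) (B : graph_alg R (lower L (osucc a)))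
    (rho : A -> B) (psi : X -> B) : Prop :=
  [/\ forall (c : R[i]) x y, psi (c *: x + y) = c *: psi x + psi y,
      continuous psi
    & forall x, cc_edges x ->
        psi (iota X x) =
          \sum_(f \in [set: edge L a]) gen B (edge_up f) ** rho (x f)].

End EdgeCorrespondence.

(* Main.v *)
Require Import Defs.
From HB Require Import structures.
From mathcomp Require Import all_boot all_order all_algebra.
From mathcomp Require Import complex finmap.
From mathcomp Require Import all_classical all_reals all_analysis.
From mathcomp Require Import ring lra zify.

Set Implicit Arguments.
Unset Strict Implicit.
Unset Printing Implicit Defensive.

Import Order.TTheory GRing.Theory Num.Theory.
Import numFieldNormedType.Exports.

Local Open Scope classical_set_scope.
Local Open Scope ring_scope.
Local Open Scope complex_scope.

(* Let [I] be the closed ideal of [O(L_a)] generated by the [a]-regular vertices.  By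
   condition (C) it is spanned by the elements [T_e ** T_f^#] with [src e = src f = w],
   where [w] is regular and the morphisms of [L_a] starting at [w] form a single branch; at
   such a vertex the compressions [T_w ** x ** T_w] are scalar multiples of [T_w].

   (1) Together with the paths of [L] that end in an edge of degree at least [omega ^ a],
   the algebra [O(L_a)], seminormed modulo [I], carries a Fock representation of [L], so
   the kernel of [rho_a] lies in [I].  As [T_w <> 0] in [O(L)], compressing to the vertices
   [w] shows that the kernel vanishes.

   (2) If [v] is regular, [T_v] acts on [X_a] by the finite-rank operator summing the
   [theta delta_f delta_f] over the edges [f] at [v], and the left action is bounded below on
   [I], again by compression; hence [I] lies in the Katsura ideal [J].  Conversely an
   element of [J] kills [delta_y] for every edge [y] none of whose vertices is regular: it
   is approximated by operators of finite rank, which are transported along [y] until they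
   only involve loops whose powers are initial segments of [y], and these are handled by
   averaging and by the gauge action.  So on [X_a] an element of [J] is a limit of elements
   of [I], and [J] meets the kernel of the left action trivially.

   (3) It is enough to check covariance on the generators [T_v] of [J] found in (2), where it
   is the summation relation of [O(L_(a+1))].

   (4) By the same relation the images of the generators of [O(L_(a+1))] in [O(X_a)] form a
   graph family, and the universal properties give mutually inverse homomorphisms. *)

(** * Real-valued norms *)

(** [O(L_a)] does not contain the relation that writes [T_v] as a sum over the edges of degree omega
    ^ a, for [v] regular at level [a]. A column over [O(L_a)] therefore represents [L] only once
    these [T_v] are negligible: this is why the Fock space is seminormed modulo [I], and why the
    part of the kernel inside [I] needs the separate argument with scalar corners. Condition (C)
    makes the corners scalar: two paths of a single branch with a common source differ by a cycle at
    a regular vertex. An irregular vertex either emits a path that no long edge continues, and then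
    some [T_e] is in the kernel of the left action, or it has infinitely many long edges, on which a
    compact operator cannot stay large. Loops at a successor level obstruct the reduction to these
    two cases. The analysis is elementary: positivity and contractivity of star homomorphisms rest
    on an iteration for [1 - sqrt (1 - w)]. Cauchy-Schwarz in a Hilbert module is used with the
    constant 4, the source of the factors 2, 8 and 20 in later bounds; where a sharp bound matters,
    powers [2 ^ n] and roots remove them. *)

Section RealNorm.
Variables (R : realType) (V : normedModType R[i]).
Implicit Types (x y z : V) (c : R[i]).

(** Norms of a module over [R[i]] take values in [R[i]]; the real part brings them into the ordered
    field [R], where [lra] and [nra] apply. *)
Definition nm x : R := complex.Re `|x|.
Definition cn c : R := complex.Re `|c|.

Lemma norm_nm x : `|x| = (nm x)%:C.
Proof. by rewrite /nm RRe_real// ger0_real. Qed.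

Lemma norm_cn c : `|c| = (cn c)%:C.
Proof. by rewrite /cn RRe_real// ger0_real. Qed.

Lemma nm_ge0 x : 0 <= nm x.
Proof. by rewrite -ler0c -norm_nm. Qed.

Lemma cn_ge0 c : 0 <= cn c.
Proof. by rewrite -ler0c -norm_cn. Qed.

Lemma nmD x y : nm (x + y) <= nm x + nm y.
Proof. by rewrite -lecR rmorphD/= -!norm_nm ler_normD. Qed.

Lemma nmN x : nm (- x) = nm x.
Proof. by rewrite /nm normrN. Qed.

Lemma nmZ c x : nm (c *: x) = cn c * nm x.
Proof. by apply: complexI; rewrite rmorphM/= -norm_nm -norm_cn -norm_nm normrZ. Qed.

Lemma nm0 : nm 0 = 0.
Proof. by rewrite /nm normr0. Qed.

Lemma nm_eq0 x : nm x = 0 -> x = 0.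
Proof. by move=> x0; apply/eqP; rewrite -normr_eq0 norm_nm x0. Qed.

Lemma nm_le0 x : nm x <= 0 -> x = 0.
Proof. by move=> x0; apply: nm_eq0; apply/eqP; rewrite eq_le x0 nm_ge0. Qed.

Lemma nmB x y : nm (x - y) = nm (y - x).
Proof. by rewrite -nmN opprB. Qed.

Lemma nm_distD z x y : nm (x - y) <= nm (x - z) + nm (z - y).
Proof. by apply: le_trans (nmD _ _); rewrite addrA subrK. Qed.

Lemma nm_le_dist x y : nm x <= nm y + nm (x - y).
Proof. by apply: le_trans (nmD _ _); rewrite addrC subrK. Qed.

Lemma nm_sum I (s : seq I) (P : pred I) (F : I -> V) :
  nm (\sum_(i <- s | P i) F i) <= \sum_(i <- s | P i) nm (F i).
Proof.
elim/big_ind2: _ => [||//]; first by rewrite nm0.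
by move=> a b c d h1 h2; apply: le_trans (nmD _ _) (lerD h1 h2).
Qed.

Lemma nm_le_eps x : (forall e : R, 0 < e -> nm x <= e) -> x = 0.
Proof.
move=> h; apply: nm_le0; rewrite leNgt; apply/negP => x0.
have := h _ (divr_gt0 x0 (ltr0n _ 2)); lra.
Qed.

Lemma nm_eq_eps x y : (forall e : R, 0 < e -> nm (x - y) <= e) -> x = y.
Proof. by move=> /nm_le_eps/eqP; rewrite subr_eq0 => /eqP. Qed.

Lemma cnM c d : cn (c * d) = cn c * cn d.
Proof. by apply: complexI; rewrite rmorphM/= -!norm_cn normrM. Qed.

Lemma cnD c d : cn (c + d) <= cn c + cn d.
Proof. by rewrite -lecR rmorphD/= -!norm_cn ler_normD. Qed.

Lemma cnN c : cn (- c) = cn c.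
Proof. by rewrite /cn normrN. Qed.

Lemma cnR (r : R) : 0 <= r -> cn r%:C = r.
Proof. by move=> r0; rewrite /cn ger0_norm ?ler0c. Qed.

Lemma cn1 : cn 1 = 1.
Proof. by rewrite /cn normr1. Qed.

Lemma cn0 : cn 0 = 0.
Proof. by rewrite /cn normr0. Qed.

Lemma cnn n : cn n%:R = n%:R.
Proof. by have := cnR (ler0n _ n); rewrite rmorph_nat. Qed.

Lemma cni : cn 'i = 1.
Proof. by rewrite /cn normc_def/= expr0n add0r expr1n sqrtr1. Qed.

Lemma cn_conj c : cn (conjc c) = cn c.
Proof. by case: c => a b; rewrite /cn !normc_def/= sqrrN. Qed.

Lemma cn_sum I (s : seq I) (P : pred I) (F : I -> R[i]) :
  cn (\sum_(i <- s | P i) F i) <= \sum_(i <- s | P i) cn (F i).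
Proof.
elim/big_ind2: _ => [||//]; first by rewrite cn0.
by move=> a b c d h1 h2; apply: le_trans (cnD _ _) (lerD h1 h2).
Qed.

Lemma nmZr (r : R) x : 0 <= r -> nm (r%:C *: x) = r * nm x.
Proof. by move=> r0; rewrite nmZ cnR. Qed.

Lemma ball_nm x (e : R) y : ball x e%:C y <-> nm (x - y) < e.
Proof. by rewrite -ball_normE /ball_/= norm_nm ltcR. Qed.

Lemma gt0_complex (e : R[i]) : 0 < e -> exists2 r : R, 0 < r & e = r%:C.
Proof.
case: e => a b; rewrite ltcE/= => /andP[/eqP-> a0].
by exists a.
Qed.

(** The closure in metric form, see [closureE_adh]. Density and limit arguments use this form;
    filters appear only at the interface with the library. *)
Definition adh (S : set V) : set V :=
  [set x | forall e : R, 0 < e -> exists2 y, S y & nm (x - y) <= e].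

Lemma nbhs_nm x (U : set V) :
  nbhs x U <-> exists2 e : R, 0 < e & forall y, nm (x - y) < e -> U y.
Proof.
rewrite -nbhs_ballE; split=> [[_ /= /gt0_complex[e e0 ->] h]|[e e0 h]].
  by exists e => // y /ball_nm; exact: h.
by exists e%:C; rewrite /= ?ltcR// => y /ball_nm; exact: h.
Qed.

Lemma closureE_adh S : closure S = adh S.
Proof.
apply/seteqP; split=> x; rewrite /closure /adh /=.
  move=> cl e e0; have /cl[y [Sy xy]] : nbhs x [set y | nm (x - y) < e].
    by apply/nbhs_nm; exists e.
  by exists y => //; exact: ltW.
move=> h U /nbhs_nm[e e0 eU]; have [|y Sy xy] := h (e / 2); first by lra.
by exists y; split => //; apply: eU; lra.
Qed.

Lemma closed_adh S : closed S <-> (forall x, adh S x -> S x).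
Proof.
rewrite -closureE_adh; split=> [cl x|h]; first by move/closure_id: cl => <-.
by apply/closure_id/seteqP; split; [exact: subset_closure|].
Qed.

Lemma adh_idem S x : adh (adh S) x -> adh S x.
Proof.
move=> h e e0; have [|y Sy xy] := h (e / 2); first by lra.
have [|z Sz yz] := Sy (e / 2); first by lra.
exists z => //; have := nm_distD y x z; lra.
Qed.

Lemma adh_mono (S S' : set V) : S `<=` S' -> adh S `<=` adh S'.
Proof. by move=> SS x h e /h[y Sy xy]; exists y => //; exact: SS. Qed.

Lemma sub_adh (S : set V) : S `<=` adh S.
Proof. by move=> x Sx e e0; exists x; rewrite // subrr nm0 ltW. Qed.

Lemma dense_adh S : dense S -> forall x, adh S x.
Proof.
move=> d x e e0.
have [||y [/=]] := d (ball x e%:C).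
- by exists x; apply: ballxx; rewrite ltcR.
- apply: ball_open; by rewrite ltcR.
by move=> /ball_nm h Sy; exists y => //; exact: ltW.
Qed.

End RealNorm.

Section Limits.
Variables (R : realType) (V : normedModType R[i]).
Implicit Types (u v : nat -> V).

Definition tends u (l : V) := forall e : R, 0 < e ->
  exists N, forall n, (N <= n)%N -> nm (u n - l) <= e.

Definition cauchys u := forall e : R, 0 < e ->
  exists N, forall n m, (N <= n)%N -> (N <= m)%N -> nm (u n - u m) <= e.

Lemma tends_unique u l l' : tends u l -> tends u l' -> l = l'.
Proof.
move=> h h'; apply: nm_eq_eps => e e0.
have [|N hN] := h (e / 2); first by lra.
have [|M hM] := h' (e / 2); first by lra.
have := hN _ (leq_maxl N M); have := hM _ (leq_maxr N M).
have := nm_distD (u (maxn N M)) l l'; rewrite (nmB l (u _)); lra.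
Qed.

Lemma archi (e : R) : 0 < e -> exists n : nat, n.+1%:R^-1 <= e.
Proof.
move=> e0; exists (Num.truncn e^-1).
rewrite -[leRHS]invrK lef_pV2 ?posrE ?invr_gt0 ?ltr0n//.
exact/ltW/truncnS_gt.
Qed.

Lemma le_invS (n m : nat) : (n <= m)%N -> m.+1%:R^-1 <= n.+1%:R^-1 :> R.
Proof. by move=> nm; rewrite lef_pV2 ?posrE ?ltr0n// ler_nat ltnS. Qed.

Lemma tends_adh (S : set V) u l : (forall n, S (u n)) -> tends u l -> adh S l.
Proof. by move=> Su h e /h[N hN]; exists (u N) => //; rewrite nmB; exact: hN. Qed.

Lemma tends_nm u l (c : R) : tends u l ->
  (forall e : R, 0 < e -> exists N, forall n, (N <= n)%N -> nm (u n) <= c + e) -> nm l <= c.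
Proof.
move=> h b; apply/ler_addgt0Pr => e e0.
have [|N hN] := h (e / 2); first by lra.
have [|M hM] := b (e / 2); first by lra.
have := hN _ (leq_maxl N M); have := hM _ (leq_maxr N M).
have := nm_le_dist l (u (maxn N M)); rewrite (nmB l (u _)); lra.
Qed.

End Limits.

Lemma complete_seq (R : realType) (V : completeNormedModType R[i]) (u : nat -> V) :
  cauchys u -> exists l, tends u l.
Proof.
move=> cu; have : cauchy (u @ \oo).
  apply/cauchy_exP => _ /gt0_complex[e e0 ->].
  have [|N hN] := cu (e / 2); first by lra.
  exists (u N); exists N => // n /= Nn; apply/ball_nm.
  by have := hN N n (leqnn _) Nn; lra.
move=> /cauchy_cvg/cvg_ex[l ul]; exists l => e e0.
have /ul[N _ hN] : nbhs l [set y | nm (l - y) < e] by apply/nbhs_nm; exists e.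
by exists N => n /hN/= /ltW; rewrite nmB.
Qed.

(** Completeness is declared through filters. A Cauchy filter contains balls of radius
    [1 / (n + 1)]; their centres form a Cauchy sequence, and its limit is a limit of the filter. *)
Lemma seq_complete (R : realType) (V : normedModType R[i]) :
  (forall u : nat -> V, cauchys u -> exists l, tends u l) ->
  forall F : set_system V, ProperFilter F -> cauchy F -> cvg F.
Proof.
move=> h F FF /cauchyP cF.
have e0 n : 0 < (n.+1%:R^-1 : R) by rewrite invr_gt0 ltr0n.
have /choice[u hu] : forall n, exists x, F (ball x (n.+1%:R^-1 : R)%:C).
  by move=> n; apply: cF; rewrite ltcR.
have [|l ul] := h u.
  move=> e ep; have [|N hN] := @archi R (e / 2); first by lra.
  exists N => n m Nn Nm.
  have [y [/= /ball_nm y1 /ball_nm y2]] := filter_ex (filterI (hu n) (hu m)).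
  have := nm_distD y (u n) (u m); rewrite (nmB y).
  move: y1 y2 (le_invS R Nn) (le_invS R Nm) hN.
  by move: (nm _) (nm _) (nm _) => p q r; move: (_^-1) (_^-1) (_^-1) => *; lra.
apply/cvg_ex; exists l => U /nbhs_nm[e ep eU].
have [|N hN] := ul (e / 3); first by lra.
have [|M hM] := @archi R (e / 3); first by lra.
apply: filterS (hu (maxn N M)) => y /ball_nm xy; apply: eU.
have := nm_distD (u (maxn N M)) l y; rewrite (nmB l (u _)).
move: xy hM (hN _ (leq_maxl N M)) (le_invS R (leq_maxr N M)).
by move: (nm _) (nm _) (nm _) => p q r; move: (_^-1) (_^-1) => *; lra.
Qed.

Section Conjugate.
Variable R : realType.

Lemma cjN (c : R[i]) : conjc (- c) = - conjc c.
Proof. by case: c. Qed.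
Lemma cj1 : conjc 1 = 1 :> R[i].
Proof. by apply/eqP; rewrite eq_complex/= oppr0 !eqxx. Qed.
Lemma cji : conjc 'i = - 'i :> R[i].
Proof. by apply/eqP; rewrite eq_complex/= oppr0 !eqxx. Qed.
Lemma cj_half : conjc 2^-1 = 2^-1 :> R[i].
Proof. by rewrite conjc_inv conjc_nat. Qed.
Lemma cn_half : cn (2^-1 : R[i]) = 2^-1.
Proof.
have -> : (2^-1 : R[i]) = (2^-1 : R)%:C by rewrite fmorphV/= rmorph_nat.
by rewrite cnR // invr_ge0 ler0n.
Qed.

End Conjugate.

(** * Algebra, norm and square roots in a C*-algebra *)

Section CStarBasics.
Variables (R : realType) (A : cstar_alg R).
Implicit Types (x y z w : A) (c : R[i]).

Lemma cmulDl x y z : (x + y) ** z = x ** z + y ** z.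
Proof. by have := cmul_linl 1 x y z; rewrite !scale1r. Qed.
Lemma cmulDr x y z : z ** (x + y) = z ** x + z ** y.
Proof. by have := cmul_linr 1 x y z; rewrite !scale1r. Qed.
Lemma cmul0l z : 0 ** z = 0 :> A.
Proof. by apply: (addrI (0 ** z)); rewrite -cmulDl !addr0. Qed.
Lemma cmul0r z : z ** 0 = 0 :> A.
Proof. by apply: (addrI (z ** 0)); rewrite -cmulDr !addr0. Qed.
Lemma cmulZl c x z : (c *: x) ** z = c *: (x ** z).
Proof. by have := cmul_linl c x 0 z; rewrite !addr0 cmul0l addr0. Qed.
Lemma cmulZr c x z : z ** (c *: x) = c *: (z ** x).
Proof. by have := cmul_linr c x 0 z; rewrite !addr0 cmul0r addr0. Qed.
Lemma cmulNl x z : (- x) ** z = - (x ** z).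
Proof. by rewrite -scaleN1r cmulZl scaleN1r. Qed.
Lemma cmulNr x z : z ** (- x) = - (z ** x).
Proof. by rewrite -scaleN1r cmulZr scaleN1r. Qed.
Lemma cmulBl x y z : (x - y) ** z = x ** z - y ** z.
Proof. by rewrite cmulDl cmulNl. Qed.
Lemma cmulBr x y z : z ** (x - y) = z ** x - z ** y.
Proof. by rewrite cmulDr cmulNr. Qed.
Lemma cmul_suml I (s : seq I) (P : pred I) (F : I -> A) z :
  (\sum_(i <- s | P i) F i) ** z = \sum_(i <- s | P i) F i ** z.
Proof. by apply: (big_morph (fun x => x ** z)) => [x y|]; rewrite ?cmulDl ?cmul0l. Qed.
Lemma cmul_sumr I (s : seq I) (P : pred I) (F : I -> A) z :
  z ** (\sum_(i <- s | P i) F i) = \sum_(i <- s | P i) z ** F i.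
Proof. by apply: big_morph => [x y|]; rewrite ?cmulDr ?cmul0r. Qed.

Lemma cadjD x y : (x + y)^# = x^# + y^#.
Proof. by have := cadj_lin 1 x y; rewrite cj1 !scale1r. Qed.
Lemma cadj0 : (0 : A)^# = 0.
Proof. by apply: (addrI (0 : A)^#); rewrite -cadjD !addr0. Qed.
Lemma cadjZ c x : (c *: x)^# = conjc c *: x^#.
Proof. by have := cadj_lin c x 0; rewrite !addr0 cadj0 addr0. Qed.
Lemma cadjN x : (- x)^# = - x^#.
Proof. by rewrite -scaleN1r cadjZ cjN cj1 scaleN1r. Qed.
Lemma cadjB x y : (x - y)^# = x^# - y^#.
Proof. by rewrite cadjD cadjN. Qed.
Lemma cadj_sum I (s : seq I) (P : pred I) (F : I -> A) :
  (\sum_(i <- s | P i) F i)^# = \sum_(i <- s | P i) (F i)^#.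
Proof. by apply: big_morph; [exact: cadjD|exact: cadj0]. Qed.

Lemma nmM x y : nm (x ** y) <= nm x * nm y.
Proof. by rewrite -lecR rmorphM/= -!norm_nm cnormM. Qed.
Lemma nm_star x : nm (x^# ** x) = nm x ^+ 2.
Proof. by apply: complexI; rewrite rmorphXn/= -!norm_nm cnorm_star. Qed.
Lemma nm_adj x : nm x^# = nm x.
Proof.
have le y : nm y <= nm y^#.
  have := nm_star y; have := nmM y^# y; have := nm_ge0 y; have := nm_ge0 y^#.
  move: (nm _) (nm _) (nm _) => p q r; nra.
by apply/le_anti; rewrite le -{2}(cadjK x) le.
Qed.

Lemma star_eq0 x : x^# ** x = 0 -> x = 0.
Proof.
move=> xx; apply: nm_eq0; apply/eqP; rewrite -sqrf_eq0 -nm_star xx.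
by rewrite nm0.
Qed.

(** The C*-identity iterated on a self-adjoint element. Together with [root_le] it sharpens a bound
    that is lossy by a constant factor. *)
Lemma nm_sa x n : x^# = x -> nm (iter n (fun y => y ** y) x) = nm x ^+ (2 ^ n).
Proof.
move=> xx.
have sa m : (iter m (fun y => y ** y) x)^# = iter m (fun y => y ** y) x.
  by elim: m => //= m IH; rewrite cadjM IH.
elim: n => [|n IH] /=; first by rewrite expr1.
by rewrite -{1}sa nm_star IH -exprM expnSr.
Qed.

Lemma tends_cst (V : normedModType R[i]) (l : V) : tends (fun=> l) l.
Proof. by move=> e e0; exists 0%N => n _; rewrite subrr nm0 ltW. Qed.

Lemma tendsD (V : normedModType R[i]) (u v : nat -> V) (l k : V) :
  tends u l -> tends v k -> tends (fun n => u n + v n) (l + k).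
Proof.
move=> hu hv e e0.
have [|N hN] := hu (e / 2); first by lra.
have [|M hM] := hv (e / 2); first by lra.
exists (maxn N M) => n; rewrite geq_max => /andP[Nn Mn].
rewrite opprD addrACA; have := nmD (u n - l) (v n - k).
have := hN _ Nn; have := hM _ Mn; lra.
Qed.

Lemma tends_lin (V W : normedModType R[i]) (f : V -> W) (K : R) (u : nat -> V) (l : V) :
  (forall x y : V, nm (f x - f y) <= K * nm (x - y)) ->
  tends u l -> tends (f \o u) (f l).
Proof.
move=> h hu e e0; have K0 : 0 < `|K| + 1 by have := normr_ge0 K; lra.
have [|N hN] := hu (e / (`|K| + 1)); first by rewrite divr_gt0.
exists N => n /hN; rewrite ler_pdivlMr// => hn; apply: le_trans (h _ _) _.
have := ler_norm K; have := nm_ge0 (u n - l); nra.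
Qed.

Lemma tendsZ (V : normedModType R[i]) c (u : nat -> V) (l : V) :
  tends u l -> tends (fun n => c *: u n) (c *: l).
Proof.
refine (@tends_lin V V (fun x : V => c *: x) (cn c) u l _) => x y.
by rewrite -scalerBr nmZ.
Qed.

Lemma tends_adj (u : nat -> A) l : tends u l -> tends (fun n => (u n)^#) l^#.
Proof.
refine (@tends_lin A A (@cadj R A) 1 u l _) => x y.
by rewrite -cadjB nm_adj mul1r.
Qed.

Lemma tends_bound (V : normedModType R[i]) (u : nat -> V) (l : V) : tends u l ->
  exists N, forall n, (N <= n)%N -> nm (u n) <= nm l + 1.
Proof.
move=> /(_ 1)[//|N hN]; exists N => n /hN.
have := nm_le_dist (u n) l; lra.
Qed.

Lemma tendsM (u v : nat -> A) l k :
  tends u l -> tends v k -> tends (fun n => u n ** v n) (l ** k).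
Proof.
move=> hu hv e e0; have [N0 b] := tends_bound hu.
have l0 := nm_ge0 l; have k0 := nm_ge0 k.
have [|N hN] := hu (e / 2 / (nm k + 1)); first by rewrite !divr_gt0//; lra.
have [|M hM] := hv (e / 2 / (nm l + 1)); first by rewrite !divr_gt0//; lra.
exists (maxn N0 (maxn N M)) => n; rewrite !geq_max => /and3P[/b bn /hN + /hM].
have k1 : 0 < nm k + 1 by lra.
have l1 : 0 < nm l + 1 by lra.
rewrite !ler_pdivlMr// => h1 h2.
have -> : u n ** v n - l ** k = u n ** (v n - k) + (u n - l) ** k.
  by rewrite cmulBr cmulBl addrA subrK.
apply: le_trans (nmD _ _) _.
have := nmM (u n) (v n - k); have := nmM (u n - l) k.
have := nm_ge0 (u n); have := nm_ge0 (v n - k); have := nm_ge0 (u n - l).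
move: (nm (u n ** _)) (nm (_ ** k)) (nm (u n)) (nm (v n - k)) (nm (u n - l)) bn h1 h2.
move=> a1 a2 a3 a4 a5 *; nra.
Qed.

Section SquareRoot.
Variable w : A.
Hypothesis w1 : nm w <= 1.

(** The iteration for [1 - sqrt (1 - w)]; its fixed points satisfy [x ** x + w = 2 *: x], an
    equation that needs no unit. [s] is the same iteration at the scalar [w = 1]: it increases to 1
    and dominates the norms and the increments of [xs]. *)
Let xs := fix xs n := if n is m.+1 then 2^-1 *: (w + xs m ** xs m) else 0 : A.
Let s := fix s n := if n is m.+1 then (1 + s m ^+ 2) / 2 else 0 : R.

Let s01 n : 0 <= s n <= 1.
Proof. by elim: n => [|n /andP[s0 s1]] /=; apply/andP; split; nra. Qed.

(** In terms of [t = 1 - s n] the recursion is [t - t ^ 2 / 2], which is increasing on [0, 1], so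
    the bound at [n] carries over to [n + 1]. This rate is the Cauchy modulus of [xs]. *)
Let s_gap n : 1 - s n <= 2 / n.+2%:R.
Proof.
elim: n => [|n IH]; first by rewrite /= subr0 divff.
have /andP[s0 s1] := s01 n; rewrite /=.
have N0 : 0 < n.+2%:R :> R by rewrite ltr0n.
move: IH; rewrite !ler_pdivlMr ?ltr0n// -[n.+3%:R]natr1.
have N1 : 2 <= n.+2%:R :> R by rewrite (ler_nat R 2).
move: (s n) (n.+2%:R : R) s0 s1 N0 N1 => t N t0 t1 N0 N1 h.
have {}h : 1 - t <= 2 / N by rewrite ler_pdivlMr.
set d := 2 / N in h; have dN : d * N = 2 by rewrite /d divfK// gt_eqF.
have d1 : d <= 1 by rewrite ler_pdivrMr// mul1r.
have -> : 1 - (1 + t ^+ 2) / 2 = (1 - t) - (1 - t) ^+ 2 / 2 by lra.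
have : (1 - t) - (1 - t) ^+ 2 / 2 <= d - d ^+ 2 / 2 by nra.
have : (d - d ^+ 2 / 2) * (N + 1) <= 2 by nra.
move: (1 - t - _) (d - _) => a b hb ab; have : (b - a) * (N + 1) >= 0 by nra.
nra.
Qed.

Let nm_xs n : nm (xs n) <= s n.
Proof.
elim: n => [|n IH] /=; first by rewrite nm0.
rewrite nmZ cn_half.
have := nmD w (xs n ** xs n); have := nmM (xs n) (xs n); have := nm_ge0 (xs n).
have /andP[s0 s1] := s01 n.
move: (nm (xs n)) (nm (_ ** _)) (nm w) (nm (_ + _)) (s n) IH w1 s0 s1.
move=> p q r t u *; have : p * p <= u ^+ 2 by nra.
lra.
Qed.

Let half_nm (x : A) : nm (2^-1 *: x) = nm x / 2.
Proof.
by rewrite nmZ cn_half mulrC.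
Qed.

Let xs_step n : nm (xs n.+1 - xs n) <= s n.+1 - s n.
Proof.
elim: n => [|n IH]; first rewrite /= subr0 half_nm cmul0r addr0 expr0n/= addr0.
  by rewrite subr0 ler_pM2r ?invr_gt0.
rewrite [xs n.+2]/= [xs n.+1]/= -scalerBr half_nm [s n.+2]/= [s n.+1]/=.
rewrite opprD addrACA subrr add0r -/(xs n.+1).
have -> : xs n.+1 ** xs n.+1 - xs n ** xs n =
    (xs n.+1 - xs n) ** xs n.+1 + xs n ** (xs n.+1 - xs n).
  by rewrite cmulBl cmulBr addrA subrK.
apply: (@le_trans _ _ ((s n.+1 - s n) * (s n.+1 + s n) / 2)); last first.
  by rewrite /=; move: (s n) => t; nra.
rewrite ler_pM2r ?invr_gt0// mulrDr; apply: le_trans (nmD _ _) _.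
apply: lerD; apply: le_trans (nmM _ _) _.
  by apply: ler_pM => //; exact: nm_ge0.
by rewrite mulrC; apply: ler_pM => //; exact: nm_ge0.
Qed.

Let xs_dist n m : nm (xs (n + m) - xs n) <= s (n + m) - s n.
Proof.
elim: m => [|m IH]; first by rewrite addn0 !subrr nm0.
rewrite addnS; have := nm_distD (xs (n + m)) (xs (n + m).+1) (xs n).
have := xs_step (n + m); lra.
Qed.

(** [1 - x] is the square root of [1 - w], stated without a unit. Self-adjointness, and commutation
    with whatever commutes with [w], hold for every iterate and pass to the limit. *)
Lemma sqrt_exists : exists x, [/\ x ** x + w = 2 *: x, nm x <= 1,
  w^# = w -> x^# = x & forall b, b ** w = w ** b -> b ** x = x ** b].
Proof.
have near n m : (n <= m)%N -> nm (xs m - xs n) <= 2 / n.+2%:R.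
  move=> nm; rewrite -(subnKC nm); apply: le_trans (xs_dist _ _) _.
  have /andP[_ ] := s01 (n + (m - n)); have := s_gap n.
  move: (s _) (s _) (2 / _) => a b c; lra.
have [|x hx] := @complete_seq R A xs.
  move=> e e0; have [|N hN] := @archi R (e / 4); first by lra.
  exists N => n m Nn Nm; have h1 := near _ _ Nn; have h2 := near _ _ Nm.
  have h3 : 2 / N.+2%:R <= e / 2.
    apply: (@le_trans _ _ (2 / N.+1%:R)); last by move: (_^-1) hN => a; lra.
    by rewrite ler_pM2l// lef_pV2 ?posrE ?ltr0n// ler_nat.
  have := nm_distD (xs N) (xs n) (xs m); rewrite (nmB (xs N)).
  move: (nm _) (nm _) (nm _) (2 / _) h1 h2 h3 => *; lra.
have xE : 2 *: x = x ** x + w.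
  have h1 : tends (fun n => 2 *: xs n.+1) (2 *: x).
    apply: tendsZ => e /hx[N hN]; exists N => n Nn; apply: hN.
    exact: leq_trans Nn (leqnSn n).
  apply: tends_unique h1 _.
  have -> : (fun n => 2 *: xs n.+1) = (fun n => xs n ** xs n + w).
    by apply/funext => n /=; rewrite scalerA divff ?scale1r 1?addrC// pnatr_eq0.
  by apply: tendsD; [exact: tendsM|exact: tends_cst].
exists x; split => //.
- apply: (tends_nm hx) => e e0; exists 0%N => n _.
  have := nm_xs n; have /andP[_] := s01 n; lra.
- move=> wsa; apply: (tends_unique (tends_adj hx)).
  suff -> : (fun n => (xs n)^#) = xs by [].
  apply/funext; elim=> [|n IH] /=; first exact: cadj0.
  rewrite cadjZ cadjD cadjM IH wsa; congr (_ *: _).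
  exact: cj_half.
move=> b bw; apply: (tends_unique (tendsM (tends_cst b) hx)).
suff -> : (fun n => b ** xs n) = (fun n => xs n ** b).
  exact: tendsM hx (tends_cst b).
apply/funext; elim=> [|n IH] /=; first by rewrite cmul0l cmul0r.
rewrite cmulZr cmulZl cmulDr cmulDl bw; congr (_ *: (_ + _)).
by rewrite cmulA IH -cmulA IH cmulA.
Qed.

End SquareRoot.
End CStarBasics.

(* With [p^2 + (1 - q)^2 = 1] the operators [p +- i (1 - q)] are isometric, and
   [p] is their average. *)
Section SelfAdjointContraction.
Variables (R : realType) (V W : normedModType R[i]) (G : V -> V -> W).
Variables (p q : V -> V).
Hypothesis G_lin : forall c x y z, G z (c *: x + y) = c *: G z x + G z y.
Hypothesis G_linl : forall c x y z, G (c *: x + y) z = conjc c *: G x z + G y z.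
Hypothesis G_nm : forall x, nm (G x x) = nm x ^+ 2.
Hypothesis p_sa : forall x y, G (p x) y = G x (p y).
Hypothesis q_sa : forall x y, G (q x) y = G x (q y).
Hypothesis pB : forall x y, p (x - y) = p x - p y.
Hypothesis pq : forall x, p (q x) = q (p x).
Hypothesis pq2 : forall x, p (p x) + q (q x) = 2 *: q x.

Let GDr x y z : G z (x + y) = G z x + G z y.
Proof. by have := G_lin 1 x y z; rewrite !scale1r. Qed.
Let GDl x y z : G (x + y) z = G x z + G y z.
Proof. by have := G_linl 1 x y z; rewrite cj1 !scale1r. Qed.
Let G0r z : G z 0 = 0.
Proof. by apply: (addrI (G z 0)); rewrite -GDr !addr0. Qed.
Let G0l z : G 0 z = 0.
Proof. by apply: (addrI (G 0 z)); rewrite -GDl !addr0. Qed.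
Let GZr c x z : G z (c *: x) = c *: G z x.
Proof. by have := G_lin c x 0 z; rewrite !addr0 G0r addr0. Qed.
Let GZl c x z : G (c *: x) z = conjc c *: G x z.
Proof. by have := G_linl c x 0 z; rewrite !addr0 G0l addr0. Qed.
Let GNr x z : G z (- x) = - G z x.
Proof. by rewrite -scaleN1r GZr scaleN1r. Qed.
Let GNl x z : G (- x) z = - G x z.
Proof. by rewrite -scaleN1r GZl cjN cj1 scaleN1r. Qed.

Let isometric (c : R[i]) x : c * c = -1 -> conjc c = - c ->
  nm (p x + c *: (x - q x)) = nm x.
Proof.
move=> cc cJ; suff e : G (p x + c *: (x - q x)) (p x + c *: (x - q x)) = G x x.
  apply/eqP; rewrite -(@eqrXn2 _ 2) ?nm_ge0// -!G_nm e; exact/eqP.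
set z := x - q x.
(* Symmetry of this pairing cancels the two cross terms, since [conjc c = - c]; what remains is the
   identity [p^2 + (1 - q)^2 = 1]. *)
have sym : G (p x) z = G z (p x).
  by rewrite /z p_sa pB !(GDr, GDl) !(GNr, GNl) q_sa pq.
rewrite !(GDr, GDl) !(GZr, GZl) cJ sym scalerA mulrN cc opprK scale1r.
rewrite -addrA scaleNr addKr.
rewrite /z !(GDr, GDl) !(GNr, GNl) !q_sa p_sa opprK addrCA.
rewrite -[RHS]addr0 -addrA; congr (_ + _).
have E : G x (p (p x)) + G x (q (q x)) = G x (q x) + G x (q x).
  by rewrite -GDr pq2 GZr scaler_nat mulr2n.
by rewrite (addrCA (G x (p (p x)))) E addKr addNr.
Qed.

Lemma sa_contraction x : nm (p x) <= nm x.
Proof.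
have h1 := @isometric 'i x; have h2 := @isometric (- 'i) x.
have ii : 'i * 'i = -1 :> R[i] by rewrite -expr2 sqr_i.
have ji := cji R.
have {}h1 := h1 ii ji; have {}h2 : nm (p x + - 'i *: (x - q x)) = nm x.
  by apply: h2; rewrite ?mulrNN// cjN ji.
have : nm (2 *: p x) <= nm x + nm x.
  rewrite -{1}h1 -h2; apply: le_trans (nmD _ _).
  by rewrite scaleNr addrACA subrr addr0 scaler_nat mulr2n.
rewrite nmZ cnn; lra.
Qed.

End SelfAdjointContraction.

Section StarHom.
Variables (R : realType) (A B : cstar_alg R) (f : A -> B).
Hypothesis fH : star_hom f.

Lemma homD x y : f (x + y) = f x + f y.
Proof. by have := star_hom_lin fH 1 x y; rewrite !scale1r. Qed.
Lemma hom0 : f 0 = 0.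
Proof. by apply: (addrI (f 0)); rewrite -homD !addr0. Qed.
Lemma homZ c x : f (c *: x) = c *: f x.
Proof. by have := star_hom_lin fH c x 0; rewrite !addr0 hom0 addr0. Qed.
Lemma homN x : f (- x) = - f x.
Proof. by rewrite -scaleN1r homZ scaleN1r. Qed.
Lemma homB x y : f (x - y) = f x - f y.
Proof. by rewrite homD homN. Qed.
Lemma hom_sum I (s : seq I) (P : pred I) (F : I -> A) :
  f (\sum_(i <- s | P i) F i) = \sum_(i <- s | P i) f (F i).
Proof. by apply: big_morph; [exact: homD|exact: hom0]. Qed.

(** With [w = h ** h] the root gives [k] commuting with [h] and [h^2 + k^2 = 2 k], an algebraic
    identity that [f] preserves. Left multiplications by [f h] and [f k] then satisfy the hypotheses
    of [sa_contraction], which bounds [f h ** f h] by [f h] in norm. *)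
Lemma hom_sa_contr h : h^# = h -> nm h <= 1 -> nm (f h) <= 1.
Proof.
move=> hsa h1; have h2 : nm (h ** h) <= 1.
  by rewrite -{1}hsa nm_star exprn_ile1// nm_ge0.
have [k [kE _ ksa kc]] := sqrt_exists h2.
have {}ksa : k^# = k by apply: ksa; rewrite cadjM hsa.
have hk : h ** k = k ** h by apply: kc; rewrite cmulA.
have := @sa_contraction R B B (fun a b => a^# ** b) (fun b => f h ** b)
  (fun b => f k ** b).
move=> /(_ _ _ _ _ _ _ _ _ (f h)) c.
have : nm (f h ** f h) <= nm (f h).
  apply: c => [c x y z|c x y z|x|x y|x y|x y|x|x].
  - exact: cmul_linr.
  - by rewrite cadj_lin cmul_linl.
  - exact: nm_star.
  - by rewrite cadjM -(star_hom_adj fH) hsa cmulA.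
  - by rewrite cadjM -(star_hom_adj fH) ksa cmulA.
  - by rewrite cmulBr.
  - by rewrite !cmulA -!(star_homM fH) hk.
  by rewrite !cmulA -!(star_homM fH) -cmulDl -homD addrC kE homZ cmulZl.
have : nm (f h ** f h) = nm (f h) ^+ 2.
  by rewrite -nm_star -(star_hom_adj fH) hsa.
have := nm_ge0 (f h); move: (nm _) (nm _) => a b; nra.
Qed.

Lemma hom_contr x : nm (f x) <= nm x.
Proof.
suff h y : y^# = y -> nm (f y) <= nm y.
  have := h (x^# ** x); rewrite cadjM cadjK => /(_ erefl).
  rewrite (star_homM fH) (star_hom_adj fH) !nm_star.
  by rewrite ler_pXn2r ?nnegrE ?nm_ge0.
move=> ysa; have [y0|y0] := eqVneq (nm y) 0.
  by rewrite (nm_eq0 y0) hom0 !nm0.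
have yp : 0 < nm y by rewrite lt_def y0 nm_ge0.
have i0 : 0 <= (nm y)^-1 by rewrite invr_ge0 nm_ge0.
have := @hom_sa_contr ((nm y)^-1%:C *: y); rewrite homZ !nmZr// mulVf// cadjZ ysa.
rewrite conjc_real => /(_ erefl (lexx _)).
by rewrite mulrC ler_pdivrMr// mul1r.
Qed.

End StarHom.

(** * The C*-algebra of adjointable operators on a seminormed space *)

(* [odom] carries the seminorm [osn], which need be neither complete nor separated.  For
   [oadj t t'], i.e. [t'] is an adjoint of [t], the inequality [oadj_star] replaces
   Cauchy-Schwarz and is all that the C*-identity uses. *)
Record op_system (R : realType) := OpSystem {
  opsp :> lmodType R[i];
  odom : set opsp;
  osn : opsp -> R;
  oadj : (opsp -> opsp) -> (opsp -> opsp) -> Prop;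
  odom_lin : forall (c : R[i]) x y, odom x -> odom y -> odom (c *: x + y);
  osn_ge0 : forall x, 0 <= osn x;
  osnZ : forall (c : R[i]) x, osn (c *: x) = cn c * osn x;
  osnD : forall x y, odom x -> odom y -> osn (x + y) <= osn x + osn y;
  oadj_dom : forall t t' x, oadj t t' -> odom x -> odom (t x);
  oadj_lin : forall t t' (c : R[i]) x y, oadj t t' -> odom x -> odom y ->
    t (c *: x + y) = c *: t x + t y;
  oadj_bd : forall t t', oadj t t' ->
    exists2 c, 0 <= c & forall x, odom x -> osn (t x) <= c * osn x;
  oadj_sym : forall t t', oadj t t' -> oadj t' t;
  oadj_star : forall t t' x, oadj t t' -> odom x ->
    osn (t x) ^+ 2 <= osn x * osn (t' (t x));
  oadj0 : oadj (fun=> 0) (fun=> 0);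
  oadj_comb : forall (c : R[i]) t t' s s', oadj t t' -> oadj s s' ->
    oadj (fun x => c *: t x + s x) (fun x => conjc c *: t' x + s' x);
  oadj_comp : forall t t' s s', oadj t t' -> oadj s s' ->
    oadj (t \o s) (s' \o t')
}.

Lemma split_eps (R : realType) (c p q x e : R) : 0 <= c -> 0 <= x -> 0 < e ->
  p <= e / (2 * (c + 1)) * x -> q <= e / 2 * x -> c * p + q <= e * x.
Proof.
move=> c0 x0 e0; have C0 : 0 < 2 * (c + 1) by lra.
have := divfK (lt0r_neq0 C0) e; have : 0 < e / (2 * (c + 1)) by rewrite divr_gt0.
move: (e / (2 * _)) => d d0 dE h1 h2.
have : c * p <= c * (d * x) by apply: ler_wpM2l.
have : 0 <= d * x by rewrite mulr_ge0 // ltW.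
have : d * x * (2 * (c + 1)) = e * x by rewrite mulrAC dE.
move: (d * x) (e * x) (e / 2 * x) (mulrAC e 2^-1 x) h2 => dx ex h E h2.
rewrite E in h2; nra.
Qed.

Lemma split_eps2 (R : realType) (b c e : R) : 0 <= b -> 0 <= c -> 0 < e ->
  b * (e / (2 * (b + 1))) + e / (2 * (c + 1)) * c <= e.
Proof.
move=> b0 c0 e0.
have h (t : R) : 0 <= t -> t * (e / (2 * (t + 1))) <= e / 2.
  move=> t0; have T0 : 0 < 2 * (t + 1) by lra.
  by rewrite mulrA ler_pdivrMr//; nra.
have := h b b0; have := h c c0; rewrite (mulrC c); lra.
Qed.

Section OperatorAlgebra.
Variables (R : realType) (S : op_system R).
Notation N := (@osn R S).
Notation dom := (@odom R S).
Notation adj := (@oadj R S).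
Notation opr := (S -> S).
Implicit Types (t s : opr) (u v : nat -> opr) (x y : S) (c : R[i]).

Let domD x y : dom x -> dom y -> dom (x + y).
Proof. by move=> dx dy; have := odom_lin 1 dx dy; rewrite scale1r. Qed.
Let dom0 x : dom x -> dom 0.
Proof. by move=> dx; have := odom_lin (-1) dx dx; rewrite scaleN1r addNr. Qed.
Let domZ c x : dom x -> dom (c *: x).
Proof. by move=> dx; have := odom_lin c dx (dom0 dx); rewrite addr0. Qed.
Let domN x : dom x -> dom (- x).
Proof. by move=> dx; rewrite -scaleN1r; exact: domZ. Qed.
Let domB x y : dom x -> dom y -> dom (x - y).
Proof. by move=> dx dy; apply: domD => //; exact: domN. Qed.
Let N0 : N 0 = 0.
Proof. by have := @osnZ R S 0 0; rewrite scale0r cn0 mul0r. Qed.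
Let NN x : N (- x) = N x.
Proof. by rewrite -scaleN1r osnZ cnN cn1 mul1r. Qed.

Definition is_op t := exists t', adj t t'.

Definition opbd t (c : R) := forall x, dom x -> N (t x) <= c * N x.

Let op_dom t x : is_op t -> dom x -> dom (t x).
Proof. by move=> [t' tt']; exact: oadj_dom tt'. Qed.
Let opB t x y : is_op t -> dom x -> dom y -> t (x - y) = t x - t y.
Proof.
move=> [t' tt'] dx dy; have := oadj_lin (-1) tt' dy dx.
by rewrite !scaleN1r addrC => ->; rewrite addrC.
Qed.
Let op_comb c t s : is_op t -> is_op s -> is_op (fun x => c *: t x + s x).
Proof. by move=> [t' tt'] [s' ss']; eexists; exact: oadj_comb tt' ss'. Qed.
Let op_comp t s : is_op t -> is_op s -> is_op (t \o s).
Proof. by move=> [t' tt'] [s' ss']; eexists; exact: oadj_comp tt' ss'. Qed.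
(** [oadj_star] for [t'] gives [N (t' x) ^ 2 <= N x * N (t (t' x))], and one factor [N (t' x)]
    cancels. *)
Let opbd_adj t t' (c : R) : 0 <= c -> adj t t' -> opbd t c -> opbd t' c.
Proof.
move=> c0 tt' b x dx; have dt := oadj_dom (oadj_sym tt') dx.
have := oadj_star (oadj_sym tt') dx; have := b _ dt.
have := osn_ge0 x; move: (osn_ge0 (t' x)); rewrite le_eqVlt => /predU1P[<-|].
  by move=> x0 _ _; rewrite mulr_ge0.
move=> p0 x0 h1 h2; rewrite -(ler_pM2l p0) -expr2; apply: le_trans h2 _.
by rewrite mulrCA mulrC mulrA; apply: ler_wpM2r.
Qed.

Let adj_comb c t t' s s' : adj t t' -> adj s s' ->
  adj (fun x => c *: t x + s x) (fun x => conjc c *: t' x + s' x).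
Proof. exact: oadj_comb. Qed.

Let adj_sub t t' s s' : adj t t' -> adj s s' ->
  adj (fun x => t x - s x) (fun x => t' x - s' x).
Proof.
move=> tt' ss'; have := adj_comb (-1) ss' tt'; rewrite cjN cj1.
have e (f g : opr) : (fun x => -1 *: f x + g x) = (fun x => g x - f x).
  by apply/funext => x; rewrite scaleN1r addrC.
by rewrite !e.
Qed.

Definition opcauchy u := forall e : R, 0 < e -> exists M, forall n m,
  (M <= n)%N -> (M <= m)%N -> opbd (fun x => u n x - u m x) e.

Definition opseq u := (forall n, is_op (u n)) /\ opcauchy u.

Definition opeqv u v := forall e : R, 0 < e -> exists M, forall n,
  (M <= n)%N -> opbd (fun x => u n x - v n x) e.

Let eqv_refl u : opeqv u u.
Proof.
move=> e e0; exists 0%N => n _ x _; rewrite subrr N0.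
by rewrite mulr_ge0 ?osn_ge0// ltW.
Qed.

Let eqv_sym u v : opeqv u v -> opeqv v u.
Proof.
by move=> h e /h[M hM]; exists M => n /hM hn x dx; rewrite -NN opprB; exact: hn.
Qed.

Let Ntri x y z : dom x -> dom y -> dom z -> N (x - z) <= N (x - y) + N (y - z).
Proof.
move=> dx dy dz; have := osnD (domB dx dy) (domB dy dz).
by rewrite addrA subrK.
Qed.

Let eqv_trans u v w : opseq u -> opseq v -> opseq w ->
  opeqv u v -> opeqv v w -> opeqv u w.
Proof.
move=> [ou _] [ov _] [ow _] uv vw e e0.
have [|M hM] := uv (e / 2); first by lra.
have [|K hK] := vw (e / 2); first by lra.
exists (maxn M K) => n; rewrite geq_max => /andP[/hM h1 /hK h2] x dx.
have := Ntri (op_dom (ou n) dx) (op_dom (ov n) dx) (op_dom (ow n) dx).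
have := h1 x dx; have := h2 x dx; lra.
Qed.

(* Elements of the C*-algebra are sequences of operators, Cauchy for the operator seminorm;
   a chosen representative of each class makes equivalence an equality. *)
Definition oprep u : nat -> opr :=
  xget (fun=> (fun=> 0)) [set v | opseq v /\ opeqv u v].

Let repP u : opseq u -> opseq (oprep u) /\ opeqv u (oprep u).
Proof.
move=> su; rewrite /oprep; case: xgetP => [v -> //|/(_ u)[]].
by split => //; exact: eqv_refl.
Qed.

Let rep_eq u v : opseq u -> opseq v -> opeqv u v -> oprep u = oprep v.
Proof.
move=> su sv uv; rewrite /oprep; congr xget; apply/funext => w; apply/propext.
split=> -[sw h]; split => //; last exact: (eqv_trans su sv sw).
by apply: (eqv_trans sv su sw) => //; exact: eqv_sym.
Qed.

Definition opalg_pred : pred (nat -> opr) :=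
  fun u => `[< opseq u /\ oprep u = u >].

Definition opalg := {u : nat -> opr | opalg_pred u}.
HB.instance Definition _ := SubChoice.on opalg.

Implicit Types (a b : opalg).

Let seqP a : opseq (val a).
Proof. by have /asboolP[] := valP a. Qed.

Let cls_subproof u : opseq u -> opalg_pred (oprep u).
Proof.
move=> su; apply/asboolP; have [sr ur] := repP su; split => //.
by apply/esym/rep_eq.
Qed.

Let cls u (su : opseq u) : opalg := exist _ (oprep u) (cls_subproof su).

Let clsP u (su : opseq u) : opeqv (val (cls su)) u.
Proof. by apply: eqv_sym; have [] := repP su. Qed.

Let val_eq a b : opeqv (val a) (val b) -> a = b.
Proof.
move=> ab; apply: val_inj; have /asboolP[sa <-] := valP a.
by have /asboolP[sb <-] := valP b; exact: rep_eq.
Qed.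

Let eq_eqv a b u : opseq u -> opeqv (val a) u -> opeqv (val b) u -> a = b.
Proof.
move=> su au bu; apply: val_eq; apply: (eqv_trans (seqP a) su (seqP b)) => //.
exact: eqv_sym.
Qed.

Let comb c u v : nat -> opr := fun n x => c *: u n x + v n x.

Let seq_comb c u v : opseq u -> opseq v -> opseq (comb c u v).
Proof.
move=> [ou cu] [ov cv]; split=> [n|e e0]; first exact: op_comb.
have c0 := cn_ge0 c; have c1 : 0 < 2 * (cn c + 1) by lra.
have [|M hM] := cu (e / (2 * (cn c + 1))); first by rewrite divr_gt0.
have [|K hK] := cv (e / 2); first by lra.
exists (maxn M K) => n m; rewrite !geq_max => /andP[n1 n2] /andP[m1 m2] x dx.
have -> : comb c u v n x - comb c u v m x =
    c *: (u n x - u m x) + (v n x - v m x).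
  by rewrite /comb opprD addrACA -scalerBr.
apply: le_trans (osnD _ _) _.
- by apply/domZ/domB; exact: op_dom.
- by apply: domB; exact: op_dom.
by rewrite osnZ; apply: split_eps => //; [exact: osn_ge0|exact: hM|exact: hK].
Qed.

Let eqv_comb c u v u' v' : opseq u -> opseq v -> opseq u' -> opseq v' ->
  opeqv u u' -> opeqv v v' -> opeqv (comb c u v) (comb c u' v').
Proof.
move=> [ou _] [ov _] [ou' _] [ov' _] hu hv e e0.
have c0 := cn_ge0 c; have c1 : 0 < 2 * (cn c + 1) by lra.
have [|M hM] := hu (e / (2 * (cn c + 1))); first by rewrite divr_gt0.
have [|K hK] := hv (e / 2); first by lra.
exists (maxn M K) => n; rewrite !geq_max => /andP[n1 n2] x dx.
have -> : comb c u v n x - comb c u' v' n x =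
    c *: (u n x - u' n x) + (v n x - v' n x).
  by rewrite /comb opprD addrACA -scalerBr.
apply: le_trans (osnD _ _) _.
- by apply/domZ/domB; exact: op_dom.
- by apply: domB; exact: op_dom.
by rewrite osnZ; apply: split_eps => //; [exact: osn_ge0|exact: hM|exact: hK].
Qed.

Let seq_bd u : opseq u -> exists2 c : R, 0 <= c &
  exists M, forall n, (M <= n)%N -> opbd (u n) c.
Proof.
move=> [ou cu]; have [//|M hM] := cu 1; have [t' ut] := ou M.
have [c c0 hc] := oadj_bd ut; exists (c + 1); first by lra.
exists M => n Mn x dx; have := hM n M Mn (leqnn _) x dx; have := hc x dx.
have := osnD (domB (op_dom (ou n) dx) (op_dom (ou M) dx)) (op_dom (ou M) dx).
rewrite subrK; lra.
Qed.

Let pcomp u v : nat -> opr := fun n => u n \o v n.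

Let comp_diff t t' s s' (b c d e : R) : is_op t -> is_op t' -> is_op s -> is_op s' ->
  0 <= b -> 0 <= c -> 0 <= d -> 0 <= e ->
  opbd t b -> opbd (fun x => s x - s' x) d -> opbd (fun x => t x - t' x) e ->
  opbd s' c ->
  opbd (fun x => t (s x) - t' (s' x)) (b * d + e * c).
Proof.
move=> ot ot' os os' b0 c0 d0 e0 tb ssd tte sc x dx.
have ds := op_dom os dx; have ds' := op_dom os' dx.
have := Ntri (op_dom ot ds) (op_dom ot ds') (op_dom ot' ds').
rewrite -opB//; have := tb _ (domB ds ds'); have := tte _ ds'.
have := ssd _ dx; have := sc _ dx; have := osn_ge0 x.
move: (N _) (N _) (N _) (N _) (N _) (N _) => p1 p2 p3 p4 p5 p6 *; nra.
Qed.

Let seq_comp u v : opseq u -> opseq v -> opseq (pcomp u v).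
Proof.
move=> su sv; have [b b0 [M1 hb]] := seq_bd su; have [c c0 [M2 hc]] := seq_bd sv.
case: su sv => ou cu [ov cv]; split=> [n|e e0]; first exact: op_comp.
have B0 : 0 < 2 * (b + 1) by lra.
have C0 : 0 < 2 * (c + 1) by lra.
have [|M hM] := cu (e / (2 * (c + 1))); first by rewrite divr_gt0.
have [|K hK] := cv (e / (2 * (b + 1))); first by rewrite divr_gt0.
exists (maxn (maxn M1 M2) (maxn M K)) => n m; rewrite !geq_max.
move=> /andP[/andP[n1 n2] /andP[n3 n4]] /andP[/andP[m1 m2] /andP[m3 m4]] x dx.
have := @comp_diff (u n) (u m) (v n) (v m) b c (e / (2 * (b + 1))) (e / (2 * (c + 1))).
move=> /(_ (ou n) (ou m) (ov n) (ov m) b0 c0).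
rewrite !divr_ge0 ?(ltW e0) ?(ltW B0) ?(ltW C0)// => /(_ isT isT (hb _ n1)).
move=> /(_ (hK _ _ n4 m4) (hM _ _ n3 m3) (hc _ m2) _ dx) h.
apply: le_trans h _; apply: ler_wpM2r; first exact: osn_ge0.
exact: split_eps2.
Qed.

Let eqv_comp u v u' v' : opseq u -> opseq v -> opseq u' -> opseq v' ->
  opeqv u u' -> opeqv v v' -> opeqv (pcomp u v) (pcomp u' v').
Proof.
move=> su sv su' sv' hu hv e e0.
have [b b0 [M1 hb]] := seq_bd su; have [c c0 [M2 hc]] := seq_bd sv'.
case: su sv su' sv' => ou _ [ov _] [ou' _] [ov' _].
have B0 : 0 < 2 * (b + 1) by lra.
have C0 : 0 < 2 * (c + 1) by lra.
have [|M hM] := hu (e / (2 * (c + 1))); first by rewrite divr_gt0.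
have [|K hK] := hv (e / (2 * (b + 1))); first by rewrite divr_gt0.
exists (maxn (maxn M1 M2) (maxn M K)) => n; rewrite !geq_max.
move=> /andP[/andP[n1 n2] /andP[n3 n4]] x dx.
have := @comp_diff (u n) (u' n) (v n) (v' n) b c (e / (2 * (b + 1))) (e / (2 * (c + 1))).
move=> /(_ (ou n) (ou' n) (ov n) (ov' n) b0 c0).
rewrite !divr_ge0 ?(ltW e0) ?(ltW B0) ?(ltW C0)// => /(_ isT isT (hb _ n1)).
move=> /(_ (hK _ n4) (hM _ n3) (hc _ n2) _ dx) h.
apply: le_trans h _; apply: ler_wpM2r; first exact: osn_ge0.
exact: split_eps2.
Qed.

Definition opstar t : opr := xget (fun=> 0) [set t' | adj t t'].

Let starP t : is_op t -> adj t (opstar t).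
Proof. by move=> [t' tt']; rewrite /opstar; case: xgetP => [s -> //|/(_ t')]. Qed.

Let pstar u : nat -> opr := fun n => opstar (u n).

Let opbd_star t t' s s' (e : R) : 0 <= e -> adj t t' -> adj s s' ->
  opbd (fun x => t x - s x) e -> opbd (fun x => t' x - s' x) e.
Proof. by move=> e0 tt' ss'; apply: opbd_adj => //; exact: adj_sub. Qed.

Let seq_star u : opseq u -> opseq (pstar u).
Proof.
move=> [ou cu]; split=> [n|e e0].
  by exists (u n); apply/oadj_sym/starP.
have [M hM] := cu e e0; exists M => n m Mn Mm.
by apply: opbd_star (hM n m Mn Mm); [exact: ltW|exact: starP|exact: starP].
Qed.

Let eqv_star u v v' : opseq u -> (forall n, adj (v n) (v' n)) ->
  opeqv u v -> opeqv (pstar u) v'.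
Proof.
move=> [ou _] vv' uv e e0; have [M hM] := uv e e0; exists M => n Mn.
by apply: opbd_star (hM n Mn); [exact: ltW|exact: starP|exact: vv'].
Qed.

Let seq_cst t : is_op t -> opseq (fun=> t).
Proof.
move=> ot; split=> // e e0; exists 0%N => n m _ _ x dx; rewrite subrr N0.
by rewrite mulr_ge0 ?osn_ge0// ltW.
Qed.

Let op0 : is_op (fun=> 0).
Proof. by exists (fun=> 0); exact: oadj0. Qed.

Let oadd a b := cls (seq_comb 1 (seqP a) (seqP b)).
Let ozer := cls (seq_cst op0).
Let oscal c a := cls (seq_comb c (seqP a) (seqP ozer)).
Let oopp a := oscal (-1) a.
Let omul a b := cls (seq_comp (seqP a) (seqP b)).
Let ostar a := cls (seq_star (seqP a)).

Let R0 : opeqv (val ozer) (fun=> (fun=> 0)).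
Proof. exact: clsP. Qed.
Let s0 : opseq (fun=> (fun=> 0)).
Proof. exact: seq_cst. Qed.
Let RD a b u v : opseq u -> opseq v -> opeqv (val a) u -> opeqv (val b) v ->
  opeqv (val (oadd a b)) (comb 1 u v).
Proof.
move=> su sv au bv; apply: (eqv_trans (seqP _) _ _ (clsP _)).
- by apply: seq_comb; exact: seqP.
- exact: seq_comb.
by apply: eqv_comb => //; exact: seqP.
Qed.
Let RZ c a u : opseq u -> opeqv (val a) u ->
  opeqv (val (oscal c a)) (comb c u (fun=> (fun=> 0))).
Proof.
move=> su au; apply: (eqv_trans (seqP _) _ _ (clsP _)).
- by apply: seq_comb; exact: seqP.
- exact: seq_comb.
by apply: eqv_comb => //; exact: seqP.
Qed.
Let RM a b u v : opseq u -> opseq v -> opeqv (val a) u -> opeqv (val b) v ->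
  opeqv (val (omul a b)) (pcomp u v).
Proof.
move=> su sv au bv; apply: (eqv_trans (seqP _) _ _ (clsP _)).
- by apply: seq_comp; exact: seqP.
- exact: seq_comp.
by apply: eqv_comp => //; exact: seqP.
Qed.
Let RJ a v v' : opseq v' -> (forall n, adj (v n) (v' n)) -> opeqv (val a) v ->
  opeqv (val (ostar a)) v'.
Proof.
move=> sv' vv' av; apply: (eqv_trans (seqP _) _ sv' (clsP _)).
- by apply: seq_star; exact: seqP.
exact: eqv_star (seqP _) vv' av.
Qed.

(** Identities in the algebra are read off representing sequences: [eqvs] turns each operation into
    the same operation on representatives, which have to agree only on [odom]. *)
Let by_fun a b u v : opseq u -> opeqv (val a) u -> opseq v -> opeqv (val b) v ->
  (forall n x, dom x -> u n x = v n x) -> a = b.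
Proof.
move=> su au sv bv uv; apply: (eq_eqv su au).
apply: (eqv_trans (seqP b) sv su bv) => e e0; exists 0%N => n _ x dx.
by rewrite (uv n x)// subrr N0 mulr_ge0 ?osn_ge0// ltW.
Qed.

Ltac eqvs := repeat lazymatch goal with
  | |- opseq (comb _ _ _) => apply: seq_comb
  | |- opseq (pcomp _ _) => apply: seq_comp
  | |- opseq (pstar _) => apply: seq_star
  | |- opseq _ => first [exact: seqP | exact: s0 | apply: seq_cst; assumption]
  | |- opeqv ?u ?u => exact: eqv_refl
  | |- opeqv (?f ozer) _ => exact: R0
  | |- opeqv (?f (oadd _ _)) _ => apply: RD
  | |- opeqv (?f (oopp _)) _ => apply: RZ
  | |- opeqv (?f (oscal _ _)) _ => apply: RZ
  | |- opeqv (?f (omul _ _)) _ => apply: RM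
  | |- opeqv (?f (ostar _)) (pstar _) => exact: clsP
  end.

Let oaddA : associative oadd.
Proof.
move=> a b d; apply: (@by_fun _ _ (comb 1 (val a) (comb 1 (val b) (val d)))
  (comb 1 (comb 1 (val a) (val b)) (val d))); eqvs.
by move=> n x _; rewrite /comb !scale1r addrA.
Qed.
Let oaddC : commutative oadd.
Proof.
move=> a b; apply: (@by_fun _ _ (comb 1 (val a) (val b))
  (comb 1 (val b) (val a))); eqvs.
by move=> n x _; rewrite /comb !scale1r addrC.
Qed.
Let oadd0 : left_id ozer oadd.
Proof.
move=> a; apply: (@by_fun _ _ (comb 1 (fun=> (fun=> 0)) (val a)) (val a)); eqvs.
by move=> n x _; rewrite /comb scaler0 add0r.
Qed.
Let oaddN : left_inverse ozer oopp oadd.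
Proof.
move=> a; apply: (@by_fun _ _ (comb 1 (comb (-1) (val a) (fun=> (fun=> 0))) (val a))
  (fun=> (fun=> 0))); eqvs.
by move=> n x _; rewrite /comb addr0 scale1r scaleN1r addNr.
Qed.

HB.instance Definition _ := GRing.isZmodule.Build opalg oaddA oaddC oadd0 oaddN.

Let oscalA c d a : oscal c (oscal d a) = oscal (c * d) a.
Proof.
apply: (@by_fun _ _ (comb c (comb d (val a) (fun=> (fun=> 0))) (fun=> (fun=> 0)))
  (comb (c * d) (val a) (fun=> (fun=> 0)))); eqvs.
by move=> n x _; rewrite /comb !addr0 scalerA.
Qed.
Let oscal1 : left_id 1 oscal.
Proof.
move=> a; apply: (@by_fun _ _ (comb 1 (val a) (fun=> (fun=> 0))) (val a)); eqvs.
by move=> n x _; rewrite /comb addr0 scale1r.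
Qed.
Let oscalDr : right_distributive oscal +%R.
Proof.
move=> c a b; change (oscal c (oadd a b) = oadd (oscal c a) (oscal c b)).
apply: (@by_fun _ _
  (comb c (comb 1 (val a) (val b)) (fun=> (fun=> 0)))
  (comb 1 (comb c (val a) (fun=> (fun=> 0))) (comb c (val b) (fun=> (fun=> 0)))));
  eqvs.
by move=> n x _; rewrite /comb !addr0 !scale1r scalerDr.
Qed.
Let oscalDl a : {morph oscal^~ a : c d / c + d}.
Proof.
move=> c d; change (oscal (c + d) a = oadd (oscal c a) (oscal d a)).
apply: (@by_fun _ _ (comb (c + d) (val a) (fun=> (fun=> 0)))
  (comb 1 (comb c (val a) (fun=> (fun=> 0))) (comb d (val a) (fun=> (fun=> 0)))));
  eqvs.
by move=> n x _; rewrite /comb !addr0 !scale1r scalerDl.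
Qed.

HB.instance Definition _ := GRing.Zmodule_isLmodule.Build R[i] opalg
  oscalA oscal1 oscalDr oscalDl.

(** Bounds valid for almost all terms of the sequence; as it is Cauchy, their infimum is the limit
    of the operator seminorms. *)
Definition opnm_set a : set R := [set c : R | 0 <= c /\
  exists M, forall n, (M <= n)%N -> opbd (val a n) c].

Definition opnm a : R := inf (opnm_set a).

Let nm_set_inf a : has_inf (opnm_set a).
Proof.
split; last by exists 0 => c [].
by have [c c0 h] := seq_bd (seqP a); exists c.
Qed.

Let opnm_le a (c : R) : opnm_set a c -> opnm a <= c.
Proof. by move=> ac; apply: ge_inf => //; have [] := nm_set_inf a. Qed.

Let opnm_ge0 a : 0 <= opnm a.
Proof. by apply: lb_le_inf; [have [] := nm_set_inf a|move=> c []]. Qed.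

Let opnm_lt a (c : R) : opnm a < c -> opnm_set a c.
Proof.
move=> /(inf_lt (nm_set_inf a).1)[d [d0 [M h]] /ltW dc].
split; first exact: le_trans dc.
exists M => n Mn x dx; apply: le_trans (h n Mn x dx) _.
by rewrite ler_wpM2r ?osn_ge0.
Qed.

Let opnm_eqv a u (c : R) : opseq u -> opeqv (val a) u -> 0 <= c ->
  (exists M, forall n, (M <= n)%N -> opbd (u n) c) -> opnm a <= c.
Proof.
move=> [ou _] au c0 [M h]; apply/ler_addgt0Pr => e e0; apply: opnm_le.
split; first by lra.
have [K hK] := au e e0; exists (maxn M K) => n.
rewrite geq_max => /andP[Mn Kn] x dx; have := h n Mn x dx.
have [oa _] := seqP a.
have := osnD (domB (op_dom (oa n) dx) (op_dom (ou n) dx)) (op_dom (ou n) dx).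
have := hK n Kn x dx; rewrite subrK; lra.
Qed.

Let opnm_bd a u (c : R) : opseq u -> opeqv (val a) u -> opnm a < c ->
  exists M, forall n, (M <= n)%N -> opbd (u n) c.
Proof.
move=> [ou _] au ac; have [] := @opnm_lt a ((opnm a + c) / 2); first by lra.
move=> _ [M h].
have [|K hK] := eqv_sym au (e := (c - opnm a) / 2); first by lra.
exists (maxn M K) => n.
rewrite geq_max => /andP[Mn Kn] x dx; have := h n Mn x dx.
have [oa _] := seqP a.
have := osnD (domB (op_dom (ou n) dx) (op_dom (oa n) dx)) (op_dom (oa n) dx).
have := hK n Kn x dx; rewrite subrK; have := osn_ge0 x; nra.
Qed.

Let opnmZ_le c a : opnm (c *: a) <= cn c * opnm a.
Proof.
have c0 := cn_ge0 c; apply/ler_addgt0Pr => e e0.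
have d0 : 0 < e / (cn c + 1) by rewrite divr_gt0//; lra.
have [|p0 [M h]] := @opnm_lt a (opnm a + e / (cn c + 1)); first by lra.
have dE : e / (cn c + 1) * (cn c + 1) = e by rewrite divfK// gt_eqF//; lra.
have a0 := opnm_ge0 a.
change (c *: a) with (oscal c a).
apply: (@opnm_eqv _ (comb c (val a) (fun=> (fun=> 0)))); [eqvs|eqvs|nra|].
exists M => n /h hn x dx; rewrite /comb addr0 osnZ.
have := hn x dx; have := osn_ge0 x; move: (e / _) d0 dE => d d0 dE *; nra.
Qed.

Let opnmZ c a : (opnm (c *: a))%:C = `|c| * (opnm a)%:C.
Proof.
rewrite norm_cn -rmorphM/=; congr (_%:C); apply/le_anti; rewrite opnmZ_le/=.
have [->|c0] := eqVneq c 0; first by rewrite cn0 mul0r.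
have := opnmZ_le c^-1 (c *: a); rewrite scalerA mulVf// scale1r.
have h : cn c * cn c^-1 = 1 by rewrite -cnM divff// cn1.
by move=> /(ler_wpM2l (cn_ge0 c)); rewrite mulrA h mul1r.
Qed.

Let opnm_eq0 a : (opnm a)%:C = 0 -> a = 0.
Proof.
move=> /(@complexI _ _ 0) a0; apply: (@eq_eqv _ _ (fun=> (fun=> 0))) => //.
move=> e e0; have [|_ [M h]] := @opnm_lt a e; first by rewrite a0.
by exists M => n /h hn x dx; rewrite subr0; exact: hn.
Qed.

Let opnm_triangle a b : opnm (a + b) <= opnm a + opnm b.
Proof.
apply/ler_addgt0Pr => e e0.
have [|p0 [M h]] := @opnm_lt a (opnm a + e / 2); first by lra.
have [|q0 [K k]] := @opnm_lt b (opnm b + e / 2); first by lra.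
change (a + b) with (oadd a b).
apply: (@opnm_eqv _ (comb 1 (val a) (val b))); [eqvs|eqvs|lra|].
exists (maxn M K) => n; rewrite geq_max => /andP[/h hn /k kn] x dx.
rewrite /comb scale1r; have [oa _] := seqP a; have [ob _] := seqP b.
have := osnD (op_dom (oa n) dx) (op_dom (ob n) dx).
have := hn x dx; have := kn x dx; lra.
Qed.

Let opnmC_triangle a b : (opnm (a + b))%:C <= (opnm a)%:C + (opnm b)%:C.
Proof. by rewrite -rmorphD/= lecR. Qed.

HB.instance Definition _ := @Lmodule_isNormed.Build R[i] opalg
  (fun a => (opnm a)%:C) opnmC_triangle opnmZ opnm_eq0.

Let nmE a : nm a = opnm a.
Proof. by []. Qed.

Let subE a b : opeqv (val (a - b)) (comb (-1) (val b) (val a)).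
Proof.
change (a - b) with (oadd a (oopp b)).
apply: (eqv_trans (seqP _) _ _ (v := comb 1 (val a) (comb (-1) (val b) (fun=> (fun=> 0))))).
- by eqvs.
- by eqvs.
- by eqvs.
move=> e e0; exists 0%N => n _ x dx; rewrite /comb addr0 scale1r [val a n x + _]addrC subrr N0.
by rewrite mulr_ge0 ?osn_ge0// ltW.
Qed.

(** Diagonal argument: [X i] is replaced by one operator [d i] of its sequence, within [1 / (i + 1)]
    of all later terms. The [d i] form a Cauchy sequence, which represents the limit. *)
Let opalg_complete (X : nat -> opalg) : cauchys X -> exists l, tends X l.
Proof.
move=> cX.
have /choice[k hk] : forall i, exists n, forall m, (n <= m)%N ->
    opbd (fun x => val (X i) m x - val (X i) n x) i.+1%:R^-1.
  move=> i; have [_ c] := seqP (X i).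
  have [|n h] := c i.+1%:R^-1; first by rewrite invr_gt0 ltr0n.
  by exists n => m nm; exact: h.
pose d i := val (X i) (k i).
have od i : is_op (d i) := (seqP (X i)).1 (k i).
have near i n m (e : R) : 0 < e -> nm (X n - X m) < e ->
    (i <= n)%N -> (i <= m)%N ->
    opbd (fun x => d n x - d m x) (e + 2 * i.+1%:R^-1).
  move=> e0 h ni mi; have [] := opnm_bd _ (subE (X n) (X m)) h; first by eqvs.
  move=> M hM x dx; pose q := maxn M (maxn (k n) (k m)).
  have h1 := hM q (leq_maxl _ _) x dx.
  have h2 := hk n q (leq_trans (leq_maxl _ _) (leq_maxr _ _)) x dx.
  have h3 := hk m q (leq_trans (leq_maxr _ _) (leq_maxr _ _)) x dx.
  have [on _] := seqP (X n); have [om _] := seqP (X m).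
  have t1 := Ntri (op_dom (od n) dx) (op_dom (on q) dx) (op_dom (od m) dx).
  have t2 := Ntri (op_dom (on q) dx) (op_dom (om q) dx) (op_dom (od m) dx).
  rewrite /comb scaleN1r addrC in h1; rewrite -(NN (val (X n) q x - _)) opprB in h2.
  have i1 := le_invS R ni; have i2 := le_invS R mi; have x0 := osn_ge0 x.
  move: (N _) (N _) (N _) (N _) (N _) (N x) h1 h2 h3 t1 t2 i1 i2 x0.
  move: (_^-1) (_^-1) (_^-1) => *; nra.
have sd : opseq d.
  split=> // e e0.
  have [i hi] := @archi R (e / 8) ltac:(lra).
  have [|K hK] := cX (e / 4); first by lra.
  exists (maxn i K) => n m; rewrite !geq_max => /andP[n1 n2] /andP[m1 m2] x dx.
  have := near i n m (e / 2); move=> /(_ ltac:(lra)).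
  have hh := hK _ _ n2 m2; move=> /(_ ltac:(lra) n1 m1 x dx) h.
  apply: le_trans h _; apply: ler_wpM2r; first exact: osn_ge0.
  move: (_^-1) hi => *; lra.
exists (cls sd) => e e0.
have [i hi] := @archi R (e / 4) ltac:(lra).
have [_ cd] := sd; have [|K hK] := cd (e / 2); first by lra.
exists (maxn i K) => n; rewrite geq_max => /andP[n1 n2].
rewrite nmE; apply: (@opnm_eqv _ (comb (-1) d (val (X n)))).
- by eqvs.
- apply: (eqv_trans (seqP _) _ _ (subE _ _)); [by eqvs|by eqvs|].
  by apply: eqv_comb; eqvs; try exact: sd; exact: clsP.
- exact: ltW.
exists (maxn K (k n)) => m; rewrite geq_max => /andP[m1 m2] x dx.
rewrite /comb scaleN1r addrC.
have h1 := hk n m m2 x dx; have h2 := hK n m n2 m1 x dx.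
have [on _] := seqP (X n).
have t1 := Ntri (op_dom (on m) dx) (op_dom (od n) dx) (op_dom (od m) dx).
have i1 := le_invS R n1; have x0 := osn_ge0 x.
move: (N _) (N _) (N _) (N x) h1 h2 t1 i1 x0.
move=> p q r s hr hq hp i1' sp.
have {}hr := le_trans hr (ler_wpM2r sp (le_trans i1' hi)).
clear i1' hi; nra.
Qed.

HB.instance Definition _ := Uniform_isComplete.Build opalg
  (seq_complete opalg_complete).

Let omulA a b d : omul a (omul b d) = omul (omul a b) d.
Proof.
by apply: (@by_fun _ _ (pcomp (val a) (pcomp (val b) (val d)))
  (pcomp (pcomp (val a) (val b)) (val d))); eqvs.
Qed.

Let omul_linl c a b d : omul (c *: a + b) d = c *: omul a d + omul b d.
Proof.
change (omul (oadd (oscal c a) b) d = oadd (oscal c (omul a d)) (omul b d)).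
apply: (@by_fun _ _ (pcomp (comb 1 (comb c (val a) (fun=> (fun=> 0))) (val b)) (val d))
  (comb 1 (comb c (pcomp (val a) (val d)) (fun=> (fun=> 0))) (pcomp (val b) (val d))));
  eqvs.
by move=> n x _; rewrite /comb /pcomp /= !scale1r.
Qed.

Let omul_linr c a b d : omul d (c *: a + b) = c *: omul d a + omul d b.
Proof.
change (omul d (oadd (oscal c a) b) = oadd (oscal c (omul d a)) (omul d b)).
apply: (@by_fun _ _ (pcomp (val d) (comb 1 (comb c (val a) (fun=> (fun=> 0))) (val b)))
  (comb 1 (comb c (pcomp (val d) (val a)) (fun=> (fun=> 0))) (pcomp (val d) (val b))));
  eqvs.
move=> n x dx; rewrite /comb /pcomp /= !scale1r !addr0.
have [od _] := seqP d; have [oa _] := seqP a; have [ob _] := seqP b.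
have [d' dd'] := od n.
exact: (oadj_lin c dd' (op_dom (oa n) dx) (op_dom (ob n) dx)).
Qed.

Let ostar_lin c a b : ostar (c *: a + b) = conjc c *: ostar a + ostar b.
Proof.
have [oa _] := seqP a; have [ob _] := seqP b.
change (ostar (oadd (oscal c a) b) = oadd (oscal (conjc c) (ostar a)) (ostar b)).
apply: (@eq_eqv _ _ (comb 1 (comb (conjc c) (pstar (val a)) (fun=> (fun=> 0)))
  (pstar (val b)))).
- by eqvs.
- apply: (@RJ _ (comb 1 (comb c (val a) (fun=> (fun=> 0))) (val b))).
  + by eqvs.
  + move=> n; rewrite -{2}(cj1 R); apply: adj_comb; last exact: starP.
    by apply: adj_comb; [exact: starP|exact: oadj0].
  by eqvs.
by eqvs.
Qed.

Let ostarM a b : ostar (omul a b) = omul (ostar b) (ostar a).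
Proof.
have [oa _] := seqP a; have [ob _] := seqP b.
apply: (@eq_eqv _ _ (pcomp (pstar (val b)) (pstar (val a)))).
- by eqvs.
- apply: (@RJ _ (pcomp (val a) (val b))).
  + by eqvs.
  + by move=> n; apply: oadj_comp; exact: starP.
  by eqvs.
by eqvs.
Qed.

Let ostarK a : ostar (ostar a) = a.
Proof.
have [oa _] := seqP a; apply: (@eq_eqv _ _ (val a)); [exact: seqP| |exact: eqv_refl].
apply: (@RJ _ (pstar (val a))); [exact: seqP| |exact: clsP].
by move=> n; apply/oadj_sym/starP.
Qed.

Let onormM a b : `|omul a b| <= `|a| * `|b|.
Proof.
rewrite !norm_nm -rmorphM lecR !nmE; apply/ler_addgt0Pr => e e0.
have a0 := opnm_ge0 a; have b0 := opnm_ge0 b.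
pose d : R := e / (opnm a + opnm b + e + 1).
have D0 : 0 < opnm a + opnm b + e + 1 by lra.
have d0 : 0 < d by rewrite divr_gt0.
have dE : d * (opnm a + opnm b + e + 1) = e by rewrite divfK// gt_eqF.
have d1 : d <= 1 by rewrite ler_pdivrMr//; lra.
have [|_ [M h]] := @opnm_lt a (opnm a + d); first by lra.
have [|_ [K k]] := @opnm_lt b (opnm b + d); first by lra.
apply: (@opnm_eqv _ (pcomp (val a) (val b))); [eqvs|eqvs|nra|].
exists (maxn M K) => n; rewrite geq_max => /andP[/h hn /k kn] x dx.
have [ob _] := seqP b; have h2 := hn _ (op_dom (ob n) dx); have h1 := kn _ dx.
apply: le_trans h2 _; apply: le_trans (ler_wpM2l _ h1) _; first by lra.
by rewrite mulrA; apply: ler_wpM2r; [exact: osn_ge0|nra].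
Qed.

Let onorm_star a : `|omul (ostar a) a| = `|a| ^+ 2.
Proof.
have [oa _] := seqP a.
(* The half of the C*-identity that is special to adjoints: [oadj_star] bounds [N (t x) ^ 2] by
   [N x * N (t' (t x))]. *)
have le1 : opnm a ^+ 2 <= opnm (omul (ostar a) a).
  apply/ler_addgt0Pr => e e0.
  have m0 := opnm_ge0 (omul (ostar a) a).
  have [] := @opnm_bd (omul (ostar a) a) (pcomp (pstar (val a)) (val a))
    (opnm (omul (ostar a) a) + e).
  - by eqvs.
  - by eqvs.
  - by lra.
  move=> M h; set c := _ + e in h *.
  have c0 : 0 <= c by rewrite /c; lra.
  rewrite -[c]sqr_sqrtr// ler_pXn2r ?nnegrE ?sqrtr_ge0 ?opnm_ge0//.
  apply: opnm_le; split; first exact: sqrtr_ge0.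
  exists M => n /h hn x dx.
  have := oadj_star (starP (oa n)) dx; have := hn x dx; rewrite /pcomp/pstar/=.
  have := osn_ge0 x; have := osn_ge0 (val a n x).
  rewrite -{1}[c]sqr_sqrtr//; have := sqrtr_ge0 c; move: (Num.sqrt c) => r.
  move: (N _) (N (val a n x)) (N x) => p q s r0 q0 s0' h1 h2.
  have : q ^+ 2 <= (r * s) ^+ 2 by nra.
  by rewrite ler_pXn2r ?nnegrE// mulr_ge0.
have le2 : opnm (ostar a) <= opnm a.
  apply/ler_addgt0Pr => e e0; have a0 := opnm_ge0 a.
  have [|_ [M h]] := @opnm_lt a (opnm a + e); first by lra.
  apply: (@opnm_eqv _ (pstar (val a))).
  - by apply: seq_star; exact: seqP.
  - exact: clsP.
  - by lra.
  by exists M => n /h; apply: opbd_adj; [lra|exact: starP].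
apply/le_anti/andP; split.
  apply: le_trans (onormM _ _) _; rewrite expr2; apply: ler_wpM2r => //.
  by rewrite !norm_nm lecR.
by rewrite !norm_nm -rmorphXn/= lecR.
Qed.

Definition opcstar : cstar_alg R :=
  @CStarAlg R opalg omul ostar omulA omul_linl omul_linr ostar_lin ostarM ostarK
    onormM onorm_star.

(** Total, with default value 0, so that statements need not carry proofs of [is_op]. *)
Definition opcls t : opcstar :=
  match pselect (is_op t) with
  | left ot => cls (seq_cst ot)
  | right _ => 0
  end.

Let opclsE t : is_op t -> opeqv (val (opcls t : opalg)) (fun=> t).
Proof. by move=> ot; rewrite /opcls; case: pselect => // ?; exact: clsP. Qed.

Lemma opcls_lin c t s : is_op t -> is_op s ->
  opcls (fun x => c *: t x + s x) = c *: opcls t + opcls s.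
Proof.
move=> ot os; change (opcls (fun x => c *: t x + s x) = oadd (oscal c (opcls t)) (opcls s)).
apply: (@by_fun _ _ (fun=> (fun x => c *: t x + s x))
  (comb 1 (comb c (fun=> t) (fun=> (fun=> 0))) (fun=> s))).
- exact/seq_cst/op_comb.
- exact/opclsE/op_comb.
- by eqvs.
- by eqvs; exact: opclsE.
by move=> n x dx; rewrite /comb addr0 scale1r.
Qed.

Lemma opclsM t s : is_op t -> is_op s -> opcls (t \o s) = opcls t ** opcls s.
Proof.
move=> ot os; apply: (@by_fun _ _ (fun=> (t \o s)) (pcomp (fun=> t) (fun=> s))) => //.
- exact/seq_cst/op_comp.
- exact/opclsE/op_comp.
- by eqvs.
- by apply: RM; try exact: seq_cst; exact: opclsE.
Qed.

Lemma opcls_adj t t' : adj t t' -> (opcls t)^# = opcls t'.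
Proof.
move=> tt'; have ot : is_op t by exists t'.
have ot' : is_op t' by exists t; exact: oadj_sym.
apply: (@eq_eqv _ _ (fun=> t')); [exact: seq_cst| |exact: opclsE].
by apply: (@RJ _ (fun=> t)); [exact: seq_cst|by []|exact: opclsE].
Qed.

Lemma opcls_eq t s : is_op t -> is_op s ->
  (forall x, dom x -> N (t x - s x) = 0) -> opcls t = opcls s.
Proof.
move=> ot os h; apply: (@eq_eqv _ _ (fun=> s)); [exact: seq_cst| |exact: opclsE].
apply: (eqv_trans (seqP _) _ _ (opclsE ot)); [exact: seq_cst|exact: seq_cst|].
move=> e e0; exists 0%N => n _ x dx; rewrite h//.
by apply: mulr_ge0; [exact: ltW|exact: osn_ge0].
Qed.

Lemma opcls_le t (c : R) : is_op t -> 0 <= c -> opbd t c -> nm (opcls t) <= c.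
Proof.
move=> ot c0 tc; apply: (@opnm_eqv (opcls t) (fun=> t)) => //.
- exact: seq_cst.
- exact: opclsE.
by exists 0%N => n _.
Qed.

Lemma opcls_bd t (c : R) : is_op t -> nm (opcls t) <= c -> opbd t c.
Proof.
move=> ot tc x dx; apply/ler_addgt0Pr => e e0; have x0 := osn_ge0 x.
have d0 : 0 < e / (N x + 1) by rewrite divr_gt0//; lra.
have [] := @opnm_bd (opcls t) (fun=> t) (c + e / (N x + 1)).
- exact: seq_cst.
- exact: opclsE.
- by move: tc; rewrite nmE; lra.
move=> M /(_ M (leqnn _) x dx) h.
have dE : e / (N x + 1) * (N x + 1) = e by rewrite divfK// gt_eqF//; lra.
move: (e / _) d0 h dE => d *; nra.
Qed.

Lemma opcls_dense (b : opcstar) (e : R) : 0 < e ->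
  exists2 t, is_op t & nm (b - opcls t) <= e.
Proof.
move=> e0; have [ob cb] := seqP b; have [M hM] := cb e e0; have obM := ob M.
exists (val (b : opalg) M) => //.
apply: (@opnm_eqv _ (comb (-1) (fun=> val (b : opalg) M) (val (b : opalg)))).
- by eqvs.
- apply: (eqv_trans (seqP _) _ _ (subE _ _)).
  + by eqvs.
  + by eqvs.
  by apply: eqv_comb; eqvs; exact: opclsE.
- exact: ltW.
exists M => n Mn x dx; rewrite /comb scaleN1r addrC.
exact: (hM n M Mn (leqnn _)).
Qed.

End OperatorAlgebra.

(** The interface of the construction. As [op_algebra_of] is opaque, the Cauchy sequences behind it
    are never unfolded afterwards. *)
Record op_algebra (R : realType) (S : op_system R) := OpAlgebra {
  oalg :> cstar_alg R;
  ocls : (S -> S) -> oalg;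
  ocls_lin : forall (c : R[i]) t s, is_op t -> is_op s ->
    ocls (fun x => c *: t x + s x) = c *: ocls t + ocls s;
  oclsM : forall t s, is_op t -> is_op s -> ocls (t \o s) = ocls t ** ocls s;
  ocls_adj : forall t t', oadj t t' -> (ocls t)^# = ocls t';
  ocls_eq : forall t s, is_op t -> is_op s ->
    (forall x, odom x -> osn (t x - s x) = 0) -> ocls t = ocls s;
  ocls_le : forall t (c : R), is_op t -> 0 <= c -> opbd t c -> nm (ocls t) <= c;
  ocls_bd : forall t (c : R), is_op t -> nm (ocls t) <= c -> opbd t c;
  ocls_dense : forall (b : oalg) (e : R), 0 < e ->
    exists2 t, is_op t & nm (b - ocls t) <= e
}.

Lemma op_algebra_of (R : realType) (S : op_system R) : op_algebra S.
Proof.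
exact: (OpAlgebra (@opcls_lin R S) (@opclsM R S) (@opcls_adj R S) (@opcls_eq R S)
  (@opcls_le R S) (@opcls_bd R S) (@opcls_dense R S)).
Qed.

(** * A decision procedure for abelian groups *)

Inductive zexp := ZVar of nat | ZZero | ZAdd of zexp & zexp | ZOpp of zexp
  | ZMul of zexp & nat.

Fixpoint zev (V : zmodType) (env : seq V) (x : zexp) : V :=
  match x with
  | ZVar n => nth 0 env n
  | ZZero => 0
  | ZAdd y z => zev env y + zev env z
  | ZOpp y => - zev env y
  | ZMul y n => zev env y *+ n
  end.

Fixpoint zco (x : zexp) (i : nat) : int :=
  match x with
  | ZVar n => (i == n)%:Z
  | ZZero => 0
  | ZAdd y z => zco y i + zco z i
  | ZOpp y => - zco y i
  | ZMul y n => zco y i *+ n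
  end.

Lemma zevE (V : zmodType) (env : seq V) x :
  zev env x = \sum_(i < size env) env`_i *~ zco x i.
Proof.
elim: x => [n||y IHy z IHz|y IHy|y IHy n] /=.
- have [ns|ns] := ltnP n (size env).
    rewrite (bigD1 (Ordinal ns))//= eqxx mulr1z big1 ?addr0// => i ni.
    by case: eqP => // ein; case/eqP: ni; exact: val_inj.
  rewrite nth_default// big1// => i _; case: eqP => // ein.
  by have := ltn_ord i; rewrite ein ltnNge ns.
- by rewrite big1.
- by rewrite IHy IHz -big_split; apply: eq_bigr => i _; rewrite mulrzDr.
- by rewrite IHy -sumrN; apply: eq_bigr => i _; rewrite mulrNz.
rewrite IHy -sumrMnl; apply: eq_bigr => i _.
by rewrite -(mulr_natr (zco y i)) natz mulrzA pmulrn.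
Qed.

(** Proof by reflection: both sides are expanded in the atoms of [env], and equality of the integer
    coefficients is decided by computation. *)
Lemma zmod_eq (V : zmodType) (env : seq V) x y :
  all (fun i => zco x i == zco y i) (iota 0 (size env)) -> zev env x = zev env y.
Proof.
move=> /allP h; rewrite !zevE; apply: eq_bigr => i _.
by rewrite (eqP (h i _))// mem_iota ltn_ord.
Qed.

Ltac zidx x l := lazymatch l with
  | x :: _ => constr:(O)
  | _ :: ?t => let n := zidx x t in constr:(S n)
  end.
Ltac zatoms t l := lazymatch t with
  | ?a + ?b => let l1 := zatoms a l in zatoms b l1
  | - ?a => zatoms a l
  | ?a *+ _ => zatoms a l
  | 0 => l
  | _ => match constr:(O) with
         | _ => let _ := zidx t l in l
         | _ => constr:(t :: l)
         end
  end.
Ltac zreify t l := lazymatch t with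
  | ?a + ?b => let x := zreify a l in let y := zreify b l in constr:(ZAdd x y)
  | - ?a => let x := zreify a l in constr:(ZOpp x)
  | ?a *+ ?n => let x := zreify a l in constr:(ZMul x n)
  | 0 => constr:(ZZero)
  | _ => let n := zidx t l in constr:(ZVar n)
  end.
Ltac zmod := lazymatch goal with |- @eq ?T ?a ?b =>
  let l0 := constr:(@nil T) in
  let l1 := zatoms a l0 in let l := zatoms b l1 in
  let x := zreify a l in let y := zreify b l in
  exact: (@zmod_eq _ l x y isT) end.

(** * Positivity *)

Section Unital.
Variables (R : realType) (M : cstar_alg R) (e : M).
Hypothesis mul1 : forall x, e ** x = x.
Hypothesis mule1 : forall x, x ** e = x.
Implicit Types (a b c h k p q w x y : M).

Let adj1 : e^# = e.
Proof. by rewrite -[LHS]mule1 -[in RHS](cadjK e) -[in RHS](mule1 e^#) cadjM cadjK. Qed.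

Let nm1 : nm e <= 1.
Proof.
have := nm_star e; rewrite adj1 mul1; have := nm_ge0 e; nra.
Qed.

(** The norm criterion for positivity: for self-adjoint [h] it says that the spectrum lies in
    [[0, 2 t]]. It is visibly stable under sums and nonnegative multiples. *)
Definition pos h := h^# = h /\ exists2 t : R, 0 <= t & nm (t%:C *: e - h) <= t.

Lemma pos_add h k : pos h -> pos k -> pos (h + k).
Proof.
move=> [hs [t t0 ht]] [ks [s s0 ks']]; split; first by rewrite cadjD hs ks.
exists (t + s); first by lra.
rewrite rmorphD/= scalerDl opprD addrACA; apply: le_trans (nmD _ _) _; lra.
Qed.

Lemma pos_scale (r : R) h : 0 <= r -> pos h -> pos (r%:C *: h).
Proof.
move=> r0 [hs [t t0 ht]]; split; first by rewrite cadjZ conjc_real hs.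
exists (r * t); first exact: mulr_ge0.
by rewrite rmorphM/= -scalerA -scalerBr nmZr// ler_wpM2l.
Qed.

Lemma pos_sub1 h : h^# = h -> nm h <= 1 -> pos (e - h).
Proof.
move=> hs h1; split; first by rewrite cadjB adj1 hs.
by exists 1 => //; rewrite scale1r opprB addrC subrK.
Qed.

(** [w = 1 - h / t] is a contraction, so [sqrt_exists] yields [1 - sqrt (h / t)]; multiplying
    [sqrt (h / t)] by [sqrt t] gives the root. For [t = 0] the criterion forces [h = 0]. *)
Lemma pos_sqrt h : pos h -> exists k, [/\ pos k, k ** k = h &
  forall b, b ** h = h ** b -> b ** k = k ** b].
Proof.
move=> [hs [t t0 ht]]; move: t0; rewrite le_eqVlt => /predU1P[t0|t0].
  have h0 : h = 0.
    move: ht; rewrite -t0 scale0r sub0r nmN => /nm_le0//.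
  exists 0; rewrite h0; split=> [||//]; last by rewrite cmul0l.
  by split; [exact: cadj0|exists 0; rewrite ?scale0r ?subr0 ?nm0].
pose w := e - t^-1%:C *: h.
have tC : t%:C != 0 :> R[i] by rewrite -(rmorph0 (real_complex R)) (inj_eq (@complexI _)) gt_eqF.
have ws : w^# = w by rewrite cadjB adj1 cadjZ conjc_real hs.
have w1 : nm w <= 1.
  have -> : w = t^-1%:C *: (t%:C *: e - h).
    by rewrite scalerBr scalerA -rmorphM/= mulVf ?gt_eqF// scale1r.
  by rewrite nmZr; [rewrite ler_pdivrMl// mulr1|rewrite invr_ge0 ltW].
have [x [xE x1 xs xc]] := sqrt_exists w1.
pose s := Num.sqrt t; have s0 : 0 <= s := sqrtr_ge0 t.
have ss : s * s = t by rewrite -expr2 sqr_sqrtr// ltW.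
exists (s%:C *: (e - x)); split.
- apply: pos_scale => //; apply: pos_sub1 => //; exact: xs.
- rewrite cmulZl cmulZr scalerA -rmorphM/= ss.
  have -> : (e - x) ** (e - x) = t^-1%:C *: h.
    have -> : t^-1%:C *: h = e - w by rewrite /w opprB addrC subrK.
    have -> : w = x + x - x ** x by rewrite -mulr2n -scaler_nat -xE addrC addKr.
    rewrite !(cmulBl, cmulBr, mul1, mule1); zmod.
  by rewrite scalerA -rmorphM/= divff ?gt_eqF// scale1r.
move=> b bh; rewrite cmulZl cmulZr; congr (_ *: _).
rewrite cmulBl cmulBr mul1 mule1; congr (_ - _); apply: xc.
by rewrite cmulBl cmulBr mul1 mule1 cmulZl cmulZr bh.
Qed.

(** [a + i b] and [a - i b] are isometric; [a] is half their sum and [b], up to a factor of modulus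
    one, half their difference. *)
Lemma unitary_parts a b : a^# = a -> b^# = b -> a ** b = b ** a ->
  a ** a + b ** b = e -> nm a <= 1 /\ nm b <= 1.
Proof.
move=> as_ bs ab ab1.
have one (c : R[i]) : c * c = -1 -> conjc c = - c -> nm (a + c *: b) <= 1.
  move=> cc cJ; have := nm_star (a + c *: b).
  rewrite cadjD cadjZ as_ bs cJ cmulDl !cmulDr !cmulZl !cmulZr ab.
  rewrite scalerA mulNr cc opprK scale1r scaleNr addrA addrK ab1.
  by have := nm_ge0 (a + c *: b); move: nm1 => /[swap] n0 /[swap] ->; nra.
have ii : 'i * 'i = -1 :> R[i] by rewrite -expr2 sqr_i.
have h1 := one 'i ii (cji R).
have h2 : nm (a + - 'i *: b) <= 1 by apply: one; rewrite ?mulrNN// cjN cji.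
split.
  have -> : a = 2^-1 *: ((a + 'i *: b) + (a + - 'i *: b)).
    rewrite scaleNr addrACA subrr addr0; have -> : a + a = 2 *: a by rewrite scaler_nat mulr2n.
    by rewrite scalerA mulVf ?scale1r// pnatr_eq0.
  rewrite nmZ cn_half; have := nmD (a + 'i *: b) (a + - 'i *: b); lra.
have -> : nm b = nm (2^-1 *: ((a + 'i *: b) - (a + - 'i *: b))).
  have -> : a + 'i *: b - (a + - 'i *: b) = 2 *: ('i *: b).
    rewrite (scaleNr 'i b) scaler_nat; move: ('i *: b) => d; zmod.
  by rewrite !nmZ cn_half cnn cni mul1r mulrA mulVf ?mul1r// pnatr_eq0.
rewrite nmZ cn_half; have := nmD (a + 'i *: b) (- (a + - 'i *: b)).
rewrite nmN; lra.
Qed.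

(** After scaling to norm at most 1, [1 - y^2 = (1 - x)^2] with [x] from [sqrt_exists]. As [y] and
    [1 - x] satisfy [unitary_parts], [1 - y^2] has norm at most 1, which is the criterion with
    [t = 1]. *)
Lemma pos_square k : k^# = k -> pos (k ** k).
Proof.
suff h y : y^# = y -> nm y <= 1 -> pos (y ** y).
  move=> ks; have [k0|k0] := eqVneq (nm k) 0.
    by rewrite (nm_eq0 k0); apply: h; rewrite ?cadj0 ?nm0.
  have kp : 0 < nm k by rewrite lt_def k0 nm_ge0.
  pose y := (nm k)^-1%:C *: k.
  have kE : k = (nm k)%:C *: y.
    by rewrite scalerA -rmorphM/= divff// scale1r.
  suff : pos (((nm k)%:C *: y) ** ((nm k)%:C *: y)) by rewrite -kE.
  rewrite cmulZl cmulZr; do 2!(apply: pos_scale; first exact: nm_ge0).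
  apply: h; first by rewrite cadjZ conjc_real ks.
  by rewrite nmZr ?invr_ge0 ?nm_ge0// mulVf.
move=> ys y1; have yy1 : nm (y ** y) <= 1.
  by rewrite -{1}ys nm_star exprn_ile1// nm_ge0.
have [x [xE _ xs xc]] := sqrt_exists yy1.
have {}xs : x^# = x by apply: xs; rewrite cadjM ys.
have yx : y ** x = x ** y by apply: xc; rewrite cmulA.
have ex : (e - x) ** (e - x) = e - y ** y.
  have -> : y ** y = x + x - x ** x.
    by rewrite -mulr2n -scaler_nat -xE addrC addKr.
  rewrite !(cmulBl, cmulBr, mul1, mule1); zmod.
have [_ h1] : nm y <= 1 /\ nm (e - x) <= 1.
  apply: unitary_parts => //.
  - by rewrite cadjB adj1 xs.
  - by rewrite cmulBl cmulBr mul1 mule1 yx.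
  by rewrite ex addrC subrK.
split; first by rewrite cadjM ys.
exists 1 => //; rewrite scale1r -ex; apply: le_trans (nmM _ _) _.
by have := nm_ge0 (e - x); nra.
Qed.

Lemma pos_le1 h : pos h -> nm h <= 1 -> nm (e - h) <= 1.
Proof.
move=> hp h1; have [k [[ks _] kE _]] := pos_sqrt hp.
have := nm_star k; rewrite ks kE => hk.
have k1 : nm k <= 1 by have := nm_ge0 k; nra.
have [y [[ys _] yE yc]] : exists y, [/\ pos y, y ** y = e - h &
    forall b, b ** (e - h) = (e - h) ** b -> b ** y = y ** b].
  by apply/pos_sqrt/pos_sub1 => //; case: hp.
have [_ y1] : nm k <= 1 /\ nm y <= 1.
  apply: unitary_parts => //; last by rewrite kE yE addrC subrK.
  by apply: yc; rewrite -kE cmulBl cmulBr mul1 mule1 cmulA.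
rewrite -yE; apply: le_trans (nmM _ _) _; have := nm_ge0 y; nra.
Qed.

(** If the sum has norm at most 1, then [1 - h = k + (1 - (h + k))] is positive. The square roots of
    [h] and [1 - h] commute and satisfy [unitary_parts], so [h] has norm at most 1; scaling gives
    the general case. *)
Lemma pos_nm_le h k : pos h -> pos k -> nm h <= nm (h + k).
Proof.
suff main x y : pos x -> pos y -> nm (x + y) <= 1 -> nm x <= 1.
  move=> hp kp; apply/ler_addgt0Pr => d d0; set r := nm (h + k) + d.
  have r0 : 0 < r by rewrite /r; have := nm_ge0 (h + k); lra.
  have i0 : 0 <= r^-1 by rewrite invr_ge0 ltW.
  have := main (r^-1%:C *: h) (r^-1%:C *: k) (pos_scale i0 hp) (pos_scale i0 kp).
  rewrite -scalerDr !nmZr// ![r^-1 * _]mulrC !ler_pdivrMr// !mul1r.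
  by apply; rewrite /r; lra.
move=> {h k} xp yp xy1; have [k [[ks _] kE kc]] := pos_sqrt xp.
have ep : pos (e - x).
  have -> : e - x = y + (e - (x + y)) by rewrite opprD addrCA [- x - y]addrC addNKr.
  apply: pos_add => //; apply: pos_sub1 => //.
  by have [] := pos_add xp yp.
have [l [[ls _] lE lc]] := pos_sqrt ep.
have [k1 _] : nm k <= 1 /\ nm l <= 1.
  apply: unitary_parts => //; last by rewrite kE lE addrC subrK.
  by apply: lc; rewrite -kE cmulBl cmulBr mul1 mule1 cmulA.
rewrite -kE; apply: le_trans (nmM _ _) _; have := nm_ge0 k; nra.
Qed.

(** Put [W = w^2]. Since [(1 - c c^#) c = c (1 + W)], the product [c^# (1 - c c^#)^2 c] equals
    [- (W + 2 W^2 + W^3)], whose norm is at least that of [2 W^2], namely 2 when [c] has norm 1. But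
    each factor of the product has norm at most 1. *)
Let no_negative c w : w^# = w -> c^# ** c = - (w ** w) -> pos (c ** c^#) -> nm c <> 1.
Proof.
move=> ws cc cp c1; set W := w ** w in cc *.
have Ws : W^# = W by rewrite cadjM ws.
have W1 : nm W = 1 by rewrite -nmN -cc nm_star c1 expr1n.
have h1 : nm (c ** c^#) <= 1.
  by have := nm_star c^#; rewrite cadjK nm_adj c1 expr1n => ->.
have hc : (e - c ** c^#) ** c = c ** (e + W).
  by rewrite cmulBl mul1 -cmulA cc cmulNr opprK cmulDr mule1.
have : nm (c^# ** ((e - c ** c^#) ** ((e - c ** c^#) ** c))) <= 1.
  have b := pos_le1 cp h1; have b0 := nm_ge0 (e - c ** c^#).
  apply: le_trans (nmM _ _) _; rewrite nm_adj c1 mul1r.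
  apply: le_trans (nmM _ _) _.
  have := nmM (e - c ** c^#) c; rewrite c1; have := nm_ge0 ((e - c ** c^#) ** c); nra.
rewrite hc cmulA -cmulA [(e - _) ** (c ** _)]cmulA hc !cmulA cc.
have -> : - W ** (e + W) ** (e + W) = - (W ** W + (W ** W + (W + W ** W ** W))).
  rewrite !(cmulDr, cmulDl, cmulNl, mule1); zmod.
rewrite nmN addrA => le1.
have WWp : pos (W ** W) by exact: pos_square.
have WWWp : pos (W ** W ** W).
  have -> : W ** W ** W = (w ** W) ** (w ** W).
    rewrite /W !cmulA//.
  by apply: pos_square; rewrite cadjM Ws ws /W cmulA.
have := pos_nm_le (pos_add WWp WWp) (pos_add (pos_square ws) WWWp).
have : nm (W ** W + W ** W) = 2.
  by rewrite -mulr2n -scaler_nat nmZ cnn -{1}Ws nm_star W1 expr1n mulr1.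
rewrite -/W; lra.
Qed.

(** With [p = a^# a] and [r = sqrt (p^2)], the element [q = r - p] is twice the negative part of
    [p]. For [c = a q] one finds [c^# c = - (s q)^2] where [s^2 = r], while [c c^#] is a sum of
    squares of self-adjoint elements; so [no_negative] forces [c = 0], and this gives [q = 0]. *)
Lemma pos_star a : pos (a^# ** a).
Proof.
set p := a^# ** a.
have ps : p^# = p by rewrite cadjM cadjK.
have [r [rp rE rc]] := pos_sqrt (pos_square ps).
have [s [[ss _] sE sc]] := pos_sqrt rp.
have rs : r^# = r by case: rp.
have pr : p ** r = r ** p by apply: rc; rewrite cmulA.
pose q := r - p.
have qs : q^# = q by rewrite cadjB rs ps.
have pq : p ** q = - (r ** q) by rewrite /q !cmulBr rE pr opprB.
have sq : s ** q = q ** s.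
  by apply/esym/sc; rewrite /q cmulBl cmulBr pr.
have c0 : a ** q = 0.
  set c := a ** q; have cc : c^# ** c = - ((s ** q) ** (s ** q)).
    rewrite cadjM qs -cmulA (cmulA _ a) -/p pq cmulNr; congr (- _).
    by rewrite {1}sq -sE !cmulA.
  have ws : (s ** q)^# = s ** q by rewrite cadjM qs ss.
  have ccp : pos (c ** c^#).
    pose u := c + c^#; pose v := 'i *: (c - c^#).
    have us : u^# = u by rewrite cadjD cadjK addrC.
    have vs : v^# = v by rewrite cadjZ cji cadjB cadjK scaleNr -scalerN opprB.
    have -> : c ** c^# = 2^-1%:C *: (u ** u + v ** v) + (s ** q) ** (s ** q).
      have -> : (s ** q) ** (s ** q) = - (c^# ** c) by rewrite cc opprK.
      have -> : u ** u + v ** v = (c ** c^# + c^# ** c) + (c ** c^# + c^# ** c).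
        rewrite /u /v cmulZl cmulZr scalerA -expr2 sqr_i scaleN1r.
        rewrite !(cmulDl, cmulDr, cmulNl, cmulNr) opprK.
        zmod.
      set d := c ** c^# + c^# ** c; have -> : d + d = 2 *: d by rewrite scaler_nat mulr2n.
      by rewrite scalerA fmorphV/= rmorph_nat mulVf ?pnatr_eq0// scale1r addrK.
    apply: pos_add; last exact: pos_square.
    by apply: pos_scale; rewrite ?invr_ge0//; apply: pos_add; exact: pos_square.
  apply: nm_eq0; apply/eqP/negPn/negP => c0.
  have cn0 : 0 <= (nm c)^-1 by rewrite invr_ge0 nm_ge0.
  pose t := (nm c)^-1%:C.
  apply: (@no_negative (t *: c) (t *: (s ** q))).
  - by rewrite cadjZ conjc_real ws.
  - by rewrite cadjZ conjc_real !(cmulZl, cmulZr) cc !scalerA scalerN.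
  - by rewrite cadjZ conjc_real !(cmulZl, cmulZr); do 2!(apply: pos_scale => //).
  by rewrite nmZr// mulVf.
have sq0 : s ** q = 0.
  apply: star_eq0; rewrite cadjM qs ss -sq.
  by rewrite {1}sq -cmulA (cmulA s) sE -[r ** q]opprK -pq -cmulA c0 cmul0r oppr0 cmul0r.
have rq0 : r ** q = 0 by rewrite -sE -cmulA sq0 cmul0r.
have pq0 : p ** q = 0 by rewrite pq rq0 oppr0.
have q0 : q = 0.
  by apply: star_eq0; rewrite qs {1}/q cmulBl rq0 pq0 subr0.
suff -> : p = r by [].
by apply/eqP; rewrite eq_sym -subr_eq0 -/q q0.
Qed.

End Unital.

(** * Adjoining a unit, and Cauchy-Schwarz for columns *)

Section UnitalHull.
Variables (R : realType) (A : cstar_alg R).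

(** Operators on [A] that are adjoint for the pairing [x^# ** y]. Their algebra contains the
    identity, hence a unit, and contains [A] isometrically through left multiplication. *)
Let hull_adj (t t' : A -> A) := [/\ forall (c : R[i]) x y, t (c *: x + y) = c *: t x + t y,
  forall (c : R[i]) x y, t' (c *: x + y) = c *: t' x + t' y,
  forall x y, (t x)^# ** y = x^# ** t' y,
  exists2 c : R, 0 <= c & forall x, nm (t x) <= c * nm x &
  exists2 c : R, 0 <= c & forall x, nm (t' x) <= c * nm x].

Let bd_comb (c : R[i]) (t s : A -> A) :
  (exists2 d : R, 0 <= d & forall x, nm (t x) <= d * nm x) ->
  (exists2 d : R, 0 <= d & forall x, nm (s x) <= d * nm x) ->
  exists2 d : R, 0 <= d & forall x, nm (c *: t x + s x) <= d * nm x.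
Proof.
move=> [p p0 tp] [q q0 sq]; exists (cn c * p + q).
  by rewrite addr_ge0// mulr_ge0// cn_ge0.
move=> x; apply: le_trans (nmD _ _) _; rewrite nmZ mulrDl -mulrA.
by apply: lerD => //; apply: ler_wpM2l => //; exact: cn_ge0.
Qed.

Let bd_comp (t s : A -> A) :
  (exists2 d : R, 0 <= d & forall x, nm (t x) <= d * nm x) ->
  (exists2 d : R, 0 <= d & forall x, nm (s x) <= d * nm x) ->
  exists2 d : R, 0 <= d & forall x, nm (t (s x)) <= d * nm x.
Proof.
move=> [p p0 tp] [q q0 sq]; exists (p * q); first exact: mulr_ge0.
by move=> x; apply: le_trans (tp _) _; rewrite -mulrA; apply: ler_wpM2l.
Qed.

Program Definition hull_system : op_system R :=
  @OpSystem R A setT (@nm R A) hull_adj _ _ _ _ _ _ _ _ _ _ _ _.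
Next Obligation. by []. Qed.
Next Obligation. exact: nm_ge0. Qed.
Next Obligation. exact: nmZ. Qed.
Next Obligation. by move=> x y _ _; exact: nmD. Qed.
Next Obligation. by []. Qed.
Next Obligation. by move=> t t' c x y [h *]; exact: h. Qed.
Next Obligation. by move=> t t' [_ _ _ [c c0 h] _]; exists c => // x _. Qed.
Next Obligation.
move=> t t' [h1 h2 h3 h4 h5]; split => // x y.
by rewrite -[LHS]cadjK cadjM cadjK -h3 cadjM cadjK.
Qed.
Next Obligation.
by move=> t t' x [_ _ h _ _] _; rewrite -nm_star h -(nm_adj x); exact: nmM.
Qed.
Next Obligation.
split=> [c x y|c x y|x y||]; rewrite ?scaler0 ?addr0 ?cadj0 ?cmul0l ?cmul0r//.
  by exists 0 => // x; rewrite nm0 mul0r.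
by exists 0 => // x; rewrite nm0 mul0r.
Qed.
Next Obligation.
move=> c t t' s s' [a1 a2 a3 a4 a5] [b1 b2 b3 b4 b5]; split=> [d x y|d x y|x y||].
- by rewrite a1 b1 !scalerDr !scalerA mulrC addrACA.
- by rewrite a2 b2 !scalerDr !scalerA mulrC addrACA.
- by rewrite cadj_lin cmulDl cmulZl a3 b3 cmulDr cmulZr.
- exact: bd_comb.
exact: bd_comb.
Qed.
Next Obligation.
move=> t t' s s' [a1 a2 a3 a4 a5] [b1 b2 b3 b4 b5].
split=> [d x y|d x y|x y||] /=.
- by rewrite b1 a1.
- by rewrite a2 b2.
- by rewrite a3 b3.
- exact: bd_comp.
exact: bd_comp.
Qed.

Let hull_alg := op_algebra_of hull_system.
Definition hull : cstar_alg R := hull_alg.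
Definition hull_in (a : A) : hull := ocls hull_alg (fun x => a ** x).
Definition hull_one : hull := ocls hull_alg id.

Let hull_adjP (a : A) : @oadj R hull_system (fun x => a ** x) (fun x => a^# ** x).
Proof.
split=> [c x y|c x y|x y||]; rewrite ?cmul_linr ?cadjM ?cmulA//.
  by exists (nm a); [exact: nm_ge0|move=> x; exact: nmM].
by exists (nm a^#); [exact: nm_ge0|move=> x; exact: nmM].
Qed.

Let hull_opP a : @is_op R hull_system (fun x => a ** x).
Proof. by eexists; exact: hull_adjP. Qed.

Let one_op : @is_op R hull_system id.
Proof.
exists id; split=> //; by exists 1 => // x; rewrite mul1r.
Qed.

Lemma hull_inH : star_hom hull_in.
Proof.
split=> [c x y|x y|x].
- rewrite /hull_in -ocls_lin//; congr ocls; apply/funext => z.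
  by rewrite cmul_linl.
- rewrite /hull_in -oclsM//; congr ocls; apply/funext => z /=.
  by rewrite cmulA.
by apply/esym/ocls_adj/hull_adjP.
Qed.

Lemma hull_in_nm a : nm (hull_in a) = nm a.
Proof.
apply/le_anti/andP; split; first exact: (hom_contr hull_inH).
have := ocls_bd (o := hull_alg) (hull_opP a) (lexx _) (x := a^#) I.
rewrite /= nm_adj -[X in nm (X ** _)]cadjK nm_star nm_adj expr2.
have [a0|a0] := eqVneq (nm a) 0; first by rewrite a0 => _; exact: nm_ge0.
by rewrite ler_pM2r// lt_def a0 nm_ge0.
Qed.

Let opgen (t : hull) : forall e : R, 0 < e ->
  exists2 s, @is_op R hull_system s & nm (t - ocls hull_alg s) <= e.
Proof. by move=> e; exact: ocls_dense. Qed.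

Lemma hull_mul1 x : hull_one ** x = x.
Proof.
apply: nm_eq_eps => e e0; have [|s os h] := opgen x (e := e / 2); first by lra.
have one1 : hull_one ** ocls hull_alg s = ocls hull_alg s.
  by rewrite /hull_one -oclsM.
have o1 : nm hull_one <= 1.
  by apply: ocls_le => // y _; rewrite mul1r.
have -> : hull_one ** x - x = hull_one ** (x - ocls hull_alg s) - (x - ocls hull_alg s).
  by rewrite cmulBr one1 opprB addrA subrK.
have := nmD (hull_one ** (x - ocls hull_alg s)) (- (x - ocls hull_alg s)).
have := nmM hull_one (x - ocls hull_alg s); rewrite nmN.
have := nm_ge0 (x - ocls hull_alg s); have := nm_ge0 hull_one; nra.
Qed.

Lemma hull_mule1 x : x ** hull_one = x.
Proof.
have one_adj : hull_one^# = hull_one.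
  apply: (@ocls_adj R hull_system hull_alg id id).
  by split => //; exists 1 => // y; rewrite mul1r.
by rewrite -[LHS]cadjK cadjM one_adj hull_mul1 cadjK.
Qed.

Definition apos (a : A) := pos hull_one (hull_in a).

Lemma apos_star a : apos (a^# ** a).
Proof.
rewrite /apos (star_homM hull_inH) (star_hom_adj hull_inH).
by apply: pos_star; [exact: hull_mul1|exact: hull_mule1].
Qed.

Lemma apos_add a b : apos a -> apos b -> apos (a + b).
Proof. by rewrite /apos (homD hull_inH) => *; exact: pos_add. Qed.

Lemma apos0 : apos 0.
Proof. by have := apos_star 0; rewrite cmul0r. Qed.

Lemma apos_nm_le a b : apos a -> apos b -> nm a <= nm (a + b).
Proof.
rewrite /apos -!hull_in_nm (homD hull_inH) => *.
exact: (@pos_nm_le R hull hull_one hull_mul1 hull_mule1).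
Qed.

End UnitalHull.

(* Finite columns over [A], indexed by a list, with their [A]-valued inner
   product. *)
Section Columns.
Variables (R : realType) (A : cstar_alg R) (I : Type) (s : seq I).
Implicit Types (x y z : I -> A) (a b c : A).

Definition cdot x y : A := \sum_(i <- s) (x i)^# ** y i.

Lemma cdot_lin (c : R[i]) x y z :
  cdot z (fun i => c *: x i + y i) = c *: cdot z x + cdot z y.
Proof.
by rewrite /cdot scaler_sumr -big_split; apply: eq_bigr => i _; rewrite cmul_linr.
Qed.

Lemma cdot_adj x y : (cdot x y)^# = cdot y x.
Proof. by rewrite /cdot cadj_sum; apply: eq_bigr => i _; rewrite cadjM cadjK. Qed.

Lemma cdot_act x y a : cdot x (fun i => y i ** a) = cdot x y ** a.
Proof. by rewrite /cdot cmul_suml; apply: eq_bigr => i _; rewrite cmulA. Qed.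

Lemma cdot_actl x y a : cdot (fun i => x i ** a) y = a^# ** cdot x y.
Proof. by rewrite -[LHS]cdot_adj cdot_act cadjM cdot_adj. Qed.

Lemma cdotDr x y z : cdot z (fun i => x i + y i) = cdot z x + cdot z y.
Proof. by rewrite /cdot -big_split; apply: eq_bigr => i _; rewrite cmulDr. Qed.

Lemma cdotDl x y z : cdot (fun i => x i + y i) z = cdot x z + cdot y z.
Proof. by rewrite -cdot_adj cdotDr cadjD !cdot_adj. Qed.

Lemma apos_cdot x : apos (cdot x x).
Proof. by apply: big_ind => [||i _]; [exact: apos0|exact: apos_add|exact: apos_star]. Qed.

(** With [z = y - x c] and [k^2 = 1 - <x, x>] in the unital hull,
    [<y, y> = c^# c + <z, z> + (k c)^# (k c)]. All three terms are positive, so [c^# c] is dominated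
    in norm. *)
Let cs1 x y : nm (cdot x x) <= 1 -> nm (cdot x y) ^+ 2 <= nm (cdot y y).
Proof.
move=> x1; set c := cdot x y; pose j : A -> hull A := @hull_in R A; have jH : star_hom j := hull_inH A.
have [k [[ks _] kE _]] : exists k : hull A, [/\ pos (hull_one A) k,
    k ** k = hull_one A - j (cdot x x) & forall b : hull A, b ** (hull_one A - j (cdot x x)) =
      (hull_one A - j (cdot x x)) ** b -> b ** k = k ** b].
  apply: pos_sqrt => //; [exact: hull_mul1|exact: hull_mule1|].
  apply: pos_sub1; try exact: hull_mul1; try exact: hull_mule1; last by rewrite hull_in_nm.
  by rewrite -(star_hom_adj jH) cdot_adj.
pose z i := y i + - (x i ** c).
have yE : j (cdot y y) = j (c^# ** c) + (j (cdot z z) + (k ** j c)^# ** (k ** j c)).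
  have zz : cdot z z = cdot y y - c^# ** c - (c^# ** c - c^# ** cdot x x ** c).
    rewrite /z cdotDr !cdotDl.
    have N f g : cdot f (fun i => - g i) = - cdot f g.
      by rewrite /cdot -sumrN; apply: eq_bigr => i _; rewrite cmulNr.
    have Nl f g : cdot (fun i => - f i) g = - cdot f g.
      by rewrite -cdot_adj N cadjN cdot_adj.
    rewrite !N !Nl cdot_act !cdot_actl cdot_act -/c -(cdot_adj x y) -/c opprK cmulA.
    zmod.
  rewrite cadjM ks cmulA -(cmulA _ k k) kE -(star_hom_adj jH).
  rewrite cmulBr cmulBl hull_mule1 zz.
  by rewrite -!(star_homM jH) !(homB jH) ; zmod.
rewrite -nm_star -(hull_in_nm (c^# ** c)) -(hull_in_nm (cdot y y)) -/j yE.
have u1 := @hull_mul1 R A; have u2 := @hull_mule1 R A.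
apply: (@pos_nm_le R _ _ u1 u2) => //; first exact: apos_star.
by apply: pos_add; [exact: apos_cdot|exact: pos_star].
Qed.

Lemma cdot_CS x y : nm (cdot x y) ^+ 2 <= nm (cdot x x) * nm (cdot y y).
Proof.
have scal (r : R) : 0 < r -> nm (cdot x x) <= r ->
    nm (cdot x y) ^+ 2 <= r * nm (cdot y y).
  move=> r0 xr; pose t := Num.sqrt r; have t0 : 0 < t by rewrite sqrtr_gt0.
  have tt : t * t = r by rewrite -expr2 sqr_sqrtr// ltW.
  pose x' i := t^-1%:C *: x i.
  have e z : cdot z x' = t^-1%:C *: cdot z x.
    by rewrite /cdot scaler_sumr; apply: eq_bigr => i _; rewrite cmulZr.
  have el z : cdot x' z = t^-1%:C *: cdot x z.
    by rewrite -cdot_adj e cadjZ conjc_real cdot_adj.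
  have i0 : 0 <= t^-1 by rewrite invr_ge0 ltW.
  have := @cs1 x' y; rewrite el e el !nmZr// => h.
  have : nm (cdot x x) * (t^-1 * t^-1) <= 1.
    by rewrite -invfM tt ler_pdivrMr// mul1r.
  rewrite mulrC -mulrA => /h; rewrite exprMn exprVn expr2 tt.
  by rewrite ler_pdivrMl.
apply/ler_addgt0Pr => d d0; have y0 := nm_ge0 (cdot y y).
(* The added term keeps [r] positive even when [<x, x> = 0], and costs at most [d] after
   multiplication by the norm of [<y, y>]. *)
pose r := nm (cdot x x) + d / (nm (cdot y y) + 1).
have D0 : 0 < d / (nm (cdot y y) + 1) by rewrite divr_gt0//; lra.
apply: le_trans (scal r _ _) _.
- by rewrite /r; have := nm_ge0 (cdot x x); lra.
- by rewrite /r; lra.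
rewrite /r mulrDl lerD2l mulrAC ler_pdivrMr; first nra.
lra.
Qed.

Lemma cdot_nm_le x y : nm (cdot x x) <= nm (cdot x x + cdot y y).
Proof. by apply: apos_nm_le; exact: apos_cdot. Qed.

Definition cnrm x : R := Num.sqrt (nm (cdot x x)).

Lemma cnrm_sq x : cnrm x ^+ 2 = nm (cdot x x).
Proof. by rewrite sqr_sqrtr// nm_ge0. Qed.

Lemma cnrm_ge0 x : 0 <= cnrm x.
Proof. exact: sqrtr_ge0. Qed.

Lemma cnrm_CS x y : nm (cdot x y) <= cnrm x * cnrm y.
Proof.
rewrite -(@ler_pXn2r _ 2) ?nnegrE ?nm_ge0 ?mulr_ge0 ?cnrm_ge0//.
by rewrite exprMn !cnrm_sq cdot_CS.
Qed.

Lemma cnrmD x y : cnrm (fun i => x i + y i) <= cnrm x + cnrm y.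
Proof.
have x0 := cnrm_ge0 x; have y0 := cnrm_ge0 y.
rewrite -(@ler_pXn2r _ 2) ?nnegrE ?addr_ge0 ?cnrm_ge0// cnrm_sq.
rewrite cdotDr !cdotDl sqrrD !cnrm_sq.
have h1 := cnrm_CS x y; have h2 := cnrm_CS y x.
apply: le_trans (nmD _ _) _; have := nmD (cdot x x) (cdot y x).
have := nmD (cdot x y) (cdot y y); rewrite mulr2n; lra.
Qed.

Lemma cnrmZ (c : R[i]) x : cnrm (fun i => c *: x i) = cn c * cnrm x.
Proof.
have -> : cnrm (fun i => c *: x i) = Num.sqrt ((cn c * cnrm x) ^+ 2).
  congr Num.sqrt; rewrite exprMn cnrm_sq.
  have -> : cdot (fun i => c *: x i) (fun i => c *: x i) = (conjc c * c) *: cdot x x.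
    rewrite /cdot scaler_sumr; apply: eq_bigr => i _.
    by rewrite cadjZ cmulZl cmulZr scalerA.
  by rewrite nmZ cnM cn_conj.
by rewrite sqrtr_sqr ger0_norm// mulr_ge0// ?cn_ge0 ?cnrm_ge0.
Qed.

End Columns.

Local Notation comp := Defs.comp.
Local Notation compA := Defs.compA.

(** * Ordinal arithmetic and path combinatorics *)

Section OrdinalFacts.
Implicit Types a b c d x y : ord.

Lemma olt_trans b a c : olt a b -> olt b c -> olt a c.
Proof. by move=> ab /oltW; exact: olt_ole_trans. Qed.

Lemma olt_le_false a b : olt a b -> ole b a -> False.
Proof. by move=> ab ba; apply: (@olt_irr a); exact: olt_ole_trans ab ba. Qed.

Lemma ole_osucc a b : ole (osucc a) b <-> olt a b.
Proof. by case: b => J g; split=> [/(_ tt)//|h []]. Qed.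

Lemma olt_osucc a b : olt a (osucc b) <-> ole a b.
Proof. by split=> [[]|h]; [|exists tt]. Qed.

Lemma oeq_sym a b : oeq a b -> oeq b a.
Proof. by case. Qed.

Lemma oeq_trans b a c : oeq a b -> oeq b c -> oeq a c.
Proof. by move=> [ab ba] [bc cb]; split; [exact: ole_trans bc|exact: ole_trans ba]. Qed.

Lemma oaddA_le a b c : ole (oadd (oadd a b) c) (oadd a (oadd b c)).
Proof.
elim: c => J g IH; apply/oleP => x /olt_add[/olt_add[xa|[y yb xy]]|].
- by apply/olt_add; left.
- by apply/olt_add; right; exists y => //; exact: olt_ole_trans yb (ole_addr _ _).
move=> [y [/= j yj] xy]; apply/olt_add; right; exists (oadd b (g j)).
  by apply: olt_add2l; exact: (@olt_sub (osup1 g) j).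
apply: (ole_trans xy); apply: ole_trans (IH j).
by apply: ole_add => //; exact: ole_refl.
Qed.

Lemma opow_mono a b : ole a b -> ole (opow a) (opow b).
Proof.
elim: a b => I f IH [J g] ab; apply: (oleP _ _).2 => x /olt_lub[[i|]] xi; apply/olt_lub.
  have [j ij] := ab i; exists (Some j); apply: olt_ole_trans xi _.
  exact/omul_omega_mono/IH.
by exists None.
Qed.

Lemma opow_lt a b : olt a b -> olt (opow a) (opow b).
Proof.
by move=> /ole_osucc/opow_mono; apply: olt_ole_trans; exact: opow_succ.
Qed.

Lemma opow_le_inv a b : ole (opow a) (opow b) -> ole a b.
Proof.
move=> ab; have [//|/opow_lt ba] := ole_total a b.
by have := olt_le_false ba ab.
Qed.

Lemma opow_lt_inv a b : olt (opow a) (opow b) -> olt a b.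
Proof.
by move=> ab; have [/opow_mono ba|//] := ole_total b a; have := olt_le_false ab ba.
Qed.

Lemma opow_ge a : ole a (opow a).
Proof.
elim: a => I f IH; apply/oleP => x [/= i xi].
apply: ole_olt_trans xi (ole_olt_trans (IH i) _).
exact/opow_lt/(@olt_sub (osup1 f) i).
Qed.

(** [omul] adds copies of [c] on the right, whereas [mor_ind] peels paths from the left; for finite
    factors the two agree by associativity. The base case amounts to [0 + c <= c]. *)
Lemma omulS_le c n : ole (omul c (onat n.+1)) (oadd c (omul c (onat n))).
Proof.
elim: n => [|n IH].
  apply: (ole_trans (omulS c 0).1); apply/oleP => x /olt_add[/olt_lub[[]]|].
  move=> [y yc xy]; apply/olt_add; left; apply: ole_olt_trans xy _.
  apply: ole_olt_trans yc; apply/oleP => z /olt_add[/olt_lub[[]]|[w wy zw]].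
  elim: y z w wy zw => I f IH z w [i wi] zw; exists i.
  apply: (ole_trans zw); apply/oleP => u /olt_add[/olt_lub[[]]|[v vw uv]].
  by apply: IH uv; exact: olt_ole_trans vw wi.
apply: (ole_trans (omulS c n.+1).1).
apply: (ole_trans (ole_add IH (ole_refl c))).
apply: (ole_trans (oaddA_le _ _ _)); apply: ole_add; first exact: ole_refl.
exact: (omulS c n).2.
Qed.

Lemma ole_add_cancel a b c : ole (oadd a b) (oadd a c) -> ole b c.
Proof.
move=> h; have [//|cb] := ole_total b c.
by have := olt_le_false (olt_add2l a cb) h.
Qed.

End OrdinalFacts.

Section Paths.
Variable L : ograph.
Implicit Types (e f g h k v : L) (a b : ord).

Lemma factor_unique e f e' f' : src e = rng f -> src e' = rng f' ->
  comp e f = comp e' f' -> oeq (deg e) (deg e') -> e = e' /\ f = f'.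
Proof.
move=> ef ef' E d.
have de : ole (deg e) (deg (comp e f)).
  by have [_ h] := deg_comp ef; apply: ole_trans h; exact: ole_addr.
have [[x y] [_ U]] := deg_factor de.
have /U[xe yf] : [/\ src (e, f).1 = rng (e, f).2, comp e f = comp (e, f).1 (e, f).2
  & oeq (deg (e, f).1) (deg e)] by split => //; split; exact: ole_refl.
have /U[xe' yf'] : [/\ src (e', f').1 = rng (e', f').2,
  comp e f = comp (e', f').1 (e', f').2 & oeq (deg (e', f').1) (deg e)].
  by split => //; exact: oeq_sym.
by rewrite -xe -yf.
Qed.

Lemma comp_inj e f f' : src e = rng f -> src e = rng f' ->
  comp e f = comp e f' -> f = f'.
Proof.
move=> ef ef' E.
by have [_] := factor_unique ef ef' E (conj (ole_refl _) (ole_refl _)).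
Qed.

Lemma deg_rng e : oeq (deg (rng e)) ozero.
Proof. by rewrite -src_rng; exact: deg_src. Qed.

Lemma vertex_src v : is_vertex v -> src v = v.
Proof. by move=> vv; rewrite -{1}vv src_rng. Qed.

Lemma vertex_deg v : is_vertex v -> oeq (deg v) ozero.
Proof. by move=> <-; exact: deg_rng. Qed.

Lemma rng_vertex e : is_vertex (rng e).
Proof. by rewrite /is_vertex -(src_rng e) rng_src. Qed.

Lemma src_vertex e : is_vertex (src e).
Proof. exact: rng_src. Qed.

Lemma src_src e : src (src e) = src e.
Proof. exact/vertex_src/src_vertex. Qed.

Lemma rng_rng e : rng (rng e) = rng e.
Proof. exact: rng_vertex. Qed.

(** [rng e] followed by [e], and [e] followed by [src e], are factorizations of [e] whose first
    factors both have degree 0. *)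
Lemma deg0_vertex e : ole (deg e) ozero -> is_vertex e.
Proof.
move=> e0; have [] := @factor_unique (rng e) e e (src e).
- by rewrite src_rng.
- by rewrite rng_src.
- by rewrite comp_rng comp_src.
- apply: (oeq_trans (deg_rng e)); split => //; exact: ole0.
by [].
Qed.

Lemma prefix_exists e a : ole a (deg e) ->
  exists2 f, extensions f e & oeq (deg f) a.
Proof.
move=> ae; have [[f g] [[/= fg -> fa] _]] := deg_factor ae.
by exists f => //; exists g.
Qed.

Lemma ext_refl e : extensions e e.
Proof. by exists (src e); rewrite ?rng_src// comp_src. Qed.

Lemma ext_trans f e g : extensions e f -> extensions f g -> extensions e g.
Proof.
move=> [k ek ->] [l]; rewrite src_comp// => kl ->.
by exists (comp k l); rewrite ?rng_comp// compA.
Qed.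

Lemma ext_rng e f : extensions e f -> rng f = rng e.
Proof. by move=> [k ek ->]; rewrite rng_comp. Qed.

Lemma ext_deg e f : extensions e f -> ole (deg e) (deg f).
Proof.
by move=> [k ek ->]; apply: ole_trans (deg_comp ek).2; exact: ole_addr.
Qed.

Lemma comp_below_tail a e f : src e = rng f -> below L a (comp e f) -> below L a f.
Proof.
move=> ef; apply: ole_olt_trans; apply: ole_trans (deg_comp ef).2.
exact: ole_addl.
Qed.

Lemma below_comp a e f : src e = rng f -> below L a e -> below L a f ->
  below L a (comp e f).
Proof.
by move=> ef ea fa; have := @comp_below L a e f ef; rewrite !inE; apply.
Qed.

(** Comparability in the prefix order. By [cmp_exts] it means that [e] and [f] have a common
    extension, so its negation is the hypothesis of relation (iii). *)
Definition cmp e f := extensions e f \/ extensions f e.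

Lemma cmp_sym e f : cmp e f -> cmp f e.
Proof. by case; [right|left]. Qed.

Lemma ext_le_deg h e f : extensions e h -> extensions f h ->
  ole (deg e) (deg f) -> extensions e f.
Proof.
move=> [k ek ->] [l fl E] /prefix_exists[e' [m em fE] ee].
have mE : src m = rng l by rewrite -fl fE src_comp.
have [-> _] : e = e' /\ k = comp m l.
  apply: factor_unique; [exact: ek|by rewrite rng_comp|by rewrite E fE compA|].
  exact: oeq_sym.
by exists m.
Qed.

Lemma ext_cmp h e f : extensions e h -> extensions f h -> cmp e f.
Proof.
move=> eh fh; have [ef|/oltW fe] := ole_total (deg e) (deg f).
  by left; exact: ext_le_deg eh fh ef.
by right; exact: ext_le_deg fh eh fe.
Qed.

Lemma cmp_exts e f : cmp e f <-> extensions e `&` extensions f !=set0.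
Proof.
split=> [[ef|fe]|[h [eh fh]]]; last exact: ext_cmp eh fh.
  by exists f; split => //; exact: ext_refl.
by exists e; split => //; exact: ext_refl.
Qed.

Lemma ext_anti e f : extensions e f -> ole (deg f) (deg e) -> e = f.
Proof.
move=> ef fe; have [] := @factor_unique e (src e) f (src f).
- by rewrite rng_src.
- by rewrite rng_src.
- have [k ek fE] := ef; rewrite !comp_src.
  suff kv : is_vertex k by rewrite fE -kv -ek comp_src.
  apply: deg0_vertex; apply: (@ole_add_cancel (deg e)).
  apply: (ole_trans (deg_comp ek).2); rewrite -fE; apply: (ole_trans fe).
  exact: ole_addr.
- split => //; exact: ext_deg.
by [].
Qed.

Lemma cmp_le e f : cmp e f -> ole (deg e) (deg f) -> extensions e f.
Proof.
by move=> [//|fe] d; rewrite (ext_anti fe d); exact: ext_refl.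
Qed.

Lemma cmp_eq e f : cmp e f -> oeq (deg e) (deg f) -> e = f.
Proof. by move=> c [d d']; apply: ext_anti => //; exact: cmp_le. Qed.

Lemma ext_compl e f g : src e = rng f -> src e = rng g ->
  extensions (comp e f) (comp e g) <-> extensions f g.
Proof.
move=> ef eg; split=> -[k]; rewrite ?src_comp// => fk gE; exists k => //.
  by apply: (@comp_inj e) => //; rewrite ?rng_comp// compA.
  by rewrite src_comp.
by rewrite gE compA.
Qed.

Lemma cmp_compl e f g : src e = rng f -> src e = rng g ->
  cmp (comp e f) (comp e g) <-> cmp f g.
Proof. by move=> ef eg; rewrite /cmp !ext_compl. Qed.

Lemma ext_comp e f : src e = rng f -> extensions e (comp e f).
Proof. by exists f. Qed.

Lemma cmp_shorter e e' f : extensions e e' -> cmp e' f -> cmp e f.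
Proof.
move=> ee [ef|fe]; first by left; exact: ext_trans ef.
exact: ext_cmp ee fe.
Qed.

Lemma pow_edges_neq0 a e : pow_edges L a e -> ~ is_vertex e.
Proof.
move=> [ea ae] /vertex_deg[e0 _].
exact: olt_le_false (opow_gt0 a) (ole_trans ae e0).
Qed.

Lemma pow_edges_exp a b e : pow_edges L a e -> pow_edges L b e -> oeq a b.
Proof.
move=> [ea ae] [eb be]; split; apply: opow_le_inv.
  exact: ole_trans ae eb.
exact: ole_trans be ea.
Qed.

Lemma pow_edges_eq a b e : oeq a b -> pow_edges L a e -> pow_edges L b e.
Proof.
move=> [ab ba] [ea ae]; split; first exact: ole_trans ea (opow_mono ab).
exact: ole_trans (opow_mono ba) ae.
Qed.

Lemma pow_edges_comp a e f : src e = rng f -> below L a e -> pow_edges L a f ->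
  pow_edges L a (comp e f).
Proof.
move=> ef ea [fa af]; have [h1 h2] := deg_comp ef.
have [k1 k2] := oadd_absorb ea; split.
  exact: ole_trans h1 (ole_trans (ole_add2l _ fa) k1).
exact: ole_trans k2 (ole_trans (ole_add2l _ af) h2).
Qed.

(** Degrees below [omega ^ a] are closed under addition: if the tail were shorter than [omega ^ a],
    so would be the whole path. *)
Lemma pow_edges_tail a e f : src e = rng f -> below L a e ->
  pow_edges L a (comp e f) -> pow_edges L a f.
Proof.
move=> ef ea [h1 h2]; have [d1 d2] := deg_comp ef; split.
  by apply: ole_trans h1; apply: ole_trans d2; exact: ole_addl.
have [//|fa] := ole_total (opow a) (deg f).
have := olt_le_false (ole_olt_trans d1 (opow_add ea fa)) h2.
by [].
Qed.

Lemma below_lt a b e : ole a b -> below L a e -> below L b e.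
Proof. by move=> /opow_mono ab ea; exact: olt_ole_trans ea ab. Qed.

Lemma pow_below a b e : olt a b -> pow_edges L a e -> below L b e.
Proof. by move=> /opow_lt ab [ea _]; exact: ole_olt_trans ea ab. Qed.

Lemma vertex_below a v : is_vertex v -> below L a v.
Proof. by move=> /vertex_deg[v0 _]; exact: ole_olt_trans v0 (opow_gt0 a). Qed.

Lemma generator_comp e f : generator e -> generator f -> src e = rng f ->
  olt (deg e) (deg f) -> generator (comp e f).
Proof.
move=> _ [fv|[a fa]] ef d.
  have [f0 _] := vertex_deg fv; have := olt_ole_trans d f0.
  by move=> h; have := olt_le_false h (ole0 _).
right; exists a; apply: pow_edges_comp => //; have [h _] := fa.
exact: olt_ole_trans d h.
Qed.

(** Induction along the Cantor normal form of the degree: [g] carries the leading power and the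
    bound on [f] says that exponents do not increase along the path. The outer induction is on a
    bound for the exponents, the inner one on a bound for the coefficient of the leading power. *)
Lemma mor_ind (P : L -> Prop) : (forall v, is_vertex v -> P v) ->
  (forall b g f, pow_edges L b g -> src g = rng f -> below L (osucc b) f ->
    P f -> P (comp g f)) ->
  forall e, P e.
Proof.
move=> Pv Pc e; have : olt (deg e) (opow (osucc (deg e))).
  exact: ole_olt_trans (opow_ge _) (opow_succ _).
move: (osucc _) => d; elim: d e => I F IH e /olt_lub[[i|]]; last first.
  by move=> /olt_osucc e0; exact/Pv/deg0_vertex.
move=> /olt_mul_omega[n]; elim: n e => [|n IHn] e en.
  by have /olt_lub[[]] := en.
have [ge|lt] := ole_total (opow (F i)) (deg e); last exact: IH lt.
have [[g f] [[/= gf eE gi] _]] := deg_factor ge.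
rewrite eE; apply: (Pc (F i)) => //.
  have [_ h] := deg_comp gf; rewrite -eE in h.
  apply: (@ole_olt_trans (deg e)); first by apply: ole_trans h; exact: ole_addl.
  by apply/olt_lub; exists (Some tt); apply/olt_mul_omega; exists n.+1.
apply: IHn; have [h|//] := ole_total (omul (opow (F i)) (onat n)) (deg f).
exfalso; apply: (olt_le_false en); apply: (ole_trans (omulS_le _ _)).
apply: (ole_trans (ole_add gi.2 h)); rewrite eE; exact: (deg_comp gf).2.
Qed.

Lemma vertex_or_pow e : is_vertex e \/ exists b g f,
  [/\ pow_edges L b g, src g = rng f, below L (osucc b) f & e = comp g f].
Proof.
elim/mor_ind: e => [v vv|b g f gb gf fb _]; first by left.
by right; exists b, g, f.
Qed.

(** Prepending [e] embeds the edges of degree [omega ^ a] at [src e] into those at [rng e]. *)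
Lemma regular_src a e : below L a e -> regular a (rng e) -> regular a (src e).
Proof.
move=> ea [_ sr rf]; split; first exact: src_vertex.
  move=> g ge ga; have [|f [fg fa]] := sr (comp e g) _ (below_comp (esym ge) ea ga).
    by rewrite rng_comp.
  by exists f; rewrite fg src_comp.
have inj : {in [set f | rng f = src e /\ pow_edges L a f] &, injective (comp e)}.
  by move=> f g; rewrite !inE => -[fe _] [ge _]; apply: comp_inj.
rewrite /row_finite -(eq_finite_set (inj_card_eq inj)).
apply: sub_finite_set rf => _ [f [fe fa] <-] /=.
by rewrite rng_comp//; split => //; apply: pow_edges_comp.
Qed.

(** By source regularity at [b] every edge of degree [omega ^ a] at [v] is a prefix of one of degree
    [omega ^ b], and an edge has only one prefix of a given degree. So the shorter edges lie in the
    image of a finite set. *)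
Lemma regular_le a b v : ole a b -> regular b v -> regular a v.
Proof.
move=> ab [vv sr rf].
have ext f : pow_edges L b f -> exists2 g, extensions g f & pow_edges L a g.
  move=> [_ bf]; have [|g gf ga] := @prefix_exists f (opow a).
    exact: ole_trans (opow_mono ab) bf.
  by exists g.
split=> //.
  move=> e ev ea; have [|f [fe fb]] := sr e ev; first exact: below_lt ea.
  by have [g gf ga] := ext f fb; exists g; rewrite -fe (ext_rng gf).
have pick f : exists g, pow_edges L b f -> extensions g f /\ pow_edges L a g.
  have [fb|nfb] := pselect (pow_edges L b f); last by exists f.
  by have [g gf ga] := ext f fb; exists g.
have [t tP] := choice pick.
have ft := finite_image t rf; apply: sub_finite_set ft => g [gv ga] /=.
have [bl|bl] := ole_total b a.
  have gb : pow_edges L b g by apply: pow_edges_eq ga; split.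
  have [tg tga] := tP g gb; exists g => //; apply: ext_anti tg _.
  exact: ole_trans ga.1 tga.2.
have [f [fg fb]] := sr g gv (pow_below bl ga).
have gf : src g = rng f by [].
exists (comp g f).
  by split; [rewrite rng_comp|apply: pow_edges_comp => //; exact: pow_below ga].
have gfb : pow_edges L b (comp g f) by apply: pow_edges_comp => //; exact: pow_below ga.
have [te tb] := tP _ gfb; apply: cmp_eq; first exact: ext_cmp te (ext_comp gf).
by split; [exact: ole_trans tb.1 ga.2|exact: ole_trans ga.1 tb.2].
Qed.

(* A cycle at a regular vertex permutes the finite set of long edges there, so a
   power of it fixes one of them. *)
Lemma regular_loop a u k : condition_C L -> regular a u -> below L a k ->
  src k = u -> rng k = u -> is_vertex k.
Proof.
move=> HC ru ka ku ur; have [uv sr rf] := ru.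
have [f [fu fa]] := sr u uv (vertex_below a uv).
rewrite vertex_src// in fu.
pose pw n := iter n (comp k) f.
have pwP n : rng (pw n) = u /\ pow_edges L a (pw n).
  elim: n => [//|n [IH1 IH2]] /=; rewrite rng_comp ?IH1//.
  by split => //; apply: pow_edges_comp => //; rewrite ku.
pose ps n := iter n (comp k) u.
have psP n : [/\ src (ps n) = u, rng (ps n) = u & pw n = comp (ps n) f].
  elim: n => [|n [IH1 IH2 IH3]] /=.
    by split; [exact: vertex_src| |rewrite -{1}(comp_rng f) fu].
  by rewrite src_comp ?rng_comp ?IH2// IH3 compA ?IH1 ?IH2.
have [n [m [nm E]]] : exists n m, (n < m)%N /\ pw n = pw m.
  apply: contrapT => ne; have inj : {in setT &, injective pw}.
    move=> n m _ _ E; apply/eqP/negPn/negP => nm; apply: ne.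
    by move: nm; rewrite neq_ltn => /orP[h|h]; [exists n, m|exists m, n].
  have : finite_set (pw @` setT) by apply: sub_finite_set rf => _ [n _ <-]; exact: pwP.
  by rewrite (eq_finite_set (inj_card_eq inj)); exact: infinite_nat.
have cancel (i j : nat) : pw i = pw (i + j)%N -> f = pw j.
  elim: i => [//|i IH] /= h; apply: IH; apply: comp_inj h; rewrite ku.
    by have [] := pwP i.
  by have [] := pwP (i + j)%N.
have /cancel fm : pw n = pw (n + (m - n))%N by rewrite subnKC// ltnW.
have m0 : (0 < m - n)%N by rewrite subn_gt0.
move: (m - n)%N m0 fm => [//|j] _ fm.
have [s1 s2 s3] := psP j.+1.
have := HC a f (ps j.+1) fa; rewrite fu -s3 -fm => /(_ ru s1 erefl)[d _].
apply: deg0_vertex; apply: ole_trans d; apply: ext_deg.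
by apply: ext_comp; rewrite ku; have [] := psP j.
Qed.

End Paths.

(** * The elements T_e *)

Section PathElements.
Variables (R : realType) (L : ograph) (B : cstar_alg R) (T : L -> B).
Hypothesis HT : graph_family T.
Implicit Types (e f g h k v : L) (a b : ord).

Lemma gen_v v : is_vertex v -> generator v. Proof. by left. Qed.
Lemma gen_p a e : pow_edges L a e -> generator e. Proof. by right; exists a. Qed.

Lemma Tvv v : is_vertex v -> (T v)^# ** T v = T v.
Proof. by move=> vv; rewrite (family_src HT) ?vertex_src//; left. Qed.

Lemma Tv_adj v : is_vertex v -> (T v)^# = T v.
Proof. by move=> vv; rewrite -{1}(Tvv vv) cadjM cadjK Tvv. Qed.

Lemma TvTv v : is_vertex v -> T v ** T v = T v.
Proof. by move=> vv; rewrite -{1}(Tv_adj vv) Tvv. Qed.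

Lemma Tg_src g : generator g -> T g ** T (src g) = T g.
Proof. by move=> gg; rewrite -(family_src HT gg) cmulA (family_pisom HT). Qed.

Lemma Tg_rng g : generator g -> T (rng g) ** T g = T g.
Proof.
move=> [gv|[a ga]]; first by rewrite gv TvTv.
rewrite (family_comp HT) ?comp_rng//.
- by left; exact: rng_vertex.
- by right; exists a.
- by rewrite src_rng.
have [h _] := deg_rng g; apply: ole_olt_trans h _.
exact: olt_ole_trans (opow_gt0 a) ga.2.
Qed.

(** A relation, because [mor_ind] only proves propositions. The bound on the tail makes the
    decomposition of a path unique, so that the value depends on the path alone. *)
Inductive path_nf : L -> B -> Prop :=
| path_nf_v v : is_vertex v -> path_nf v (T v)
| path_nf_c a g f t : pow_edges L a g -> src g = rng f ->
    below L (osucc a) f -> path_nf f t -> path_nf (comp g f) (T g ** t).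

Lemma comp_pow_notv a g f : pow_edges L a g -> src g = rng f ->
  ~ is_vertex (comp g f).
Proof.
move=> [_ ag] gf /vertex_deg[d _]; apply: (olt_le_false (opow_gt0 a)).
apply: ole_trans ag (ole_trans _ d); exact/ext_deg/ext_comp.
Qed.

Lemma path_nf_inv e t : path_nf e t -> is_vertex e /\ t = T e \/
  exists a g f s, [/\ pow_edges L a g, src g = rng f, below L (osucc a) f,
    path_nf f s & e = comp g f /\ t = T g ** s].
Proof. by case=> [v vv|a g f s *]; [left|right; exists a, g, f, s]. Qed.

Lemma path_nf_unique e t t' : path_nf e t -> path_nf e t' -> t = t'.
Proof.
move=> h; elim: h t' => {e t} [v vv t'|a g f t ga gf fa _ IH t'] /path_nf_inv[].
- by case.
- move=> [a [g [f [s [ga gf _ _ [vE _]]]]]].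
  by have := comp_pow_notv ga gf; rewrite -vE.
- by case=> /(comp_pow_notv ga gf).
move=> [a' [g' [f' [s [ga' gf' fa' ns [E ->]]]]]].
(* The leading exponent is determined by the degree of the whole path; unique factorization then
   identifies the factors. *)
have key b b' x x' y y' : pow_edges L b x -> src x = rng y ->
    below L (osucc b') y' -> pow_edges L b' x' -> src x' = rng y' ->
    comp x y = comp x' y' -> ole b b'.
  move=> xb xy y'b xb' xy' e; apply/(olt_osucc b b')/opow_lt_inv.
  apply: (@ole_olt_trans (deg (comp x' y'))).
    by rewrite -e; apply: ole_trans xb.2 _; exact/ext_deg/ext_comp.
  apply: below_comp => //; apply: pow_below xb'; exact/olt_osucc/ole_refl.
have aa : oeq a a' by split; [exact: key E|exact: key (esym E)].
have [gE fE] : g = g' /\ f = f'.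
  apply: factor_unique => //; apply: oeq_trans ga _; apply: oeq_sym.
  exact: (pow_edges_eq (oeq_sym aa) ga').
by rewrite -gE; congr (_ ** _); apply: IH; rewrite fE.
Qed.

Lemma path_nf_exists e : exists t, path_nf e t.
Proof.
elim/mor_ind: e => [v vv|b g f gb gf fb [t ft]]; first by exists (T v); left.
by exists (T g ** t); exact: (path_nf_c gb gf fb ft).
Qed.

Definition Tp e : B := xget 0 [set t | path_nf e t].

Lemma TpP e : path_nf e (Tp e).
Proof.
by rewrite /Tp; case: xgetP => [t -> //|h]; have [t /h] := path_nf_exists e.
Qed.

Lemma Tp_eq e t : path_nf e t -> Tp e = t.
Proof. by move=> h; exact: path_nf_unique (TpP e) h. Qed.

Lemma Tp_v v : is_vertex v -> Tp v = T v.
Proof. by move=> vv; apply: Tp_eq; left. Qed.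

Lemma Tp_gen g : generator g -> Tp g = T g.
Proof.
move=> [/Tp_v//|[a ga]]; apply: Tp_eq.
rewrite -{1}(comp_src g) -(Tg_src (gen_p ga)).
apply: (@path_nf_c a) => //; first by rewrite rng_src.
  exact/vertex_below/src_vertex.
by left; exact: src_vertex.
Qed.

Lemma Tp_cons a g f : pow_edges L a g -> src g = rng f -> below L (osucc a) f ->
  Tp (comp g f) = T g ** Tp f.
Proof. by move=> ga gf fa; apply: Tp_eq; exact: (path_nf_c ga gf fa (TpP f)). Qed.

Lemma Tp_rng e : T (rng e) ** Tp e = Tp e.
Proof.
elim/mor_ind: e => [v vv|b g f gb gf fb _].
  by rewrite Tp_v// vv TvTv.
by rewrite (Tp_cons gb gf fb) rng_comp// cmulA Tg_rng//; right; exists b.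
Qed.

(** If the leading exponent [b] of [f] is at most [a], this is the normal form itself. Otherwise [g]
    is absorbed into the first edge of [f], which is relation (ii). *)
Let Tp_gM a g f : pow_edges L a g -> src g = rng f -> Tp (comp g f) = T g ** Tp f.
Proof.
move=> ga gf; have gg := gen_p ga.
have [fv|[b [g1 [f1 [g1b gf1 f1b fE]]]]] := vertex_or_pow f.
  have fE : f = src g by rewrite gf fv.
  by rewrite fE comp_src Tp_gen// Tp_v ?Tg_src//; exact: src_vertex.
have g1g := gen_p g1b; have gg1 : src g = rng g1 by rewrite gf fE rng_comp.
have [ba|ab] := ole_total b a.
  apply: (Tp_cons ga) => //; rewrite fE; apply: below_comp => //.
    by apply: pow_below g1b; exact/olt_osucc.
  by apply: below_lt f1b; apply/ole_osucc/olt_osucc.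
rewrite fE compA// (Tp_cons (a := b)).
- rewrite -(family_comp HT gg g1g) //.
    by rewrite -cmulA (Tp_cons g1b).
  exact: ole_olt_trans ga.1 (olt_ole_trans (opow_lt ab) g1b.2).
- by apply: pow_edges_comp => //; exact: pow_below ga.
- by rewrite src_comp.
by [].
Qed.

Lemma TpM e f : src e = rng f -> Tp (comp e f) = Tp e ** Tp f.
Proof.
elim/mor_ind: e f => [v vv f|b g e gb ge eb IH f].
  move=> vf; have -> : v = rng f by rewrite -vf vertex_src.
  by rewrite comp_rng (Tp_v (rng_vertex f)) Tp_rng.
rewrite src_comp// => ef; rewrite -compA// (Tp_gM gb) ?rng_comp// IH// cmulA.
by rewrite (Tp_cons gb).
Qed.

Lemma Tp_src e : Tp e ** T (src e) = Tp e.
Proof.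
have := @TpM e (src e); rewrite rng_src comp_src => /(_ erefl) {2}->.
by rewrite (Tp_v (src_vertex _)).
Qed.

Lemma Tp_star e : (Tp e)^# ** Tp e = T (src e).
Proof.
elim/mor_ind: e => [v vv|b g f gb gf fb IH].
  by rewrite Tp_v// Tvv// vertex_src.
rewrite (Tp_cons gb)// cadjM cmulA -(cmulA _ (T g)^#) (family_src HT (gen_p gb)).
by rewrite gf -cmulA Tp_rng IH src_comp.
Qed.

Lemma Tp_gorth g f : generator g -> ~ cmp g f -> (T g)^# ** Tp f = 0.
Proof.
move=> gg; elim/mor_ind: f g gg => [v vv|b h f hb hf fb IH] g gg ngf.
  rewrite Tp_v//; apply: (family_orth HT gg (gen_v vv)).
  by apply/eqP/negPn/negP => /set0P /cmp_exts.
rewrite (Tp_cons hb)// cmulA.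
have [c|nc] := pselect (cmp g h); last first.
  rewrite (family_orth HT gg (gen_p hb)) ?cmul0l//.
  by apply/eqP/negPn/negP => /set0P /cmp_exts.
case: c => [gh|[k hk gE]].
  by case: ngf; left; apply: ext_trans gh _; exact: ext_comp.
have kg : generator k.
  have [gv|[a ga]] := gg.
    exfalso; apply: (comp_pow_notv hb hk); by rewrite -gE.
  have [ha|ah] := ole_total (opow a) (deg h).
    left; have hg : h = g.
      apply: ext_anti; [by exists k|exact: ole_trans ga.1 ha].
    apply: deg0_vertex; apply: (@ole_add_cancel (deg h)).
    apply: (ole_trans (deg_comp hk).2); rewrite -gE hg; exact: ole_addr.
  by right; exists a; apply: (@pow_edges_tail L a h) => //; rewrite -gE.
have nkf : ~ cmp k f.
  by move=> kf; apply: ngf; rewrite gE; apply/cmp_compl.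
have <- : Tp g = T g by exact: Tp_gen.
rewrite gE TpM// cadjM (Tp_gen (gen_p hb)) -(cmulA _ (T h)^#).
rewrite (family_src HT (gen_p hb)) -cmulA hf Tp_rng (Tp_gen kg).
exact: IH.
Qed.

Lemma Tp_orth e f : ~ cmp e f -> (Tp e)^# ** Tp f = 0.
Proof.
elim/mor_ind: e f => [v vv|b g e gb ge eb IH] f nef.
  by rewrite (Tp_v vv); apply: Tp_gorth => //; left.
rewrite (Tp_cons gb)// cadjM -cmulA.
have [c|nc] := pselect (cmp g f); last by rewrite (Tp_gorth (gen_p gb) nc) cmul0r.
case: c => [[k gk fE]|fg]; last first.
  by case: nef; right; apply: ext_trans fg _; exact: ext_comp.
rewrite fE TpM// (Tp_gen (gen_p gb)) (cmulA (T g)^#).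
rewrite (family_src HT (gen_p gb)) gk Tp_rng; apply: IH.
by move=> ek; apply: nef; rewrite fE; apply/cmp_compl.
Qed.

Lemma Tp_ext e k : src e = rng k -> (Tp e)^# ** Tp (comp e k) = Tp k.
Proof. by move=> ek; rewrite TpM// cmulA Tp_star ek Tp_rng. Qed.

Lemma Tp_extl e k : src e = rng k -> (Tp (comp e k))^# ** Tp e = (Tp k)^#.
Proof. by move=> ek; rewrite -(Tp_ext ek) cadjM cadjK. Qed.

Lemma Tp_pisom e : Tp e ** (Tp e)^# ** Tp e = Tp e.
Proof. by rewrite -cmulA Tp_star Tp_src. Qed.

Lemma Tp_nm1 e : nm (Tp e) <= 1.
Proof.
have [e0|e0] := eqVneq (nm (Tp e)) 0; first by rewrite e0.
have ep : 0 < nm (Tp e) by rewrite lt_def e0 nm_ge0.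
have h : nm (Tp e) ^+ 2 <= 1.
  have h1 := nm_star (Tp e); rewrite Tp_star in h1.
  have h2 := nm_star (T (src e)); rewrite Tvv ?h1 in h2; last exact: src_vertex.
  have := exprn_gt0 2 ep; move: (_ ^+ 2) h2 => x *; nra.
nra.
Qed.

Lemma T_nm v : is_vertex v -> T v <> 0 -> nm (T v) = 1.
Proof.
move=> vv v0; have := nm_star (T v); rewrite Tvv//.
have : nm (T v) != 0 by apply/eqP => /nm_eq0.
by move=> n0; rewrite expr2 -{1}(mul1r (nm _)) => /(mulIf n0).
Qed.

Lemma Tp_nm e : T (src e) <> 0 -> nm (Tp e) = 1.
Proof.
move=> s0; have := nm_star (Tp e); rewrite Tp_star T_nm//; last exact: src_vertex.
have := nm_ge0 (Tp e); move: (nm _) => x x0 h; nra.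
Qed.

End PathElements.

(** * Closed subalgebras, and density of the polynomials in the generators *)

Section SubCStar.
Variables (R : realType) (A : cstar_alg R) (P : set A).
Hypothesis P0 : P 0.
Hypothesis P_lin : forall (c : R[i]) x y, P x -> P y -> P (c *: x + y).
Hypothesis P_mul : forall x y, P x -> P y -> P (x ** y).
Hypothesis P_adj : forall x, P x -> P x^#.
Hypothesis P_closed : forall x, adh P x -> P x.

Definition subcs_pred : pred A := fun x => `[< P x >].
Definition subcs := {x : A | subcs_pred x}.
HB.instance Definition _ := SubChoice.on subcs.
Implicit Types x y z : subcs.

Let valP' x : P (val x). Proof. exact/asboolP/(valP x). Qed.
Let mk (x : A) (Px : P x) : subcs := exist _ x (asboolT Px).

Let PZ (c : R[i]) (x : A) : P x -> P (c *: x).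
Proof. by move=> Px; rewrite -[_ *: _]addr0; exact: P_lin. Qed.
Let PD (x y : A) : P x -> P y -> P (x + y).
Proof. by move=> Px Py; rewrite -(scale1r x); exact: P_lin. Qed.
Let PN (x : A) : P x -> P (- x).
Proof. by rewrite -scaleN1r; exact: PZ. Qed.

Let sadd x y := mk (PD (valP' x) (valP' y)).
Let szero := mk P0.
Let sopp x := mk (PN (valP' x)).
Let sscal c x := mk (PZ c (valP' x)).
Let smul x y := mk (P_mul (valP' x) (valP' y)).
Let sadj x := mk (P_adj (valP' x)).

Let saddA : associative sadd. Proof. by move=> x y z; apply: val_inj; exact: addrA. Qed.
Let saddC : commutative sadd. Proof. by move=> x y; apply: val_inj; exact: addrC. Qed.
Let sadd0 : left_id szero sadd. Proof. by move=> x; apply: val_inj; exact: add0r. Qed.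
Let saddN : left_inverse szero sopp sadd.
Proof. by move=> x; apply: val_inj; exact: addNr. Qed.
HB.instance Definition _ := GRing.isZmodule.Build subcs saddA saddC sadd0 saddN.

Let sscalA c d x : sscal c (sscal d x) = sscal (c * d) x.
Proof. by apply: val_inj; exact: scalerA. Qed.
Let sscal1 : left_id 1 sscal. Proof. by move=> x; apply: val_inj; exact: scale1r. Qed.
Let sscalDr : right_distributive sscal +%R.
Proof. by move=> c x y; apply: val_inj; exact: scalerDr. Qed.
Let sscalDl x : {morph sscal^~ x : c d / c + d}.
Proof. by move=> c d; apply: val_inj; exact: scalerDl. Qed.
HB.instance Definition _ := GRing.Zmodule_isLmodule.Build R[i] subcs
  sscalA sscal1 sscalDr sscalDl.

Let snorm x : R[i] := `|val x|.
Let snormD x y : snorm (x + y) <= snorm x + snorm y. Proof. exact: ler_normD. Qed.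
Let snormZ c x : snorm (c *: x) = `|c| * snorm x. Proof. exact: normrZ. Qed.
Let snorm0 x : snorm x = 0 -> x = 0.
Proof. by move=> h; apply: val_inj; apply/eqP; rewrite -normr_eq0; apply/eqP. Qed.
HB.instance Definition _ := @Lmodule_isNormed.Build R[i] subcs snorm snormD snormZ snorm0.

Let scomplete (u : nat -> subcs) : cauchys u -> exists l, tends u l.
Proof.
move=> cu; have [|l hl] := @complete_seq R A (fun n => val (u n)); first exact: cu.
have Pl : P l by apply: P_closed; apply: tends_adh hl => n; exact: valP'.
by exists (mk Pl).
Qed.
HB.instance Definition _ := Uniform_isComplete.Build subcs (seq_complete scomplete).

Let smulA x y z : smul x (smul y z) = smul (smul x y) z.
Proof. by apply: val_inj; exact: cmulA. Qed.
Let smul_linl (c : R[i]) x y z : smul (c *: x + y) z = c *: smul x z + smul y z.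
Proof. by apply: val_inj; exact: cmul_linl. Qed.
Let smul_linr (c : R[i]) x y z : smul z (c *: x + y) = c *: smul z x + smul z y.
Proof. by apply: val_inj; exact: cmul_linr. Qed.
Let sadj_lin (c : R[i]) x y : sadj (c *: x + y) = conjc c *: sadj x + sadj y.
Proof. by apply: val_inj; exact: cadj_lin. Qed.
Let sadjM x y : sadj (smul x y) = smul (sadj y) (sadj x).
Proof. by apply: val_inj; exact: cadjM. Qed.
Let sadjK x : sadj (sadj x) = x.
Proof. by apply: val_inj; exact: cadjK. Qed.
Let snormM x y : `|smul x y| <= `|x| * `|y|. Proof. exact: cnormM. Qed.
Let snorm_star x : `|smul (sadj x) x| = `|x| ^+ 2. Proof. exact: cnorm_star. Qed.

Lemma sub_cstar : exists (B : cstar_alg R) (j : B -> A),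
  [/\ star_hom j, injective j & forall x : A, P x <-> exists b, j b = x].
Proof.
exists (CStarAlg smulA smul_linl smul_linr sadj_lin sadjM sadjK snormM snorm_star).
exists (fun x : subcs => val x); split => [|x y|x]; first by split.
  exact: val_inj.
by split=> [Px|[b <-]]; [exists (mk Px)|exact: valP'].
Qed.

End SubCStar.

Lemma hom_fsum (R : realType) (A B : cstar_alg R) (f : A -> B) (I : choiceType)
  (D : set I) (F : I -> A) : star_hom f -> finite_set D ->
  f (\sum_(i \in D) F i) = \sum_(i \in D) f (F i).
Proof. by move=> fH fD; rewrite !fsbig_finite// (hom_sum fH). Qed.

Lemma graph_family_inj (R : realType) (L : ograph) (A B : cstar_alg R) (j : B -> A)
  (T : L -> B) : star_hom j -> injective j -> graph_family (j \o T) -> graph_family T.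
Proof.
move=> jH ji HT; split=> [e eg|e eg|e f eg fg ef d|e f eg fg ef|a v rv];
  apply: ji; rewrite ?(star_homM jH) ?(star_hom_adj jH) ?(hom0 jH).
- exact: (family_pisom HT).
- exact: (family_src HT).
- exact: (family_comp HT).
- exact: (family_orth HT).
rewrite hom_fsum//; last by have [] := rv.
rewrite [LHS](family_sum HT rv); apply: eq_fsbigr => e _.
by rewrite (star_homM jH) (star_hom_adj jH).
Qed.

Lemma graph_family_ext (R : realType) (L : ograph) (B : cstar_alg R) (T S : L -> B) :
  (forall e, generator e -> T e = S e) -> graph_family T -> graph_family S.
Proof.
move=> TS HT; have TSs e : T (src e) = S (src e) by apply: TS; left; exact: src_vertex.
split=> [e eg|e eg|e f eg fg ef d|e f eg fg ef|a v rv].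
- by rewrite -!TS// (family_pisom HT).
- by rewrite -!TS ?(family_src HT)//; left; exact: src_vertex.
- by rewrite -!TS ?(family_comp HT)//; exact: generator_comp.
- by rewrite -!TS// (family_orth HT).
rewrite -TS; last by left; case: rv.
rewrite (family_sum HT rv); apply: eq_fsbigr => e; rewrite inE => -[_ ea].
by rewrite TS//; right; exists a.
Qed.

Section GraphAlgebraGenerated.
Variables (R : realType) (L : ograph) (O : graph_alg R L).

Lemma graph_hom_eq (B : cstar_alg R) (h k : O -> B) : star_hom h -> star_hom k ->
  (forall e, generator e -> h (gen O e) = k (gen O e)) -> h = k.
Proof.
move=> hH kH hk; pose T e := h (gen O e).
have HT : graph_family T.
  have HO := gen_family O.
  split=> [e eg|e eg|e f eg fg ef d|e f eg fg ef|a v rv];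
    rewrite /T -?(star_hom_adj hH) -?(star_homM hH).
  - by rewrite (family_pisom HO).
  - by rewrite (family_src HO).
  - by rewrite (family_comp HO).
  - by rewrite (family_orth HO)// (hom0 hH).
  rewrite (family_sum HO rv) hom_fsum//; last by have [] := rv.
  by apply: eq_fsbigr => e _; rewrite (star_homM hH) (star_hom_adj hH).
have [l [_ U]] := gen_universal O HT.
have <- : l = h by apply: U; split.
by apply: U; split => // e eg; rewrite -hk.
Qed.

(** The elements satisfying [P] form a closed star subalgebra, that is a C*-algebra [B] containing
    the family. The universal map into [B], followed by the inclusion, fixes the generators and is
    therefore the identity, so every element lies in [B]. *)
Lemma graph_alg_ind (P : set O) : P 0 ->
  (forall (c : R[i]) x y, P x -> P y -> P (c *: x + y)) ->
  (forall x y, P x -> P y -> P (x ** y)) -> (forall x, P x -> P x^#) ->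
  (forall x, adh P x -> P x) -> (forall e, generator e -> P (gen O e)) ->
  forall x, P x.
Proof.
move=> P0 Pl Pm Pa Pc Pg x.
have [B [j [jH ji jP]]] := sub_cstar P0 Pl Pm Pa Pc.
have /choice[T hT] : forall e, exists b, generator e -> j b = gen O e.
  move=> e; have [eg|ne] := pselect (generator e); last by exists 0.
  by have /jP[b bE] := Pg e eg; exists b.
have HT : graph_family T.
  apply: (graph_family_inj jH ji); apply: graph_family_ext (gen_family O).
  by move=> e eg /=; rewrite hT.
have [h [[hH hg] _]] := gen_universal O HT.
have jh : star_hom (j \o h).
  split=> [c y z|y z|y] /=.
  - by rewrite (star_hom_lin hH) (star_hom_lin jH).
  - by rewrite (star_homM hH) (star_homM jH).
  by rewrite (star_hom_adj hH) (star_hom_adj jH).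
have idh : star_hom (@idfun O) by [].
apply/jP; exists (h x).
have := graph_hom_eq jh idh; move=> /(_ _)/(congr1 (fun k => k x)); apply.
by move=> e eg /=; rewrite hg// hT.
Qed.

Notation T := (gen O).
Let HO := gen_family O.

Definition monomial (p : R[i] * (L * L)) : O :=
  p.1 *: (Tp T p.2.1 ** (Tp T p.2.2)^#).

Definition poly_in (G : L -> L -> Prop) : set O := [set x |
  exists s : seq (R[i] * (L * L)), (forall p, p \in s -> G p.2.1 p.2.2) /\
    x = \sum_(p <- s) monomial p].

Lemma poly_in0 G : poly_in G 0.
Proof. by exists nil; rewrite big_nil. Qed.

Lemma poly_in_lin G (c : R[i]) x y : poly_in G x -> poly_in G y -> poly_in G (c *: x + y).
Proof.
move=> [s [sG ->]] [t [tG ->]].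
exists ([seq (c * p.1, p.2) | p <- s] ++ t); split.
  by move=> p; rewrite mem_cat => /orP[/mapP[q qs ->]|/tG//]; exact: sG q qs.
rewrite big_cat/= big_map scaler_sumr; congr (_ + _).
by apply: eq_bigr => p _; rewrite /monomial/= scalerA.
Qed.

Lemma poly_in1 G (e f : L) : G e f -> poly_in G (Tp T e ** (Tp T f)^#).
Proof.
move=> ef; exists [:: (1, (e, f))]; split; first by move=> p; rewrite inE => /eqP->.
by rewrite big_seq1 /monomial scale1r.
Qed.

Lemma adh_lin (V : normedModType R[i]) (P : set V) :
  (forall (c : R[i]) x y, P x -> P y -> P (c *: x + y)) ->
  forall (c : R[i]) x y, adh P x -> adh P y -> adh P (c *: x + y).
Proof.
move=> Pl c x y hx hy e e0.
have [|x' Px hx'] := hx (e / (2 * (cn c + 1))).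
  by rewrite divr_gt0//; have := cn_ge0 c; lra.
have [|y' Py hy'] := hy (e / 2); first by lra.
exists (c *: x' + y'); first exact: Pl.
rewrite opprD addrACA -scalerBr; apply: le_trans (nmD _ _) _; rewrite nmZ.
have := @split_eps R (cn c) (nm (x - x')) (nm (y - y')) 1 e (cn_ge0 c) ler01 e0.
by rewrite !mulr1; apply.
Qed.

Lemma adh_hom (V W : normedModType R[i]) (P : set V) (Q : set W) (f : V -> W) (K : R) :
  (forall x y, nm (f x - f y) <= K * nm (x - y)) -> (forall x, P x -> adh Q (f x)) ->
  forall x, adh P x -> adh Q (f x).
Proof.
move=> fK fP x hx; apply: adh_idem => e e0.
have K0 : 0 < `|K| + 1 by have := normr_ge0 K; lra.
have [|y Py xy] := hx (e / (`|K| + 1)); first by rewrite divr_gt0.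
exists (f y); first exact: fP.
apply: le_trans (fK _ _) _; move: xy; rewrite ler_pdivlMr// => xy.
have := ler_norm K; have := nm_ge0 (x - y); nra.
Qed.

Lemma adh_mul_lip (A : cstar_alg R) (a x y : A) :
  nm (a ** x - a ** y) <= nm a * nm (x - y) /\ nm (x ** a - y ** a) <= nm a * nm (x - y).
Proof. by rewrite -cmulBr -cmulBl; split; [exact: nmM|rewrite mulrC; exact: nmM]. Qed.

Lemma adj_lip (A : cstar_alg R) (x y : A) : nm (x^# - y^#) <= 1 * nm (x - y).
Proof. by rewrite -cadjB nm_adj mul1r. Qed.

Lemma adh_mull (A : cstar_alg R) (P Q : set A) (a : A) :
  (forall x, P x -> adh Q (a ** x)) -> forall x, adh P x -> adh Q (a ** x).
Proof.
apply: (@adh_hom _ _ P Q (fun x => a ** x) (nm a)) => x y.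
by have [] := adh_mul_lip a x y.
Qed.

Lemma adh_mulr (A : cstar_alg R) (P Q : set A) (a : A) :
  (forall x, P x -> adh Q (x ** a)) -> forall x, adh P x -> adh Q (x ** a).
Proof.
apply: (@adh_hom _ _ P Q (fun x => x ** a) (nm a)) => x y.
by have [] := adh_mul_lip a x y.
Qed.

Definition paired (e f : L) := src e = src f.

Lemma monM e f g h : src e = src f -> src g = src h ->
  poly_in paired (Tp T e ** (Tp T f)^# ** (Tp T g ** (Tp T h)^#)).
Proof.
move=> ef gh; rewrite cmulA -(cmulA _ (Tp T f)^#).
have [c|nc] := pselect (cmp f g); last first.
  by rewrite (Tp_orth HO nc) cmul0r cmul0l; exact: poly_in0.
case: c => [[k fk gE]|[k gk fE]].
  rewrite gE (Tp_ext HO)// -(TpM HO) ?ef//; apply: poly_in1.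
  by rewrite /paired src_comp ?ef// -gh gE src_comp.
rewrite fE (Tp_extl HO)// -cmulA -cadjM -(TpM HO) -?gh//; apply: poly_in1.
by rewrite /paired ef fE !src_comp// -gh.
Qed.

Lemma poly_in_ind G (P : set O) : P 0 ->
  (forall (c : R[i]) x y, P x -> P y -> P (c *: x + y)) ->
  (forall e f, G e f -> P (Tp T e ** (Tp T f)^#)) -> forall x, poly_in G x -> P x.
Proof.
move=> P0 Pl PG x [s [sG ->]]; elim: s sG => [_|p s IH sG]; first by rewrite big_nil.
rewrite big_cons; apply: Pl; first by apply/PG/sG; rewrite inE eqxx.
by apply: IH => q qs; apply: sG; rewrite inE qs orbT.
Qed.

Lemma poly_in_adj G x : (forall e f, G e f -> G f e) -> poly_in G x -> poly_in G x^#.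
Proof.
move=> GS [s [sG ->]]; exists [seq (conjc p.1, (p.2.2, p.2.1)) | p <- s]; split.
  by move=> p /mapP[q /sG qs ->]; exact: GS.
rewrite big_map cadj_sum; apply: eq_bigr => p _.
by rewrite /monomial cadjZ cadjM cadjK.
Qed.

Lemma poly_inM x y : poly_in paired x -> poly_in paired y -> poly_in paired (x ** y).
Proof.
move=> hx hy; move: x hx; apply: poly_in_ind => [|c x x' h h'|e f ef].
- by rewrite cmul0l; exact: poly_in0.
- by rewrite cmul_linl; exact: poly_in_lin.
move: y hy; apply: poly_in_ind => [|c y y' h h'|g h gh].
- by rewrite cmul0r; exact: poly_in0.
- by rewrite cmul_linr; exact: poly_in_lin.
exact: monM.
Qed.

Lemma graph_alg_span x : adh (poly_in paired) x.
Proof.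
move: x; apply: graph_alg_ind => [|c x y|x y hx hy|x|x|e eg].
- exact/sub_adh/poly_in0.
- exact/adh_lin/poly_in_lin.
- move: y hy; apply: adh_mull => y hy; move: x hx; apply: adh_mulr => x hx.
  exact/sub_adh/poly_inM.
- apply: (@adh_hom _ _ _ _ _ 1) => [u v|u hu]; first exact: adj_lip.
  by apply/sub_adh/poly_in_adj.
- exact: adh_idem.
apply/sub_adh; have -> : gen O e = Tp T e ** (Tp T (src e))^#.
  rewrite (Tp_gen HO eg) (Tp_v _ (src_vertex _)) (Tv_adj HO (src_vertex _)).
  by rewrite (Tg_src HO).
by apply: poly_in1; rewrite /paired src_src.
Qed.

End GraphAlgebraGenerated.

(** * The lower graphs *)

Section LowerGraph.
Variables (L : ograph) (a : ord).
Implicit Types (e f g : lower L a).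

Lemma lval_inj : injective (@lval L a).
Proof. exact: val_inj. Qed.

Lemma lval_rng e : lval (rng e) = rng (lval e).
Proof. by rewrite /lval (_ : rng e = insubd e (rng (val e)))// val_insubd rng_below. Qed.

Lemma lval_src e : lval (src e) = src (lval e).
Proof. by rewrite /lval (_ : src e = insubd e (src (val e)))// val_insubd src_below. Qed.

Lemma lval_composable e f : src e = rng f <-> src (lval e) = rng (lval f).
Proof.
rewrite -lval_src -lval_rng; split=> [->//|]; exact: lval_inj.
Qed.

Lemma lval_below e : below L a (lval e).
Proof. by have := valP e; rewrite inE. Qed.

Lemma lval_comp e f : src e = rng f -> lval (comp e f) = comp (lval e) (lval f).
Proof.
move=> /lval_composable ef; rewrite /lval (_ : comp e f = insubd e (comp (val e) (val f)))//.
by rewrite val_insubd comp_below//; exact: valP.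
Qed.

Definition lmk (x : L) (xa : below L a x) : lower L a := exist _ x (mem_set xa).

Lemma lval_mk x (xa : below L a x) : lval (lmk xa) = x. Proof. by []. Qed.

Lemma lval_vertex e : is_vertex e <-> is_vertex (lval e).
Proof. by rewrite /is_vertex -lval_rng; split=> [->//|]; exact: lval_inj. Qed.

Lemma lval_ext e f : extensions e f <-> extensions (lval e) (lval f).
Proof.
split=> [[k ek ->]|[k ek fE]].
  by exists (lval k); rewrite ?lval_comp//; exact/lval_composable.
have ka : below L a k.
  by apply: (comp_below_tail ek); rewrite -fE; exact: lval_below.
have ek' : src e = rng (lmk ka) by apply/lval_composable.
by exists (lmk ka) => //; apply: lval_inj; rewrite lval_comp.
Qed.

Lemma lval_cmp e f : cmp e f <-> cmp (lval e) (lval f).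
Proof. by rewrite /cmp !lval_ext. Qed.

Lemma lower_pow b e : pow_edges (lower L a) b e -> olt b a.
Proof.
by move=> [_ be]; apply: opow_lt_inv; exact: ole_olt_trans be (lval_below e).
Qed.

(** Source regularity, applied to the vertex itself, produces an edge of degree [omega ^ b] inside
    the lower graph. *)
Lemma lower_regular (b : ord) (v : lower L a) : regular b v -> olt b a.
Proof.
move=> [vv sr _]; have [|f [_ fb]] := sr v vv; first exact: vertex_below.
exact: lower_pow fb.
Qed.

(** For [b < a] every morphism that enters the definition of regularity at level [b] has degree
    below [omega ^ a]. *)
Lemma lval_regular (b : ord) (v : lower L a) : olt b a -> regular b v <-> regular b (lval v).
Proof.
move=> ba; have pb x : pow_edges L b x -> below L a x by apply: pow_below.
split=> -[vv sr rf]; split.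
- exact/lval_vertex.
- move=> e ev eb; have ea : below L a e by apply: below_lt eb; exact: oltW.
  have [|//|f [fe fb]] := sr (lmk ea); first by apply: lval_inj; rewrite lval_rng.
  by exists (lval f); rewrite -lval_rng fe lval_src.
- apply: sub_finite_set (finite_image (@lval L a) rf) => f [fv fb] /=.
  exists (lmk (pb _ fb)) => //; split => //; apply: lval_inj.
  by rewrite lval_rng.
- exact/lval_vertex.
- move=> e ev eb; have [|f [fe fb]] := sr (lval e) _ eb.
    by rewrite -lval_rng ev.
  exists (lmk (pb _ fb)); split => //; apply: lval_inj.
  by rewrite lval_rng lval_src.
have inj : {in [set f | rng f = v /\ pow_edges (lower L a) b f] &, injective (@lval L a)}.
  by move=> x y _ _; exact: lval_inj.
rewrite /row_finite -(eq_finite_set (inj_card_eq inj)).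
by apply: sub_finite_set rf => _ [f [<- fb] <-] /=; rewrite lval_rng.
Qed.

Lemma lower_disjoint e f :
  extensions (lval e) `&` extensions (lval f) = set0 -> extensions e `&` extensions f = set0.
Proof.
move=> h; apply/eqP/negPn/negP => /set0P/cmp_exts/lval_cmp/cmp_exts[x].
by rewrite h.
Qed.

Lemma lower_disjoint' e f :
  extensions e `&` extensions f = set0 -> extensions (lval e) `&` extensions (lval f) = set0.
Proof.
move=> h; apply/eqP/negPn/negP => /set0P/cmp_exts/lval_cmp/cmp_exts[x].
by rewrite h.
Qed.

Lemma lval_generator e : generator e -> generator (lval e).
Proof. by move=> [/lval_vertex|[b]]; [left|right; exists b]. Qed.

Lemma generator_lval e : generator (lval e) -> generator e.
Proof. by move=> [/lval_vertex|[b]]; [left|right; exists b]. Qed.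

End LowerGraph.

(** * The ideal of the regular vertices *)

Section RegularIdeal.
Variables (R : realType) (L : ograph) (HC : condition_C L) (a : ord).
Variable A : graph_alg R (lower L a).
Notation M := (lower L a).
Notation T := (gen A).
Notation Tq := (Tp (gen A)).
Implicit Types (e f g h k u v w : M).

Let HA := gen_family A.

Definition areg v := regular a (lval v).

(* The tree of morphisms below [a] starting at a good vertex is a single branch. *)
Definition good w := areg w /\ forall e f, rng e = w -> rng f = w -> cmp e f.

Lemma areg_v v : areg v -> is_vertex v.
Proof. by move=> [/lval_vertex]. Qed.

Lemma areg_src e : areg (rng e) -> areg (src e).
Proof.
by rewrite /areg lval_rng lval_src; apply: regular_src; exact: lval_below.
Qed.

Lemma areg_regular b v : olt b a -> areg v -> regular b v.
Proof. by move=> ba h; apply/lval_regular => //; apply: regular_le h; exact: oltW. Qed.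

Lemma good_src e : good (rng e) -> good (src e).
Proof.
move=> [re br]; split; first exact: areg_src.
by move=> f g fe ge; apply/(@cmp_compl M e) => //; apply: br; rewrite rng_comp.
Qed.

(** At a good vertex every relation (iv) of a level below [a] has a single summand, so cutting down
    to the range of a path loses nothing. *)
Lemma good_full e : good (rng e) -> T (rng e) = Tq e ** (Tq e)^#.
Proof.
elim/mor_ind: e => [v vv _|b g e gb ge eb IH gd].
  by rewrite vv (Tp_v _ vv) (Tv_adj HA vv) (TvTv HA vv).
have ba := lower_pow gb; rewrite rng_comp// in gd *.
have S1 : [set f | rng f = rng g /\ pow_edges M b f] = [set g].
  apply/seteqP; split=> f; last by move=> ->.
  case=> fg fb; apply: cmp_eq; first by apply: gd.2.
  by apply: oeq_trans fb _; apply: oeq_sym.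
rewrite (family_sum HA (areg_regular ba gd.1)) S1 fsbig_set1.
rewrite (Tp_cons _ gb)// cadjM cmulA -(cmulA (T g)) -IH -?ge; last exact: good_src.
by rewrite (Tg_src HA)//; right; exists b.
Qed.

Definition decomposed v := exists s : seq M,
  (forall e, e \in s -> rng e = v /\ good (src e)) /\
  T v = \sum_(e <- s) Tq e ** (Tq e)^#.

Lemma decomposed_comb v (l : seq M) :
  (forall g, g \in l -> [/\ generator g, rng g = v & decomposed (src g)]) ->
  T v = \sum_(g <- l) T g ** (T g)^# -> decomposed v.
Proof.
move=> h vE; have /choice[s hs] : forall g, exists s : seq M, g \in l ->
    (forall e, e \in s -> rng e = src g /\ good (src e)) /\
    T (src g) = \sum_(e <- s) Tq e ** (Tq e)^#.
  move=> g; have [gl|ng] := boolP (g \in l); last by exists nil.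
  by have [_ _ [s hs]] := h g gl; exists s.
exists (flatten [seq [seq comp g e | e <- s g] | g <- l]); split.
  move=> x /flattenP[_ /mapP[g gl ->] /mapP[e es ->]].
  have [_ gv _] := h g gl; have [/(_ e es)[eg ge] _] := hs g gl.
  by rewrite rng_comp// src_comp.
rewrite vE big_flatten big_map big_seq [RHS]big_seq; apply: eq_bigr => g gl.
have [gg gv _] := h g gl; have [gs sE] := hs g gl.
rewrite -{1}(Tg_src HA gg) sE cmul_sumr cmul_suml big_map.
rewrite big_seq [RHS]big_seq; apply: eq_bigr => e es.
have [eg _] := gs e es.
by rewrite (TpM HA)// (Tp_gen HA gg) cadjM !cmulA.
Qed.

Let Yat (x : L) := [set f : L | rng f = x /\ pow_edges L a f].
(** The induction measure of [areg_decomposed]: at regular vertices this number of long edges does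
    not grow along a path ([ncard_src]) and drops when the path passes a branching ([ncard_lt]). *)
Let ncard v := #|` fset_set (Yat (lval v))|.

Let Yat_comp g (f : L) : src (lval g) = rng f -> pow_edges L a f ->
  Yat (lval (rng g)) (comp (lval g) f).
Proof.
move=> gf fa; split; first by rewrite rng_comp// lval_rng.
by apply: pow_edges_comp => //; exact: lval_below.
Qed.

Let ncard_src g : areg (rng g) -> (ncard (src g) <= ncard (rng g))%N.
Proof.
move=> rg; have [_ _ rf] := rg; have [_ _ rfs] := areg_src rg.
have <- : #|` [fset comp (lval g) x | x in fset_set (Yat (lval (src g)))]%fset| = ncard (src g).
  apply: card_in_imfset.
  move=> x y; rewrite !in_fset_set// !inE lval_src => -[xs _] [ys _].
  by apply: comp_inj; rewrite ?xs ?ys.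
apply: fsubset_leq_card; apply/fsubsetP => _ /imfsetP[x /= + ->].
rewrite !in_fset_set// !inE lval_src => -[xs xa].
by apply: Yat_comp.
Qed.

(** A long edge that begins with [g'] is not of the form [comp g x], so the embedding given by
    prepending [g] misses it. *)
Let ncard_lt g g' b : areg (rng g) -> rng g' = rng g -> pow_edges M b g ->
  pow_edges M b g' -> g <> g' -> (ncard (src g) < ncard (rng g))%N.
Proof.
move=> rg gg' gb gb' ne; have [_ sr rf] := rg; have [_ _ rfs] := areg_src rg.
have [|h [hg ha]] := sr (lval g') _ (lval_below g'); first by rewrite -lval_rng gg'.
have <- : #|` [fset comp (lval g) x | x in fset_set (Yat (lval (src g)))]%fset| = ncard (src g).
  apply: card_in_imfset.
  move=> x y; rewrite !in_fset_set// !inE lval_src => -[xs _] [ys _].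
  by apply: comp_inj; rewrite ?xs ?ys.
apply: fproper_ltn_card; rewrite fproperE; apply/andP; split.
  apply/fsubsetP => _ /imfsetP[x /= + ->].
  rewrite !in_fset_set// !inE lval_src => -[xs xa].
  by apply: Yat_comp.
apply/negP => /fsubsetP /(_ (comp (lval g') h)).
rewrite in_fset_set// inE -{1}gg' => /(_ (Yat_comp (esym hg) ha)).
move=> /imfsetP[x /=]; rewrite in_fset_set// !inE lval_src => -[xs xa] E.
case: ne; apply: cmp_eq; last by apply: oeq_trans gb _; exact: oeq_sym.
apply/lval_cmp; apply: (@ext_cmp L (comp (lval g) x)).
  by apply: ext_comp.
by rewrite -E; apply: ext_comp.
Qed.

(** Strong induction on [ncard]. If [v] is not good, take two incomparable paths at [v] and follow
    one of them. If its first edge [g] has a sibling of the same degree, the count drops at the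
    source of every edge in relation (iv). Otherwise that relation has the single term [g], the
    other path also begins with [g], and the incomparable pair moves on to [src g]. *)
Lemma areg_decomposed v : areg v -> decomposed v.
Proof.
have [n] := ubnP (ncard v); elim: n v => // n IHn v vn rv.
have [gd|ngd] := pselect (good v).
  have vv := areg_v rv; exists [:: v]; split.
    by move=> e; rewrite inE => /eqP ->; rewrite (vertex_src vv).
  by rewrite big_seq1 (Tp_v _ vv) (Tv_adj HA vv) (TvTv HA vv).
have [e [f [ev fv nef]]] : exists e f, [/\ rng e = v, rng f = v & ~ cmp e f].
  apply: contrapT => h; apply: ngd; split => // e f ev fv.
  by apply: contrapT => nef; apply: h; exists e, f.
elim/mor_ind: e v f vn rv ev fv nef {ngd} => [u uu|b g e gb ge eb IH] v f vn rv ev fv nef.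
  case: nef; left; exists f; first by rewrite (vertex_src uu) fv -ev uu.
  by rewrite -uu ev -fv comp_rng.
rewrite rng_comp// in ev; have ba := lower_pow gb.
have gg : generator g by right; exists b.
have rb := areg_regular ba rv; have [_ _ fin] := rb.
have vE := family_sum HA rb; rewrite fsbig_finite// in vE.
have [[g' [g'v g'b gg']]|uniq] :=
    pselect (exists g', [/\ rng g' = v, pow_edges M b g' & g <> g']).
  apply: decomposed_comb vE => h; rewrite in_fset_set// inE => -[hv hb].
  split=> //; first by right; exists b.
  apply: IHn; last by apply: areg_src; rewrite hv.
  move: vn; rewrite ltnS; apply: leq_trans.
  have [hg|hg] := pselect (h = g).
    by rewrite -hv; apply: (@ncard_lt h g' b); rewrite ?hv ?hg.
  by rewrite -hv; apply: (@ncard_lt h g b); rewrite ?hv ?ev.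
have only h : rng h = v -> pow_edges M b h -> h = g.
  by move=> hv hb; apply: contrapT => hg; apply: uniq; exists h; split => // /esym.
have S1 : [set f | rng f = v /\ pow_edges M b f] = [set g].
  by apply/seteqP; split=> x /=; [case; exact: only|move=> ->].
rewrite S1 fset_set1 in vE.
apply: decomposed_comb vE => h; rewrite inE => /eqP -> {h}; split => //.
have [_ sr _] := rv.
have [|h [hf ha]] := sr (lval f) _ (lval_below f); first by rewrite -lval_rng fv.
(* [f] may be shorter than [g], so it is first prolonged by an edge [h] of degree [omega ^ a]; the
   prefix of degree [omega ^ b] of the result must be [g]. *)
have [|x xf xb] := @prefix_exists L (comp (lval f) h) (opow b).
  have [_ ah] := ha; apply: ole_trans (deg_comp (esym hf)).2.
  by apply: ole_trans (ole_addl _ _); apply: ole_trans ah; exact/opow_mono/oltW.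
have xa : below L a x by apply: pow_below ba xb.
have xg : lmk xa = g.
  apply: only => //; apply: lval_inj.
  by rewrite lval_rng lval_mk -(ext_rng xf) rng_comp// -lval_rng fv.
have [gf|fg] : cmp g f.
  apply/lval_cmp; rewrite -xg lval_mk; apply: ext_cmp xf _; exact: ext_comp.
  have [f2 gf2 fE] := gf; apply: (IH _ f2) => //.
  + by apply: leq_ltn_trans vn; rewrite -ev; apply: ncard_src; rewrite ev.
  + by apply: areg_src; rewrite ev.
  + by move=> c; apply: nef; rewrite fE; apply/cmp_compl.
by case: nef; right; apply: ext_trans fg _; exact: ext_comp.
Qed.

Definition gpair e f := src e = src f /\ good (src e).

Lemma gpair_sym e f : gpair e f -> gpair f e.
Proof. by move=> [ef ge]; split; rewrite -?ef. Qed.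

Definition regideal : set A := adh (poly_in (O := A) gpair).

Lemma poly_mul_good x y : poly_in (O := A) (@paired M) x -> poly_in (O := A) gpair y ->
  poly_in (O := A) gpair (x ** y).
Proof.
move=> hx hy; move: x hx; apply: poly_in_ind => [|c x x' h h'|e f ef].
- by rewrite cmul0l; exact: poly_in0.
- by rewrite cmul_linl; exact: poly_in_lin.
move: y hy; apply: poly_in_ind => [|c y y' h h'|g h [gh gg]].
- by rewrite cmul0r; exact: poly_in0.
- by rewrite cmul_linr; exact: poly_in_lin.
rewrite cmulA -(cmulA _ (Tq f)^#).
have [c|nc] := pselect (cmp f g); last first.
  by rewrite (Tp_orth HA nc) cmul0r cmul0l; exact: poly_in0.
case: c => [[k fk gE]|[k gk fE]].
  rewrite gE (Tp_ext HA)// -(TpM HA) ?ef//; apply: poly_in1.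
  by rewrite gE src_comp// in gh gg *; split; rewrite src_comp ?ef// -gh gE src_comp.
rewrite fE (Tp_extl HA)// -cmulA -cadjM -(TpM HA) -?gh//; apply: poly_in1.
rewrite /gpair ef fE !src_comp -?gh//; split => //.
by apply: good_src; rewrite -gk.
Qed.

Lemma regideal_mull x y : regideal y -> regideal (x ** y).
Proof.
have hx := graph_alg_span x; move: y; apply: adh_mull => y hy.
move: x hx; apply: adh_mulr => x hx.
exact/sub_adh/poly_mul_good.
Qed.

Lemma regideal_adj x : regideal x -> regideal x^#.
Proof.
apply: (@adh_hom _ _ _ _ _ (@cadj R A) 1) => [u v|u hu]; first exact: adj_lip.
by apply/sub_adh/poly_in_adj => //; exact: gpair_sym.
Qed.

Lemma regideal_mulr x y : regideal x -> regideal (x ** y).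
Proof. by move=> hx; rewrite -[_ ** _]cadjK cadjM; apply/regideal_adj/regideal_mull/regideal_adj. Qed.

Lemma regideal_lin (c : R[i]) x y : regideal x -> regideal y -> regideal (c *: x + y).
Proof. exact/adh_lin/poly_in_lin. Qed.

Lemma regideal0 : regideal 0.
Proof. exact/sub_adh/poly_in0. Qed.

Lemma regideal_closed x : adh regideal x -> regideal x.
Proof. exact: adh_idem. Qed.

Lemma regidealP : closed_ideal regideal.
Proof.
split; [exact: regideal0|exact: regideal_lin|by move=> *; exact: regideal_mull|
  by move=> *; exact: regideal_mulr|].
exact/closed_adh/regideal_closed.
Qed.

Lemma regideal_gpair e f : gpair e f -> regideal (Tq e ** (Tq f)^#).
Proof. by move=> ef; exact/sub_adh/poly_in1. Qed.

Lemma regideal_areg v : areg v -> regideal (T v).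
Proof.
move=> /areg_decomposed[s [hs ->]]; rewrite big_seq.
apply: (big_ind regideal) => [|x y hx hy|e es]; first exact: regideal0.
  by rewrite -(scale1r x); exact: regideal_lin.
by apply: regideal_gpair; split => //; have [] := hs e es.
Qed.

Lemma regideal_smallest : regideal =
  smallest (@closed_ideal R A) [set T v | v in [set v : M | areg v]].
Proof.
apply/seteqP; split; last first.
  by apply: smallest_sub; [exact: regidealP|move=> _ [v rv <-]; exact: regideal_areg].
move=> x hx J [[J0 Jl Jml Jmr Jc] hJ]; move/closed_adh: Jc => Jc; apply: Jc.
move: x hx; apply: adh_mono; apply: poly_in_ind => // e f [ef [rg _]].
rewrite -(Tp_src HA e) -cmulA; apply: Jml; apply: Jmr; apply: hJ.
by exists (src e).
Qed.

Lemma Torth v w : is_vertex v -> is_vertex w -> v <> w -> T v ** T w = 0.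
Proof.
move=> vv ww vw; rewrite -(Tv_adj HA vv) -(Tp_v T vv) -(Tp_v T ww) (Tp_orth HA)//.
move=> c; apply: vw; apply: cmp_eq => //.
by apply: oeq_trans (vertex_deg vv) _; apply/oeq_sym/vertex_deg.
Qed.

(** The monomial vanishes in the corner unless both paths start at [w]. There they lie on one branch
    and have the same source, so they differ by a cycle at a regular vertex, trivial by
    [regular_loop]; hence [e = f], and [good_full] gives [T w]. *)
Lemma corner_mon w e f : good w -> src e = src f ->
  exists c : R[i], T w ** (Tq e ** (Tq f)^#) ** T w = c *: T w.
Proof.
move=> gw ef; have ww := areg_v gw.1.
have [ew|ew] := pselect (rng e = w); last first.
  exists 0; rewrite scale0r -(Tp_rng HA e) !cmulA Torth ?cmul0l//; last by move/esym.
  exact: rng_vertex.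
have [fw|fw] := pselect (rng f = w); last first.
  exists 0; rewrite scale0r -(Tp_rng HA f) cadjM (Tv_adj HA (rng_vertex f)).
  by rewrite -!cmulA Torth ?cmul0r//; exact: rng_vertex.
suff fE : f = e.
  exists 1; rewrite fE scale1r -good_full ?ew// !(TvTv HA ww)//.
have loop x y : rng x = w -> src x = src y -> extensions x y -> y = x.
  move=> xw xy [k xk yE]; suff kv : is_vertex k by rewrite yE -kv -xk comp_src.
  apply/lval_vertex; apply: (@regular_loop L a (lval (src x))) => //.
  - by apply: areg_src; rewrite xw; exact: gw.1.
  - exact: lval_below.
  - by rewrite -lval_src xy yE src_comp.
  - by rewrite -lval_rng xk.
by have [ext|ext] := gw.2 e f ew fw; [apply: loop|apply/esym/loop].
Qed.

Lemma corner w x (d : R) : good w -> 0 < d ->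
  exists c : R[i], nm (T w ** x ** T w - c *: T w) <= d.
Proof.
move=> gw d0; have [|y py xy] := graph_alg_span x (e := d); first by [].
suff [c cE] : exists c : R[i], T w ** y ** T w = c *: T w.
  exists c; rewrite -cE -cmulBl -cmulBr.
  have w1 : nm (T w) <= 1.
    by rewrite -(Tp_v T (areg_v gw.1)); exact: (Tp_nm1 HA).
  apply: le_trans (nmM _ _) _; have := nmM (T w) (x - y).
  have := nm_ge0 (T w); have := nm_ge0 (x - y); have := nm_ge0 (T w ** (x - y)).
  move: (nm (T w)) (nm (x - y)) (nm _) w1 xy => p q r *; nra.
move: y py {xy}; apply: poly_in_ind => [|c y y' [p pE] [q qE]|e f ef].
- by exists 0; rewrite cmul0r cmul0l scale0r.
- by exists (c * p + q); rewrite cmul_linr cmul_linl pE qE scalerDl scalerA.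
exact: corner_mon.
Qed.

Lemma good_range e k : src e = rng k -> good (src e) ->
  Tq (comp e k) ** (Tq (comp e k))^# = Tq e ** (Tq e)^#.
Proof.
move=> ek ge; rewrite (TpM HA)// cadjM cmulA -(cmulA (Tq e)).
by rewrite -good_full -?ek// (Tp_src HA).
Qed.

Definition antichain (l : seq M) := uniq l /\ forall e f, e \in l -> f \in l ->
  cmp e f -> e = f.

(** For an antichain, a sum of orthogonal range projections. Over the good antichains these form an
    approximate unit of the ideal ([aunit_approx]), directed by [aunit_directed]. *)
Definition aunit (l : seq M) : A := \sum_(e <- l) Tq e ** (Tq e)^#.

Definition gantichain l := antichain l /\ forall e, e \in l -> good (src e).

Lemma aunit_adj l : (aunit l)^# = aunit l.
Proof. by rewrite /aunit cadj_sum; apply: eq_bigr => e _; rewrite cadjM cadjK. Qed.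

Lemma aunit_fix l e : antichain l -> e \in l -> aunit l ** Tq e = Tq e.
Proof.
move=> [ul al] el; rewrite /aunit cmul_suml (bigD1_seq e)//= (Tp_pisom HA) big_seq_cond.
rewrite big1 ?addr0// => f /andP[fl fe]; rewrite -cmulA (Tp_orth HA) ?cmul0r//.
by move=> c; case/eqP: fe; apply: al.
Qed.

Lemma aunit_idem l : antichain l -> aunit l ** aunit l = aunit l.
Proof.
move=> al; rewrite {2}/aunit cmul_sumr big_seq [RHS]/aunit [RHS]big_seq.
by apply: eq_bigr => e el; rewrite cmulA aunit_fix.
Qed.

Lemma aunit_regideal l : gantichain l -> regideal (aunit l).
Proof.
move=> [_ gl]; rewrite /aunit big_seq.
apply: (big_ind regideal) => [|x y hx hy|e es]; first exact: regideal0.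
  by rewrite -(scale1r x); exact: regideal_lin.
by apply: regideal_gpair; split => //; exact: gl.
Qed.

Lemma gantichain_nil : gantichain [::].
Proof. by []. Qed.

(** A path [x] comparable to some [y] already in the list is not added: if [x] extends [y], its
    range lies under that of [y]; if [y] extends [x], the two ranges coincide since nothing branches
    after [src x] ([good_range]). *)
Lemma gantichain_add l (s : seq M) : gantichain l -> (forall e, e \in s -> good (src e)) ->
  exists2 l', gantichain l' & forall e, e \in l ++ s -> aunit l' ** Tq e = Tq e.
Proof.
elim: s l => [|x s IH] l gl gs.
  by exists l => // e; rewrite cats0; apply: aunit_fix; case: gl.
have gx : good (src x) by apply: gs; rewrite inE eqxx.
have gs' e : e \in s -> good (src e) by move=> es; apply: gs; rewrite inE es orbT.
have [[y yl xy]|nx] := pselect (exists2 y, y \in l & cmp x y).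
  have [l' gl' h] := IH l gl gs'; exists l' => // e.
  rewrite mem_cat inE orbCA => /predU1P[->|]; last by rewrite -mem_cat => /h.
  have hy : aunit l' ** Tq y = Tq y by apply: h; rewrite mem_cat yl.
  case: xy => [[k xk yE]|[k yk ->]]; last by rewrite (TpM HA)// cmulA hy.
  rewrite -(Tp_pisom HA x) -(good_range xk gx) -yE.
  by rewrite !cmulA hy.
have gl' : gantichain (x :: l).
  have [[ul al] gdl] := gl; split; last first.
    by move=> e; rewrite inE => /predU1P[->//|/gdl].
  split; first by rewrite /= ul andbT; apply/negP => xl; apply: nx; exists x => //; left; exact: ext_refl.
  move=> e f; rewrite !inE => /predU1P[->|el] /predU1P[->|fl] // c.
  - by case: nx; exists f.
  - by case: nx; exists e => //; exact: cmp_sym.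
  exact: al.
have [l' gl'' h] := IH _ gl' gs'; exists l' => // e el; apply: h.
by move: el; rewrite !mem_cat !inE orbCA orbA.
Qed.

Lemma aunit_directed l m : gantichain l -> gantichain m -> exists2 n, gantichain n &
  aunit n ** aunit l = aunit l /\ aunit n ** aunit m = aunit m.
Proof.
move=> gl [am gm]; have [n gn h] := gantichain_add gl gm; exists n => //.
split; rewrite {2}/aunit cmul_sumr big_seq [RHS]/aunit [RHS]big_seq;
  by apply: eq_bigr => e el; rewrite cmulA h// mem_cat el ?orbT.
Qed.

Lemma aunit_nm1 l : antichain l -> nm (aunit l) <= 1.
Proof.
move=> al; have := nm_star (aunit l); rewrite aunit_adj aunit_idem//.
have := nm_ge0 (aunit l); move: (nm _) => p *; nra.
Qed.

Lemma aunit_approx x (d : R) : regideal x -> 0 < d ->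
  exists2 l, gantichain l & nm (x - aunit l ** x) <= d.
Proof.
move=> hx d0; have [|y [s [gs yE]] xy] := hx (d / 2); first by lra.
have [|l gl h] := @gantichain_add [::] [seq p.2.1 | p <- s] gantichain_nil.
  by move=> e /mapP[p ps ->]; have [] := gs p ps.
exists l => //; have yl : aunit l ** y = y.
  rewrite yE cmul_sumr big_seq [RHS]big_seq; apply: eq_bigr => p ps.
  by rewrite /monomial cmulZr cmulA h//=; apply: map_f.
have -> : x - aunit l ** x = (x - y) - aunit l ** (x - y) by rewrite cmulBr yl; zmod.
have := nmD (x - y) (- (aunit l ** (x - y))); rewrite nmN.
have := nmM (aunit l) (x - y); have := aunit_nm1 gl.1.
have := nm_ge0 (x - y); have := nm_ge0 (aunit l).
move: (nm (aunit l)) (nm (x - y)) (nm _) xy => p q r *; nra.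
Qed.

Lemma regideal_eq0 x : regideal x ->
  (forall e, good (src e) -> (Tq e)^# ** x = 0) -> x = 0.
Proof.
move=> hx h; apply: nm_le_eps => d d0.
have [l [_ gl]] := aunit_approx hx d0.
have -> : aunit l ** x = 0; last by rewrite subr0.
by rewrite /aunit cmul_suml big_seq big1// => e el; rewrite -cmulA h ?cmul0r//; exact: gl.
Qed.

End RegularIdeal.

(** * Operators on functions with values in a C*-algebra *)

(** Pythagoras: [d^# ** d] is the sum of the positive elements coming from [d - p ** d] and
    [p ** d]. *)
Lemma proj_contr (R : realType) (A : cstar_alg R) (p c : A) : p^# = p -> p ** p = p ->
  nm (c - c ** p) <= nm c /\ nm (c - p ** c) <= nm c.
Proof.
move=> ps pp.
have h (d : A) : nm (d - p ** d) <= nm d.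
  rewrite -(@ler_pXn2r _ 2) ?nnegrE ?nm_ge0// -!nm_star.
  have -> : d^# ** d = (d - p ** d)^# ** (d - p ** d) + (p ** d)^# ** (p ** d).
    rewrite cadjB !cadjM ps !cmulBr !cmulBl.
    have -> : d^# ** p ** (p ** d) = d^# ** p ** d by rewrite -cmulA (cmulA p) pp cmulA.
    rewrite !cmulA; zmod.
  by apply: apos_nm_le; exact: apos_star.
split; last exact: h.
by rewrite -nm_adj -[leRHS]nm_adj cadjB cadjM ps; exact: h.
Qed.

Section ModuleOperators.
Variables (R : realType) (A : cstar_alg R) (I : choiceType) (D : I -> set A) (P : set A).
Hypothesis D0 : forall i, D i 0.
Hypothesis D_lin : forall i (c : R[i]) x y, D i x -> D i y -> D i (c *: x + y).
Hypothesis D_act : forall i x a, D i x -> D i (x ** a).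
Hypothesis P_ne : P !=set0.
Hypothesis P_proj : forall p, P p -> p^# = p /\ p ** p = p.
Hypothesis P_dir : forall p q, P p -> P q ->
  exists2 r, P r & r ** p = p /\ r ** q = q.
Implicit Types (x y z : I -> A) (a b p : A).

(* Finitely supported columns over [A], seminormed by the infimum of the norms of
   [x (1 - p)]: when [P] is an approximate unit of an ideal, this is the norm modulo the
   ideal, and [P = [set 0]] gives the usual norm. *)
Definition supp x : set I := [set i | x i <> 0].
Definition mdom x := finite_set (supp x) /\ forall i, D i (x i).
Definition suppq x : seq I := fset_set (supp x).
Definition mdot x y := cdot (suppq x) x y.
Definition mnrm x := cnrm (suppq x) x.
Definition mact x a : I -> A := fun i => x i ** a.
Definition mcut x p : I -> A := x - mact x p.

Let addE x y i : (x + y) i = x i + y i. Proof. by []. Qed.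
Let scaleE (c : R[i]) x i : (c *: x) i = c *: x i. Proof. by []. Qed.
Lemma mcut_i x p i : mcut x p i = x i - x i ** p. Proof. by []. Qed.

Lemma mem_suppq x i : finite_set (supp x) -> (i \in suppq x) = (x i != 0).
Proof.
move=> fx; rewrite /suppq in_fset_set//.
by apply/idP/idP => [/set_mem/eqP//|/eqP h]; exact: mem_set.
Qed.

Lemma suppq_cover x y (s : seq I) : finite_set (supp x) -> uniq s ->
  (forall i, x i <> 0 -> i \in s) -> cdot s x y = mdot x y.
Proof.
move=> fx us cs; rewrite /mdot /cdot.
rewrite (bigID (fun i => x i == 0))/= big1 ?add0r; last first.
  by move=> i /eqP ->; rewrite cadj0 cmul0l.
rewrite -big_filter; apply: perm_big; apply: uniq_perm.
- exact: filter_uniq.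
- exact: fset_uniq.
move=> i; rewrite mem_filter mem_suppq//; case: eqP => //= xi.
exact: cs.
Qed.

Lemma cover2 x y : finite_set (supp x) -> finite_set (supp y) ->
  exists s, [/\ uniq s, forall i, x i <> 0 -> i \in s & forall i, y i <> 0 -> i \in s].
Proof.
move=> fx fy; have fxy : finite_set (supp x `|` supp y) by rewrite finite_setU.
exists (fset_set (supp x `|` supp y)); split; first exact: fset_uniq.
  by move=> i xi; rewrite in_fset_set// inE; left.
by move=> i yi; rewrite in_fset_set// inE; right.
Qed.

Lemma mdot_adj x y : finite_set (supp x) -> finite_set (supp y) ->
  (mdot x y)^# = mdot y x.
Proof.
move=> fx fy; have [s [us sx sy]] := cover2 fx fy.
by rewrite -(suppq_cover _ fx us sx) -(suppq_cover _ fy us sy) cdot_adj.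
Qed.

Lemma mdot_lin (c : R[i]) x y z : mdot z (c *: x + y) = c *: mdot z x + mdot z y.
Proof. exact: cdot_lin. Qed.

Lemma mdot_act x y a : mdot x (mact y a) = mdot x y ** a.
Proof. exact: cdot_act. Qed.

Lemma fin_lin (c : R[i]) x y : finite_set (supp x) -> finite_set (supp y) ->
  finite_set (supp (c *: x + y)).
Proof.
move=> fx fy; apply: (@sub_finite_set _ _ (supp x `|` supp y)); last by rewrite finite_setU.
move=> i; rewrite /supp /= => h; apply: contrapT => /not_orP[/contrapT x0 /contrapT y0].
by apply: h; rewrite addE scaleE x0 y0 scaler0 addr0.
Qed.

Lemma mdom_lin (c : R[i]) x y : mdom x -> mdom y -> mdom (c *: x + y).
Proof. by move=> [fx Dx] [fy Dy]; split; [exact: fin_lin|move=> i; exact: D_lin]. Qed.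

Lemma mdom0 : mdom 0.
Proof.
split=> [|i]; last exact: D0.
by rewrite (_ : supp 0 = set0)//; apply/seteqP; split=> i // [].
Qed.

Lemma mdom_act x a : mdom x -> mdom (mact x a).
Proof.
move=> [fx Dx]; split; last by move=> i; exact: D_act.
by apply: sub_finite_set fx => i; rewrite /supp /mact /= => h x0; apply: h; rewrite x0 cmul0l.
Qed.

Lemma mcutE x p : mcut x p = -1 *: mact x p + x.
Proof. by rewrite /mcut scaleN1r addrC. Qed.

Lemma mdom_cut x p : mdom x -> mdom (mcut x p).
Proof. by move=> dx; rewrite mcutE; apply: mdom_lin => //; exact: mdom_act. Qed.

Lemma mnrm_sq x : mnrm x ^+ 2 = nm (mdot x x).
Proof. exact: cnrm_sq. Qed.

Lemma mnrm_ge0 x : 0 <= mnrm x.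
Proof. exact: cnrm_ge0. Qed.

Lemma mnrm_cover x (s : seq I) : finite_set (supp x) -> uniq s -> (forall i, x i <> 0 -> i \in s) ->
  mnrm x = cnrm s x.
Proof. by move=> fx us sx; rewrite /mnrm /cnrm (suppq_cover _ fx us sx). Qed.

Lemma mdot_CS x y : finite_set (supp x) -> finite_set (supp y) ->
  nm (mdot x y) <= mnrm x * mnrm y.
Proof.
move=> fx fy; have [s [us sx sy]] := cover2 fx fy.
rewrite (mnrm_cover fx us sx) (mnrm_cover fy us sy) -(suppq_cover _ fx us sx).
exact: cnrm_CS.
Qed.

Lemma mnrmD x y : finite_set (supp x) -> finite_set (supp y) ->
  mnrm (x + y) <= mnrm x + mnrm y.
Proof.
move=> fx fy; have [s [us sx sy]] := cover2 fx fy.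
have fxy : finite_set (supp (x + y)) by rewrite -(scale1r x); exact: fin_lin.
rewrite (mnrm_cover fx us sx) (mnrm_cover fy us sy) (mnrm_cover fxy us).
  exact: cnrmD.
move=> i xyi; have [x0|/sx//] := pselect (x i = 0); apply: sy => y0; apply: xyi.
by rewrite addE x0 y0 addr0.
Qed.

Lemma mnrmZ (c : R[i]) x : mnrm (c *: x) = cn c * mnrm x.
Proof.
have [->|c0] := eqVneq c 0.
  rewrite scale0r cn0 mul0r /mnrm /cnrm /cdot big1 ?nm0 ?sqrtr0// => i _.
  by rewrite cadj0 cmul0l.
rewrite -cnrmZ /mnrm /suppq (_ : supp (c *: x) = supp x)//.
apply/seteqP; split=> i; rewrite /supp /= scaleE => h x0; apply: h; first by rewrite x0 scaler0.
by move/eqP: x0; rewrite scaler_eq0 (negPf c0)/= => /eqP.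
Qed.

Definition mvals x : set R := [set mnrm (mcut x p) | p in P].
Definition msn x : R := inf (mvals x).

Lemma mvals_lb x : has_lbound (mvals x).
Proof. by exists 0 => _ [p _ <-]; exact: mnrm_ge0. Qed.

Lemma mvals_inf x : has_inf (mvals x).
Proof.
by split; [have [p Pp] := P_ne; exists (mnrm (mcut x p)); exists p|exact: mvals_lb].
Qed.

Lemma msn_le x p : P p -> msn x <= mnrm (mcut x p).
Proof. by move=> Pp; apply: ge_inf; [exact: mvals_lb|exists p]. Qed.

Lemma msn_ge0 x : 0 <= msn x.
Proof.
apply: lb_le_inf; first by case: (mvals_inf x).
by move=> _ [p _ <-]; exact: mnrm_ge0.
Qed.

Lemma msn_approx x (e : R) : 0 < e -> exists2 p, P p & mnrm (mcut x p) < msn x + e.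
Proof.
move=> e0; have [_ [p Pp <-] h] := inf_adherent e0 (mvals_inf x).
by exists p.
Qed.

Lemma mnrm_cut x p : mdom x -> P p -> mnrm (mcut x p) <= mnrm x.
Proof.
move=> dx Pp; have [ps pp] := P_proj Pp; have dc := mdom_cut p dx.
rewrite -(@ler_pXn2r _ 2) ?nnegrE ?mnrm_ge0// !mnrm_sq.
have fx := dx.1.
have E : mdot (mcut x p) (mcut x p) =
    mdot x x - mdot x x ** p - p ** (mdot x x - mdot x x ** p).
  have e y : finite_set (supp y) -> mdot (mcut x p) y = mdot x y - p ** mdot x y.
    move=> fy; rewrite -mdot_adj//; last by case: dc.
    rewrite mcutE mdot_lin mdot_act scaleN1r cadjD cadjN cadjM ps mdot_adj//.
    by rewrite addrC.
  rewrite e; last by case: dc.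
  by rewrite mcutE mdot_lin mdot_act scaleN1r (addrC _ (mdot x x)).
rewrite E; apply: le_trans (proj_contr _ ps pp).2 _.
exact: (proj_contr _ ps pp).1.
Qed.

Lemma mcut_cut x p r : P p -> P r -> r ** p = p -> mcut x r = mcut (mcut x p) r.
Proof.
move=> Pp Pr rp; have [ps _] := P_proj Pp; have [rs _] := P_proj Pr.
have pr : p ** r = p by rewrite -{1}ps -rs -cadjM rp ps.
apply/funext => i; rewrite !mcut_i cmulBl -cmulA pr opprB addrA.
by rewrite subrK.
Qed.

(** Cutting by a larger projection only decreases the norm, so by directedness one projection serves
    both vectors. *)
Lemma msn_approx2 x y (e : R) : mdom x -> mdom y -> 0 < e -> exists p,
  [/\ P p, mnrm (mcut x p) < msn x + e & mnrm (mcut y p) < msn y + e].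
Proof.
move=> dx dy e0; have [p Pp hp] := msn_approx x e0; have [q Pq hq] := msn_approx y e0.
have [r Pr [rp rq]] := P_dir Pp Pq; exists r; split => //.
  by apply: le_lt_trans hp; rewrite (mcut_cut _ Pp)//; apply: mnrm_cut => //; exact: mdom_cut.
by apply: le_lt_trans hq; rewrite (mcut_cut _ Pq)//; apply: mnrm_cut => //; exact: mdom_cut.
Qed.

Lemma mcut_lin (c : R[i]) x y p : mcut (c *: x + y) p = c *: mcut x p + mcut y p.
Proof.
apply/funext => i; rewrite mcut_i [RHS]addE !addE !scaleE !mcut_i cmul_linl scalerBr opprD.
exact: addrACA.
Qed.

Lemma mcut0 p : mcut 0 p = 0.
Proof. by apply/funext => i; rewrite mcut_i cmul0l subr0. Qed.

Lemma msn_0 : msn 0 = 0.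
Proof.
have [p Pp] := P_ne; apply/eqP; rewrite eq_le msn_ge0 andbT; apply: le_trans (msn_le _ Pp) _.
by rewrite mcut0 -(scale0r 0) mnrmZ cn0 mul0r.
Qed.

Lemma mcutZ (c : R[i]) x p : mcut (c *: x) p = c *: mcut x p.
Proof. by rewrite -[c *: x]addr0 mcut_lin mcut0 addr0. Qed.

Lemma msnZ (c : R[i]) x : msn (c *: x) = cn c * msn x.
Proof.
have [->|c0] := eqVneq c 0; first by rewrite scale0r cn0 mul0r msn_0.
have le d y : msn (d *: y) <= cn d * msn y.
  apply/ler_addgt0Pr => e e0; have D0' : 0 < cn d + 1 by have := cn_ge0 d; lra.
  have [p Pp hp] := msn_approx y (divr_gt0 e0 D0').
  apply: le_trans (msn_le _ Pp) _; rewrite mcutZ mnrmZ.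
  have h1 : e / (cn d + 1) * (cn d + 1) = e by rewrite divfK// lt0r_neq0.
  have := cn_ge0 d; have := divr_gt0 e0 D0'.
  move: (e / _) h1 hp => q; move: (mnrm _) (msn y) (cn d) => u v w *; nra.
apply/eqP; rewrite eq_le le/=.
have := le c^-1 (c *: x); rewrite scalerA mulVf// scale1r.
have : cn c * cn c^-1 = 1 by rewrite -cnM mulfV// cn1.
have := cn_ge0 c; have := msn_ge0 (c *: x).
move: (msn _) (msn _) (cn c) (cn _) => u v w z *; nra.
Qed.

Lemma msnD x y : mdom x -> mdom y -> msn (x + y) <= msn x + msn y.
Proof.
move=> dx dy; apply/ler_addgt0Pr => e e0.
have e20 : 0 < e / 2 by lra.
have [p [Pp hx hy]] := msn_approx2 dx dy e20.
apply: le_trans (msn_le _ Pp) _.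
have -> : mcut (x + y) p = mcut x p + mcut y p.
  by rewrite -(scale1r x) mcut_lin !scale1r.
apply: le_trans (mnrmD _ _) _; [by case: (mdom_cut p dx)|by case: (mdom_cut p dy)|].
by move: (mnrm _) (mnrm _) (msn x) (msn y) hx hy => u v w z *; lra.
Qed.

(** One direction of an adjoint pair. Commutation with the right action makes the operator commute
    with [mcut], and so turns the bound for [mnrm] into one for the quotient seminorm. *)
Record mhalf (t t' : (I -> A) -> I -> A) : Prop := {
  mh_dom : forall x, mdom x -> mdom (t x);
  mh_lin : forall (c : R[i]) x y, mdom x -> mdom y -> t (c *: x + y) = c *: t x + t y;
  mh_act : forall x a, mdom x -> t (mact x a) = mact (t x) a;
  mh_bd : exists2 c, 0 <= c & forall x, mdom x -> mnrm (t x) <= c * mnrm x;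
  mh_adj : forall x y, mdom x -> mdom y -> mdot (t x) y = mdot x (t' y)
}.

Definition madj t t' := mhalf t t' /\ mhalf t' t.

Lemma mh_cut t t' x p : mhalf t t' -> mdom x -> t (mcut x p) = mcut (t x) p.
Proof.
by move=> h dx; rewrite !mcutE (mh_lin h)// ?(mh_act h)//; exact: mdom_act.
Qed.

Let mh_dom' t t' x : madj t t' -> mdom x -> mdom (t x).
Proof. by move=> [h _]; exact: mh_dom h x. Qed.

Let mh_lin' t t' (c : R[i]) x y : madj t t' -> mdom x -> mdom y ->
  t (c *: x + y) = c *: t x + t y.
Proof. by move=> [h _]; exact: mh_lin h c x y. Qed.

Let mh_bd' t t' : madj t t' -> exists2 c, 0 <= c & forall x, mdom x -> msn (t x) <= c * msn x.
Proof.
move=> [h _]; have [c c0 hc] := mh_bd h; exists c => // x dx.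
apply/ler_addgt0Pr => e e0; have D0' : 0 < c + 1 by lra.
have [p Pp hp] := msn_approx x (divr_gt0 e0 D0').
apply: le_trans (msn_le _ Pp) _; rewrite -(mh_cut _ h dx).
apply: le_trans (hc _ (mdom_cut p dx)) _.
have h1 : e / (c + 1) * (c + 1) = e by rewrite divfK// lt0r_neq0.
have := divr_gt0 e0 D0'.
move: (e / _) h1 hp => q; move: (mnrm _) (msn x) => u v *; nra.
Qed.

Let mh_sym t t' : madj t t' -> madj t' t. Proof. by case. Qed.

(** For a projection that nearly attains the seminorms of both [x] and [t' (t x)], adjointness turns
    the square into an inner product, to which Cauchy-Schwarz applies. *)
Let mh_star t t' x : madj t t' -> mdom x -> msn (t x) ^+ 2 <= msn x * msn (t' (t x)).
Proof.
move=> [h h'] dx; have dtx := mh_dom h dx; have dttx := mh_dom h' dtx.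
apply/ler_addgt0Pr => e e0.
have M0 : 0 < msn x + msn (t' (t x)) + 1.
  by have := msn_ge0 x; have := msn_ge0 (t' (t x)); lra.
pose d := Num.min 1 (e / (msn x + msn (t' (t x)) + 1)).
have d0 : 0 < d by rewrite lt_min ltr01 divr_gt0.
have [p [Pp hx hy]] := msn_approx2 dx dttx d0.
have sq : msn (t x) ^+ 2 <= mnrm (mcut x p) * mnrm (mcut (t' (t x)) p).
  have h1 := msn_le (t x) Pp.
  apply: (@le_trans _ _ (mnrm (mcut (t x) p) ^+ 2)).
    by rewrite ler_pXn2r// nnegrE ?msn_ge0 ?mnrm_ge0.
  rewrite mnrm_sq -(mh_cut _ h dx).
  have dcx := mdom_cut p dx; have dtc := mh_dom h dcx.
  rewrite (mh_adj h dcx dtc).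
  have -> : t' (t (mcut x p)) = mcut (t' (t x)) p by rewrite (mh_cut _ h dx) (mh_cut _ h' dtx).
  by apply: mdot_CS; [case: dcx|case: (mdom_cut p dttx)].
apply: (le_trans sq).
have dle1 : d <= 1 by rewrite ge_min lexx.
have dle2 : d * (msn x + msn (t' (t x)) + 1) <= e.
  by rewrite -ler_pdivlMr// ge_min lexx orbT.
have := mnrm_ge0 (mcut x p); have := mnrm_ge0 (mcut (t' (t x)) p).
have := msn_ge0 x; have := msn_ge0 (t' (t x)).
move: d d0 dle1 dle2 hx hy => d d0 dle1 dle2.
move: (mnrm (mcut x p)) (mnrm (mcut (t' (t x)) p)) (msn x) (msn (t' (t x))) dle2 => p1 p2 m1 m2 dle2 h1 h2 m20 m10 p20 p10.
have : p1 * p2 <= (m1 + d) * (m2 + d) by apply: ler_pM => //; exact/ltW.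
have : d * d <= d by rewrite ler_piMr// ltW.
move: (d * d) => dd *; nra.
Qed.

Let mh0 : madj (fun=> 0) (fun=> 0).
Proof.
have h : mhalf (fun=> 0) (fun=> 0).
  split=> [x dx|c x y|x a dx||x y dx dy].
  - exact: mdom0.
  - by rewrite scaler0 addr0.
  - by apply/funext => i; rewrite /mact cmul0l.
  - exists 0 => // x dx; rewrite mul0r -(scale0r 0) mnrmZ cn0 mul0r//.
  rewrite -mdot_adj; [|exact: dy.1|exact: mdom0.1].
  have e z : mdot z 0 = 0 by rewrite /mdot /cdot big1// => i _; rewrite cmul0r.
  by rewrite !e cadj0.
by [].
Qed.

Let mh_comb1 (c : R[i]) t t' s s' : mhalf t t' -> mhalf s s' -> mhalf t' t -> mhalf s' s ->
  mhalf (fun x => c *: t x + s x) (fun x => conjc c *: t' x + s' x).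
Proof.
move=> ht hs ht' hs'; split=> [x dx|d x y dx dy|x a dx||x y dx dy].
- by apply: mdom_lin; [exact: mh_dom ht x dx|exact: mh_dom hs x dx].
- rewrite (mh_lin ht)// (mh_lin hs)// !scalerDr !scalerA (mulrC c); exact: addrACA.
- rewrite (mh_act ht)// (mh_act hs)//; apply/funext => i.
  by rewrite /mact [RHS]cmul_linl.
- have [k k0 kt] := mh_bd ht; have [l l0 ls] := mh_bd hs.
  exists (cn c * k + l); first by rewrite addr_ge0// mulr_ge0// cn_ge0.
  move=> x dx; apply: le_trans (mnrmD _ _) _.
  + by rewrite -[_ *: _]addr0; apply: fin_lin; [case: (mh_dom ht dx)|case: mdom0].
  + by case: (mh_dom hs dx).
  rewrite mnrmZ mulrDl lerD ?ls// -mulrA ler_wpM2l ?cn_ge0//; exact: kt.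
have dt := mh_dom ht dx; have ds := mh_dom hs dx.
rewrite -mdot_adj; [|exact: dy.1|exact: (mdom_lin c dt ds).1].
rewrite mdot_lin cadjD cadjZ.
rewrite (mdot_adj dy.1 dt.1) (mdot_adj dy.1 ds.1) (mh_adj ht)// (mh_adj hs)//.
by rewrite mdot_lin.
Qed.

Let mh_comb (c : R[i]) t t' s s' : madj t t' -> madj s s' ->
  madj (fun x => c *: t x + s x) (fun x => conjc c *: t' x + s' x).
Proof.
move=> [ht ht'] [hs hs']; split; first exact: mh_comb1.
have := mh_comb1 (conjc c) ht' hs' ht hs; rewrite conjcK.
by [].
Qed.

Let mh_comp1 t t' s s' : mhalf t t' -> mhalf s s' -> mhalf t' t -> mhalf s' s ->
  mhalf (t \o s) (s' \o t').
Proof.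
move=> ht hs ht' hs'; split=> [x dx|d x y dx dy|x a dx||x y dx dy] /=.
- exact/(mh_dom ht)/(mh_dom hs).
- by rewrite (mh_lin hs)// (mh_lin ht)//; exact: (mh_dom hs).
- by rewrite (mh_act hs)// (mh_act ht)//; exact: (mh_dom hs).
- have [k k0 kt] := mh_bd ht; have [l l0 ls] := mh_bd hs.
  exists (k * l); first by rewrite mulr_ge0.
  move=> x dx; apply: le_trans (kt _ (mh_dom hs dx)) _.
  by rewrite -mulrA ler_wpM2l// ls.
rewrite (mh_adj ht)//; last exact: (mh_dom hs).
by rewrite (mh_adj hs)//; exact: (mh_dom ht').
Qed.

Let mh_comp t t' s s' : madj t t' -> madj s s' -> madj (t \o s) (s' \o t').
Proof. by move=> [ht ht'] [hs hs']; split; exact: mh_comp1. Qed.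

Definition mod_system : op_system R :=
  @OpSystem R (I -> A) mdom msn madj mdom_lin msn_ge0 msnZ msnD mh_dom' mh_lin'
    mh_bd' mh_sym mh_star mh0 mh_comb mh_comp.

(* A partial isometry is bounded because its initial projection is. *)
Lemma madj_pisom t t' :
  (forall x, mdom x -> mdom (t x)) -> (forall x, mdom x -> mdom (t' x)) ->
  (forall (c : R[i]) x y, mdom x -> mdom y -> t (c *: x + y) = c *: t x + t y) ->
  (forall (c : R[i]) x y, mdom x -> mdom y -> t' (c *: x + y) = c *: t' x + t' y) ->
  (forall x a, mdom x -> t (mact x a) = mact (t x) a) ->
  (forall x a, mdom x -> t' (mact x a) = mact (t' x) a) ->
  (forall x y, mdom x -> mdom y -> mdot (t x) y = mdot x (t' y)) ->
  (forall x, mdom x -> t (t' (t x)) = t x) ->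
  (forall x, mdom x -> t' (t (t' x)) = t' x) ->
  madj t t'.
Proof.
move=> td td' tl tl' ta ta' tt tp tp'.
have tt' x y : mdom x -> mdom y -> mdot (t' x) y = mdot x (t y).
  move=> dx dy; rewrite -mdot_adj; [|exact: dy.1|by case: (td' _ dx)].
  by rewrite -tt// mdot_adj//; [case: (td _ dy)|case: dx].
have bd s s' : (forall x, mdom x -> mdom (s x)) -> (forall x, mdom x -> mdom (s' x)) ->
    (forall x y, mdom x -> mdom y -> mdot (s x) y = mdot x (s' y)) ->
    (forall x y, mdom x -> mdom y -> mdot (s' x) y = mdot x (s y)) ->
    (forall x, mdom x -> s (s' (s x)) = s x) ->
    exists2 c, 0 <= c & forall x, mdom x -> mnrm (s x) <= c * mnrm x.
  move=> sd sd' ss ss' sp; exists 1 => // x dx; rewrite mul1r.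
  rewrite -(@ler_pXn2r _ 2) ?nnegrE ?mnrm_ge0// !mnrm_sq ss//; last exact: sd.
  set p := s' (s x); have dp : mdom p by exact/sd'/sd.
  have pp : mdot p p = mdot x p.
    transitivity (mdot (s x) (s p)); first exact: ss' (sd _ dx) dp.
    by have -> : s p = s x by [exact: sp]; apply: ss => //; exact: sd.
  pose y := -1 *: p + x; have dy : mdom y by exact: mdom_lin.
  have px : mdot p x = mdot x p.
    by rewrite -[LHS](mdot_adj dx.1 dp.1) -pp (mdot_adj dp.1 dp.1).
  have yE : mdot x x = mdot p p + mdot y y.
    have e z : finite_set (supp z) -> mdot y z = mdot x z - mdot p z.
      move=> fz; rewrite -mdot_adj//; last by case: dy.
      rewrite mdot_lin scaleN1r cadjD cadjN !mdot_adj//; [by rewrite addrC|by case: dx|by case: dp].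
    rewrite e; last by case: dy.
    by rewrite !mdot_lin !scaleN1r px pp; zmod.
  rewrite -pp yE; have [l [ul lp ly]] := cover2 dp.1 dy.1.
  rewrite -(suppq_cover _ dp.1 ul lp) -(suppq_cover _ dy.1 ul ly).
  exact: cdot_nm_le.
by split; split => //; [exact: (bd t t')|exact: (bd t' t)].
Qed.

(** The elements approximately fixed by right multiplication with projections of [P] are closed
    under sums and under left multiplication. So [<x, x>] is one of them as soon as all entries of
    [x] are. *)
Lemma msn_null x : mdom x -> (forall i (e : R), 0 < e -> exists2 p, P p &
  nm (x i - x i ** p) <= e) -> msn x = 0.
Proof.
move=> dx hx; pose J := [set c : A | forall e : R, 0 < e ->
  exists2 p, P p & nm (c - c ** p) <= e].
have Jc c p r : P p -> P r -> r ** p = p -> nm (c - c ** r) <= nm (c - c ** p).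
  move=> Pp Pr rp; have [ps _] := P_proj Pp; have [rs rr] := P_proj Pr.
  have pr : p ** r = p by rewrite -{1}ps -rs -cadjM rp ps.
  have -> : c - c ** r = (c - c ** p) - (c - c ** p) ** r.
    by rewrite cmulBl -cmulA pr; zmod.
  exact: (proj_contr _ rs rr).1.
have JD c d : J c -> J d -> J (c + d).
  move=> hc hd e e0; have [|p Pp hp] := hc (e / 2); first lra.
  have [|q Pq hq] := hd (e / 2); first lra.
  have [r Pr [rp rq]] := P_dir Pp Pq; exists r => //.
  have -> : c + d - (c + d) ** r = (c - c ** r) + (d - d ** r) by rewrite cmulDl; zmod.
  have := nmD (c - c ** r) (d - d ** r); have := Jc c p r Pp Pr rp; have := Jc d q r Pq Pr rq.
  move: (nm _) (nm _) (nm _) (nm _) (nm _) hp hq => *; lra.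
have JM a c : J c -> J (a ** c).
  move=> hc e e0; have D0' : 0 < nm a + 1 by have := nm_ge0 a; lra.
  have [p Pp hp] := hc _ (divr_gt0 e0 D0'); exists p => //.
  rewrite -cmulA -cmulBr; apply: le_trans (nmM _ _) _.
  have h1 : e / (nm a + 1) * (nm a + 1) = e by rewrite divfK// lt0r_neq0.
  have := nm_ge0 a; have := divr_gt0 e0 D0'; have := nm_ge0 (c - c ** p).
  move: (e / _) h1 hp => q; move: (nm _) (nm _) => u v *; nra.
have J0 : J 0.
  by move=> e e0; have [p Pp] := P_ne; exists p => //; rewrite cmul0l subr0 nm0 ltW.
have Jx : J (mdot x x).
  apply: (big_ind J) => // i _; apply: JM; exact: hx.
apply/eqP; rewrite eq_le msn_ge0 andbT; apply/ler_addgt0Pr => e e0; rewrite add0r.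
have [p Pp hp] := Jx _ (exprn_gt0 2 e0).
apply: le_trans (msn_le _ Pp) _.
rewrite -(@ler_pXn2r _ 2) ?nnegrE ?mnrm_ge0 ?(ltW e0)// mnrm_sq.
apply: le_trans hp; have [ps pp] := P_proj Pp; have dc := mdom_cut p dx.
have -> : mdot (mcut x p) (mcut x p) =
    mdot x x - mdot x x ** p - p ** (mdot x x - mdot x x ** p).
  have e' y : finite_set (supp y) -> mdot (mcut x p) y = mdot x y - p ** mdot x y.
    move=> fy; rewrite -mdot_adj//; last by case: dc.
    rewrite mcutE mdot_lin mdot_act scaleN1r cadjD cadjN cadjM ps mdot_adj//.
      by rewrite addrC.
    by case: dx.
  rewrite e'; last by case: dc.
  by rewrite mcutE mdot_lin mdot_act scaleN1r (addrC _ (mdot x x)).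
exact: (proj_contr _ ps pp).2.
Qed.

Lemma nm_le_mnrm x i : finite_set (supp x) -> nm (x i) <= mnrm x.
Proof.
move=> fx; have [h|h] := eqVneq (x i) 0; first by rewrite h nm0 mnrm_ge0.
rewrite -(@ler_pXn2r _ 2) ?nnegrE ?mnrm_ge0 ?nm_ge0// mnrm_sq -nm_star.
have iq : i \in suppq x by rewrite mem_suppq.
rewrite /mdot /cdot (big_rem _ iq)/=; apply: apos_nm_le; first exact: apos_star.
exact: apos_cdot.
Qed.

Lemma msn_comp x i (c e : R) : mdom x -> msn x <= c -> 0 < e ->
  exists2 p, P p & nm (x i - x i ** p) <= c + e.
Proof.
move=> dx xc e0; have [p Pp hp] := msn_approx x e0.
exists p => //; have dc := mdom_cut p dx.
by apply: le_trans (nm_le_mnrm i dc.1) _; lra.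
Qed.

End ModuleOperators.

Section WeightedShift.
Variables (R : realType) (A : cstar_alg R) (I : choiceType) (D : I -> set A).
Hypothesis D0 : forall i, D i 0.

(* [f i] is the index from which the value at [i] is taken. *)
Definition wshift (f : I -> option I) (w : I -> A -> A) (x : I -> A) : I -> A :=
  fun i => if f i is Some j then w i (x j) else 0.

Variables (f g : I -> option I) (w w' : I -> A -> A).
Hypothesis fg : forall i j, f i = Some j <-> g j = Some i.
Hypothesis w_lin : forall i (c : R[i]) a b, w i (c *: a + b) = c *: w i a + w i b.
Hypothesis w_act : forall i a b, w i (a ** b) = w i a ** b.
Hypothesis wD : forall i j a, f i = Some j -> D j a -> D i (w i a).
Hypothesis w'0 : forall j, w' j 0 = 0.
Hypothesis ww' : forall i j a b, f i = Some j -> D j a -> D i b ->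
  (w i a)^# ** b = a^# ** w' j b.

Let w0 i : w i 0 = 0.
Proof.
have := w_lin i 1 0 0; rewrite !scale1r addr0 => /(congr1 (fun z => z - w i 0)).
by rewrite addrK subrr.
Qed.

Lemma wshift_dom x : mdom D x -> mdom D (wshift f w x).
Proof.
move=> [fx Dx]; split; last first.
  move=> i; rewrite /wshift; case fi: (f i) => [j|]; last exact: D0.
  exact: wD fi (Dx j).
have sub : supp (wshift f w x) `<=` [set i | exists2 j, supp x j & g j = Some i].
  move=> i; rewrite /supp /wshift /=; case fi: (f i) => [j|//] h.
  by exists j; [move=> x0; apply: h; rewrite x0 w0|apply/fg].
apply: (sub_finite_set sub).
pose h j := if g j is Some i then [set i] else set0.
have -> : [set i | exists2 j, supp x j & g j = Some i] = \bigcup_(j in supp x) h j.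
  apply/seteqP; split=> i [j xj] /=; first by move=> gj; exists j => //; rewrite /h gj.
  by rewrite /h; case gj: (g j) => [k|//] /= ->; exists j.
apply: bigcup_finite => // j _; rewrite /h; case: (g j) => [i|]; last exact: finite_set0.
exact: finite_set1.
Qed.

Lemma wshift_lin (c : R[i]) x y : wshift f w (c *: x + y) = c *: wshift f w x + wshift f w y.
Proof.
apply/funext => i; rewrite [RHS]/(c *: wshift f w x i + wshift f w y i) /wshift.
by case: (f i) => [j|]; [exact: w_lin|rewrite scaler0; exact/esym/addr0].
Qed.

Lemma wshift_act x a : wshift f w (mact x a) = mact (wshift f w x) a.
Proof.
apply/funext => i; rewrite /mact /wshift; case: (f i) => [j|]; first exact: w_act.
by rewrite cmul0l.
Qed.

Lemma wshift_adj x y : mdom D x -> mdom D y -> mdot (wshift f w x) y = mdot x (wshift g w' y).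
Proof.
move=> dx dy; have dtx := wshift_dom dx.
have [U [uU tU yU]] := cover2 dtx.1 dy.1.
rewrite -(suppq_cover _ dtx.1 uU tU) /mdot /cdot.
pose F i j := (x j)^# ** w' j (y i).
have pick (s : seq I) (o : option I) (G : I -> A) : uniq s ->
    (forall j, o = Some j -> j \notin s -> G j = 0) ->
    \sum_(j <- s | o == Some j) G j = if o is Some j then G j else 0.
  move=> us; case: o => [j|] h; last by rewrite big_pred0_eq.
  rewrite (eq_bigl (pred1 j)); last by move=> k /=; rewrite eq_sym.
  have [js|js] := boolP (j \in s); first last.
    by rewrite h// big1_seq// => k /andP[/eqP -> ks]; rewrite ks in js.
  rewrite big_mkcond (bigD1_seq j)//= eqxx big1 ?addr0// => k /negPf kj.
  by rewrite kj.
have eL i : (wshift f w x i)^# ** y i = \sum_(j <- suppq x | f i == Some j) F i j.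
  rewrite (pick (suppq x) (f i) (F i)); first last.
  - move=> j fi; rewrite mem_suppq ?negbK; last by case: dx.
    by move=> /eqP xj; rewrite /F xj cadj0 cmul0l.
  - exact: fset_uniq.
  rewrite /wshift; case fi: (f i) => [j|]; last by rewrite cadj0 cmul0l.
  by apply: ww' => //; [exact: (dx.2 j)|exact: (dy.2 i)].
have eR j : (x j)^# ** wshift g w' y j = \sum_(i <- U | g j == Some i) F i j.
  rewrite (pick U (g j) (fun i => F i j)) => [|//|i gj iU].
    by rewrite /wshift; case: (g j) => [//|]; exact: cmul0r.
  have -> : F i j = (x j)^# ** w' j 0.
    by congr (_ ** w' j _); apply: contrapT => /yU; rewrite (negPf iU).
  by rewrite w'0 cmul0r.
rewrite (eq_bigr _ (fun i _ => eL i)) [RHS](eq_bigr _ (fun j _ => eR j)).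
rewrite (exchange_big_dep xpredT)//=; apply: eq_bigr => j _; apply: eq_bigl => i.
by apply/eqP/eqP => /fg.
Qed.

End WeightedShift.

(** * Vertex elements are nonzero *)

Section ScalarAlgebra.
Variable R : realType.

Let E : lmodType R[i] := R[i]^o.
Let sadj (t t' : E -> E) := exists c : R[i],
  t = (fun x => c *: x) /\ t' = (fun x => conjc c *: x).

Let sdom_lin (c : R[i]) (x y : E) : setT x -> setT y -> setT (c *: x + y).
Proof. by []. Qed.
Let sn_ge0 (x : E) : 0 <= cn (x : R[i]). Proof. exact: cn_ge0. Qed.
Let snZ (c : R[i]) (x : E) : cn ((c *: x : E) : R[i]) = cn c * cn (x : R[i]).
Proof. exact: cnM. Qed.
Let snD (x y : E) : setT x -> setT y -> cn ((x + y : E) : R[i]) <= cn (x : R[i]) + cn (y : R[i]).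
Proof. by move=> _ _; exact: cnD. Qed.
Let sa_dom t t' x : sadj t t' -> setT x -> setT (t x). Proof. by []. Qed.
Let sa_lin t t' (c : R[i]) x y : sadj t t' -> setT x -> setT y ->
  t (c *: x + y) = c *: t x + t y.
Proof.
by move=> [d [-> _]] _ _; rewrite scalerDr !scalerA mulrC.
Qed.
Let sa_bd t t' : sadj t t' -> exists2 c, 0 <= c & forall x : E, setT x ->
  cn (t x : R[i]) <= c * cn (x : R[i]).
Proof.
move=> [d [-> _]]; exists (cn d) => [|x _]; first exact: cn_ge0.
by rewrite snZ.
Qed.
Let sa_sym t t' : sadj t t' -> sadj t' t.
Proof. by move=> [d [-> ->]]; exists (conjc d); rewrite conjcK. Qed.
Let sa_star t t' x : sadj t t' -> setT x ->
  cn (t x : R[i]) ^+ 2 <= cn (x : R[i]) * cn (t' (t x) : R[i]).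
Proof.
by move=> [d [-> ->]] _; rewrite !snZ cn_conj expr2 mulrCA mulrA mulrC mulrA mulrCA.
Qed.
Let sa0 : sadj (fun=> 0) (fun=> 0).
Proof. by exists 0; rewrite conjc0; split; apply/funext => x; rewrite scale0r. Qed.
Let sa_comb (c : R[i]) t t' s s' : sadj t t' -> sadj s s' ->
  sadj (fun x => c *: t x + s x) (fun x => conjc c *: t' x + s' x).
Proof.
move=> [d [-> ->]] [e [-> ->]]; exists (c * d + e).
by split; apply/funext => x; rewrite scalerA -scalerDl// rmorphD rmorphM.
Qed.
Let sa_comp t t' s s' : sadj t t' -> sadj s s' -> sadj (t \o s) (s' \o t').
Proof.
move=> [d [-> ->]] [e [-> ->]]; exists (d * e).
by split; apply/funext => x; rewrite /= scalerA// rmorphM mulrC.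
Qed.

(** The complex numbers, obtained as scalar operators on themselves; the identity operator has norm
    1. *)
Lemma nonzero_cstar_alg : exists (C : cstar_alg R) (c : C), c <> 0.
Proof.
pose S := @OpSystem R E setT (fun x => cn (x : R[i])) sadj sdom_lin sn_ge0 snZ snD
  sa_dom sa_lin sa_bd sa_sym sa_star sa0 sa_comb sa_comp.
have iop : @is_op R S id by exists id, 1; rewrite cj1; split; apply/funext => x; rewrite scale1r.
exists (op_algebra_of S), (ocls (op_algebra_of S) id) => h0.
have := @ocls_bd _ _ (op_algebra_of S) id 0 iop; rewrite h0 nm0 => /(_ (lexx _)).
by move=> /(_ (1 : R[i])) /(_ I); rewrite mul0r /= cn1 ler10.
Qed.

End ScalarAlgebra.

Section OperatorFamilies.
Variables (R : realType) (S : op_system R).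
Notation O := (op_algebra_of S).

Lemma osn0 : osn (0 : S) = 0.
Proof. by rewrite -(scale0r 0) osnZ cn0 mul0r. Qed.

Lemma is_op_adj (t t' : S -> S) : oadj t t' -> is_op t. Proof. by exists t'. Qed.

Lemma ocls_eqf (t s : S -> S) : is_op t -> is_op s -> (forall x, odom x -> t x = s x) ->
  ocls O t = ocls O s.
Proof. by move=> ht hs ts; apply: ocls_eq => // x dx; rewrite ts// subrr osn0. Qed.

Lemma ocls0 : ocls O (fun=> 0) = 0.
Proof.
apply: nm_le0; apply: ocls_le => //; first by exists (fun=> 0); exact: oadj0.
by move=> x _; rewrite mul0r osn0.
Qed.

Lemma oadj_sum (I : Type) (s : seq I) (t t' : I -> S -> S) :
  (forall i, oadj (t i) (t' i)) ->
  oadj (fun x => \sum_(i <- s) t i x) (fun x => \sum_(i <- s) t' i x).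
Proof.
move=> h; elim: s => [|i s IH].
  rewrite [X in oadj X](_ : _ = fun=> 0); last by apply/funext => x; rewrite big_nil.
  rewrite [X in oadj _ X](_ : _ = fun=> 0); last by apply/funext => x; rewrite big_nil.
  exact: oadj0.
have := oadj_comb 1 (h i) IH; congr oadj; apply/funext => x; rewrite big_cons ?cj1 scale1r//.
Qed.

Lemma ocls_sum (I : Type) (s : seq I) (t t' : I -> S -> S) :
  (forall i, oadj (t i) (t' i)) ->
  ocls O (fun x => \sum_(i <- s) t i x) = \sum_(i <- s) ocls O (t i).
Proof.
move=> h; elim: s => [|i s IH].
  by rewrite big_nil -ocls0; congr ocls; apply/funext => x; rewrite big_nil.
rewrite big_cons -IH -[X in X + _]scale1r -ocls_lin; first 1 last.
- exact: is_op_adj (h i).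
- exact: is_op_adj (oadj_sum s h).
by congr ocls; apply/funext => x; rewrite big_cons scale1r.
Qed.

(** Relations (i)-(iii) are asked pointwise, (iv) only up to vectors of seminorm zero: this is the
    slack that the Fock representation uses. *)
Lemma ops_family (L : ograph) (t t' : L -> S -> S) :
  (forall g, generator g -> oadj (t g) (t' g)) ->
  (forall g x, generator g -> odom x -> t g (t' g (t g x)) = t g x) ->
  (forall g x, generator g -> odom x -> t' g (t g x) = t (src g) x) ->
  (forall g h x, generator g -> generator h -> src g = rng h -> olt (deg g) (deg h) ->
    odom x -> t g (t h x) = t (comp g h) x) ->
  (forall g h x, generator g -> generator h -> ~ cmp g h -> odom x ->
    t' g (t h x) = 0) ->
  (forall a v (s : seq L) x, regular a v -> odom x -> uniq s ->
    (forall f, f \in s <-> rng f = v /\ pow_edges L a f) ->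
    osn (t v x - \sum_(e <- s) t e (t' e x)) = 0) ->
  graph_family (fun g => ocls O (t g)).
Proof.
move=> tt tp ts tc to tsum.
have op g : generator g -> is_op (t g) by move=> /tt; exact: is_op_adj.
have op' g : generator g -> is_op (t' g) by move=> /tt/oadj_sym; exact: is_op_adj.
have opc (x y : S -> S) : is_op x -> is_op y -> is_op (x \o y).
  by move=> [x' hx] [y' hy]; exists (y' \o x'); exact: oadj_comp.
have vg e : generator (src e) by left; exact: src_vertex.
split=> [e eg|e eg|e f eg fg ef d|e f eg fg ef|a v rv].
- rewrite (ocls_adj O (tt _ eg)) -!oclsM; try by [exact: op|exact: op'|apply: opc; [exact: op|exact: op']].
  apply: ocls_eqf; [exact: (opc _ _ (opc _ _ (op _ eg) (op' _ eg)) (op _ eg))|exact: op|].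
  by move=> x dx /=; exact: tp.
- rewrite (ocls_adj O (tt _ eg)) -oclsM; [|exact: op'|exact: op].
  apply: ocls_eqf; [by apply: opc; [exact: op'|exact: op]|exact/op/vg|].
  by move=> x dx /=; exact: ts.
- rewrite -oclsM; [|exact: op|exact: op].
  apply: ocls_eqf; [by apply: opc; exact: op|exact/op/generator_comp|].
  by move=> x dx /=; exact: tc.
- rewrite (ocls_adj O (tt _ eg)) -oclsM; [|exact: op'|exact: op].
  rewrite -ocls0; apply: ocls_eqf; [by apply: opc; [exact: op'|exact: op]| |].
    by exists (fun=> 0); exact: oadj0.
  move=> x dx /=; apply: to => // /cmp_exts[y].
  by rewrite ef.
have fin : finite_set [set f | rng f = v /\ pow_edges L a f] by case: rv.
pose s : seq L := fset_set [set f | rng f = v /\ pow_edges L a f].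
have sP f : f \in s <-> rng f = v /\ pow_edges L a f.
  by rewrite /s in_fset_set//; split=> [/set_mem|h]//; exact: mem_set.
(* [ocls_sum] asks for an adjoint at every index, so [t] and [t'] are replaced by 0 outside the
   generators. *)
pose u e := if `[< generator e >] then t e else fun=> 0.
pose u' e := if `[< generator e >] then t' e else fun=> 0.
have uu e : oadj (u e) (u' e).
  by rewrite /u /u'; case: asboolP => [/tt//|_]; exact: oadj0.
have gs e : e \in s -> generator e by move=> /sP[_ ea]; right; exists a.
have us e : e \in s -> u e = t e /\ u' e = t' e.
  by move=> /gs eg; rewrite /u /u' asboolT.
have tts e : oadj (u e \o u' e) (u e \o u' e).
  by apply: oadj_comp => //; exact: oadj_sym.
rewrite fsbig_finite// -/s (eq_big_seq (fun e => ocls O (u e \o u' e))); last first.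
  move=> e es; have [-> ->] := us e es; have eg := gs e es.
  by rewrite (ocls_adj O (tt _ eg)) -oclsM//; [exact: op|exact: op'].
rewrite -(ocls_sum _ tts); apply: ocls_eq => [||x dx].
- by apply: op; left; case: rv.
- exact: is_op_adj (oadj_sum s tts).
rewrite (eq_big_seq (fun e => t e (t' e x))); first exact: tsum rv dx (fset_uniq _) sP.
by move=> e es; have [-> ->] := us e es.
Qed.

End OperatorFamilies.

(** * The path space and its representation *)

Section Chains.
Variable L : ograph.
Implicit Types (C D : set L) (e f g h : L).

(* The maximal chains of initial segments are the points of the path space. *)
Definition chain C := (forall e f, C e -> C f -> cmp e f) /\
  (forall e f, extensions e f -> C f -> C e).
Definition mchain C := [/\ chain C, C !=set0 & forall D, chain D -> C `<=` D -> D `<=` C].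

Definition ctail g C : set L := [set h | src g = rng h /\ C (comp g h)].
Definition chead g C : set L :=
  [set e | exists h, [/\ C h, src g = rng h & extensions e (comp g h)]].

Lemma chain_tail g C : chain C -> chain (ctail g C).
Proof.
move=> [cc cp]; split=> [e f [ge Ce] [gf Cf]|e f ef [gf Cf]].
  by apply/(@cmp_compl L g) => //; exact: cc.
have ge : src g = rng e by rewrite gf (ext_rng ef).
by split=> //; apply: cp Cf; exact/ext_compl.
Qed.

Lemma chain_head g C : chain C -> chain (chead g C).
Proof.
move=> [cc cp]; split=> [e f [h [Ch gh eh]] [k [Ck gk fk]]|e f ef [h [Ch gh fh]]].
  have [hk|kh] := cc h k Ch Ck.
    by apply: (@ext_cmp L (comp g k)) => //; apply: ext_trans eh _; exact/ext_compl.
  by apply: (@ext_cmp L (comp g h)) => //; apply: ext_trans fk _; exact/ext_compl.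
by exists h; split => //; exact: ext_trans fh.
Qed.

Lemma tail_head g C : chain C -> (forall e, C e -> rng e = src g) -> ctail g (chead g C) = C.
Proof.
move=> [cc cp] gC; apply/seteqP; split=> e.
  by move=> [ge [h [Ch gh /ext_compl]]] => /(_ ge gh)/cp; apply.
move=> Ce; have ge := esym (gC e Ce).
by split => //; exists e; split => //; exact: ext_refl.
Qed.

Lemma head_tail g C : chain C -> C g -> chead g (ctail g C) = C.
Proof.
move=> [cc cp] Cg; apply/seteqP; split=> e.
  by move=> [h [[_ Ch] gh eh]]; exact: cp Ch.
move=> Ce; have [[k gk eE]|eg] := cc g e Cg Ce.
  by exists k; split => //; [split => //; rewrite -eE|rewrite -eE; exact: ext_refl].
exists (src g); split; [split|by rewrite rng_src|by rewrite comp_src].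
  by rewrite rng_src.
by rewrite comp_src.
Qed.

Lemma chain_rng C e f : chain C -> C e -> C f -> rng e = rng f.
Proof. by move=> [cc _] Ce Cf; have [/ext_rng|/ext_rng] := cc e f Ce Cf. Qed.

Lemma chain_vertex C e : chain C -> C e -> C (rng e).
Proof.
by move=> [_ cp]; apply: cp; exists e; rewrite ?src_rng// comp_rng.
Qed.

Lemma chain_src C g : chain C -> C g -> ctail g C (src g).
Proof. by move=> _ Cg; split; rewrite ?rng_src// comp_src. Qed.

Lemma mchain_tail g C : mchain C -> C g -> mchain (ctail g C).
Proof.
move=> [cC nC mC] Cg; split; first exact: chain_tail.
  by exists (src g); exact: chain_src.
move=> D cD sD e De.
have rD f : D f -> rng f = src g.
  move=> Df; rewrite (chain_rng cD Df (sD _ (chain_src cC Cg))); exact: rng_src.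
rewrite -(tail_head cD rD) in De; case: De => ge Ce; split=> //.
apply: (mC _ (chain_head g cD)) Ce => f; rewrite -{1}(head_tail cC Cg).
by move=> [h [/sD Dh gh fh]]; exists h.
Qed.

Lemma mchain_head g C : mchain C -> C (src g) -> mchain (chead g C) /\ chead g C g.
Proof.
move=> [cC nC mC] Cg.
have rC f : C f -> rng f = src g by move=> Cf; rewrite (chain_rng cC Cf Cg) rng_src.
have hg : chead g C g.
  by exists (src g); split => //; rewrite ?rng_src// comp_src; exact: ext_refl.
split=> //; split; [exact: chain_head|by exists g|].
move=> D cD sD e; have Dg : D g by exact: sD.
rewrite -{1}(head_tail cD Dg) => -[h [Dh gh eh]]; exists h; split => //.
apply: (mC _ (chain_tail g cD)) Dh => f Cf; split; first by rewrite rC.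
by apply: sD; exists f; split => //; [rewrite rC|exact: ext_refl].
Qed.

Definition prefixes f : set L := [set e | extensions e f].

Lemma prefixes_chain f : chain (prefixes f).
Proof.
split=> [e g ef gf|e g eg gf]; first exact: ext_cmp ef gf.
exact: ext_trans gf.
Qed.

Lemma mchain_exists w : exists2 C, mchain C & C w.
Proof.
have [|C [[cC Cw] mC]] := @Zorn_bigcup L [set C | chain C /\ (C !=set0 -> C w)].
  move=> F sF tF; split; last first.
    by move=> [e [C FC Ce]]; exists C => //; have [_] := sF C FC; apply; exists e.
  split=> [e f [C FC Ce] [D FD Df]|e f ef [C FC Cf]].
    have [CD|DC] := tF C D FC FD.
      by have [[h _] _] := sF D FD; apply: h => //; exact: CD.
    by have [[h _] _] := sF C FC; apply: h => //; exact: DC.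
  by exists C => //; have [[_ h] _] := sF C FC; exact: h Cf.
have Cn : C !=set0.
  apply: contrapT => C0; apply: (mC (prefixes w)).
    split; first by move=> e Ce; case: C0; exists e.
    by move=> h; apply: C0; exists w; apply: h; exact: ext_refl.
  by split; [exact: prefixes_chain|move=> _; exact: ext_refl].
exists C; last exact: Cw.
split=> // D cD CD e De; apply: contrapT => nCe; apply: (mC D).
  by split => // h; apply: nCe; exact: h.
by split => // _; apply: CD; exact: Cw.
Qed.

(* Otherwise all members extend below [omega ^ a] to finitely many edges, one of
   which extends them all. *)
Lemma mchain_regular a v C : mchain C -> regular a v -> C v ->
  exists2 e, C e & pow_edges L a e.
Proof.
move=> [cC _ mC] [vv sr rf] Cv; apply: contrapT => none.
have bl e : C e -> below L a e.
  move=> Ce; have [h|//] := ole_total (opow a) (deg e).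
  have [f fe fa] := prefix_exists h; case: none; exists f => //.
  exact: cC.2 fe Ce.
have rv e : C e -> rng e = v by move=> Ce; rewrite (chain_rng cC Ce Cv).
pose F := [set f | rng f = v /\ pow_edges L a f].
have up e : C e -> exists2 f, F f & extensions e f.
  move=> Ce; have [f [fe fa]] := sr e (rv e Ce) (bl e Ce).
  have ef : src e = rng f by [].
  exists (comp e f); last exact: ext_comp.
  by split; [rewrite rng_comp//; exact: rv|apply: pow_edges_comp => //; exact: bl].
have [f Ff fC] : exists2 f, F f & C `<=` prefixes f.
  apply: contrapT => nf.
  have bad f : exists e, F f -> C e /\ ~ extensions e f.
    have [Ff|nFf] := pselect (F f); last by exists v.
    apply: contrapT => h; apply: nf; exists f => // e Ce.
    by apply: contrapT => ne; apply: h; exists e.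
  have [b bP] := choice bad.
  have [e Ce eb] : exists2 e, C e & forall f, F f -> extensions (b f) e.
    have up_seq : forall s : seq L, (forall f, f \in s -> F f) ->
        exists2 e, C e & forall f, f \in s -> extensions (b f) e.
      elim=> [_|x s IH sF]; first by exists v.
      have [|e Ce es] := IH; first by move=> f fs; apply: sF; rewrite inE fs orbT.
      have [Cb _] := bP x (sF x (mem_head _ _)).
      have [h|h] := cC.1 _ _ Cb Ce.
        by exists e => // f; rewrite inE => /predU1P[->//|/es].
      exists (b x) => // f; rewrite inE => /predU1P[->|/es ef]; first exact: ext_refl.
      exact: ext_trans h.
    have [|e Ce es] := up_seq (fset_set F); first by move=> f; rewrite in_fset_set// => /set_mem.
    by exists e => // f Ff; apply: es; rewrite in_fset_set//; exact: mem_set.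
  have [f Ff ef] := up e Ce; have [_] := bP f Ff; apply.
  exact: ext_trans (eb f Ff) ef.
case: none; exists f; last by case: Ff.
exact: (mC _ (prefixes_chain f) fC) (ext_refl f).
Qed.

End Chains.

Section ChainRepresentation.
Variables (R : realType) (L : ograph) (K : cstar_alg R).
Notation I := {classic (set L)}.
Implicit Types (g h : L).

Let D (C : I) : set K := [set a | a <> 0 -> mchain (C : set L)].

Let D0 C : D C 0. Proof. by []. Qed.
Let D_lin C (c : R[i]) (x y : K) : D C x -> D C y -> D C (c *: x + y).
Proof.
move=> hx hy h; have [x0|/hx//] := pselect (x = 0); apply: hy => y0.
by apply: h; rewrite x0 y0 scaler0 addr0.
Qed.
Let D_act C (x a : K) : D C x -> D C (x ** a).
Proof. by move=> hx h; apply: hx => x0; apply: h; rewrite x0 cmul0l. Qed.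
Let P_ne : [set (0 : K)] !=set0. Proof. by exists 0. Qed.
Let P_proj (p : K) : [set 0] p -> p^# = p /\ p ** p = p.
Proof. by move=> ->; rewrite cadj0 cmul0l. Qed.
Let P_dir (p q : K) : [set 0] p -> [set 0] q -> exists2 r, [set (0 : K)] r & r ** p = p /\ r ** q = q.
Proof. by move=> -> ->; exists 0 => //; rewrite cmul0l. Qed.

Let S := mod_system D0 D_lin D_act P_ne P_proj P_dir.

Let ft g (C : I) : option I :=
  if `[< mchain (C : set L) /\ (C : set L) g >] then Some (ctail g C : I) else None.
Let fh g (C : I) : option I :=
  if `[< mchain (C : set L) /\ (C : set L) (src g) >] then Some (chead g C : I) else None.
Let w (_ : I) (a : K) : K := a.

Let ft_fh g (C E : I) : ft g C = Some E <-> fh g E = Some C.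
Proof.
rewrite /ft /fh; split.
  case: asboolP => // -[mC Cg] [<-]; have cC : chain C by case: mC.
  rewrite asboolT ?head_tail//; split; first exact: mchain_tail.
  exact: chain_src.
case: asboolP => // -[mE Eg] [<-]; have cE : chain E by case: mE.
have [mh hg] := mchain_head mE Eg.
rewrite asboolT// tail_head// => f Ef.
by rewrite (chain_rng cE Ef Eg) rng_src.
Qed.

Let t g : S -> S := @wshift R K I (ft g) w.
Let t' g : S -> S := @wshift R K I (fh g) w.

Let ftD g i j a : ft g i = Some j -> D j a -> D i (w i a).
Proof. by rewrite /ft; case: asboolP => // -[mC _] _ _ _. Qed.

Let fhD g i j a : fh g i = Some j -> D j a -> D i (w i a).
Proof. by rewrite /fh; case: asboolP => // -[mC _] _ _ _. Qed.

Let tE g (x : S) C : t g x C = if ft g C is Some E then x E else 0. Proof. by []. Qed.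
Let t'E g (x : S) C : t' g x C = if fh g C is Some E then x E else 0. Proof. by []. Qed.

Let tt't g x : t g (t' g (t g x)) = t g x.
Proof.
apply/funext => C; rewrite !tE; case fC: (ft g C) => [E|//].
by rewrite t'E ((ft_fh _ _ _).1 fC) tE fC.
Qed.

Let t'tt' g x : t' g (t g (t' g x)) = t' g x.
Proof.
apply/funext => C; rewrite !t'E; case fC: (fh g C) => [E|//].
by rewrite tE ((ft_fh _ _ _).2 fC) t'E fC.
Qed.

Let tt g : madj D (t g) (t' g).
Proof.
apply: (madj_pisom D_lin) => [x dx|x dx|c x y _ _|c x y _ _|x a _|x a _|x y dx dy|x _|x _].
- by apply: (wshift_dom D0 (@ft_fh g)) => //; exact: ftD.
- by apply: (wshift_dom D0 (fun i j => iff_sym (@ft_fh g j i))) => //; exact: fhD.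
- exact: wshift_lin.
- exact: wshift_lin.
- exact: wshift_act.
- exact: wshift_act.
- by apply: (@wshift_adj R K I D D0 (ft g) (fh g) w w (@ft_fh g)) => //; exact: ftD.
- exact: tt't.
- exact: t'tt'.
Qed.

Let tv v x C : is_vertex v -> t v x C = if `[< mchain (C : set L) /\ (C : set L) v >] then x C else 0.
Proof.
move=> vv; rewrite tE /ft; case: asboolP => // -[mC Cv].
congr (x _); have cC : chain C by case: mC.
apply/seteqP; split=> e.
  move=> [ve]; rewrite (vertex_src vv) in ve.
  by rewrite ve comp_rng.
move=> Ce; have ve : v = rng e by rewrite -[LHS]vv; exact: chain_rng Cv Ce.
by split; [rewrite (vertex_src vv)|rewrite {1}ve comp_rng].
Qed.

(** On point masses [t g] prepends [g] to a path. Relation (iv) holds because a maximal chain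
    through a regular vertex contains an edge of the relevant degree ([mchain_regular]), and only
    one since its members are comparable. *)
Lemma chain_family : graph_family (fun g => ocls (op_algebra_of S) (t g)).
Proof.
apply: (@ops_family R S L t t') => [g _|g x _ _|g x _ dx|g h x _ _ gh _ dx|g h x _ _ gh dx|a v s x rv dx us sP].
- exact: tt.
- exact: tt't.
- apply/funext => C; rewrite (tv _ _ (src_vertex g)) t'E /fh.
  case: asboolP => // -[mC Cg]; rewrite tE.
  have [_ _] := mchain_head mC Cg.
  by rewrite ((ft_fh g (chead g C) C).2 _)// /fh asboolT.
- apply/funext => C; rewrite !tE /ft; case: asboolP => [[mC Cg]|nC]; last first.
    rewrite asboolF// => -[mC Cgh]; apply: nC; split => //.
    by case: mC => -[_ cp] _ _; apply: cp Cgh; exact: ext_comp.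
  rewrite tE /ft; have mt := mchain_tail mC Cg.
  have eT : ctail h (ctail g C) = ctail (comp g h) C.
    apply/seteqP; split=> e [] /=.
      by move=> he [ge Ce]; split; rewrite ?src_comp// -compA.
    rewrite src_comp// => he Ce; split => //; split; first by rewrite rng_comp.
    by rewrite compA.
  case: asboolP => [[_ [_ Ch]]|nC].
    by rewrite asboolT// eT.
  by rewrite asboolF// => -[_ Ch]; apply: nC.
- apply/funext => C; rewrite t'E /fh; case: asboolP => // -[mC Cg].
  rewrite tE /ft asboolF// => -[[[cc _] _ _] hh]; apply: gh; apply: cc hh.
  by have [] := mchain_head mC Cg.
suff -> : t v x = \sum_(e <- s) t e (t' e x) by rewrite subrr; exact: osn0.
apply/funext => C; have [vv _ _] := rv.
have sE : (\sum_(e <- s) t e (t' e x)) C = \sum_(e <- s) (t e (t' e x)) C.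
  elim: (s) => [|e l IH]; first by rewrite !big_nil.
  by rewrite !big_cons -IH.
rewrite sE tv//.
have eE e : (t e (t' e x)) C = if `[< mchain (C : set L) /\ (C : set L) e >] then x C else 0.
  rewrite tE /ft; case: asboolP => // -[mC Ce].
  rewrite t'E ((ft_fh e C (ctail e C)).1 _)// /ft asboolT//.
rewrite (eq_bigr _ (fun e _ => eE e)).
case: asboolP => [[mC Cv]|nC]; last first.
  rewrite big_seq big1// => e /sP[ev _]; rewrite asboolF// => -[mC Ce].
  apply: nC; split => //; rewrite -ev; apply: chain_vertex => //.
  by case: mC.
have cC : chain C by case: mC.
have [e Ce ea] := mchain_regular mC rv Cv.
have es : e \in s.
  by apply/sP; split => //; rewrite (chain_rng cC Ce Cv).
rewrite (bigD1_seq e)//= asboolT// big_seq_cond big1 ?addr0// => f /andP[/sP[_ fa] fe].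
rewrite asboolF// => -[_ Cf]; case/eqP: fe; apply: cmp_eq; first exact: cC.1.
exact: oeq_trans fa (oeq_sym ea).
Qed.

(** The point mass at a maximal chain through [v] is fixed by [t v]. *)
Lemma chain_vertex_neq0 (k : K) v : k <> 0 -> is_vertex v ->
  ocls (op_algebra_of S) (t v) <> 0.
Proof.
move=> k0 vv t0; have [C mC Cv] := mchain_exists v.
pose x : S := fun E : I => if E == (C : I) then k else 0.
have dx : mdom D x.
  split=> [|E]; last by rewrite /x; case: eqP => [-> _|//].
  apply: (@sub_finite_set _ _ [set (C : I)]); last exact: finite_set1.
  by move=> E; rewrite /supp /= /x; case: eqP.
have := @ocls_bd _ _ (op_algebra_of S) (t v) 0 (@is_op_adj R S _ _ (tt v)).
rewrite t0 nm0 => /(_ (lexx _))/(_ x dx); rewrite mul0r => le0.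
have tx : t v x = x.
  apply/funext => E; rewrite tv// /x; case: eqP => [->|_]; last by case: asboolP.
  by rewrite asboolT.
rewrite tx in le0; apply: k0; apply: nm_le_eps => e e0.
have [p ->] := msn_comp D_lin D_act P_ne (C : I) dx le0 e0.
by rewrite cmul0r subr0 /x eqxx add0r.
Qed.

End ChainRepresentation.

Lemma gen_vertex_neq0 (R : realType) (L : ograph) (O : graph_alg R L) v :
  is_vertex v -> gen O v <> 0.
Proof.
move=> vv; have [K [k k0]] := nonzero_cstar_alg R.
have F := chain_family L K; have [h [[hH hg] _]] := gen_universal O F => v0.
apply: (chain_vertex_neq0 k0 vv).
by rewrite -[LHS](hg v); [rewrite v0 (hom0 hH)|left].
Qed.

(** * The Fock representation *)

(* The algebra of the lower graph acts on its own column modulo the ideal of the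
   regular vertices; the longer paths are represented by translations. *)
Section Fock.
Variables (R : realType) (L : ograph) (HC : condition_C L) (a : ord).
Variable A : graph_alg R (lower L a).
Notation M := (lower L a).
Notation T := (gen A).
Notation I := (option L).
Implicit Types (e f g h s v : L).

Let HA := gen_family A.

(** The paths whose degree has all terms of its Cantor normal form at least [omega ^ a]: no final
    piece other than a vertex is shorter than that. *)
Definition lim_edge s := ~ is_vertex s /\
  forall f g, src f = rng g -> s = comp f g -> below L a g -> is_vertex g.

Definition end_of s : M := exist _ (src s) (src_below a s).
Definition low g : M := insubd (end_of g) g.

Lemma low_val g : below L a g -> lval (low g) = g.
Proof. by move=> ga; rewrite /lval val_insubd mem_set. Qed.

Lemma end_vertex s : is_vertex (end_of s).
Proof. by apply/lval_vertex; rewrite /lval /=; exact: src_vertex. Qed.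

Lemma low_vertex v : is_vertex v -> low v = end_of v.
Proof.
move=> vv; apply: lval_inj; rewrite low_val; last exact: vertex_below.
by rewrite /lval /= vertex_src.
Qed.

Lemma low_src g : low (src g) = end_of g.
Proof. rewrite low_vertex; last exact: src_vertex.
by apply: val_inj; rewrite /= src_src. Qed.

Lemma src_low g : below L a g -> src (low g) = end_of g.
Proof. by move=> ga; apply: lval_inj; rewrite lval_src low_val. Qed.

Lemma low_generator g : below L a g -> generator g -> generator (low g).
Proof. by move=> ga gg; apply: generator_lval; rewrite low_val. Qed.

Lemma TTend s : T (end_of s) ** T (end_of s) = T (end_of s).
Proof. exact/(TvTv HA)/end_vertex. Qed.

(** The index [None] carries the column [O(L_a)], and a long path [s] carries a copy of
    [T_(src s) O(L_a)]: a model of formal products of [s] with elements of [O(L_a)]. *)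
Definition fdom (i : I) : set A := if i is Some s then
  [set x | (x <> 0 -> lim_edge s) /\ T (end_of s) ** x = x] else setT.
Definition funits : set A := [set p | exists2 l, gantichain l & p = aunit A l].

Let D0 i : fdom i 0. Proof. by case: i => // s; split; rewrite ?cmul0r. Qed.
Let D_lin i (c : R[i]) (x y : A) : fdom i x -> fdom i y -> fdom i (c *: x + y).
Proof.
case: i => // s [hx xE] [hy yE]; split; last by rewrite cmul_linr xE yE.
move=> h; have [x0|/hx//] := pselect (x = 0); apply: hy => y0.
by apply: h; rewrite x0 y0 scaler0 addr0.
Qed.
Let D_act i (x b : A) : fdom i x -> fdom i (x ** b).
Proof.
case: i => // s [hx xE]; split; last by rewrite cmulA xE.
by move=> h; apply: hx => x0; apply: h; rewrite x0 cmul0l.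
Qed.
Let P_ne : funits !=set0. Proof. by exists (aunit A [::]), [::]. Qed.
Let P_proj p : funits p -> p^# = p /\ p ** p = p.
Proof. by move=> [l [al _] ->]; rewrite aunit_adj aunit_idem. Qed.
Let P_dir p q : funits p -> funits q -> exists2 r, funits r & r ** p = p /\ r ** q = q.
Proof.
move=> [l gl ->] [m gm ->]; have [n gn [nl nm]] := aunit_directed A gl gm.
by exists (aunit A n) => //; exists n.
Qed.

Let S := mod_system D0 D_lin D_act P_ne P_proj P_dir.
Notation mdom := (mdom fdom).


Definition lsplit g s h := src g = rng h /\ s = comp g h.

Let tl g s : option L :=
  if pselect (exists h, lsplit g s h) is left p then Some (projT1 (cid p)) else None.

Let tlP g s h : tl g s = Some h <-> lsplit g s h.
Proof.
rewrite /tl; case: pselect => [p|np]; last by split=> // hh; case: np; exists h.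
case: (cid p) => k [gk sk] /=; split=> [[<-]//|[gh sh]].
by congr Some; apply: (comp_inj gk gh); rewrite -sk.
Qed.

Let bel g : bool := `[< below L a g >].

(** [ft g] and [fh g] are inverse partial maps. A short [g] acts on [None] by left multiplication, a
    long [g] moves [None] to the index [g], and every [g] moves a non-vertex [h] to [comp g h]. The
    index [g] itself is the case of a vertex [h]; it is reserved for the image of [None]. *)
Let ft g (i : I) : option I :=
  if i is Some s then
    if tl g s is Some h then
      if `[< is_vertex h >] then (if bel g then None else Some None) else Some (Some h)
    else None
  else if bel g then Some None else None.
Let fh g (i : I) : option I :=
  if i is Some h then
    if `[< src g = rng h /\ ~ is_vertex h >] then Some (Some (comp g h)) else None
  else if bel g then Some None else Some (Some g).
Let w g (i : I) (x : A) : A :=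
  if i is Some s then (if s == g then T (end_of g) ** x else x) else T (low g) ** x.
Let w' g (i : I) (x : A) : A :=
  if i is None then (if bel g then (T (low g))^# ** x else T (end_of g) ** x) else x.

Let vcomp g h : src g = rng h -> is_vertex h -> comp g h = g.
Proof. by move=> gh hv; rewrite -hv -gh comp_src. Qed.

Let nvcomp g h : src g = rng h -> ~ is_vertex h -> comp g h <> g.
Proof.
move=> gh nh E; apply: nh; apply: deg0_vertex; apply: (@ole_add_cancel (deg g)).
apply: (ole_trans (deg_comp gh).2); rewrite E; exact: ole_addr.
Qed.

Let ft_fh g i j : ft g i = Some j <-> fh g j = Some i.
Proof.
rewrite /ft /fh; split.
  case: i => [s|]; last by case: (bel g) => // -[<-].
  case st: (tl g s) => [h|//]; have [gh ->] := (tlP _ _ _).1 st.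
  case: asboolP => [hv|nv] => [|[<-]]; last by rewrite asboolT.
  by case: (bel g) => // -[<-]; rewrite vcomp.
case: j => [h|].
  case: asboolP => // -[gh nh] [<-].
  by rewrite ((tlP g (comp g h) h).2 _)// asboolF.
case bg: (bel g) => -[<-] //.
rewrite ((tlP g g (src g)).2 _); last by split; rewrite ?rng_src ?comp_src.
by rewrite asboolT//; exact: src_vertex.
Qed.

Let t g : S -> S := @wshift R A I (ft g) (w g).
Let t' g : S -> S := @wshift R A I (fh g) (w' g).

Let t_none g x : t g x None = if bel g then T (low g) ** x None else 0.
Proof. by rewrite /t /wshift /= /bel; case: asboolP. Qed.

Let t_self g x : t g x (Some g) = if bel g then 0 else T (end_of g) ** x None.
Proof.
rewrite /t /wshift /= ((tlP g g (src g)).2 _); last by split; rewrite ?rng_src ?comp_src.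
by rewrite asboolT; [case: (bel g) => //; rewrite eqxx|exact: src_vertex].
Qed.

Let t_comp g h x : src g = rng h -> ~ is_vertex h -> t g x (Some (comp g h)) = x (Some h).
Proof.
move=> gh nh; rewrite /t /wshift /= ((tlP _ _ h).2 _)// asboolF// ifN//.
by apply/eqP; exact: nvcomp.
Qed.

Let t_out g s x : ~ extensions g s -> t g x (Some s) = 0.
Proof.
move=> ns; rewrite /t /wshift /=; case st: (tl g s) => [h|//].
by have [gh sE] := (tlP _ _ _).1 st; case: ns; exists h.
Qed.

Let t'_none g x : t' g x None =
  if bel g then (T (low g))^# ** x None else T (end_of g) ** x (Some g).
Proof. by rewrite /t' /wshift /=; case: (bel g). Qed.

Let t'_comp g h x : src g = rng h -> ~ is_vertex h -> t' g x (Some h) = x (Some (comp g h)).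
Proof. by move=> gh nh; rewrite /t' /wshift /= asboolT. Qed.

Let t'_out g h x : ~ (src g = rng h /\ ~ is_vertex h) -> t' g x (Some h) = 0.
Proof. by move=> nh; rewrite /t' /wshift /= asboolF. Qed.

Let ext_cases g s : [\/ ~ extensions g s, s = g | exists h, [/\ src g = rng h,
  ~ is_vertex h & s = comp g h]].
Proof.
have [[h gh ->]|] := pselect (extensions g s); last by constructor 1.
have [hv|nh] := pselect (is_vertex h); last by constructor 3; exists h.
by constructor 2; rewrite vcomp.
Qed.

Let pow_nbelow g : generator g -> ~ below L a g -> exists2 b, pow_edges L b g & ole a b.
Proof.
move=> [gv|[c gc]] ng; first by case: ng; exact: vertex_below.
exists c => //; have [//|ca] := ole_total a c; case: ng; exact: pow_below gc.
Qed.

Let gen_lim g : generator g -> ~ below L a g -> lim_edge g.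
Proof.
move=> gg ng; split; first by move=> gv; apply: ng; exact: vertex_below.
have [c gc ac] := pow_nbelow gg ng.
move=> f h fgh gE ha; apply: deg0_vertex.
have [h1 h2] := deg_comp fgh; rewrite -gE in h1 h2; have [g1 g2] := gc.
have hc : below L c h by apply: below_lt ha.
have [fc|cf] := ole_total (opow c) (deg f).
  apply: (@ole_add_cancel (deg f)); apply: (ole_trans h2); apply: (ole_trans g1).
  by apply: (ole_trans fc); exact: ole_addr.
by have := olt_le_false (ole_olt_trans h1 (opow_add cf hc)) g2.
Qed.

Let lim_comp g h : src g = rng h -> ~ is_vertex h -> lim_edge h -> lim_edge (comp g h).
Proof.
move=> gh nh [_ lh]; split.
  move=> /vertex_deg[d _]; apply: nh; apply: deg0_vertex; apply: ole_trans d.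
  by apply: ole_trans (deg_comp gh).2; exact: ole_addl.
move=> f k fk E ka.
have [gf|fg] : cmp g f by apply: (@ext_cmp L (comp g h)); [exists h|exists k].
  have [m gm fE] := gf; apply: (lh m k) => //; first by rewrite -fk fE src_comp.
  apply: (@comp_inj L g) => //; first by rewrite rng_comp// -fk fE src_comp.
  by rewrite E fE compA// -fk fE src_comp.
have [m fm gE] := fg.
have mh : src m = rng h by rewrite -gh gE src_comp.
have kE : k = comp m h.
  apply: (@comp_inj L f) => //; first by rewrite rng_comp.
  by rewrite -E gE compA.
case: nh; apply: (lh (rng h) h); rewrite ?src_rng ?comp_rng//.
by apply: (comp_below_tail mh); rewrite -kE.
Qed.

Let lim_tail g h : src g = rng h -> ~ is_vertex h -> lim_edge (comp g h) -> lim_edge h.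
Proof.
move=> gh nh [_ l]; split => // f k fk E ka; apply: (l (comp g f) k) => //.
  by rewrite src_comp// gh E rng_comp.
by rewrite E compA// gh E rng_comp.
Qed.

Let end_comp g h : src g = rng h -> end_of (comp g h) = end_of h.
Proof. by move=> gh; apply: lval_inj; rewrite /lval /= src_comp. Qed.

Let ftD g i j (x : A) : generator g -> ft g i = Some j -> fdom j x -> fdom i (w g i x).
Proof.
move=> gg; case: i => [s|//] /=; case st: (tl g s) => [h|//].
have [gh ->] := (tlP _ _ _).1 st; case: asboolP => [hv|nh].
  rewrite /bel; case: asboolP => // ng _ _; rewrite vcomp// eqxx; split.
    by move=> _; exact: gen_lim.
  by rewrite cmulA TTend.
move=> [<-] [lx ex]; rewrite ifN; last by apply/eqP; exact: nvcomp.
split; first by move=> /lx; exact: lim_comp.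
by rewrite end_comp.
Qed.

Let fhD g i j (x : A) : generator g -> fh g i = Some j -> fdom j x -> fdom i (w' g i x).
Proof.
move=> gg; case: i => [h|//] /=; case: asboolP => // -[gh nh] [<-] [lx ex].
by split; [move=> /lx; exact: lim_tail|rewrite -(end_comp gh)].
Qed.

Let dom_end x s : mdom x -> T (end_of s) ** x (Some s) = x (Some s).
Proof. by move=> [_ dx]; have [] := dx (Some s). Qed.

Let dom_lim x s : mdom x -> ~ lim_edge s -> x (Some s) = 0.
Proof. by move=> [_ dx] nl; have [h _] := dx (Some s); apply: contrapT => /h. Qed.

Let t't g x : generator g -> mdom x -> t' g (t g x) = t (src g) x.
Proof.
move=> gg dx; have sv := src_vertex g; have sb : bel (src g) by rewrite /bel asboolT//; exact: vertex_below.
apply/funext => -[h|].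
  have E : t (src g) x (Some h) = if `[< src g = rng h /\ ~ is_vertex h >] then x (Some h) else 0.
    case: asboolP => [[gh nh]|n].
      by rewrite -{1}(comp_rng h) -gh t_comp// src_src.
    have [no|->|[k [gk nk hE]]] := ext_cases (src g) h; first by rewrite t_out.
      by rewrite t_self sb.
    rewrite src_src in gk; case: n; have hk : h = k by rewrite hE gk comp_rng.
    by rewrite hk.
  rewrite E; case: asboolP => [[gh nh]|n]; last by rewrite t'_out.
  by rewrite t'_comp// t_comp.
rewrite t'_none !t_none t_self sb low_src /bel; case: asboolP => [ga|na].
  by rewrite cmulA (family_src HA) ?src_low//; exact: low_generator.
by rewrite cmulA TTend.
Qed.

Let tt't g x : generator g -> mdom x -> t g (t' g (t g x)) = t g x.
Proof.
move=> gg dx; rewrite t't//; have sv := src_vertex g.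
have sb : bel (src g) by rewrite /bel asboolT//; exact: vertex_below.
apply/funext => -[s|].
  have [no|->|[h [gh nh ->]]] := ext_cases g s; first by rewrite !t_out.
    by rewrite !t_self t_none sb low_src; case: ifP => // _; rewrite cmulA TTend.
  by rewrite !t_comp// -{1}(comp_rng h) -gh t_comp// src_src.
rewrite !t_none sb low_src /bel; case: asboolP => // ga.
by rewrite cmulA -src_low// (Tg_src HA)//; exact: low_generator.
Qed.

Let t'tt' g x : generator g -> mdom x -> t' g (t g (t' g x)) = t' g x.
Proof.
move=> gg dx; apply/funext => -[h|].
  have [[gh nh]|n] := pselect (src g = rng h /\ ~ is_vertex h); last by rewrite !t'_out.
  by rewrite t'_comp// t_comp.
rewrite !t'_none t_none t_self t'_none /bel; case: asboolP => ga.
  rewrite cmulA (family_src HA); last exact: low_generator.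
  rewrite cmulA src_low// -(Tv_adj HA (end_vertex g)) -cadjM -src_low//.
  by rewrite (Tg_src HA)//; exact: low_generator.
by rewrite !cmulA !TTend.
Qed.

Let tt g : generator g -> madj fdom (t g) (t' g).
Proof.
move=> gg.
have w_lin i (c : R[i]) (x y : A) : w g i (c *: x + y) = c *: w g i x + w g i y.
  by rewrite /w; case: i => [s|]; [case: ifP => _ //|]; exact: cmul_linr.
have w'_lin i (c : R[i]) (x y : A) : w' g i (c *: x + y) = c *: w' g i x + w' g i y.
  by rewrite /w'; case: i => [s//|]; case: ifP => _; exact: cmul_linr.
have w_act i (x y : A) : w g i (x ** y) = w g i x ** y.
  by rewrite /w; case: i => [s|]; [case: ifP => _ //|]; rewrite cmulA.
have w'_act i (x y : A) : w' g i (x ** y) = w' g i x ** y.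
  by rewrite /w'; case: i => [s//|]; case: ifP => _; rewrite cmulA.
have w'0 i : w' g i 0 = 0.
  by rewrite /w'; case: i => [s//|]; case: ifP => _; rewrite cmul0r.
have ww' i j (x y : A) : ft g i = Some j -> fdom j x -> fdom i y ->
    (w g i x)^# ** y = x^# ** w' g j y.
  case: i => [s|] /=.
    case st: (tl g s) => [h|//]; have [gh ->] := (tlP _ _ _).1 st.
    case: asboolP => [hv|nh].
      case bg: (bel g) => // -[<-] _ _; rewrite vcomp// eqxx /w' bg.
      by rewrite cadjM (Tv_adj HA (end_vertex g)) cmulA.
    by move=> [<-] _ _; rewrite ifN//; apply/eqP; exact: nvcomp.
  by case bg: (bel g) => // -[<-] _ _; rewrite /w' bg cadjM cmulA.
apply: (madj_pisom D_lin) => [x dx|x dx|c x y _ _|c x y _ _|x b _|x b _|x y dx dy|x dx|x dx].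
- by apply: (wshift_dom D0 (@ft_fh g) w_lin) => // i j y; exact: ftD.
- by apply: (wshift_dom D0 (fun i j => iff_sym (@ft_fh g j i)) w'_lin) => // i j y; exact: fhD.
- exact: wshift_lin.
- exact: wshift_lin.
- exact: wshift_act.
- exact: wshift_act.
- apply: (wshift_adj D0 (@ft_fh g) w_lin _ w'0 ww') => // i j z; exact: ftD.
- exact: tt't.
- exact: t'tt'.
Qed.

Let t_t g h x : generator g -> generator h -> src g = rng h -> olt (deg g) (deg h) ->
  mdom x -> t g (t h x) = t (comp g h) x.
Proof.
move=> gg hg gh d dx.
have hb : below L a h -> below L a g by move=> ha; exact: olt_trans d ha.
have bE : bel (comp g h) = bel h.
  rewrite /bel; apply/asboolP/asboolP => [|ha]; first exact: comp_below_tail.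
  by apply: below_comp => //; exact: hb.
have nself : ~ extensions (comp g h) g.
  move=> /ext_deg E; apply: (olt_le_false d); apply: ole_trans E.
  by apply: ole_trans (deg_comp gh).2; exact: ole_addl.
apply/funext => -[s|].
  have [no|->|[k [gk nk ->]]] := ext_cases g s.
  - by rewrite !t_out// => gs; apply: no; apply: ext_trans gs; exact: ext_comp.
  - rewrite t_self t_none (t_out _ nself) /bel; case: asboolP => // ga.
    by rewrite asboolF ?cmul0r// => /hb.
  rewrite t_comp//; have [no|kh|[m [hm nm kE]]] := ext_cases h k.
  - by rewrite !t_out// => gs; apply: no; apply/(@ext_compl L g).
  - by rewrite kh !t_self bE end_comp.
  - by rewrite kE t_comp// compA// t_comp// src_comp.
rewrite !t_none bE /bel; case: (asboolP (below L a h)) => [ha|na]; last by rewrite cmul0r if_same.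
have ga := hb ha; rewrite asboolT// cmulA (family_comp HA).
- congr (T _ ** _); apply: lval_inj; rewrite lval_comp ?low_val//; first exact: below_comp.
  by apply/lval_composable; rewrite !low_val.
- exact: low_generator.
- exact: low_generator.
- by apply/lval_composable; rewrite !low_val.
by have := d; rewrite -{1}(low_val ga) -{1}(low_val ha).
Qed.

Let t'_t g h x : generator g -> generator h -> ~ cmp g h -> mdom x -> t' g (t h x) = 0.
Proof.
move=> gg hg gh dx; apply/funext => -[k|].
  have [[gk nk]|n] := pselect (src g = rng k /\ ~ is_vertex k); last by rewrite t'_out.
  rewrite t'_comp// t_out// => hk; apply: gh; apply: ext_cmp hk.
  exact: ext_comp.
rewrite t'_none /bel; case: asboolP => ga; last by rewrite t_out ?cmul0r// => hg'; apply: gh; right.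
rewrite t_none /bel; case: asboolP => ha; last exact: cmul0r.
rewrite cmulA (family_orth HA) ?cmul0l//; [exact: low_generator|exact: low_generator|].
apply/eqP/negPn/negP => /set0P/cmp_exts/lval_cmp.
by rewrite !low_val.
Qed.

Let tt'_some e s x : generator e -> mdom x ->
  t e (t' e x) (Some s) = if `[< extensions e s >] then x (Some s) else 0.
Proof.
move=> eg dx; have [no|->|[h [eh nh ->]]] := ext_cases e s.
- by rewrite t_out// asboolF.
- rewrite t_self asboolT; last exact: ext_refl.
  rewrite /bel; case: asboolP => ea.
    rewrite dom_lim// => -[ne le]; apply: ne; apply: (le (rng e) e) => //.
      by rewrite src_rng.
    by rewrite comp_rng.
  by rewrite t'_none /bel asboolF// dom_end// dom_end.
by rewrite t_comp// t'_comp// asboolT//; exact: ext_comp.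
Qed.

Lemma regideal_cut (c : A) (d : R) : regideal c -> 0 < d ->
  exists2 p, funits p & nm (c - c ** p) <= d.
Proof.
move=> /regideal_adj hc d0; have [l gl h] := aunit_approx hc d0.
exists (aunit A l); first by exists l.
by rewrite -nm_adj cadjB cadjM aunit_adj.
Qed.

Let tv_some v s x : is_vertex v -> mdom x ->
  t v x (Some s) = if rng s == v then x (Some s) else 0.
Proof.
move=> vv dx; have vb : bel v by rewrite /bel asboolT//; exact: vertex_below.
have [no|->|[h [vh nh ->]]] := ext_cases v s.
- rewrite t_out//; case: eqP => // sv; case: no; exists s; rewrite ?vertex_src//.
  by rewrite -sv comp_rng.
- rewrite t_self vb dom_lim ?if_same// => -[nv _]; exact: nv.
rewrite rng_comp// vv eqxx t_comp//; congr (x (Some _)).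
by rewrite -{1}(comp_rng h) -vh vertex_src.
Qed.

(** The defect of relation (iv) lies in the ideal. At [None] with [a <= b] the sum vanishes and the
    left side contains [T v] with [v] regular at level [a]. At a path [r] from [v] that begins with
    none of the edges, [deg r < omega ^ b], so [src r] is still regular at level [b], hence at [a],
    and the value at [r] is in the ideal. In all other cases the relation is exact. *)
Let t_sum b v (s : seq L) x : regular b v -> mdom x -> uniq s ->
  (forall f, f \in s <-> rng f = v /\ pow_edges L b f) ->
  msn funits (t v x - \sum_(e <- s) t e (t' e x)) = 0.
Proof.
move=> rv dx us sP; have [vv _ _] := rv; have va := vertex_below a vv.
have eg e : e \in s -> generator e by move=> /sP[_ eb]; right; exists b.
have sumE i : (\sum_(e <- s) t e (t' e x)) i = \sum_(e <- s) (t e (t' e x)) i.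
  by elim: (s) => [|e l IH]; rewrite ?big_nil// !big_cons -IH.
have gv : generator v by left.
have dsum : mdom (\sum_(e <- s) t e (t' e x)).
  rewrite big_seq; apply: (big_ind mdom) => [|y z dy dz|e es].
  - exact: mdom0.
  - by rewrite -(scale1r y); exact: mdom_lin.
  have [[h _ _ _ _] [h' _ _ _ _]] := tt (eg e es); exact/h/h'.
have dtv : mdom (t v x) by have [[h _ _ _ _] _] := tt gv; exact: h.
have dy : mdom (t v x - \sum_(e <- s) t e (t' e x)).
  by rewrite addrC -scaleN1r; exact: mdom_lin.
apply: (msn_null D_lin D_act P_ne P_proj P_dir dy) => i d d0.
have null0 : exists2 p, funits p & nm (0 - (0 : A) ** p) <= d.
  by have [p Pp] := P_ne; exists p => //; rewrite cmul0l subr0 nm0 ltW.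
have yE j : (t v x - \sum_(e <- s) t e (t' e x)) j =
  t v x j - \sum_(e <- s) t e (t' e x) j by rewrite -sumE.
rewrite yE; case: i => [r|]; last first.
  rewrite t_none /bel asboolT//.
  have [ab|ba] := ole_total a b.
    rewrite big_seq big1 ?subr0 => [|e /sP[_ eb]]; last first.
      rewrite t_none /bel asboolF// => ea.
      exact: olt_le_false ea (ole_trans (opow_mono ab) eb.2).
    apply: regideal_cut => //; apply: regideal_mulr; apply: regideal_areg => //.
    by rewrite /areg low_val//; exact: regular_le ab rv.
  have sa e : e \in s -> below L a e by move=> /sP[_ eb]; exact: pow_below eb.
  suff -> : T (low v) ** x None = \sum_(e <- s) t e (t' e x) None by rewrite subrr.
  have rl : regular b (low v) by apply/lval_regular => //; rewrite low_val.
  rewrite (family_sum HA rl) fsbig_finite//; last by case: rl.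
  have lE : [set f | rng f = low v /\ pow_edges M b f] = [set low e | e in [set e | e \in s]].
    apply/seteqP; split=> [f [fv fb]|_ [e es <-]].
      have fs : lval f \in s by apply/sP; rewrite -lval_rng fv low_val.
      by exists (lval f) => //; apply: lval_inj; rewrite low_val//; exact: lval_below.
    have [ev eb] := (sP e).1 es; split; first by apply: lval_inj; rewrite lval_rng !low_val//; exact: sa.
    by rewrite -(low_val (sa e es)) in eb; exact: eb.
  have pE : perm_eq (fset_set [set f | rng f = low v /\ pow_edges M b f]) (map low s).
    apply: uniq_perm; first exact: fset_uniq.
      rewrite map_inj_in_uniq// => e f es fs /(congr1 (@lval L a)).
      by rewrite (low_val (sa _ es)) (low_val (sa _ fs)).
    move=> f; rewrite in_fset_set; last by case: rl.
    rewrite lE; apply/idP/mapP => [/set_mem[e es <-]|[e es ->]]; first by exists e.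
    by apply: mem_set; exists e.
  rewrite (perm_big _ pE)/= big_map cmul_suml big_seq [RHS]big_seq.
  apply: eq_bigr => e es; rewrite t_none t'_none /bel asboolT; last exact: sa.
  by rewrite cmulA.
rewrite tv_some// (eq_big_seq (fun e => if `[< extensions e r >] then x (Some r) else 0)); last first.
  by move=> e es; rewrite tt'_some//; exact: eg.
have [rE|rv'] := eqVneq (rng r) v; last first.
  rewrite big_seq big1 ?subr0// => e /sP[ev _]; rewrite asboolF// => /ext_rng rr.
  by case/eqP: rv'; rewrite rr.
have [[e es er]|sum0] := pselect (exists2 e, e \in s & extensions e r).
  rewrite (bigD1_seq e)//= asboolT// big_seq_cond big1 ?addr0 ?subrr// => f /andP[fs fe].
  rewrite asboolF// => fr; case/eqP: fe; apply: cmp_eq; first exact: ext_cmp fr er.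
  by have [_ fb] := (sP f).1 fs; have [_ eb] := (sP e).1 es; exact: oeq_trans fb (oeq_sym eb).
rewrite big_seq big1 ?subr0 => [|e es]; last first.
  by rewrite asboolF// => er; apply: sum0; exists e.
have [->//|xr] := eqVneq (x (Some r)) 0.
have lr : lim_edge r by have [h _] := dx.2 (Some r); apply: h; exact/eqP.
have rb : below L b r.
  have [h|//] := ole_total (opow b) (deg r); have [f fr fb] := prefix_exists h.
  case: sum0; exists f => //; apply/sP; split => //.
  by rewrite -rE (ext_rng fr).
have ab : ole a b.
  have [//|ba] := ole_total a b; case: lr => nr lr; case: nr.
  apply: (lr (rng r) r); rewrite ?src_rng ?comp_rng//.
  exact: below_lt (oltW ba) rb.
rewrite -(dom_end r dx); apply: regideal_cut => //; apply: regideal_mulr.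
apply: regideal_areg => //; apply: (regular_le ab).
by rewrite /lval /=; apply: regular_src => //; rewrite rE.
Qed.

Definition fock_alg := op_algebra_of S.

Lemma fock_family : graph_family (fun g => ocls fock_alg (t g)).
Proof.
apply: (@ops_family R S L t t') => [g|g x gg|g x gg|g h x gg hg gh d|g h x gg hg|b v s x].
- exact: tt.
- exact: tt't.
- exact: t't.
- exact: t_t.
- exact: t'_t.
- exact: t_sum.
Qed.

Let col (c : A) : S := fun i => if i is None then c else 0.

Let col_dom c : mdom (col c).
Proof.
split=> [|[s|]]; [|exact: (D0 (Some s))|by []].
apply: (@sub_finite_set _ _ [set None]); last exact: finite_set1.
by case=> [s|].
Qed.

Let col_nm c : msn funits (col c) <= nm c.
Proof.
have [p Pp] := P_ne; apply: le_trans (msn_le _ Pp) _.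
apply: le_trans (mnrm_cut D_lin D_act P_proj (col_dom c) Pp) _.
rewrite -(@ler_pXn2r _ 2) ?nnegrE ?mnrm_ge0 ?nm_ge0// mnrm_sq -nm_star.
rewrite -(suppq_cover (s := [:: None]) _ (col_dom c).1)//; last by case.
by rewrite /cdot big_seq1.
Qed.

(** [b] is the class of an operator that acts on the [None] column exactly as left multiplication by
    [c]. Such operators are produced for polynomials; a general element is reached through norm
    estimates. *)
Let exact_op (c : A) (b : fock_alg) := exists k, [/\ is_op k, ocls fock_alg k = b &
  forall z, k (col z) = col (c ** z)].

Let exact_lin (c : R[i]) x y b d : exact_op x b -> exact_op y d -> exact_op (c *: x + y) (c *: b + d).
Proof.
move=> [k [ko kb kE]] [l [lo lb lE]]; exists (fun z => c *: k z + l z); split.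
- by have [k' kk'] := ko; have [l' ll'] := lo; exists (fun z => conjc c *: k' z + l' z); exact: oadj_comb.
- by rewrite ocls_lin// kb lb.
move=> z; rewrite kE lE; apply/funext => -[s|]; rewrite [LHS]/(c *: _ + _)/=.
  by rewrite scaler0; exact: addr0.
by rewrite cmul_linl.
Qed.

Let exact_mul x y b d : exact_op x b -> exact_op y d -> exact_op (x ** y) (b ** d).
Proof.
move=> [k [ko kb kE]] [l [lo lb lE]]; exists (k \o l); split.
- by have [k' kk'] := ko; have [l' ll'] := lo; exists (l' \o k'); exact: oadj_comp.
- by rewrite oclsM// kb lb.
by move=> z /=; rewrite lE kE cmulA.
Qed.

Let exact_gen (g : M) : generator g -> exact_op (T g) (ocls fock_alg (t (lval g))) /\
  exact_op (T g)^# (ocls fock_alg (t (lval g)))^#.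
Proof.
move=> gg; have ga := lval_below g; have lg : low (lval g) = g.
  by apply: lval_inj; rewrite low_val.
have gg' := lval_generator gg; have adj : @oadj R S (t (lval g)) (t' (lval g)) by exact: tt.
have lc z : lim_edge (lval g) -> z = 0 :> A.
  move=> [nv lv]; case: nv; apply: (lv (rng (lval g)) (lval g)) => //.
    by rewrite src_rng.
  by rewrite comp_rng.
split.
  exists (t (lval g)); split => [|//|z]; first by exists (t' (lval g)).
  apply/funext => -[s|]; last by rewrite t_none /bel asboolT// lg.
  have [no|->|[h [gh nh ->]]] := ext_cases (lval g) s; first by rewrite t_out.
    by rewrite t_self /bel asboolT.
  by rewrite t_comp.
exists (t' (lval g)); split => [||z]; first by exists (t (lval g)); exact: oadj_sym.
  by rewrite (ocls_adj _ adj).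
apply/funext => -[s|]; last by rewrite t'_none /bel asboolT// lg.
have [[gh nh]|n] := pselect (src (lval g) = rng s /\ ~ is_vertex s); last by rewrite t'_out.
by rewrite t'_comp.
Qed.

Variables (OL : graph_alg R L) (rho : A -> OL).
Hypothesis rhoH : lower_hom rho.

(** Approximate [c] by a polynomial [y]. The map to the Fock algebra kills [c], so the operator of
    [y] has small norm; applied to the column [c^#] it shows that [y ** c^#], and with it
    [c ** c^#], is close to the ideal. The approximate unit passes from [c ** c^#] to [c]. *)
Lemma rho_ker_regideal c : rho c = 0 -> regideal c.
Proof.
move=> c0; have [h [[hH hg] _]] := gen_universal OL fock_family.
have [rH rg] := rhoH.
pose k x := h (rho x); have kH : star_hom k.
  split=> [d x y|x y|x]; rewrite /k.
  - by rewrite (star_hom_lin rH) (star_hom_lin hH).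
  - by rewrite (star_homM rH) (star_homM hH).
  by rewrite (star_hom_adj rH) (star_hom_adj hH).
have kg (g : M) : generator g -> k (T g) = ocls fock_alg (t (lval g)).
  by move=> gg; rewrite /k rg// hg//; exact: lval_generator.
have eTp (e : M) : exact_op (Tp T e) (k (Tp T e)) /\ exact_op (Tp T e)^# (k (Tp T e)^#).
  elim/mor_ind: e => [v vv|b g f gb gf fb [IH1 IH2]].
    have gv : generator v by left.
    by rewrite (Tp_v _ vv) (star_hom_adj kH) kg//; exact: exact_gen.
  have gg : generator g by right; exists b.
  have [e1 e2] := exact_gen gg.
  rewrite (Tp_cons _ gb gf fb) cadjM !(star_homM kH) (star_hom_adj kH (T g)) kg//.
  by split; exact: exact_mul.
have ex x : poly_in (O := A) (@paired M) x -> exact_op x (k x).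
  move: x; apply: poly_in_ind => [|d x y|e f ef].
  - rewrite (hom0 kH); exists (fun=> 0); split.
    + by exists (fun=> 0); exact: oadj0.
    + exact: ocls0.
    by move=> z; apply/funext => -[s|//]; rewrite cmul0l.
  - by rewrite (star_hom_lin kH); exact: exact_lin.
  by rewrite (star_homM kH); apply: exact_mul; [case: (eTp e)|case: (eTp f)].
suff cc : regideal (c ** c^#).
  apply: regideal_closed => d d0.
  have [l gl hl] := aunit_approx cc (exprn_gt0 2 d0).
  exists (aunit A l ** c); first by apply: regideal_mulr; exact: aunit_regideal.
  rewrite -(@ler_pXn2r _ 2) ?nnegrE ?nm_ge0 ?(ltW d0)//.
  rewrite -[nm _]nm_adj -nm_star cadjK; apply: le_trans hl.
  have [us uu] : (aunit A l)^# = aunit A l /\ aunit A l ** aunit A l = aunit A l.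
    by rewrite aunit_adj aunit_idem//; case: gl.
  set y := c ** c^#; have -> : (c - aunit A l ** c) ** (c - aunit A l ** c)^# =
      (y - aunit A l ** y) - (y - aunit A l ** y) ** aunit A l.
    by rewrite cadjB cadjM us !cmulBr !cmulBl /y !cmulA; zmod.
  exact: (proj_contr _ us uu).1.
apply: regideal_closed => d d0.
have C0 : 0 < 4 * (nm c + 1) by have := nm_ge0 c; lra.
pose e := d / (4 * (nm c + 1)); have e0 : 0 < e by exact: divr_gt0.
have [y py hy] := graph_alg_span c e0.
have [q [qo qb qE]] := ex y py.
have ny : nm (ocls fock_alg q) <= e.
  rewrite qb; have -> : k y = - k (c - y).
    by rewrite (homB kH) /k c0 (hom0 hH) sub0r opprK.
  by rewrite nmN; apply: le_trans (hom_contr kH _) hy.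
have := ocls_bd qo ny (col_dom c^#); rewrite qE => h1.
have h2 : msn funits (col (y ** c^#)) <= e * nm c.
  apply: (le_trans h1); rewrite ler_wpM2l ?(ltW e0)// -(nm_adj c).
  exact: col_nm.
have [p Pp hp] := msn_comp D_lin D_act P_ne None (col_dom _) h2 e0.
have [l gl pE] := Pp; have [ps pp] := P_proj Pp.
exists (c ** c^# ** p); first by apply: regideal_mull; rewrite pE; exact: aunit_regideal.
have -> : c ** c^# - c ** c^# ** p = (y ** c^# - y ** c^# ** p) +
    ((c - y) ** c^# - (c - y) ** c^# ** p) by rewrite !cmulBl; zmod.
apply: le_trans (nmD _ _) _.
have h3 : nm ((c - y) ** c^# - (c - y) ** c^# ** p) <= e * nm c.
  apply: le_trans (proj_contr _ ps pp).1 _; apply: le_trans (nmM _ _) _.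
  by rewrite nm_adj ler_wpM2r// nm_ge0.
have dE : e * (4 * (nm c + 1)) = d by rewrite divfK// lt0r_neq0.
have := nm_ge0 c; move: hp h3 dE => /=.
move: (nm (_ - _)) (nm (_ - _)) (nm c) (e) e0 => u1 u2 n e' e0'; nra.
Qed.

(** For [y = T_e^# c] with [src e] good, [corner] puts [y ** y^#] close to a multiple [z *: T w0].
    Applying [rho], which kills [y] while the image of [T w0] has norm 1 because vertex elements of
    [O(L)] do not vanish, bounds [z]; so [y = 0]. *)
Lemma rho_inj : injective rho.
Proof.
have [rH rg] := rhoH.
suff ker c : rho c = 0 -> c = 0.
  by move=> x y xy; apply/eqP; rewrite -subr_eq0; apply/eqP/ker; rewrite (homB rH) xy subrr.
move=> c0; apply: (regideal_eq0 (rho_ker_regideal c0)) => e ge.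
set w0 := src e in ge *; have wv : is_vertex w0 by exact: src_vertex.
have gw : generator w0 by left.
set y := (Tp T e)^# ** c.
have yw : T w0 ** y = y.
  by rewrite /y cmulA -{1}(Tv_adj HA wv) -cadjM (Tp_src HA).
have ry : rho y = 0 by rewrite /y (star_homM rH) c0 cmul0r.
have rw : nm (rho (T w0)) = 1.
  rewrite rg//; apply: (T_nm (gen_family OL)); first exact/lval_vertex.
  by apply: gen_vertex_neq0; exact/lval_vertex.
have w1 : nm (T w0) <= 1 by rewrite -(Tp_v T wv); exact: Tp_nm1.
suff yy : y ** y^# = 0.
  have y0 : y^# = 0 by apply: star_eq0; rewrite cadjK.
  by rewrite -[y]cadjK y0 cadj0.
apply: nm_le_eps => d d0; have d20 : 0 < d / 2 by lra.
have [z hz] := corner HC (y ** y^#) ge d20.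
have yE : T w0 ** (y ** y^#) ** T w0 = y ** y^#.
  by rewrite cmulA yw -cmulA -{1}(Tv_adj HA wv) -cadjM yw.
rewrite yE in hz.
have cz : cn z <= d / 2.
  have := hom_contr rH (y ** y^# - z *: T w0); rewrite (homB rH) (star_homM rH) ry cmul0l.
  by rewrite sub0r (homZ rH) nmN nmZ rw mulr1 => h; exact: le_trans h hz.
apply: le_trans (nm_le_dist _ (z *: T w0)) _; rewrite nmZ.
have := cn_ge0 z; have := nm_ge0 (T w0).
move: (nm (T w0)) (cn z) (nm _) w1 cz hz => p q r *; nra.
Qed.

End Fock.

Local Notation iota := Defs.iota.
Local Notation delta := Defs.delta.

(** * Hilbert modules and correspondences *)

Section HilbertModules.
Variables (R : realType) (A : cstar_alg R) (X : hilbert_module A).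
Implicit Types (x y z : X) (a b : A) (c : R[i]).

Lemma innerDr x y z : inner z (x + y) = inner z x + inner z y.
Proof. by have := inner_lin 1 x y z; rewrite !scale1r. Qed.
Lemma inner0r z : inner z 0 = 0.
Proof. by apply: (addrI (inner z 0)); rewrite -innerDr !addr0. Qed.
Lemma innerZr c x z : inner z (c *: x) = c *: inner z x.
Proof. by have := inner_lin c x 0 z; rewrite !addr0 inner0r addr0. Qed.
Lemma innerNr x z : inner z (- x) = - inner z x.
Proof. by rewrite -scaleN1r innerZr scaleN1r. Qed.
Lemma inner_linl c x y z : inner (c *: x + y) z = conjc c *: inner x z + inner y z.
Proof. by rewrite -[LHS]inner_adj inner_lin cadj_lin !inner_adj. Qed.
Lemma innerDl x y z : inner (x + y) z = inner x z + inner y z.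
Proof. by rewrite -[LHS]inner_adj innerDr cadjD !inner_adj. Qed.
Lemma inner0l z : inner 0 z = 0.
Proof. by rewrite -[LHS]inner_adj inner0r cadj0. Qed.
Lemma innerZl c x z : inner (c *: x) z = conjc c *: inner x z.
Proof. by rewrite -[LHS]inner_adj innerZr cadjZ inner_adj. Qed.
Lemma innerNl x z : inner (- x) z = - inner x z.
Proof. by rewrite -[LHS]inner_adj innerNr cadjN inner_adj. Qed.
Lemma inner_actl x a y : inner (act x a) y = a^# ** inner x y.
Proof. by rewrite -[LHS]inner_adj inner_act cadjM inner_adj. Qed.
Lemma inner_sumr I (s : seq I) (P : pred I) (F : I -> X) z :
  inner z (\sum_(i <- s | P i) F i) = \sum_(i <- s | P i) inner z (F i).
Proof.
by apply: (big_morph (inner z)) => [x y|]; [exact: innerDr|exact: inner0r].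
Qed.
Lemma inner_suml I (s : seq I) (P : pred I) (F : I -> X) z :
  inner (\sum_(i <- s | P i) F i) z = \sum_(i <- s | P i) inner (F i) z.
Proof.
apply: (big_morph (fun x => inner x z)) => [x y|]; [exact: innerDl|exact: inner0l].
Qed.

Lemma nm_inner x : nm (inner x x) = nm x ^+ 2.
Proof.
have := inner_norm x; rewrite (norm_nm x) (norm_nm (inner x x)) -rmorphXn.
by move=> /(congr1 (@complex.Re R))/= ->.
Qed.

Lemma inner_eq0 x : inner x x = 0 -> x = 0.
Proof.
move=> x0; apply: nm_eq0; have := nm_inner x; rewrite x0 nm0 => /esym/eqP.
by rewrite expf_eq0 /= => /eqP.
Qed.

Lemma actDl x y a : act (x + y) a = act x a + act y a.
Proof. by have := act_linl 1 x y a; rewrite !scale1r. Qed.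
Lemma actDr x a b : act x (a + b) = act x a + act x b.
Proof. by have := act_linr 1 x a b; rewrite !scale1r. Qed.
Lemma act0l a : act 0 a = 0 :> X.
Proof. by apply: (addrI (act 0 a)); rewrite -actDl !addr0. Qed.
Lemma act0r x : act x 0 = 0.
Proof. by apply: (addrI (act x 0)); rewrite -actDr !addr0. Qed.
Lemma actZl c x a : act (c *: x) a = c *: act x a.
Proof. by have := act_linl c x 0 a; rewrite !addr0 act0l addr0. Qed.
Lemma actZr c x a : act x (c *: a) = c *: act x a.
Proof. by have := act_linr c x a 0; rewrite !addr0 act0r addr0. Qed.

Lemma nm_act x a : nm (act x a) <= nm x * nm a.
Proof.
have x0 := nm_ge0 x; have a0 := nm_ge0 a.
rewrite -(@ler_pXn2r _ 2) ?nnegrE ?mulr_ge0 ?nm_ge0//.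
rewrite -nm_inner inner_act inner_actl.
have h1 := nmM (a^# ** inner x x) a; have h2 := nmM a^# (inner x x).
rewrite nm_adj nm_inner in h2; apply: (le_trans h1).
rewrite exprMn (expr2 (nm a)) mulrA ler_wpM2r// mulrC; exact: h2.
Qed.

(** For vectors of norm at most 1 each of the four square terms is bounded by 4, whence the constant
    in [inner_CS]. *)
Let pol x y : 4 *: inner x y = inner (y + x) (y + x) - inner (y - x) (y - x)
  + 'i *: (inner ('i *: x + y) ('i *: x + y)) - 'i *: inner (y - 'i *: x) (y - 'i *: x).
Proof.
rewrite !(innerDl, innerDr, innerNl, innerNr, innerZl, innerZr) cji.
rewrite !(scalerDr, scalerN, scaleNr, opprD, opprK, scalerA).
have ii : 'i * 'i = -1 :> R[i] by rewrite -expr2 sqr_i.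
rewrite ?(mulrN, mulNr, ii, opprK, mulr1) ?scale1r ?scaleN1r ?opprK.
rewrite (_ : 4 = 1 + 1 + 1 + 1 :> R[i]); last by ring.
rewrite !scalerDl !scale1r.
move: (inner y x) (inner x y) (inner x x) (inner y y) => p q r s.
move: ('i *: r) ('i *: s) => r' s'; zmod.
Qed.

(* The constant is not optimal: the estimate comes from polarization. *)
Lemma inner_CS x y : nm (inner x y) <= 4 * (nm x * nm y).
Proof.
have step (u v : X) : nm u <= 1 -> nm v <= 1 -> nm (inner u v) <= 4.
  move=> u1 v1.
  have q (w : X) : nm w <= 2 -> nm (inner w w) <= 4.
    by move=> w2; rewrite nm_inner; have := nm_ge0 w; nra.
  have h1 : nm (inner (v + u) (v + u)) <= 4 by apply: q; have := nmD v u; lra.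
  have h2 : nm (inner (v - u) (v - u)) <= 4.
    by apply: q; have := nmD v (- u); rewrite nmN; lra.
  have h3 : nm (inner ('i *: u + v) ('i *: u + v)) <= 4.
    by apply: q; have := nmD ('i *: u) v; rewrite nmZ cni mul1r; lra.
  have h4 : nm (inner (v - 'i *: u) (v - 'i *: u)) <= 4.
    by apply: q; have := nmD v (- ('i *: u)); rewrite nmN nmZ cni mul1r; lra.
  have := congr1 (@nm _ _) (pol u v); rewrite nmZ cnn => E.
  have : 4 * nm (inner u v) <= 4 + 4 + 4 + 4; last by lra.
  rewrite E; apply: le_trans (nmD _ _) _; rewrite nmN nmZ cni mul1r lerD//.
  apply: le_trans (nmD _ _) _; rewrite nmZ cni mul1r lerD//.
  by apply: le_trans (nmD _ _) _; rewrite nmN lerD.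
have [x0|x0] := eqVneq (nm x) 0; first by rewrite (nm_eq0 x0) inner0l !nm0 mul0r mulr0.
have [y0|y0] := eqVneq (nm y) 0; first by rewrite (nm_eq0 y0) inner0r !nm0 !mulr0.
have xp : 0 < nm x by rewrite lt_def x0 nm_ge0.
have yp : 0 < nm y by rewrite lt_def y0 nm_ge0.
have n1 (z : X) : 0 < nm z -> nm ((nm z)^-1%:C *: z) = 1.
  by move=> zp; rewrite nmZr ?invr_ge0 ?(ltW zp)// mulVf// lt0r_neq0.
have := step ((nm x)^-1%:C *: x) ((nm y)^-1%:C *: y).
rewrite (n1 x xp) (n1 y yp) => /(_ (lexx _) (lexx _)).
rewrite innerZl innerZr conjc_real nmZr; last by rewrite invr_ge0 ltW.
rewrite nmZr; last by rewrite invr_ge0 ltW.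
by rewrite ler_pdivrMl// ler_pdivrMl// => h; apply: (le_trans h); rewrite le_eqVlt; apply/orP; left; apply/eqP; ring.
Qed.

Lemma compactsP (t : X -> X) : compacts t <-> forall e : R, 0 < e -> exists s : seq (X * X),
  forall z, nm (t z - \sum_(p <- s) theta p.1 p.2 z) <= e * nm z.
Proof.
split=> h e e0.
  have [|s hs] := h e%:C; first by rewrite ltcR.
  exists s => z; have := hs z; rewrite !norm_nm -rmorphM lecR.
  by [].
have [r r0 ->] := gt0_complex e0; have [s hs] := h r r0.
by exists s => z; rewrite !norm_nm -rmorphM lecR; exact: hs.
Qed.

End HilbertModules.

Section CorrespondenceFacts.
Variables (R : realType) (A : cstar_alg R) (X : correspondence A).
Implicit Types (x y z : X) (a b : A) (c : R[i]).

Lemma lact_adjr a x y : inner x (lact a y) = inner (lact a^# x) y.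
Proof. by rewrite lact_adj cadjK. Qed.

(** Linearity follows from the existence of an adjoint: the defect is orthogonal to everything, in
    particular to itself. *)
Lemma lact_linr a c x y : lact a (c *: x + y) = c *: lact a x + lact a y.
Proof.
apply/eqP; rewrite -subr_eq0; apply/eqP/inner_eq0; set w := _ - _.
rewrite {2}/w innerDr innerNr lact_adjr !inner_lin !lact_adjr subrr.
by [].
Qed.
Lemma lactD a x y : lact a (x + y) = lact a x + lact a y.
Proof. by have := lact_linr a 1 x y; rewrite !scale1r. Qed.
Lemma lact0 a : lact a (0 : X) = 0.
Proof. by apply: (addrI (lact a 0)); rewrite -lactD !addr0. Qed.
Lemma lactZ a c x : lact a (c *: x) = c *: lact a x.
Proof. by have := lact_linr a c x 0; rewrite !addr0 lact0 addr0. Qed.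
Lemma lactN a x : lact a (- x) = - lact a x.
Proof. by rewrite -scaleN1r lactZ scaleN1r. Qed.
Lemma lactB a x y : lact a (x - y) = lact a x - lact a y.
Proof. by rewrite lactD lactN. Qed.
Lemma lact_sum a I (s : seq I) (P : pred I) (F : I -> X) :
  lact a (\sum_(i <- s | P i) F i) = \sum_(i <- s | P i) lact a (F i).
Proof. by apply: (big_morph (lact a)) => [x y|]; [exact: lactD|exact: lact0]. Qed.
Lemma lactDl a b x : lact (a + b) x = lact a x + lact b x.
Proof. by have := lact_lin 1 a b x; rewrite !scale1r. Qed.
Lemma lact0l x : lact 0 x = 0.
Proof. by apply: (addrI (lact 0 x)); rewrite -lactDl !addr0. Qed.
Lemma lactZl c a x : lact (c *: a) x = c *: lact a x.
Proof. by have := lact_lin c a 0 x; rewrite !addr0 lact0l addr0. Qed.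
Lemma lactNl a x : lact (- a) x = - lact a x.
Proof. by rewrite -scaleN1r lactZl scaleN1r. Qed.
Lemma lactBl a b x : lact (a - b) x = lact a x - lact b x.
Proof. by rewrite lactDl lactNl. Qed.
Lemma lact_suml I (s : seq I) (P : pred I) (F : I -> A) x :
  lact (\sum_(i <- s | P i) F i) x = \sum_(i <- s | P i) lact (F i) x.
Proof.
apply: (big_morph (fun a => lact a x)) => [a b|]; [exact: lactDl|exact: lact0l].
Qed.

Lemma lact_act a x b : lact a (act x b) = act (lact a x) b.
Proof.
apply/eqP; rewrite -subr_eq0; apply/eqP/inner_eq0; set w := _ - _.
by rewrite {2}/w innerDr innerNr lact_adjr !inner_act lact_adjr subrr.
Qed.

(** The argument of [hom_sa_contr], with the inner product of [X] as the pairing. *)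
Lemma lact_sa_contr h x : h^# = h -> nm h <= 1 -> nm (lact h x) <= nm x.
Proof.
move=> hsa h1; have h2 : nm (h ** h) <= 1.
  by rewrite -{1}hsa nm_star exprn_ile1// nm_ge0.
have [k [kE _ ksa kc]] := sqrt_exists h2.
have {}ksa : k^# = k by apply: ksa; rewrite cadjM hsa.
have hk : h ** k = k ** h by apply: kc; rewrite cmulA.
apply: (@sa_contraction R X A (@inner _ _ X) (@lact _ _ X h) (@lact _ _ X k)) => [c y z w|c y z w|y|y z|y z|y z|y|y].
- exact: inner_lin.
- exact: inner_linl.
- exact: nm_inner.
- by rewrite lact_adj hsa.
- by rewrite lact_adj ksa.
- exact: lactB.
- by rewrite -!lactM hk.
by rewrite -!lactM -lactDl addrC kE lactZl.
Qed.

(** The factor 2 is the square root of the constant 4 in [inner_CS]. *)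
Lemma lact_bound a x : nm (lact a x) <= 2 * (nm a * nm x).
Proof.
have sa h : h^# = h -> nm (lact h x) <= nm h * nm x.
  move=> hsa; have [h0|h0] := eqVneq (nm h) 0.
    by rewrite (nm_eq0 h0) lact0l !nm0 mul0r.
  have hp : 0 < nm h by rewrite lt_def h0 nm_ge0.
  have := @lact_sa_contr ((nm h)^-1%:C *: h) x; rewrite cadjZ conjc_real hsa => /(_ erefl).
  rewrite nmZr ?invr_ge0 ?(ltW hp)// mulVf// => /(_ (lexx _)).
  by rewrite lactZl nmZr ?invr_ge0 ?(ltW hp)// ler_pdivrMl.
have a0 := nm_ge0 a; have x0 := nm_ge0 x.
rewrite -(@ler_pXn2r _ 2) ?nnegrE ?nm_ge0 ?mulr_ge0// -nm_inner lact_adj -lactM.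
apply: le_trans (inner_CS _ _) _.
have := sa (a^# ** a); rewrite cadjM cadjK nm_star => /(_ erefl).
move: (nm (lact _ x)) => u hu; rewrite expr2; move: (nm a) (nm x) a0 x0 hu => p q p0 q0 hu.
have : q * u <= q * (p ^+ 2 * q) by rewrite ler_wpM2l.
rewrite expr2; nra.
Qed.

End CorrespondenceFacts.

Section SelfCorrespondence.
Variables (R : realType) (A : cstar_alg R).

Let linl (c : R[i]) (x y a : A) : (c *: x + y) ** a = c *: (x ** a) + y ** a.
Proof. exact: cmul_linl. Qed.
Let linr (c : R[i]) (x a b : A) : x ** (c *: a + b) = c *: (x ** a) + x ** b.
Proof. exact: cmul_linr. Qed.
Let iact (x y a : A) : x^# ** (y ** a) = x^# ** y ** a.
Proof. exact: cmulA. Qed.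
Let iadj (x y : A) : (x^# ** y)^# = y^# ** x.
Proof. by rewrite cadjM cadjK. Qed.
Let ige0 (x : A) : exists a, x^# ** x = a^# ** a.
Proof. by exists x. Qed.
Let inorm (x : A) : `|x| ^+ 2 = `|x^# ** x|.
Proof. by rewrite cnorm_star. Qed.
Let amul (x a b : A) : x ** (a ** b) = x ** a ** b.
Proof. exact: cmulA. Qed.

Definition self_module : hilbert_module A :=
  @HilbertModule R A A (@cmul R A) (fun x y => x^# ** y) linl linr amul
    (fun c x y z => linr c z^# x y) iact iadj ige0 inorm.

Let lmul (a b x : A) : a ** b ** x = a ** (b ** x).
Proof. by rewrite cmulA. Qed.
Let ladj (a x y : A) : (a ** x)^# ** y = x^# ** (a^# ** y).
Proof. by rewrite cadjM cmulA. Qed.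

(** It allows [averaging] to run on vectors of the algebra itself, when a path from the base vertex
    is continued by no long edge ([from_dead]). *)
Definition self_corr : correspondence A :=
  @Correspondence R A self_module (@cmul R A) (fun c a b x => linl c a b x) lmul ladj.

End SelfCorrespondence.

(** * The vectors of the edges *)

Section EdgeVectors.
Variables (R : realType) (L : ograph) (a : ord) (A : graph_alg R (lower L a)).
Variable X : edge_corr A.
Notation M := (lower L a).
Notation T := (gen A).
Notation Tq := (Tp (gen A)).
Implicit Types (g h : M) (y : L).

Let HA := gen_family A.

Lemma path_value_Tp g : path_value (O := A) g (Tq g).
Proof.
elim/mor_ind: g => [v vv|b g f gb gf fb IH].
  by rewrite (Tp_v _ vv); apply: path_value1; left.
rewrite (Tp_cons _ gb)//; apply: path_value_cons => //.
by right; exists b.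
Qed.

(** Indexed by all of [L], with value 0 off the edges of degree [omega ^ a], so that indices can be
    composed without carrying membership proofs. *)
Definition dvec y : X :=
  if pselect (pow_edges L a y) is left ya then iota X (delta A (exist _ y (mem_set ya))) else 0.

Lemma dvec_edge (e : edge L a) : dvec (val e) = iota X (delta A e).
Proof.
have ya : pow_edges L a (val e) by have := valP e; rewrite inE.
rewrite /dvec; case: pselect => [ya'|//]; congr (iota X (delta A _)).
exact: val_inj.
Qed.

Lemma delta_cc (e : edge L a) : cc_edges (A := A) (delta A e).
Proof.
split=> [|f].
  apply: (@sub_finite_set _ _ [set e]); last exact: finite_set1.
  by move=> f; rewrite /delta /=; case: eqP.
rewrite /delta; case: eqP => [->|_]; last exact: cmul0r.
by apply: (TvTv HA); apply/lval_vertex; rewrite /lval /=; exact: src_vertex.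
Qed.

Lemma edge_end (e : edge L a) : edge_src e = end_of a (val e).
Proof. exact: val_inj. Qed.

Lemma inner_dvec y f : pow_edges L a y -> pow_edges L a f ->
  inner (dvec y) (dvec f) = if y == f then T (end_of a y) else 0.
Proof.
move=> ya fa; pose ey : edge L a := exist _ y (mem_set ya).
pose ef : edge L a := exist _ f (mem_set fa).
have -> : dvec y = iota X (delta A ey) by rewrite -dvec_edge.
have -> : dvec f = iota X (delta A ef) by rewrite -dvec_edge.
rewrite iota_inner; [|exact: delta_cc|exact: delta_cc].
rewrite -(@fsbig_widen _ _ _ _ [set ey] setT)//=; last first.
  by move=> g [_] /= /eqP/negPf gy; rewrite /delta gy cadj0 cmul0l.
rewrite fsbig_set1.
rewrite /delta eqxx -(inj_eq val_inj)/=; case: eqP => [yf|_]; last exact: cmul0r.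
by rewrite !edge_end /= -yf; apply: (Tvv HA); exact: end_vertex.
Qed.

Lemma dvec_out y : ~ pow_edges L a y -> dvec y = 0.
Proof. by rewrite /dvec; case: pselect. Qed.

Lemma nm_dvec y : pow_edges L a y -> nm (dvec y) = 1.
Proof.
move=> ya; have := nm_inner (dvec y); rewrite inner_dvec// eqxx (T_nm HA).
- by move=> /esym h; have := nm_ge0 (dvec y); nra.
- exact: end_vertex.
by apply: gen_vertex_neq0; exact: end_vertex.
Qed.

Lemma act_dvec y : act (dvec y) (T (end_of a y)) = dvec y.
Proof.
have [ya|ny] := pselect (pow_edges L a y); last by rewrite dvec_out// act0l.
pose ey : edge L a := exist _ y (mem_set ya).
have -> : dvec y = iota X (delta A ey) by rewrite -dvec_edge.
rewrite -iota_act; last exact: delta_cc.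
congr iota; apply/funext => f; rewrite /delta; case: eqP => _; last exact: cmul0l.
by rewrite edge_end; exact/(TvTv HA)/end_vertex.
Qed.

Lemma lact_dvec g y : src (lval g) = rng y -> pow_edges L a y ->
  lact (Tq g) (dvec y) = dvec (comp (lval g) y).
Proof.
move=> gy ya; pose ey : edge L a := exist _ y (mem_set ya).
have -> : dvec y = iota X (delta A ey) by rewrite -dvec_edge.
rewrite (edge_lact X (e := ey) gy (path_value_Tp g)).
by rewrite -dvec_edge.
Qed.

Lemma lact_dvec0 g y : src (lval g) <> rng y -> lact (Tq g) (dvec y) = 0.
Proof.
move=> gy; have [ya|ny] := pselect (pow_edges L a y); last by rewrite dvec_out// lact0.
pose ey : edge L a := exist _ y (mem_set ya).
have -> : dvec y = iota X (delta A ey) by rewrite -dvec_edge.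
exact: (edge_lact0 X (e := ey) gy (path_value_Tp g)).
Qed.

Lemma cc_decomp x : cc_edges (A := A) x -> exists s : seq (L * A),
  iota X x = \sum_(p <- s) act (dvec p.1) p.2.
Proof.
move=> [fx Tx]; pose s : seq (edge L a) := fset_set [set f | x f <> 0].
have cc_sum (l : seq (edge L a)) : cc_edges (A := A) (fun f => \sum_(e <- l) delta A e f ** x e) /\
    iota X (fun f => \sum_(e <- l) delta A e f ** x e) =
    \sum_(e <- l) act (dvec (val e)) (x e).
  have cc1 e : cc_edges (A := A) (fun f => delta A e f ** x e).
    have [fd Td] := delta_cc e; split; last by move=> f; rewrite cmulA Td.
    by apply: sub_finite_set fd => f /= h d0; apply: h; rewrite d0 cmul0l.
  have cc0 : cc_edges (A := A) (fun=> 0).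
    split; last by move=> f; rewrite cmul0r.
    by apply: (@sub_finite_set _ _ set0) => // f /=.
  have ccl u v : cc_edges (A := A) u -> cc_edges (A := A) v -> cc_edges (A := A) (fun f => 1 *: u f + v f).
    move=> [fu Tu] [fv Tv]; split; last by move=> f; rewrite cmul_linr Tu Tv.
    apply: (@sub_finite_set _ _ ([set f | u f <> 0] `|` [set f | v f <> 0])).
      move=> f /= h; apply: contrapT => /not_orP[/contrapT u0 /contrapT v0].
      by apply: h; rewrite u0 v0 scaler0 addr0.
    by rewrite finite_setU.
  elim: l => [|e l [IHc IHi]].
    have -> : (fun f : edge L a => \sum_(e <- [::]) delta A e f ** x e) = fun=> 0.
      by apply/funext => f; rewrite big_nil.
    split => //; rewrite big_nil; apply/eqP.
    have := iota_lin X 1 cc0 cc0; rewrite (_ : (fun f => _) = fun=> 0); last first.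
      by apply/funext => f; rewrite scaler0 addr0.
    by rewrite scale1r => /(congr1 (fun z => z - iota X (fun=> 0))); rewrite subrr addrK => <-.
  have -> : (fun f => \sum_(e <- e :: l) delta A e f ** x e) =
      (fun f => 1 *: (delta A e f ** x e) + \sum_(e <- l) delta A e f ** x e).
    by apply/funext => f; rewrite big_cons scale1r.
  split; first exact: ccl.
  rewrite (iota_lin X 1 (cc1 e) IHc) IHi big_cons scale1r; congr (_ + _).
  by rewrite (iota_act X _ (delta_cc e)) dvec_edge.
exists [seq (val e, x e) | e <- s]; rewrite big_map -(cc_sum s).2.
congr iota; apply/funext => f.
have [f0|f0] := eqVneq (x f) 0.
  rewrite f0 big1_seq// => e /andP[_ es]; rewrite /delta; case: eqP => [fe|_]; last exact: cmul0l.
  by rewrite -fe f0 cmul0r.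
have fs : f \in s by rewrite in_fset_set//; apply: mem_set; exact/eqP.
rewrite (bigD1_seq f)//=; last exact: fset_uniq.
rewrite {1}/delta eqxx Tx big1 ?addr0// => e ef.
by rewrite /delta eq_sym (negPf ef) cmul0l.
Qed.

Lemma dvec_span (x : X) : adh [set z | exists s : seq (L * A),
  z = \sum_(p <- s) act (dvec p.1) p.2] x.
Proof.
have := dense_adh (@iota_dense _ _ _ _ X) x; apply: adh_mono => _ [u cu <-].
exact: cc_decomp.
Qed.

Lemma inner_lip (z x y : X) : nm (inner z x - inner z y) <= 4 * nm z * nm (x - y).
Proof. by rewrite -innerNr -innerDr -mulrA; exact: inner_CS. Qed.

(** The vectors [act (dvec X y) b] have dense span, so a vector orthogonal to all [dvec X y] is
    orthogonal to itself. *)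
Lemma dvec_orth_eq0 (x : X) : (forall y, pow_edges L a y -> inner x (dvec y) = 0) -> x = 0.
Proof.
move=> h; apply: inner_eq0.
have : adh [set 0] (inner x x).
  apply: (adh_hom _ _ (dvec_span x)); first exact: inner_lip.
  move=> _ [s ->]; apply: sub_adh => /=; rewrite inner_sumr big1// => p _.
  rewrite inner_act; have [ya|ny] := pselect (pow_edges L a p.1).
    by rewrite h// cmul0l.
  by rewrite dvec_out// inner0r cmul0l.
move=> h0; apply: nm_le_eps => e e0; have [_ -> ] := h0 e e0.
by rewrite subr0.
Qed.

Lemma lact_ker c : (forall y, pow_edges L a y -> lact c (dvec y) = 0) ->
  forall x : X, lact c x = 0.
Proof.
move=> h x; apply: nm_le_eps => e e0.
have C0 : 0 < 2 * nm c + 1 by have := nm_ge0 c; lra.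
have [_ [s ->] hx] := dvec_span x (divr_gt0 e0 C0).
set z := \sum_(p <- s) _ in hx.
have z0 : lact c z = 0.
  rewrite /z lact_sum big1// => p _; rewrite lact_act.
  have [ya|ny] := pselect (pow_edges L a p.1); first by rewrite h// act0l.
  by rewrite dvec_out// lact0 act0l.
have -> : lact c x = lact c (x - z) by rewrite lactB z0 subr0.
apply: le_trans (lact_bound _ _) _.
have E : e / (2 * nm c + 1) * (2 * nm c + 1) = e by rewrite divfK// lt0r_neq0.
have := nm_ge0 c; have := nm_ge0 (x - z); have := divr_gt0 e0 C0.
move: (e / _) hx E => d; move: (nm _) (nm _) => p q *; nra.
Qed.

Lemma lactA_dvec g y : src (lval g) = rng y -> pow_edges L a y ->
  lact (Tq g)^# (dvec (comp (lval g) y)) = dvec y.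
Proof.
move=> gy ya; rewrite -lact_dvec// -lactM (Tp_star HA) -(Tp_v T (src_vertex g)).
rewrite lact_dvec// lval_src; first by rewrite gy comp_rng.
by rewrite src_src.
Qed.

Lemma lactA_dvec0 g y : pow_edges L a y -> ~ extensions (lval g) y ->
  lact (Tq g)^# (dvec y) = 0.
Proof.
move=> ya ny; apply: dvec_orth_eq0 => f fa; rewrite lact_adj cadjK.
have [gf|gf] := pselect (src (lval g) = rng f); last by rewrite lact_dvec0// inner0r.
rewrite lact_dvec// inner_dvec//; last by apply: pow_edges_comp => //; exact: lval_below.
by case: eqP => // yE; case: ny; rewrite yE; exact: ext_comp.
Qed.

End EdgeVectors.

(** * The Katsura ideal *)

Section Compacts.
Variables (R : realType) (A : cstar_alg R) (X : hilbert_module A).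
Implicit Types (s t : X -> X).

Lemma compacts_lin (c : R[i]) s t : compacts s -> compacts t ->
  compacts (fun x => c *: s x + t x).
Proof.
move=> /compactsP hs /compactsP ht; apply/compactsP => e e0.
have C0 : 0 < 2 * (cn c + 1) by have := cn_ge0 c; lra.
have [u hu] := hs _ (divr_gt0 e0 C0); have [|w hw] := ht (e / 2); first by lra.
exists ([seq (c *: p.1, p.2) | p <- u] ++ w) => z.
rewrite big_cat big_map/=.
have -> : \sum_(p <- u) theta (c *: p.1) p.2 z = c *: \sum_(p <- u) theta p.1 p.2 z.
  by rewrite scaler_sumr; apply: eq_bigr => p _; rewrite /theta actZl.
rewrite opprD addrACA -scalerBr; apply: le_trans (nmD _ _) _; rewrite nmZ.
apply: (split_eps (cn_ge0 c) (nm_ge0 z) e0); [exact: hu|exact: hw].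
Qed.

Lemma compacts_limit t : (forall e : R, 0 < e -> exists2 s, compacts s &
  forall z, nm (t z - s z) <= e * nm z) -> compacts t.
Proof.
move=> h; apply/compactsP => e e0; have e20 : 0 < e / 2 by lra.
have [s /compactsP hs ts] := h _ e20; have [u hu] := hs _ e20.
exists u => z; apply: le_trans (nm_distD (s z) _ _) _.
have := ts z; have := hu z; lra.
Qed.

Lemma compacts_theta x y : compacts (@theta R A X x y).
Proof.
apply/compactsP => e e0; exists [:: (x, y)] => z.
by rewrite big_seq1 subrr nm0 mulr_ge0 ?nm_ge0// ltW.
Qed.

Lemma compacts_compl s t (k : R) : (forall x y, s (x - y) = s x - s y) ->
  (forall I (r : seq I) (F : I -> X), s (\sum_(i <- r) F i) = \sum_(i <- r) s (F i)) ->
  (forall x a, s (act x a) = act (s x) a) -> 0 <= k ->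
  (forall x, nm (s x) <= k * nm x) -> compacts t -> compacts (s \o t).
Proof.
move=> sB ss sa k0 sk /compactsP ht; apply/compactsP => e e0.
have C0 : 0 < k + 1 by lra.
have [u hu] := ht _ (divr_gt0 e0 C0); exists [seq (s p.1, p.2) | p <- u] => z.
rewrite big_map /=.
have -> : \sum_(p <- u) theta (s p.1) p.2 z = s (\sum_(p <- u) theta p.1 p.2 z).
  by rewrite ss; apply: eq_bigr => p _; rewrite /theta sa.
rewrite -sB; apply: le_trans (sk _) _; have := hu z; have z0 := nm_ge0 z.
have E : e / (k + 1) * (k + 1) = e by rewrite divfK// lt0r_neq0.
have d0 := divr_gt0 e0 C0; move: (e / _) d0 E => d d0 <-.
move: (nm _) (nm z) z0 => p q q0 h; have := ler_wpM2l k0 h.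
have : 0 <= d * q by rewrite mulr_ge0// ltW.
nra.
Qed.

Lemma compacts_compr s s' t (k : R) : (forall x y, inner (s x) y = inner x (s' y)) ->
  (forall x, nm (s x) <= k * nm x) -> 0 <= k -> compacts t -> compacts (t \o s).
Proof.
move=> ss' sk k0 /compactsP ht; apply/compactsP => e e0.
have C0 : 0 < k + 1 by lra.
have [u hu] := ht _ (divr_gt0 e0 C0); exists [seq (p.1, s' p.2) | p <- u] => z.
rewrite big_map /=.
have -> : \sum_(p <- u) theta p.1 (s' p.2) z = \sum_(p <- u) theta p.1 p.2 (s z).
  apply: eq_bigr => p _; rewrite /theta; congr act.
  by rewrite -[LHS]inner_adj -ss' inner_adj.
apply: le_trans (hu (s z)) _; have := sk z; have z0 := nm_ge0 z.
have E : e / (k + 1) * (k + 1) = e by rewrite divfK// lt0r_neq0.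
have d0 := divr_gt0 e0 C0; move: (e / _) d0 E => d d0 <-.
move: (nm _) (nm z) z0 => p q q0 h.
have : d * p <= d * (k * q) by rewrite ler_wpM2l// ltW.
have : 0 <= d * q by rewrite mulr_ge0// ltW.
nra.
Qed.

End Compacts.

Section KatsuraIdeal.
Variables (R : realType) (A : cstar_alg R) (X : correspondence A).
Implicit Types (a b k : A).

Lemma lact_compl a (t : X -> X) : compacts t -> compacts (@lact R A X a \o t).
Proof.
apply: (@compacts_compl R A X _ _ (2 * nm a)) => [x y|I r F|x b||x].
- exact: lactB.
- exact: lact_sum.
- exact: lact_act.
- by rewrite mulr_ge0 ?nm_ge0.
by rewrite -mulrA; exact: lact_bound.
Qed.

Lemma lact_compr a (t : X -> X) : compacts t -> compacts (t \o @lact R A X a).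
Proof.
apply: (@compacts_compr R A X _ (@lact R A X a^#) _ (2 * nm a)) => [x y|x|].
- exact: lact_adj.
- by rewrite -mulrA; exact: lact_bound.
by rewrite mulr_ge0 ?nm_ge0.
Qed.

Lemma katsura_closed_ideal : closed_ideal (katsura X).
Proof.
split=> [|c a b [ha ca] [hb cb]|a b [hb cb]|a b [hb cb]|].
- split=> [b _|]; first exact: cmul0l.
  apply/compactsP => e e0; exists nil => z.
  by rewrite big_nil lact0l subrr nm0 mulr_ge0 ?nm_ge0// ltW.
- split=> [k hk|]; first by rewrite cmul_linl ha// hb// scaler0 addr0.
  have := compacts_lin c ca cb; congr compacts; apply/funext => x.
  by rewrite lact_lin.
- split=> [k hk|]; first by rewrite -cmulA hb// cmul0r.
  have := lact_compl a cb; congr compacts; apply/funext => x.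
  by rewrite /= lactM.
- split=> [k hk|].
    by rewrite -cmulA hb// => x; rewrite lactM hk lact0.
  have := lact_compr a cb; congr compacts; apply/funext => x.
  by rewrite /= lactM.
apply/closed_adh => b hb; split=> [k hk|].
  apply: nm_le_eps => e e0; have C0 : 0 < nm k + 1 by have := nm_ge0 k; lra.
  have [b' [hb' _] bb'] := hb _ (divr_gt0 e0 C0).
  have -> : b ** k = (b - b') ** k by rewrite cmulBl hb'// subr0.
  apply: le_trans (nmM _ _) _.
  have E : e / (nm k + 1) * (nm k + 1) = e by rewrite divfK// lt0r_neq0.
  have := nm_ge0 k; have := divr_gt0 e0 C0; move: (e / _) bb' E => d.
  move: (nm _) (nm k) => p q *; nra.
apply: compacts_limit => e e0; have [|b' [_ cb'] bb'] := hb (e / 2); first by lra.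
exists (@lact R A X b') => // z; rewrite -lactBl; apply: le_trans (lact_bound _ _) _.
by have := nm_ge0 z; move: (nm _) (nm z) bb' => p q *; nra.
Qed.

End KatsuraIdeal.

Section CompactOffFinite.
Variables (R : realType) (L : ograph) (a : ord) (A : graph_alg R (lower L a)).
Variable X : edge_corr A.

(** Approximate [t] by finitely many rank-one operators, and the right-hand vector of each by a
    finite combination of edge vectors. A vector orthogonal to the edges that occur is almost
    killed. *)
Lemma compacts_off_finite (t : X -> X) (e : R) : compacts t -> 0 < e ->
  exists F : seq L, forall z, (forall f, f \in F -> inner (dvec X f) z = 0) ->
    nm (t z) <= e * nm z.
Proof.
move=> /compactsP ht e0; have [|s hs] := ht (e / 2); first by lra.
have [F hF] : exists F : seq L, forall z, (forall f, f \in F -> inner (dvec X f) z = 0) ->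
    nm (\sum_(p <- s) theta p.1 p.2 z) <= e / 2 * nm z.
  have : 0 < e / 2 by lra.
  move: (e / 2) => d; elim: s {hs} d => [|p s IH] d d0.
    exists nil => z _; rewrite big_nil nm0 mulr_ge0 ?nm_ge0// ltW//.
  have [|F hF] := IH (d / 2); first by lra.
  (* The 8 is the constant 4 of [inner_CS] times the 2 that halves [d]. *)
  have C0 : 0 < 8 * (nm p.1 + 1) by have := nm_ge0 p.1; lra.
  have [_ [r ->] hr] := dvec_span p.2 (divr_gt0 d0 C0).
  exists ([seq q.1 | q <- r] ++ F) => z hz; rewrite big_cons.
  have h1 : nm (\sum_(j <- s) theta j.1 j.2 z) <= d / 2 * nm z.
    by apply: hF => f fF; apply: hz; rewrite mem_cat fF orbT.
  have h2 : nm (theta p.1 p.2 z) <= d / 2 * nm z.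
    rewrite /theta; apply: le_trans (nm_act _ _) _.
    set y := \sum_(q <- r) _ in hr.
    have -> : inner p.2 z = inner (p.2 - y) z.
      rewrite innerDl innerNl /y inner_suml big_seq big1 ?subr0// => q qr.
      by rewrite inner_actl hz ?cmul0r// mem_cat map_f.
    have h := inner_CS (p.2 - y) z; have z0 := nm_ge0 z; have p0 := nm_ge0 p.1.
    have E : d / (8 * (nm p.1 + 1)) * (8 * (nm p.1 + 1)) = d by rewrite divfK// lt0r_neq0.
    have q0 := divr_gt0 d0 C0; move: (d / (8 * _)) q0 E hr => q q0 <- hr.
    have h3 : nm (inner (p.2 - y) z) <= 4 * (q * nm z).
      by apply: (le_trans h); rewrite ler_pM2l// ler_wpM2r.
    apply: le_trans (ler_wpM2l p0 h3) _.
    have : 0 <= q * nm z by rewrite mulr_ge0// ltW.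
    move: (nm p.1) (nm z) p0 z0 => u v u0 v0; nra.
  apply: le_trans (nmD _ _) _; have z0 := nm_ge0 z; lra.
exists F => z hz; apply: le_trans (nm_le_dist _ (\sum_(p <- s) theta p.1 p.2 z)) _.
have := hs z; have := hF z hz; lra.
Qed.

End CompactOffFinite.

(** * Averaging along an orbit *)

Section Averaging.
Variables (R : realType) (A : cstar_alg R) (W : correspondence A).
Variables (S : nat -> A) (N : nat) (s : seq (R[i] * (nat * bool))).
Hypothesis N0 : (0 < N)%N.

Definition sterm (t : R[i] * (nat * bool)) : A :=
  t.1 *: (if t.2.2 then S t.2.1 else (S t.2.1)^#).
Definition spoly : A := \sum_(t <- s) sterm t.
(** The diagonal entry of the polynomial on an orbit of period [N]: exactly the exponents divisible
    by [N] contribute, for [S n] as well as for its adjoint. *)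
Definition smean : R[i] := \sum_(t <- s) (if (N %| t.2.1)%N then t.1 else 0).

(** For [V] the sum of the [v (N * i)] with [i < m], this is the coefficient of [q] in [<V, S n V>]:
    [m - n / N] if [N] divides [n], and 0 otherwise. *)
Let cnt m n : nat := \sum_(j < m) \sum_(i < m) (N * i == N * j + n)%N.

Let cnt_lt m k : (\sum_(j < m) (j < k)%N = minn k m)%N.
Proof.
elim: m => [|m IH]; first by rewrite big_ord0 minn0.
rewrite big_ord_recr /= IH /minn; case: (ltngtP k m) => h; case: (ltngtP k m.+1) => h' /=; lia.
Qed.

Let cnt_dvd m n : (N %| n)%N -> (cnt m n = m - n %/ N)%N.
Proof.
move=> /dvdnP[k ->]; rewrite mulnK// /cnt.
have -> : (m - k = minn (m - k) m)%N by rewrite /minn; case: ltnP => //; lia.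
rewrite -cnt_lt; apply: eq_bigr => j _.
rewrite ltn_subRL (addnC k); have e i : (N * i == N * j + k * N)%N = (i == j + k)%N.
  by rewrite (mulnC k) -mulnDr eqn_pmul2l.
under eq_bigr do rewrite e.
have [h|h] := ltnP (j + k) m.
  rewrite (bigD1 (Ordinal h))//= eqxx big1 ?addn0// => i ij.
  by apply/eqP; rewrite eqb0; move: ij; rewrite -val_eqE.
rewrite big1// => i _; apply/eqP; rewrite eqb0; apply/eqP => ij.
by have := ltn_ord i; rewrite ij ltnNge h.
Qed.

Let cnt_ndvd m n : ~~ (N %| n)%N -> cnt m n = 0%N.
Proof.
move=> nd; rewrite /cnt big1// => j _; rewrite big1// => i _.
apply/eqP; rewrite eqb0; apply/eqP => E; case/negP: nd.
by rewrite -(dvdn_addr n (dvdn_mulr j (dvdnn N))) -E dvdn_mulr.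
Qed.

(** [<V, spoly V>] is [m * smean] times [q] up to an error [C] that does not depend on [m], and the
    norm of [V] squared is [m]. So [m * cn smean <= 4 * d * m + C], and [m] tends to infinity. [K]
    bounds the indices reached when the [S n] of the polynomial are applied to the vectors in
    [V]. *)
Lemma averaging (d : R) :
  (forall m : nat, exists (q : A) (v : nat -> W), let K := (N * m + \max_(t <- s) t.2.1)%N in
    [/\ nm q = 1,
        forall i n, (i + n < K)%N -> lact (S n) (v i) = v (i + n)%N,
        forall i j, (i < K)%N -> (j < K)%N -> inner (v i) (v j) = if i == j then q else 0 &
        nm (lact spoly (\sum_(i < m) v (N * i)%N)) <= d * nm (\sum_(i < m) v (N * i)%N)]) ->
  cn smean <= 4 * d.
Proof.
move=> h; pose C := \sum_(t <- s) cn t.1 * t.2.1%:R : R.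
have C0 : 0 <= C by apply: sumr_ge0 => t _; rewrite mulr_ge0 ?cn_ge0.
suff key m : cn smean * m%:R <= 4 * d * m%:R + C.
  apply/ler_addgt0Pr => e e0; have C1 : 0 < C + 1 by lra.
  have [m hm] := archi (divr_gt0 e0 C1); have := key m.+1.
  have M0 : 0 < m.+1%:R :> R by rewrite ltr0n.
  move: hm; rewrite ler_pdivlMr// ler_pdivrMl//.
  move: (m.+1%:R : R) M0 => M M0 hm k; rewrite -(ler_pM2r M0); nra.
have [q [v [q1 vS vO vd]]] := h m; set K := (N * m + _)%N in vS vO.
set V := \sum_(i < m) v (N * i)%N in vd.
have iK i n t : (i < m)%N -> t \in s -> n = t.2.1 -> (N * i + n < K)%N.
  move=> im ts ->; rewrite /K -addSn; apply: leq_add.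
    by rewrite ltn_pmul2l.
  exact: leq_bigmax_seq.
have iK0 i : (i < m)%N -> (N * i < K)%N.
  by move=> im; rewrite /K; apply: leq_trans (leq_addr _ _); rewrite ltn_pmul2l.
have [m0|m0] := posnP m; first by rewrite m0 !mulr0 add0r.
have qa : q^# = q.
  have z : (0 < K)%N by have := iK0 0%N m0; rewrite muln0.
  by have := vO 0%N 0%N z z; rewrite eqxx => <-; rewrite inner_adj.
have VS t : t \in s -> inner V (lact (S t.2.1) V) = (cnt m t.2.1)%:R *: q.
  move=> ts; rewrite /V lact_sum inner_sumr /cnt natr_sum scaler_suml.
  apply: eq_bigr => j _; rewrite vS; last exact: iK ts _.
  rewrite inner_suml natr_sum scaler_suml; apply: eq_bigr => i _.
  rewrite vO; [|exact: iK0|exact: iK ts _].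
  by case: eqP; rewrite ?scale1r ?scale0r.
have VV : nm V ^+ 2 = m%:R.
  rewrite -nm_inner /V inner_suml (eq_bigr (fun=> q)) => [|j _]; last first.
    rewrite inner_sumr (bigD1 j)//= vO ?iK0// eqxx big1 ?addr0// => i ij.
    by rewrite vO ?iK0// eqn_pmul2l// eq_sym ifN.
  by rewrite sumr_const card_ord -scaler_nat nmZ cnn q1 mulr1.
have E : inner V (lact spoly V) = (\sum_(t <- s) t.1 * (cnt m t.2.1)%:R) *: q.
  rewrite /spoly lact_suml inner_sumr scaler_suml big_seq [RHS]big_seq.
  apply: eq_bigr => t ts; rewrite /sterm lactZl innerZr -scalerA; congr (_ *: _).
  case: ifP => _; first exact: VS.
  by rewrite -lact_adj -[LHS]inner_adj VS// cadjZ qa conjc_nat.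
have B : cn (\sum_(t <- s) t.1 * (cnt m t.2.1)%:R) <= 4 * d * m%:R.
  have := inner_CS V (lact spoly V); rewrite E nmZ q1 mulr1 => B.
  apply: (le_trans B); have V0 := nm_ge0 V; rewrite -mulrA ler_pM2l//.
  apply: le_trans (ler_wpM2l V0 vd) _; rewrite -VV expr2 mulrCA le_eqVlt eqxx//.
have D : cn (smean * m%:R - \sum_(t <- s) t.1 * (cnt m t.2.1)%:R) <= C.
  rewrite /smean mulr_suml -sumrB; apply: le_trans (cn_sum _ _ _) _.
  apply: ler_sum => t _; case: ifP => dv; last first.
    by rewrite mul0r cnt_ndvd ?dv// mulr0 subr0 cn0 mulr_ge0// cn_ge0.
  rewrite -mulrBr cnM ler_wpM2l ?cn_ge0// cnt_dvd//.
  have [le|lt] := leqP (t.2.1 %/ N) m.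
    rewrite natrB// opprB addrC subrK cnn ler_nat; exact: leq_div.
  rewrite (_ : (m - t.2.1 %/ N)%N = 0%N) ?subr0; last by apply/eqP; rewrite subn_eq0 ltnW.
  rewrite cnn ler_nat; apply: leq_trans (ltnW lt) _; exact: leq_div.
have -> : cn smean * m%:R = cn (smean * m%:R) by rewrite cnM cnn.
have := cnD (smean * m%:R - \sum_(t <- s) t.1 * (cnt m t.2.1)%:R) (\sum_(t <- s) t.1 * (cnt m t.2.1)%:R).
rewrite subrK; lra.
Qed.

End Averaging.

(** * Words in edges of a fixed degree *)

Section Words.
Variables (G : ograph) (b : ord).
Implicit Types (e g p q k x : G).

(** Words of length [n] in edges of degree [omega ^ b]. At a successor level their degrees are
    cofinal below [omega ^ a] ([below_word]), so long word prefixes of an edge absorb any given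
    path. *)
Inductive word : nat -> G -> Prop :=
| word_vertex v : is_vertex v -> word 0 v
| word_cons n x p : pow_edges G b x -> src x = rng p -> word n p -> word n.+1 (comp x p).

Lemma word0 p : word 0 p -> is_vertex p.
Proof.
by move E: 0%N => n h; case: h E.
Qed.

Lemma wordS n g : word n.+1 g -> exists x p,
  [/\ pow_edges G b x, src x = rng p, word n p & g = comp x p].
Proof.
move E: n.+1 => m h; case: h E => // m' x p xb xp wp [->].
by exists x, p.
Qed.

Lemma word_comp m n p q : word m p -> word n q -> src p = rng q -> word (m + n) (comp p q).
Proof.
move=> h; elim: h q => [v vv q wq vq|m' x p' xb xp _ IH q wq]; rewrite ?add0n.
  by rewrite -(vertex_src vv) vq comp_rng.
rewrite src_comp// => pq; rewrite addSn -compA//; apply: word_cons => //.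
  by rewrite rng_comp.
exact: IH.
Qed.

(** Comparable edges of equal degree coincide, so the common letters cancel one by one. *)
Lemma word_cmp m n p q : word m p -> word n q -> (m <= n)%N -> cmp p q ->
  exists k, [/\ src p = rng k, q = comp p k & word (n - m) k].
Proof.
move=> h; elim: h n q => [v vv|m' x p' xb xp _ IH] n q wq mn c.
  exists q; rewrite subn0 (vertex_src vv).
  have vq : v = rng q.
    by case: c => [/ext_rng ->|/ext_rng <-]; rewrite vv.
  by split => //; rewrite vq comp_rng.
case: n wq mn => // n /wordS[z [q' [zb zq wq' qE]]] mn; rewrite qE in c *.
have xz : x = z.
  apply: cmp_eq; last exact: oeq_trans xb (oeq_sym zb).
  apply: (@cmp_shorter G _ (comp x p')); first exact: ext_comp.
  by apply: cmp_sym; apply: (@cmp_shorter G _ (comp z q')); [exact: ext_comp|exact: cmp_sym].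
rewrite -xz in zq qE c *.
have [k [pk q'E wk]] := IH n q' wq' mn ((cmp_compl xp zq).1 c).
by exists k; rewrite src_comp// subSS q'E compA.
Qed.

Lemma word_ext m n p q : word m p -> word n q -> (m <= n)%N -> cmp p q -> extensions p q.
Proof. by move=> wp wq mn /(word_cmp wp wq mn)[k [pk qE _]]; exists k. Qed.

(** A prefix that ends inside a letter leaves a final piece of that letter, which again has degree
    [omega ^ b]; so the remainder is still a word. *)
Lemma word_prefix j g e : word j g -> extensions e g ->
  exists p m, [/\ src e = rng p, g = comp e p & word m p].
Proof.
move=> h; elim: h e => [v vv e|n x p xb xp wp IH e] eg.
  have ev : e = v.
    apply: (ext_anti eg); apply: ole_trans (vertex_deg vv).1 _; exact: ole0.
  exists v, 0%N; split; [by rewrite ev (vertex_src vv) vv| |by left].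
  by rewrite ev -{2}vv comp_rng.
have [xe|ex] : cmp x e by apply: (ext_cmp (ext_comp xp) eg).
  have [e' xe' eE] := xe; rewrite eE in eg *.
  have [q [m [eq pE wq]]] := IH e' ((ext_compl xe' xp).1 eg).
  by exists q, m; rewrite src_comp// pE compA.
have [q eq xE] := ex.
have [ed|ed] := ole_total (opow b) (deg e).
  have ex' : e = x by apply: (ext_anti ex); exact: ole_trans xb.1 ed.
  by exists p, n; rewrite ex'.
have qp : src q = rng p by rewrite -xp xE src_comp.
exists (comp q p), n.+1; rewrite rng_comp// compA// -xE; split => //.
by apply: word_cons => //; apply: (pow_edges_tail eq ed); rewrite -xE.
Qed.

Lemma omul_mono (c : ord) m n : (m <= n)%N -> ole (omul c (onat m)) (omul c (onat n)).
Proof.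
move=> /subnK <-; elim: (n - m)%N => [|k IH]; first exact: ole_refl.
apply: (ole_trans IH); rewrite addSn; apply: ole_trans (omulS _ _).2.
exact: ole_addr.
Qed.

Lemma word_deg j g : word j g -> ole (omul (opow b) (onat j)) (deg g).
Proof.
elim=> [v vv|n x p xb xp _ IH]; first by apply/oleP => z /olt_lub[[]].
apply: (ole_trans (omulS_le _ _)); apply: ole_trans (deg_comp xp).2.
exact: ole_add xb.2 IH.
Qed.

End Words.

(** * Compression along an edge of the correspondence *)

Section Compression.
Variables (R : realType) (L : ograph) (a : ord) (A : graph_alg R (lower L a)).
Notation M := (lower L a).
Notation T := (gen A).
Notation Tq := (Tp (gen A)).
Notation Y := (pow_edges L a).
Implicit Types (e g h k : M) (y : L).

Let HA := gen_family A.

Definition side (p : bool) (x : A) : A := if p then x else x^#.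

Lemma tail_edge e y : src (lval e) = rng y -> Y (comp (lval e) y) -> Y y.
Proof. by move=> ey; apply: (pow_edges_tail ey); exact: lval_below. Qed.

Lemma compress e h g : src e = src h -> ole (deg e) (deg g) -> ole (deg h) (deg g) ->
  (Tq g)^# ** (Tq e ** (Tq h)^#) ** Tq g = 0 \/
  exists p q, [/\ src e = rng p, g = comp e p, src h = rng q, g = comp h q &
    (Tq g)^# ** (Tq e ** (Tq h)^#) ** Tq g = (Tq p)^# ** Tq q].
Proof.
move=> eh de dh.
have [ce|nce] := pselect (cmp e g); last first.
  by left; rewrite !cmulA (Tp_orth HA) ?cmul0l// => /cmp_sym.
have [ch|nch] := pselect (cmp h g); last first.
  by left; rewrite -!cmulA (Tp_orth HA) ?cmul0r.
have [p ep gE] := cmp_le ce de; have [q hq gE'] := cmp_le ch dh.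
right; exists p, q; split => //.
by rewrite cmulA {1}gE (Tp_extl HA)// -cmulA {1}gE' (Tp_ext HA).
Qed.

Definition lterm (t : R[i] * (M * bool)) : A := t.1 *: side t.2.2 (Tq t.2.1).
Definition lspan (P : M -> Prop) : set A := [set x | exists s,
  (forall t, t \in s -> P t.2.1) /\ x = \sum_(t <- s) lterm t].

Lemma lspan0 P : lspan P 0. Proof. by exists nil; rewrite big_nil. Qed.

Lemma lspan_lin P (c : R[i]) x z : lspan P x -> lspan P z -> lspan P (c *: x + z).
Proof.
move=> [s [sP ->]] [s' [sP' ->]]; exists ([seq (c * t.1, t.2) | t <- s] ++ s'); split.
  by move=> t; rewrite mem_cat => /orP[/mapP[t' ts ->]|/sP'//]; exact: sP t' ts.
rewrite big_cat big_map scaler_sumr; congr (_ + _); apply: eq_bigr => t _.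
by rewrite /lterm scalerA.
Qed.

Lemma lspan1 (P : M -> Prop) k p : P k -> lspan P (side p (Tq k)).
Proof.
move=> Pk; exists [:: (1, (k, p))]; split; first by move=> t; rewrite inE => /eqP ->.
by rewrite big_seq1 /lterm scale1r.
Qed.

Definition vloop y k := is_vertex k /\ lval k = rng y.

(** * Successor levels: the loops that survive compression *)

Section Successor.
Variable b : ord.
Hypothesis ba : olt b a.
Hypothesis bmax : forall c, olt c a -> ole c b.

Definition wloop y k := [/\ lval (rng k) = rng y, lval (src k) = rng y & exists n, word b n k].
(* A loop at the range of [y] which remains comparable to the prefixes of [y]; for [k]
   not a vertex, [y] then starts with all the powers of [k]. *)
Definition ploop y k := wloop y k /\ forall j g, word b j g ->
  extensions (lval g) y -> cmp (comp k g) g.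

Lemma word_prefix_exists y j : Y y -> exists g y1,
  [/\ word b j g, src (lval g) = rng y1, y = comp (lval g) y1 & Y y1].
Proof.
elim: j y => [|j IH] y ya.
  exists (end_of a (rng y)), y.
  have e : lval (end_of a (rng y)) = rng y by rewrite /lval /= src_rng.
  rewrite e src_rng comp_rng; split => //; left; exact: end_vertex.
have [|x xy xb] := @prefix_exists L y (opow b).
  by apply: ole_trans ya.2; exact: oltW (opow_lt ba).
have xa : below L a x by apply: pow_below ba xb.
have [y' xy' yE] := xy.
have y'a : Y y' by apply: (pow_edges_tail xy' xa); rewrite -yE.
have [g [y1 [wg gy yE' y1a]]] := IH y' y'a.
have xg : src (lmk xa) = rng g.
  by apply/lval_composable; rewrite lval_mk xy' yE' rng_comp.
exists (comp (lmk xa) g), y1; split => //; first exact: word_cons.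
  by rewrite lval_comp// src_comp//; exact/lval_composable.
by rewrite lval_comp// -compA// ?yE ?yE'//; exact/lval_composable.
Qed.

(** As [a] is at most the successor of [b], a degree below [omega ^ a] is below [omega ^ b * n] for
    some finite [n]. *)
Lemma below_word e : exists n, forall j g, (n <= j)%N -> word b j g -> olt (deg e) (deg g).
Proof.
have ea : olt (deg (lval e)) (opow (osucc b)).
  apply: olt_ole_trans (lval_below e) (opow_mono _).
  by apply/oleP => c /bmax/olt_osucc.
suff [n hn] : exists n, olt (deg e) (omul (opow b) (onat n)).
  exists n => j g nj wg; apply: olt_ole_trans hn _.
  by apply: ole_trans (word_deg wg); exact: omul_mono.
move: ea => /olt_lub[[[]|]]; first by move=> /olt_mul_omega.
move=> /olt_osucc e0; exists 1%N; apply: (@ole_olt_trans ozero) => //.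
apply: olt_ole_trans (opow_gt0 b) _; apply: ole_trans (omulS _ _).2.
exact: ole_addl.
Qed.

(** The threshold [J] is uniform: every word prefix of [y] of length at least [J] compresses [x]
    into the span. Hence one prefix can serve several terms at once. *)
Definition eventually y (P : L -> M -> Prop) (x : A) := exists J : nat, forall j g y1,
  (J <= j)%N -> word b j g -> src (lval g) = rng y1 -> y = comp (lval g) y1 ->
  lspan (P y1) ((Tq g)^# ** x ** Tq g).

Lemma eventually_lin y P (c : R[i]) x z : eventually y P x -> eventually y P z ->
  eventually y P (c *: x + z).
Proof.
move=> [J hJ] [K hK]; exists (maxn J K) => j g y1; rewrite geq_max => /andP[Jj Kj] wg gy yE.
rewrite cmul_linr cmul_linl; apply: lspan_lin; [exact: hJ Jj wg gy yE|exact: hK Kj wg gy yE].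
Qed.

Lemma eventually0 y P : eventually y P 0.
Proof. by exists 0%N => *; rewrite cmul0r cmul0l; exact: lspan0. Qed.

(** A word prefix longer than both paths compresses the monomial to its two tails, which are words
    by [word_prefix]. If these are comparable, their quotient is a word that is a loop at [src g];
    if not, nothing is left. *)
Lemma eventually_mon y e h : src e = src h -> eventually y wloop (Tq e ** (Tq h)^#).
Proof.
move=> eh; have [n hn] := below_word e; have [m hm] := below_word h.
exists (maxn n m) => j g y1; rewrite geq_max => /andP[nj mj] wg gy yE.
have [->|[p [q [ep gp hq gq ->]]]] := compress eh (oltW (hn _ _ nj wg)) (oltW (hm _ _ mj wg)).
  exact: lspan0.
have [p' [i [ep' gp' wp]]] := word_prefix wg (ex_intro2 _ _ p ep gp).
have [q' [i' [hq' gq' wq]]] := word_prefix wg (ex_intro2 _ _ q hq gq).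
have pE : p = p' by apply: (comp_inj ep ep'); rewrite -gp -gp'.
have qE : q = q' by apply: (comp_inj hq hq'); rewrite -gq -gq'.
rewrite -pE in wp; rewrite -qE in wq.
have [c|nc] := pselect (cmp p q); last by rewrite (Tp_orth HA)//; exact: lspan0.
have sp : src p = src g by rewrite gp src_comp.
have sq : src q = src g by rewrite gq src_comp.
have sg : lval (src g) = rng y1 by rewrite lval_src.
have [ii|ii] := leqP i i'.
  have [k [pk qk wk]] := word_cmp wp wq ii c.
  rewrite qk (Tp_ext HA)//; apply: (@lspan1 _ k true); split; [by rewrite -pk sp| |by exists (i' - i)%N].
  by rewrite -(src_comp pk) -qk sq.
have [k [qk pk wk]] := word_cmp wq wp (ltnW ii) (cmp_sym c).
rewrite pk (Tp_extl HA)//; apply: (@lspan1 _ k false); split; [by rewrite -qk sq| |by exists (i - i')%N].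
by rewrite -(src_comp qk) -pk sp.
Qed.

Lemma word_prefix_le y i j g h : word b i g -> word b j h -> (i <= j)%N ->
  extensions (lval g) y -> extensions (lval h) y -> extensions g h.
Proof.
move=> wg wh ij gy hy; apply: (word_ext wg wh ij).
by apply/lval_cmp; exact: ext_cmp gy hy.
Qed.

(* A loop which stops being comparable with the prefixes of [y] is eventually
   compressed to zero; otherwise it is shifted to another loop. *)
Lemma eventually_loop y k p : wloop y k -> eventually y ploop (side p (Tq k)).
Proof.
move=> [rk sk [n wk]].
have adj j g y1 : src (lval g) = rng y1 -> lspan (ploop y1) ((Tq g)^# ** Tq k ** Tq g) ->
    lspan (ploop y1) ((Tq g)^# ** side p (Tq k) ** Tq g).
  case: p => // gy [s [sP E]]; exists [seq (conjc t.1, (t.2.1, ~~ t.2.2)) | t <- s]; split.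
    by move=> t /mapP[t' /sP ts ->].
  rewrite big_map; have -> : (Tq g)^# ** side false (Tq k) ** Tq g = ((Tq g)^# ** Tq k ** Tq g)^#.
    by rewrite !cadjM cadjK cmulA.
  rewrite E cadj_sum.
  apply: eq_bigr => t _; rewrite /lterm /side cadjZ; congr (_ *: _).
  by case: t.2.2 => //=; rewrite cadjK.
have kcomp g : extensions (lval g) y -> src k = rng g.
  by move=> /ext_rng gy; apply: lval_inj; rewrite sk lval_rng gy.
have [pk|npk] := pselect (ploop y k).
  exists n => j g y1 nj wg gy yE; apply: adj => //.
  have gy' : extensions (lval g) y by exists y1.
  have kg := kcomp g gy'; have c := pk.2 j g wg gy'.
  have wkg : word b (n + j) (comp k g) by exact: word_comp.
  have [k' [gk' kE wk']] := word_cmp wg wkg (leq_addl _ _) (cmp_sym c).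
  have sk' : src k' = src g by rewrite -(src_comp gk') -kE src_comp.
  have -> : (Tq g)^# ** Tq k ** Tq g = Tq k'.
    by rewrite -cmulA -(TpM HA)// kE (Tp_ext HA).
  apply: (@lspan1 _ k' true); split.
    split; [by rewrite -gk' lval_src|by rewrite sk' lval_src|by exists (n + j - j)%N].
  move=> i g3 wg3 [y2 g3y y1E].
  have gg3 : src g = rng g3 by apply/lval_composable; rewrite gy y1E rng_comp.
  have k'g3 : src k' = rng g3 by rewrite sk'.
  apply/(@cmp_compl M g) => //; first by rewrite rng_comp.
  rewrite compA// -kE -compA//; apply: (pk.2 (j + i)%N); first exact: word_comp.
  rewrite lval_comp//; exists y2; first by rewrite src_comp//; exact/lval_composable.
  by rewrite -compA// -?y1E//; exact/lval_composable.
have [i [g0 [wg0 g0y ng0]]] : exists i g0,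
    [/\ word b i g0, extensions (lval g0) y & ~ cmp (comp k g0) g0].
  apply: contrapT => h; apply: npk; split; first by split=> //; exists n.
  by move=> j g wg gy; apply: contrapT => nc; apply: h; exists j, g.
exists i => j g y1 ij wg gy yE; apply: adj => //.
have gy' : extensions (lval g) y by exists y1.
rewrite -cmulA -(TpM HA)//; last exact: kcomp.
rewrite (Tp_orth HA); first exact: lspan0.
move=> c; apply: ng0; have g0g := word_prefix_le wg0 wg ij g0y gy'.
have kk : extensions (comp k g0) (comp k g) by apply/ext_compl => //; exact: kcomp.
apply: cmp_shorter kk _; apply: cmp_sym; apply: cmp_shorter g0g _; exact: c.
Qed.

Lemma settle_succ y x : Y y -> poly_in (O := A) (@paired M) x -> exists g y1,
  [/\ src (lval g) = rng y1, y = comp (lval g) y1, Y y1 &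
      lspan (ploop y1) ((Tq g)^# ** x ** Tq g)].
Proof.
move=> ya px; have [J hJ] : eventually y wloop x.
  move: x px; apply: poly_in_ind => [|c x z|e h eh]; first exact: eventually0.
    exact: eventually_lin.
  exact: eventually_mon.
have [g [y1 [wg gy yE y1a]]] := word_prefix_exists J ya.
have [s [sP sE]] := hJ J g y1 (leqnn _) wg gy yE.
have [K hK] : eventually y1 ploop ((Tq g)^# ** x ** Tq g).
  rewrite sE big_seq; apply: (big_ind (eventually y1 ploop)) => [|u v hu hv|t ts].
  - exact: eventually0.
  - by rewrite -(scale1r u); exact: eventually_lin.
  rewrite -[lterm t]addr0; apply: eventually_lin; last exact: eventually0.
  exact/eventually_loop/sP.
have [h [y2 [wh hy y1E y2a]]] := word_prefix_exists K y1a.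
have gh : src g = rng h by apply/lval_composable; rewrite gy y1E rng_comp.
have gh' : src (lval g) = rng (lval h) by exact/lval_composable.
exists (comp g h), y2; rewrite lval_comp// src_comp// -compA// -y1E; split => //.
have := hK K h y2 (leqnn _) wh hy y1E.
by rewrite (TpM HA)// cadjM !cmulA.
Qed.

End Successor.

(** Here one prefix is enough. Its degree [d] is a power [omega ^ b] above the degrees of all paths
    involved (or 0 if these are all vertices), so the two tails of a monomial both have degree
    exactly [d] and, if comparable, coincide. Only multiples of a vertex element remain. *)
Lemma settle_limit y x : (forall b, olt b a -> exists2 c, olt b c & olt c a) ->
  Y y -> poly_in (O := A) (@paired M) x -> exists g y1,
  [/\ src (lval g) = rng y1, y = comp (lval g) y1, Y y1 &
      lspan (vloop y1) ((Tq g)^# ** x ** Tq g)].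
Proof.
move=> lim ya [s [sG ->]].
pose l : seq M := [seq p.2.1 | p <- s] ++ [seq p.2.2 | p <- s].
have [d [da dl]] : exists d, olt d (opow a) /\ forall e, e \in l ->
    ole (deg e) d /\ forall f, src e = rng f -> oeq (deg (comp e f)) d -> oeq (deg f) d.
  have [allv|nv] := pselect (forall e, e \in l -> is_vertex e).
    exists ozero; split; first exact: opow_gt0.
    move=> e el; have ve := allv e el; split; first exact: (vertex_deg ve).1.
    by move=> f ef; rewrite -{1}(vertex_src ve) ef comp_rng.
  have [b bl] : exists2 b, olt b a & forall e, e \in l -> below M b e.
    have : forall l' : seq M, {subset l' <= l} -> exists2 b, olt b a & forall e, e \in l' -> below M b e.
      elim=> [_|e l' IH sub].
        have /existsNP[e /not_implyP[el ne]] := nv.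
        have [/ne//|[c [g [f [gc gf fc eE]]]]] := vertex_or_pow e.
        by exists c => //; exact: lower_pow gc.
      have [|b ba hb] := IH; first by move=> f fl; apply: sub; rewrite inE fl orbT.
      have [c ca ec] : exists2 c, olt c a & below M c e.
        have [ve|[c [g [f [gc gf fc eE]]]]] := vertex_or_pow e.
          by exists b => //; exact: vertex_below.
        have [c' cc' c'a] := lim c (lower_pow gc); exists c' => //.
        rewrite eE; apply: below_comp => //; first exact: pow_below cc' gc.
        by apply: below_lt fc; exact/ole_osucc.
      have [bc|/oltW cb] := ole_total b c.
        exists c => // f; rewrite inE => /predU1P[->//|/hb]; exact: below_lt.
      exists b => // f; rewrite inE => /predU1P[->|/hb//]; exact: below_lt ec.
    by move=> h; exact: h.
  move=> hb; exists (opow b); split; first exact/opow_lt.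
  move=> e el; have eb := hb e el; split; first exact: oltW.
  move=> f ef efb; exact: (pow_edges_tail ef eb efb).
have [g0 [y1 gy1 yE] g0d] := prefix_exists (ole_trans (oltW da) ya.2).
have g0a : below L a g0 by exact: ole_olt_trans g0d.1 da.
have dg : oeq (deg (lmk g0a)) d by [].
have gy : src (lval (lmk g0a)) = rng y1 by [].
move: (lmk g0a) dg gy (erefl : lval (lmk g0a) = g0) => g dg gy gE.
rewrite -gE in yE; exists g, y1; split => //; first by apply: (tail_edge gy); rewrite -yE.
rewrite cmul_sumr cmul_suml big_seq.
apply: (big_ind (lspan (vloop y1))) => [|u v hu hv|t ts]; first exact: lspan0.
  by rewrite -(scale1r u); exact: lspan_lin.
have [el hl] : t.2.1 \in l /\ t.2.2 \in l.
  by rewrite !mem_cat; split; [rewrite (map_f (fun p => p.2.1) ts)|rewrite (map_f (fun p => p.2.2) ts) orbT].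
have [de ce] := dl _ el; have [dh ch] := dl _ hl.
rewrite /monomial cmulZr cmulZl -[_ *: _]addr0; apply: lspan_lin; last exact: lspan0.
have [->|[p [q [ep gp hq gq ->]]]] := compress (sG t ts) (ole_trans de dg.2) (ole_trans dh dg.2).
  exact: lspan0.
have [c|nc] := pselect (cmp p q); last by rewrite (Tp_orth HA)//; exact: lspan0.
have pq : p = q.
  apply: cmp_eq c _; apply: (@oeq_trans d); first by apply: ce ep _; rewrite -gp.
  by apply/oeq_sym/(ch _ hq); rewrite -gq.
rewrite -pq (Tp_star HA) -(Tp_v T (src_vertex p)).
apply: (@lspan1 _ (src p) true); split; first exact: src_vertex.
by rewrite -(src_comp ep) -gp lval_src.
Qed.

End Compression.

(** * Gauge automorphisms *)

Section Gauge.
Variables (R : realType) (L : ograph) (a : ord) (A : graph_alg R (lower L a)).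
Notation M := (lower L a).
Notation T := (gen A).
Notation Tq := (Tp (gen A)).
Variable b : ord.
Hypothesis bmax : forall c, olt c a -> ole c b.
Implicit Types (e f g h : M) (z : R[i]).

Let HA := gen_family A.

Definition unimod z := conjc z * z = 1.
(** Only edges of the top degree [omega ^ b] are rotated: relation (ii) absorbs an edge into a
    longer one, which does not change the number of top edges. *)
Definition gscale z e : R[i] := if `[< pow_edges M b e >] then z else 1.

Lemma unimod_cn z : unimod z -> cn z = 1.
Proof.
move=> zz; have := congr1 (@cn R) zz; rewrite cnM cn_conj cn1.
by have := cn_ge0 z; nra.
Qed.

Lemma gscale_v z v : is_vertex v -> gscale z v = 1.
Proof. by move=> vv; rewrite /gscale asboolF// => /pow_edges_neq0. Qed.

Lemma gauge_family z : unimod z -> graph_family (fun e => gscale z e *: T e).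
Proof.
move=> zz; have gz e : conjc (gscale z e) * gscale z e = 1.
  by rewrite /gscale; case: asboolP => _ //; rewrite cj1 mul1r.
have sv e : gscale z (src e) = 1 by apply: gscale_v; exact: src_vertex.
have star e f : (gscale z e *: T e)^# ** (gscale z f *: T f) =
    (conjc (gscale z e) * gscale z f) *: ((T e)^# ** T f).
  by rewrite cadjZ cmulZl cmulZr scalerA.
split=> [e eg|e eg|e f eg fg ef d|e f eg fg ef|c v rv].
- by rewrite -cmulA star gz scale1r cmulZl cmulA (family_pisom HA).
- by rewrite star gz scale1r sv scale1r (family_src HA).
- rewrite cmulZl cmulZr scalerA (family_comp HA)//; congr (_ *: _).
  case: fg => [fv|[c fc]].
    by have := olt_le_false (olt_ole_trans d (vertex_deg fv).1) (ole0 _).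
  have ec : below M c e by exact: olt_ole_trans d fc.1.
  have cb := bmax (lower_pow fc).
  rewrite {1}/gscale asboolF ?mul1r; last first.
    by move=> eb; apply: (olt_le_false ec); apply: ole_trans (opow_mono cb) eb.2.
  have fe : pow_edges M c (comp e f) by apply: pow_edges_comp.
  rewrite /gscale; congr (if _ then _ else _); apply: asbool_equiv_eq.
  by split=> h; [apply: (pow_edges_eq (pow_edges_exp fc h) fe)|apply: (pow_edges_eq (pow_edges_exp fe h) fc)].
- by rewrite star (family_orth HA)// scaler0.
rewrite gscale_v ?scale1r; last by case: rv.
rewrite (family_sum HA rv); apply: eq_fsbigr => e _.
by rewrite cadjZ cmulZl cmulZr scalerA mulrC gz scale1r.
Qed.

Definition is_gauge z (G : A -> A) := star_hom G /\ forall e, generator e -> G (T e) = gscale z e *: T e.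

Lemma gauge_exists z : unimod z -> exists G, is_gauge z G.
Proof.
by move=> /gauge_family F; have [G [[GH Gg] _]] := gen_universal A F; exists G.
Qed.

Lemma gauge_Tq e : exists m, forall z G, is_gauge z G -> G (Tq e) = z ^+ m *: Tq e.
Proof.
elim/mor_ind: e => [v vv|c g f gc gf fc [m IH]].
  exists 0%N => z G [GH Gg]; rewrite (Tp_v _ vv) Gg; last by left.
  by rewrite gscale_v.
have gg : generator g by right; exists c.
exists (`[< pow_edges M b g >] + m)%N => z G GG; have [GH Gg] := GG.
rewrite (Tp_cons _ gc)// (star_homM GH) Gg// (IH z G GG) cmulZl cmulZr scalerA.
by rewrite exprD /gscale; case: asboolP.
Qed.

Lemma gauge_word n p z G : is_gauge z G -> word b n p -> G (Tq p) = z ^+ n *: Tq p.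
Proof.
move=> GG; elim=> [v vv|m x q xb xq _ IH].
  have [GH Gg] := GG; rewrite (Tp_v _ vv) Gg; last by left.
  by rewrite gscale_v.
have xg : generator x by right; exists b.
have [GH Gg] := GG; rewrite (TpM HA)// (star_homM GH) (Tp_gen HA xg) Gg// IH.
by rewrite /gscale asboolT// cmulZl cmulZr scalerA exprS.
Qed.

Lemma expr_dist z m : unimod z -> cn (z ^+ m - 1) <= m%:R * cn (z - 1).
Proof.
move=> zz; have z1 := unimod_cn zz; elim: m => [|m IH]; first by rewrite subrr cn0 mul0r.
have -> : z ^+ m.+1 - 1 = z * (z ^+ m - 1) + (z - 1) by rewrite exprS mulrBr mulr1 addrA subrK.
apply: le_trans (cnD _ _) _; rewrite cnM z1 mul1r -addn1 natrD mulrDl mul1r.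
by rewrite lerD2r.
Qed.

(** Monomials are eigenvectors, so on polynomials the dependence on [z] is Lipschitz; contractivity
    of [G] extends continuity to the closure. *)
Lemma gauge_cont (x : A) (d : R) : 0 < d -> exists2 r : R, 0 < r &
  forall z G, unimod z -> is_gauge z G -> cn (z - 1) <= r -> nm (G x - x) <= d.
Proof.
move=> d0; have [|y py xy] := graph_alg_span x (e := d / 3); first by lra.
have [C C0 hC] : exists2 C : R, 0 <= C & forall z G, unimod z -> is_gauge z G ->
    nm (G y - y) <= C * cn (z - 1).
  move: y py {xy}; apply: poly_in_ind => [|c u v [C C0 hC] [D D0 hD]|e f ef].
  - by exists 0 => // z G _ [GH _]; rewrite (hom0 GH) subrr nm0 mul0r.
  - exists (cn c * C + D); first by rewrite addr_ge0// mulr_ge0// cn_ge0.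
    move=> z G zz GG; have [GH _] := GG; rewrite (star_hom_lin GH).
    rewrite opprD addrACA -scalerBr; apply: le_trans (nmD _ _) _.
    rewrite nmZ mulrDl -mulrA lerD ?hD// ler_wpM2l ?cn_ge0//; exact: hC.
  have [m hm] := gauge_Tq e; have [n hn] := gauge_Tq f.
  exists (m%:R + n%:R); first by rewrite addr_ge0.
  move=> z G zz GG; have [GH _] := GG.
  rewrite (star_homM GH) (star_hom_adj GH) (hm z G GG) (hn z G GG).
  rewrite cadjZ cmulZl cmulZr scalerA -{2}[Tq e ** _]scale1r -scalerBl nmZ.
  have n1 : nm (Tq e ** (Tq f)^#) <= 1.
    have := nmM (Tq e) (Tq f)^#; rewrite nm_adj.
    have := Tp_nm1 HA e; have := Tp_nm1 HA f; have := nm_ge0 (Tq e); have := nm_ge0 (Tq f).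
    move: (nm _) (nm _) (nm _) => p q r *; nra.
  have c1 : cn (z ^+ m * conjc (z ^+ n) - 1) <= (m%:R + n%:R) * cn (z - 1).
    have -> : z ^+ m * conjc (z ^+ n) - 1 = (z ^+ m - 1) * conjc (z ^+ n) + conjc (z ^+ n - 1).
      by rewrite mulrBl mul1r rmorphB rmorph1 addrA subrK.
    apply: le_trans (cnD _ _) _; rewrite cnM !cn_conj mulrDl.
    have -> : cn (z ^+ n) = 1.
      by elim: (n) => [|k IH]; rewrite ?cn1// exprS cnM IH (unimod_cn zz) mulr1.
    by rewrite mulr1 lerD// expr_dist.
  have := cn_ge0 (z ^+ m * conjc (z ^+ n) - 1); have := nm_ge0 (Tq e ** (Tq f)^#).
  move: (nm _) (cn _) (_ * cn _) c1 n1 => p q r *; nra.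
exists (d / (3 * (C + 1))); first by rewrite divr_gt0//; lra.
move=> z G zz GG zr; have [GH _] := GG.
have -> : G x - x = G (x - y) + ((G y - y) - (x - y)) by rewrite (homB GH); zmod.
apply: le_trans (nmD _ _) _; have h1 := hom_contr GH (x - y).
have h2 := nmD (G y - y) (- (x - y)); rewrite nmN in h2.
have h3 := hC z G zz GG.
have E : d / (3 * (C + 1)) * (3 * (C + 1)) = d by rewrite divfK// lt0r_neq0//; lra.
have : C * cn (z - 1) <= C * (d / (3 * (C + 1))) by rewrite ler_wpM2l.
have q0 : 0 < d / (3 * (C + 1)) by rewrite divr_gt0//; lra.
move: (d / (3 * _)) q0 E => q q0 E h4.
have : C * q * 3 <= d by rewrite -E; nra.
lra.
Qed.

(** The Cayley transform [(1 + i s) / (1 - i s)] of a small [s] is a unimodular number near 1. If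
    its [q]-th power were 1, its first [q] powers would sum to 0, although each of them is within
    [1 / 2] of 1. *)
Lemma unimod_near (q : nat) (r : R) : (0 < q)%N -> 0 < r ->
  exists z : R[i], [/\ unimod z, cn (z - 1) <= r & z ^+ q <> 1].
Proof.
move=> q0 r0; pose s : R := Num.min (r / 2) (1 / (4 * q%:R)).
have Q0 : 0 < q%:R :> R by rewrite ltr0n.
have s0 : 0 < s by rewrite lt_min !divr_gt0//; lra.
have sr : 2 * s <= r.
  have : s <= r / 2 by rewrite ge_min lexx.
  lra.
have sq : 4 * s * q%:R <= 1.
  have : s <= 1 / (4 * q%:R) by rewrite ge_min lexx orbT.
  rewrite ler_pdivlMr; last by lra.
  by rewrite mulrCA mulrA.
pose w : R[i] := 1 + 'i * s%:C.
have wE : w = Complex 1 s.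
  by rewrite /w; apply/eqP; rewrite eq_complex /= !(mul0r, mul1r, mulr0, addr0, add0r, subr0) !eqxx.
have w0 : w != 0 by rewrite wE eq_complex /= oner_eq0.
have cw0 : conjc w != 0 by rewrite conjc_eq0.
pose z := w / conjc w.
have zz : unimod z.
  have zE : conjc z * w = conjc w.
    transitivity (conjc (z * conjc w)); last by rewrite /z divfK.
    by case: (z) (w) => [z1 z2] [w1 w2]; congr Complex; ring.
  by rewrite /unimod {2}/z mulrA zE mulfV.
have z1E : z - 1 = (w - conjc w) / conjc w by rewrite mulrBl mulfV.
have wcw : w - conjc w = 2 * 'i * s%:C.
  by rewrite wE; apply/eqP; rewrite eq_complex /=; apply/andP; split; apply/eqP; ring.
have cnw : 1 <= cn w.
  have := cnD w (conjc w); rewrite cn_conj.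
  have -> : w + conjc w = 2%:R.
    by rewrite wE; apply/eqP; rewrite eq_complex /=; apply/andP; split; apply/eqP; ring.
  by rewrite cnn; lra.
have z1 : cn (z - 1) * cn w = 2 * s.
  rewrite z1E cnM -[cn w]cn_conj -mulrA -cnM mulVf// cn1 mulr1 wcw.
  by rewrite !cnM cnn cni cnR ?(ltW s0)// mulr1.
have zle : cn (z - 1) <= 2 * s.
  by rewrite -z1; have := cn_ge0 (z - 1); move: (cn _) (cn _) cnw => u v *; nra.
exists z; split => //; first exact: le_trans zle sr.
move=> zq; have nz : z - 1 != 0.
  rewrite z1E mulf_neq0 ?invr_eq0// wcw !mulf_neq0//.
  - by apply/eqP => /(congr1 (@cn R)); rewrite cni cn0; lra.
  by rewrite eq_complex /= eqxx andbT; exact: lt0r_neq0.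
have sum0 : \sum_(i < q) z ^+ i = 0.
  apply: (mulfI nz); rewrite mulr0 -subrX1 zq subrr//.
have : cn (q%:R : R[i]) <= q%:R * (q%:R * (2 * s)).
  have -> : q%:R = \sum_(i < q) (1 - z ^+ i) :> R[i].
    by rewrite sumrB sum0 subr0 sumr_const card_ord.
  apply: le_trans (cn_sum _ _ _) _.
  apply: le_trans (_ : \sum_(i < q) q%:R * (2 * s) <= _).
    apply: ler_sum => i _; rewrite -cnN opprB.
    apply: le_trans (expr_dist i zz) _; apply: ler_pM => //; first exact: cn_ge0.
    by rewrite ler_nat ltnW.
  by rewrite sumr_const card_ord -[X in X <= _]mulr_natl.
rewrite cnn; move: Q0 sq s0; move: (q%:R : R) => Q *; nra.
Qed.

End Gauge.

(** * Compact operators vanish at irregular edges *)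

Section LoopPowers.
Variables (G : ograph) (l : G).
Hypothesis ll : src l = rng l.
Notation u := (rng l).

Definition lpow n : G := iter n (comp l) u.

Lemma lpowP n : rng (lpow n) = u /\ src (lpow n) = u.
Proof.
elim: n => [|n [IH1 IH2]] /=; first by rewrite rng_rng src_rng.
by rewrite rng_comp ?src_comp ?ll ?IH1.
Qed.

Lemma lpowD m n : comp (lpow m) (lpow n) = lpow (m + n).
Proof.
have [rn sn] := lpowP n; elim: m => [|m IH]; first by rewrite /= -{1}rn comp_rng.
have [rm sm] := lpowP m.
by rewrite addSn /= -compA ?IH// ?ll ?rm// sm rn.
Qed.

Lemma word_lpow b m n : word b m l -> word b (m * n) (lpow n).
Proof.
move=> wl; elim: n => [|n IH]; first by rewrite muln0; left; exact: rng_vertex.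
rewrite mulnS /=; apply: word_comp => //; rewrite ll; by case: (lpowP n).
Qed.

Lemma lpow_ext n e : rng e = u -> extensions e (comp (lpow n) e) ->
  forall r, extensions e (comp (lpow (n * r)) e).
Proof.
move=> eu en; elim=> [|r IH]; first by rewrite muln0 /= -eu comp_rng; exact: ext_refl.
rewrite mulnS -lpowD -compA; [|by case: (lpowP n) => _ ->; case: (lpowP (n * r))|by case: (lpowP (n * r)) => _ ->].
apply: ext_trans en _; apply/ext_compl => //; first by case: (lpowP n) => _ ->.
rewrite rng_comp; first by case: (lpowP n) => _ ->; case: (lpowP (n * r)).
by case: (lpowP (n * r)) => _ ->.
Qed.

End LoopPowers.

Section Irregular.
Variables (R : realType) (L : ograph) (a : ord) (A : graph_alg R (lower L a)).
Variable X : edge_corr A.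
Notation M := (lower L a).
Notation T := (gen A).
Notation Tq := (Tp (gen A)).
Notation Y := (pow_edges L a).
Implicit Types (e f g h k l : M) (y : L).

Let HA := gen_family A.

Definition alive e := exists f : L, rng f = src (lval e) /\ Y f.

Lemma dead_ker e : ~ alive e -> forall x : X, lact (Tq e) x = 0.
Proof.
move=> de; apply: lact_ker => y ya; apply: lact_dvec0 => ey.
by apply: de; exists y.
Qed.

(** Used in contrapositive form: an irregular vertex either emits a path that is not [alive] or has
    infinitely many long edges. *)
Lemma alive_areg u : is_vertex u -> (forall e, rng e = u -> alive e) ->
  finite_set [set f | rng f = lval u /\ Y f] -> areg u.
Proof.
move=> uu al fin; split; [exact/lval_vertex| |exact: fin].
move=> e ev ea; have [|f [fe fa]] := al (lmk ea).
  by apply: lval_inj; rewrite lval_rng.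
by exists f.
Qed.

Lemma infinite_off (P : set L) (F : seq L) : infinite_set P -> exists2 y, P y & y \notin F.
Proof.
move=> iP; apply: contrapT => h; apply: iP.
apply: (@sub_finite_set _ _ [set` F]); last exact: finite_seq.
move=> y Py /=; apply: contrapT => /negP yF; apply: h; exists y => //.
Qed.

Lemma inj_off (s : nat -> L) (F : seq L) : injective s -> exists i0, forall i, s (i0 + i)%N \notin F.
Proof.
move=> si; elim: F => [|f F [i0 IH]]; first by exists 0%N.
have [[j sj]|ns] := pselect (exists j, s j = f).
  exists (i0 + j.+1)%N => i; rewrite inE negb_or -addnA IH andbT.
  by apply/eqP => E; have := si _ _ (etrans E (esym sj)); lia.
exists i0 => i; rewrite inE negb_or IH andbT; apply/eqP => E.
by apply: ns; exists (i0 + i)%N.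
Qed.

Lemma vec_small (c : A) (d : R) : katsura X c -> 0 < d -> exists F : seq L,
  forall (n : nat) (s : nat -> L), (forall i, (i < n)%N -> s i \notin F /\ Y (s i)) ->
  nm (lact c (\sum_(i < n) dvec X (s i))) <= d * nm (\sum_(i < n) dvec X (s i)).
Proof.
move=> [_ cc] d0; have [F hF] := compacts_off_finite cc d0; exists F => n s sF.
apply: hF => f fF; rewrite inner_sumr big1// => i _.
have [siF siY] := sF i (ltn_ord i).
have [fa|nf] := pselect (Y f); last by rewrite dvec_out// inner0l.
by rewrite inner_dvec//; case: eqP => // E; rewrite -E fF in siF.
Qed.

(** By irregularity either [c ** T_e = 0] for a path [e] from [u] that is not alive, or [c] is small
    on [dvec X y] for one of infinitely many [y]; both give [cn lam <= 3 * d]. Adding [2 * d] from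
    [lact_bound] and multiplying by the 4 of [inner_CS] gives [20 * d]. *)
Lemma scalar_case (c : A) (lam : R[i]) (u : M) y1 (d : R) : katsura X c -> is_vertex u ->
  rng y1 = lval u -> Y y1 -> ~ areg u -> 0 < d -> nm (c - lam *: T u) <= d ->
  nm (inner (dvec X y1) (lact c (dvec X y1))) <= 20 * d.
Proof.
move=> kc uu y1u y1a nr d0 cd.
have lamd : cn lam <= 3 * d.
  have [[e eu de]|al] := pselect (exists2 e, rng e = u & ~ alive e).
    have [ce _] := kc; have c0 := ce _ (dead_ker de).
    have : nm ((c - lam *: T u) ** Tq e) <= d.
      apply: le_trans (nmM _ _) _; have := Tp_nm1 HA e; have := nm_ge0 (c - lam *: T u).
      have := nm_ge0 (Tq e); move: (nm _) (nm _) cd => p q *; nra.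
    rewrite cmulBl c0 sub0r nmN cmulZl -eu (Tp_rng HA) nmZ (Tp_nm HA) ?mulr1; first lra.
    by apply: gen_vertex_neq0; exact: src_vertex.
  have inf : infinite_set [set f | rng f = lval u /\ Y f].
    move=> fin; apply: nr; apply: alive_areg => // e eu; apply: contrapT => de.
    by apply: al; exists e.
  have [F hF] := vec_small kc d0; have [y [yu ya] yF] := infinite_off F inf.
  have := hF 1%N (fun=> y); rewrite /= big_ord1 nm_dvec// mulr1.
  move=> /(_ (fun _ _ => conj yF ya)) h.
  have E : lact (lam *: T u) (dvec X y) = lam *: dvec X y.
    rewrite lactZl -(Tp_v T uu) lact_dvec ?(vertex_src ((lval_vertex u).1 uu))//.
    by rewrite -yu comp_rng.
  have h2 := lact_bound (c - lam *: T u) (dvec X y); rewrite nm_dvec// mulr1 lactBl E in h2.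
  have := nm_distD (lact c (dvec X y)) (lam *: dvec X y) 0.
  by rewrite !subr0 nmZ nm_dvec// mulr1 nmB; lra.
have E : lact (lam *: T u) (dvec X y1) = lam *: dvec X y1.
  rewrite lactZl -(Tp_v T uu) lact_dvec ?(vertex_src ((lval_vertex u).1 uu))//.
  by rewrite -y1u comp_rng.
have h2 := lact_bound (c - lam *: T u) (dvec X y1); rewrite nm_dvec// mulr1 lactBl E in h2.
have := inner_CS (dvec X y1) (lact c (dvec X y1)); rewrite nm_dvec// mul1r.
have := nm_le_dist (lact c (dvec X y1)) (lam *: dvec X y1); rewrite nmZ nm_dvec// mulr1.
lra.
Qed.

Section Loop.
Variables (b : ord) (l : M) (n0 : nat) (y1 : L).
Hypothesis bmax : forall c, olt c a -> ole c b.
Hypothesis ll : src l = rng l.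
Hypothesis wl : word b n0 l.
Hypothesis n0_gt0 : (0 < n0)%N.
Hypothesis y1u : rng y1 = lval (rng l).
Hypothesis y1a : Y y1.
Notation u := (rng l).
Notation S n := (Tq (lpow l n)).

Let uY y := rng y = lval u /\ Y y.
Definition lmul n y := comp (lval (lpow l n)) y.

Let lsrc n : src (lval (lpow l n)) = lval u.
Proof. by rewrite -lval_src; case: (lpowP ll n) => _ ->. Qed.

Lemma lmulP n y : uY y -> uY (lmul n y).
Proof.
move=> [yu ya]; split; last by apply: pow_edges_comp; rewrite ?lsrc//; exact: lval_below.
by rewrite rng_comp ?lsrc// -lval_rng; case: (lpowP ll n) => ->.
Qed.

Lemma lmulD m n y : uY y -> lmul m (lmul n y) = lmul (m + n) y.
Proof.
move=> [yu ya]; rewrite /lmul compA ?lsrc//; last first.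
  by rewrite -lval_rng; case: (lpowP ll n) => ->.
rewrite -lval_comp ?lpowD//; by case: (lpowP ll n) => ->; case: (lpowP ll m).
Qed.

Lemma lmul0 y : uY y -> lmul 0 y = y.
Proof. by move=> [yu _]; rewrite /lmul /= -yu comp_rng. Qed.

Lemma lmul_inj n y y' : uY y -> uY y' -> lmul n y = lmul n y' -> y = y'.
Proof. by move=> [yu _] [yu' _]; apply: comp_inj; rewrite lsrc. Qed.

Lemma lmul_src n y : uY y -> src (lmul n y) = src y.
Proof. by move=> [yu _]; rewrite /lmul src_comp// lsrc. Qed.

Lemma lmul_mul n r y : uY y -> lmul n y = y -> lmul (n * r) y = y.
Proof.
move=> hy E; elim: r => [|r IH]; first by rewrite muln0 lmul0.
by rewrite mulnS -lmulD// IH.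
Qed.

Lemma lmul_eq i j y : uY y -> (i < j)%N -> lmul i y = lmul j y -> lmul (j - i) y = y.
Proof.
move=> hy ij E; apply: (@lmul_inj i) => //; first exact: lmulP.
by rewrite lmulD// subnKC// ltnW.
Qed.

Lemma lact_lmul n y : uY y -> lact (S n) (dvec X y) = dvec X (lmul n y).
Proof. by move=> [yu ya]; rewrite lact_dvec// lsrc. Qed.

Let lmul_end n y : uY y -> T (end_of a (lmul n y)) = T (end_of a y).
Proof. by move=> hy; congr (T _); apply: val_inj; rewrite /= lmul_src. Qed.

Variables (c : A) (d : R) (s : seq (R[i] * (nat * bool))).
Hypothesis kc : katsura X c.
Hypothesis d0 : 0 < d.
Hypothesis cd : nm (c - spoly (fun n => S n) s) <= d.
Hypothesis nr : ~ areg u.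

Let p := spoly (fun n => S n) s.

(** [N] is the period of [y1] under the loop or, if the orbit is free, a number above all exponents,
    so that among them only 0 is divisible by it. *)
Let step : exists2 N, (0 < N)%N & forall n, n \in [seq t.2.1 | t <- s] ->
  (N %| n)%N <-> lmul n y1 = y1.
Proof.
have hy1 : uY y1 by [].
have [[i [i0 iy]]|free] := pselect (exists i, (0 < i)%N /\ lmul i y1 = y1).
  have ex : exists n, (0 < n)%N && (lmul n y1 == y1) by exists i; rewrite i0 iy eqxx.
  case: (ex_minnP ex) => N /andP[N0 /eqP NE] Nmin; exists N => // n _; split.
    by move=> /dvdnP[r ->]; rewrite mulnC; exact: lmul_mul.
  move=> nE; rewrite /dvdn; apply/negPn/negP => r0.
  have rE : lmul (n %% N) y1 = y1.
    have := lmul_mul (n %/ N) hy1 NE; rewrite mulnC => qE.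
    by rewrite -{1}qE lmulD// addnC -divn_eq nE.
  have := Nmin (n %% N)%N; rewrite lt0n r0 rE eqxx => /(_ isT).
  by rewrite leqNgt ltn_pmod.
exists (\max_(t <- s) t.2.1).+1 => // n /mapP[t ts ->].
have le : (t.2.1 <= \max_(t <- s) t.2.1)%N by exact: leq_bigmax_seq.
split=> [dv|E].
  have -> : t.2.1 = 0%N by apply/eqP; apply: contraTT dv => n1; rewrite gtnNdvd// lt0n.
  exact: lmul0.
have [->//|n1] := posnP t.2.1; by case: free; exists t.2.1.
Qed.

Let q := T (end_of a y1).

(** [smean N s] is the diagonal entry of the polynomial at [dvec X y1]. It contributes [12 * d], and
    the distance from [c] to the polynomial contributes [8 * d]. *)
Let finish N : (forall n, n \in [seq t.2.1 | t <- s] -> (N %| n)%N <-> lmul n y1 = y1) ->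
  cn (smean N s) <= 4 * (3 * d) ->
  nm (inner (dvec X y1) (lact c (dvec X y1))) <= 20 * d.
Proof.
move=> hN hm; have hy1 : uY y1 by [].
have E : inner (dvec X y1) (lact p (dvec X y1)) = smean N s *: q.
  rewrite /p /spoly lact_suml inner_sumr /smean scaler_suml big_seq [RHS]big_seq.
  apply: eq_bigr => t ts; rewrite /sterm lactZl innerZr.
  have e1 : inner (dvec X y1) (lact (S t.2.1) (dvec X y1)) = if (N %| t.2.1)%N then q else 0.
    rewrite lact_lmul// inner_dvec//; last by case: (lmulP t.2.1 hy1).
    have h := hN _ (map_f (fun t => t.2.1) ts).
    by case: (boolP (N %| _)%N) => [/h ->|/negP nd]; [rewrite eqxx|case: eqP => // /esym/h].
  have e2 : inner (dvec X y1) (lact (S t.2.1)^# (dvec X y1)) = if (N %| t.2.1)%N then q else 0.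
    rewrite -lact_adj -inner_adj e1; case: ifP => _; last exact: cadj0.
    by apply: (Tv_adj HA); exact: end_vertex.
  have -> : inner (dvec X y1) (lact (if t.2.2 then S t.2.1 else (S t.2.1)^#) (dvec X y1)) =
      if (N %| t.2.1)%N then q else 0 by case: (t.2.2).
  by case: ifP => _; rewrite ?scaler0 ?scale0r.
have q1 : nm q = 1 by apply: (T_nm HA); [exact: end_vertex|apply: gen_vertex_neq0; exact: end_vertex].
have := inner_CS (dvec X y1) (lact (c - p) (dvec X y1)).
have := lact_bound (c - p) (dvec X y1); rewrite nm_dvec// mulr1 mul1r => h1 h2.
have -> : inner (dvec X y1) (lact c (dvec X y1)) = smean N s *: q +
    inner (dvec X y1) (lact (c - p) (dvec X y1)).
  by rewrite -E -innerDr -lactDl addrC subrK.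
by have := nmD (smean N s *: q) (inner (dvec X y1) (lact (c - p) (dvec X y1))); rewrite nmZ q1 mulr1; move: h1 h2 cd hm; rewrite -/p; lra.
Qed.

(** Of the [3 * d], one [d] comes from compactness of [c] off [F] and two from replacing [c] by the
    polynomial. *)
Let from_vectors N : (0 < N)%N ->
  (forall (K : nat) (F : seq L), exists2 y, uY y & (forall i j, (i < K)%N -> (j < K)%N ->
    lmul i y = lmul j y -> i = j) /\ forall i, (i < K)%N -> lmul i y \notin F) ->
  cn (smean N s) <= 4 * (3 * d).
Proof.
move=> N0 h; have [F hF] := vec_small kc d0.
apply: (@averaging R A X (fun n => S n) N s N0) => m.
set K := (N * m + _)%N; have [y hy [inj off]] := h K F.
exists (T (end_of a y)), (fun i => dvec X (lmul i y)); split.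
- by apply: (T_nm HA); [exact: end_vertex|apply: gen_vertex_neq0; exact: end_vertex].
- by move=> i n _; rewrite lact_lmul ?lmulD// ?(addnC n)//; exact: lmulP.
- move=> i j iK jK; rewrite inner_dvec; [|by case: (lmulP i hy)|by case: (lmulP j hy)].
  have [->|ij] := eqVneq i j; first by rewrite eqxx lmul_end.
  by rewrite ifN//; apply: contra_neq ij; exact: inj.
have hV : nm (lact c (\sum_(i < m) dvec X (lmul (N * i) y))) <= d * nm (\sum_(i < m) dvec X (lmul (N * i) y)).
  apply: (hF m (fun i => lmul (N * i) y)) => i im; split; last by case: (lmulP (N * i) hy).
  by apply: off; rewrite /K; apply: leq_trans (leq_addr _ _); rewrite ltn_pmul2l.
move: (\sum_(i < m) _) hV => V hV.
have := lact_bound (c - p) V; rewrite lactBl => h1.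
have := nm_le_dist (lact p V) (lact c V); rewrite nmB.
have V0 := nm_ge0 V; have := cd; rewrite -/p; move: (nm (c - p)) h1 => w h1 wd.
have : w * nm V <= d * nm V by rewrite ler_wpM2r.
lra.
Qed.

(** If [e] is not alive, [c] kills every [Tq (comp (lpow l i) e)], and these serve as orbit vectors
    in the algebra. They are orthogonal: if two of the paths were comparable, [e] would be a prefix
    of a power of [l], and then [y1] would provide a long edge continuing [e]. *)
Let from_dead N : (0 < N)%N -> (exists2 e, rng e = u & ~ alive e) ->
  cn (smean N s) <= 4 * (3 * d).
Proof.
move=> N0 [e eu de]; apply: (@averaging R A (self_corr A) (fun n => S n) N s N0) => m.
have se n : src (lpow l n) = rng e by case: (lpowP ll n) => _ ->.
have nep n : (0 < n)%N -> ~ cmp e (comp (lpow l n) e).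
  move=> n1 ce; have {}ce : extensions e (comp (lpow l n) e).
    by apply: (cmp_le ce); apply: ole_trans (deg_comp (se n)).2; exact: ole_addl.
  have [r hr] := below_word bmax e.
  have rr := lpow_ext ll eu ce r.
  have ew : extensions e (lpow l (n * r)).
    apply: (ext_le_deg rr (ext_comp (se _))); apply: oltW.
    by apply: (hr (n0 * (n * r))%N); [rewrite mulnA leq_pmull// muln_gt0 n0_gt0|exact: word_lpow].
  have [h eh hE] := ew; apply: de.
  have hu : src h = u by rewrite -(src_comp eh) -hE; case: (lpowP ll (n * r)).
  have hy : src (lval h) = rng y1 by rewrite -lval_src hu.
  exists (comp (lval h) y1); rewrite rng_comp// -lval_rng -eh lval_src; split => //.
  by apply: pow_edges_comp => //; exact: lval_below.
have orth i j : (i < j)%N -> ~ cmp (comp (lpow l i) e) (comp (lpow l j) e).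
  move=> ij; rewrite -(subnKC (ltnW ij)) -(lpowD ll) -compA; last first.
  - exact: se.
  - by case: (lpowP ll i) => _ ->; case: (lpowP ll (j - i)).
  move=> /cmp_compl c'; apply: (nep (j - i)%N); first by rewrite subn_gt0.
  apply: c'; first exact: se.
  by rewrite rng_comp ?se//; case: (lpowP ll (j - i)) => ->; rewrite eu.
exists (T (src e)), (fun i => Tq (comp (lpow l i) e)); split.
- by apply: (T_nm HA); [exact: src_vertex|apply: gen_vertex_neq0; exact: src_vertex].
- move=> i n _; change (Tq (lpow l n) ** Tq (comp (lpow l i) e) = Tq (comp (lpow l (i + n)) e)).
  rewrite -(TpM HA); last first.
    by rewrite rng_comp ?se//; case: (lpowP ll i) => ->; rewrite eu.
  rewrite compA ?se// ?lpowD ?(addnC n)//.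
  by case: (lpowP ll i) => ->; rewrite eu.
- move=> i j _ _; change ((Tq (comp (lpow l i) e))^# ** Tq (comp (lpow l j) e) =
    if i == j then T (src e) else 0); case: (ltngtP i j) => ij.
  + by rewrite (Tp_orth HA)//; exact: orth.
  + by rewrite (Tp_orth HA)// => /cmp_sym; exact: orth.
  by rewrite ij (Tp_star HA) src_comp.
have c0 i : c ** Tq (comp (lpow l i) e) = 0.
  have [h _] := kc; apply: h; apply: dead_ker => -[f [fe fa]]; apply: de.
  by exists f; rewrite fe -!lval_src src_comp.
have V0 : c ** \sum_(i < m) Tq (comp (lpow l (N * i)) e) = 0.
  by rewrite cmul_sumr big1// => i _; exact: c0.
move: (\sum_(i < m) _) V0 => V V0; change (nm (p ** V) <= 3 * d * nm V).
have -> : p ** V = - ((c - p) ** V) by rewrite cmulBl V0 sub0r opprK.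
rewrite nmN; apply: le_trans (nmM _ _) _; rewrite ler_wpM2r ?nm_ge0//.
apply: (le_trans cd); have := d0; lra.
Qed.

(** Unless some path is not alive, there are infinitely many long edges at the base vertex, and
    orbit vectors are sought among them. A free orbit eventually leaves [F]. If all orbits are
    finite, either one power of [l] fixes every long edge, the second alternative, or there are
    orbits of arbitrarily large period avoiding [F]. *)
Lemma loop_case : nm (inner (dvec X y1) (lact c (dvec X y1))) <= 20 * d \/
  exists2 n, (0 < n)%N & forall y, uY y -> lmul n y = y.
Proof.
have [N N0 hN] := step.
have [de|al] := pselect (exists2 e, rng e = u & ~ alive e).
  by left; apply: (finish hN); exact: from_dead.
have inf : infinite_set uY.
  move=> fin; apply: nr; apply: alive_areg => //; first exact: rng_vertex.
  by move=> e eu; apply: contrapT => de; apply: al; exists e.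
have [com|ncom] := pselect (exists2 n, (0 < n)%N & forall y, uY y -> lmul n y = y).
  by right.
left; apply: (finish hN); apply: from_vectors => // K F.
have [[y hy free]|nfree] := pselect (exists2 y, uY y & forall n, (0 < n)%N -> lmul n y <> y).
  have inj : injective (fun n => lmul n y).
    move=> i j E; case: (ltngtP i j) => // ij; exfalso.
      by apply: (free (j - i)%N); [rewrite subn_gt0|exact: lmul_eq].
    by apply: (free (i - j)%N); [rewrite subn_gt0|exact: lmul_eq].
  have [i0 hi] := inj_off F inj; exists (lmul i0 y); first exact: lmulP.
  split=> [i j _ _|i _]; rewrite !lmulD//; last by rewrite addnC.
  by move=> /inj; lia.
have per y : exists n, uY y -> (0 < n)%N /\ lmul n y = y.
  have [hy|nh] := pselect (uY y); last by exists 0%N.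
  apply: contrapT => h; apply: nfree; exists y => // n n1 E; apply: h.
  by exists n.
have [pr prP] := choice per.
have prF : (0 < \prod_(f <- F | `[< uY f >]) pr f)%N.
  apply: prodn_cond_gt0 => f /asboolP hf; by have [] := prP f hf.
(* A multiple of all positive numbers up to [K] and of the periods of the edges in [F]: an edge
   moved by the [n]-th power of the loop has a period above [K] and an orbit disjoint from [F]. *)
pose n := (K`! * \prod_(f <- F | `[< uY f >]) pr f)%N.
have n1 : (0 < n)%N by rewrite muln_gt0 fact_gt0.
have [y hy yn] : exists2 y, uY y & lmul n y <> y.
  apply: contrapT => h; apply: ncom; exists n => // y hy.
  by apply: contrapT => yn; apply: h; exists y.
have ndv i : (0 < i)%N -> lmul i y = y -> ~ (i %| n)%N.
  by move=> i1 E /dvdnP[r nE]; apply: yn; rewrite nE mulnC lmul_mul.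
exists y => //; split=> [i j iK jK E|i iK].
  case: (ltngtP i j) => // ij; exfalso.
    apply: (@ndv (j - i)%N); [by rewrite subn_gt0|exact: lmul_eq|].
    apply: dvdn_mulr; apply: dvdn_fact; rewrite subn_gt0 ij/=; lia.
  apply: (@ndv (i - j)%N); [by rewrite subn_gt0|exact: lmul_eq|].
  apply: dvdn_mulr; apply: dvdn_fact; rewrite subn_gt0 ij/=; lia.
apply/negP => fF; set f := lmul i y in fF; have hf : uY f by exact: lmulP.
have [p1 pE] := prP f hf; apply: (@ndv (pr f)) => //.
  apply: (@lmul_inj i) => //; first exact: lmulP.
  by rewrite lmulD// addnC -lmulD.
apply: dvdn_mull; rewrite (big_rem f)//= asboolT// dvdn_mulr//.
Qed.

End Loop.

(* The loop [l^n] acts trivially on [X], so [c (T_(l^n) - T_u) = 0]; rotating by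
   the gauge action and letting the parameter tend to 1 kills the vectors fixed
   by [l^n]. *)
Lemma gauge_case b (l : M) n0 (c : A) y1 n : (forall d, olt d a -> ole d b) ->
  src l = rng l -> word b n0 l -> (0 < n0)%N -> katsura X c -> rng y1 = lval (rng l) -> Y y1 ->
  (0 < n)%N -> (forall y, rng y = lval (rng l) /\ Y y -> lmul l n y = y) ->
  lact c (dvec X y1) = 0.
Proof.
move=> bmax ll wl n00 [kc _] y1u y1a n1 fix_.
have c0 : c ** (Tq (lpow l n) - T (rng l)) = 0.
  apply: kc; apply: lact_ker => y ya; rewrite lactBl -(Tp_v T (rng_vertex l)).
  have [yu|yu] := pselect (rng y = lval (rng l)); last first.
    rewrite !lact_dvec0 ?subr0//; rewrite -lval_src; first by rewrite src_rng => /esym.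
    by case: (lpowP ll n) => _ -> /esym.
  rewrite lact_lmul// fix_// lact_dvec//; last by rewrite -lval_src src_rng.
  by rewrite -{1}(comp_rng y) yu subrr.
apply: nm_le_eps => d d0; have d20 : 0 < d / 2 by lra.
have [r r0 hr] := gauge_cont b c d20.
have qp : (0 < n0 * n)%N by rewrite muln_gt0 n00.
have [z [zz zr zq]] := unimod_near qp r0.
have [G GG] := gauge_exists A bmax zz; have [GH Gg] := GG.
have E : G c ** (z ^+ (n0 * n) *: Tq (lpow l n) - T (rng l)) = 0.
  have := congr1 G c0; rewrite (star_homM GH) (homB GH) (hom0 GH).
  rewrite (gauge_word GG (word_lpow ll n wl)) Gg; last by left; exact: rng_vertex.
  by rewrite gscale_v ?scale1r//; exact: rng_vertex.
have hy : rng y1 = lval (rng l) /\ Y y1 by [].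
have := congr1 (fun t => lact t (dvec X y1)) E; rewrite lact0l lactM lactBl lactZl.
rewrite lact_lmul// fix_// -(Tp_v T (rng_vertex l)) lact_dvec//; last by rewrite -lval_src src_rng.
rewrite -y1u comp_rng -{2}[dvec X y1]scale1r -scalerBl lactZ => /eqP.
rewrite scaler_eq0 subr_eq0 => /orP[/eqP//|/eqP G0].
have := lact_bound (G c - c) (dvec X y1); rewrite lactBl G0 sub0r nmN nm_dvec// mulr1.
have := hr z G zz GG zr; lra.
Qed.

(** [b^# ** b] is approximated by a polynomial and compressed along a prefix of [y], which moves the
    inner product at [y] to the remaining edge [y1]. At a limit level the result is a scalar; at a
    successor level it is a scalar or a polynomial in the powers of one loop. As the base vertex is
    irregular, [scalar_case] and [loop_case] apply, and [gauge_case] when a power of the loop acts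
    trivially. *)
Lemma irregular_kills b y : katsura X b -> Y y ->
  (forall g, extensions (lval g) y -> ~ areg (src g)) -> lact b (dvec X y) = 0.
Proof.
move=> kb ya irr; have KI := katsura_closed_ideal X.
have compressed g y1 c : src (lval g) = rng y1 -> y = comp (lval g) y1 -> Y y1 ->
    inner (dvec X y) (lact c (dvec X y)) =
    inner (dvec X y1) (lact ((Tq g)^# ** c ** Tq g) (dvec X y1)).
  by move=> gy yE y1a; rewrite !lactM -lact_adj lact_dvec// -yE.
have kc : katsura X (b^# ** b) by exact: ideal_mull.
have small d : 0 < d -> nm (inner (dvec X y) (lact (b^# ** b) (dvec X y))) <= 20 * d \/
    lact b (dvec X y) = 0.
  move=> d0; have [c0 c0p c0d] := graph_alg_span (b^# ** b) d0.
  have near g : nm ((Tq g)^# ** (b^# ** b) ** Tq g - (Tq g)^# ** c0 ** Tq g) <= d.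
    rewrite -cmulBl -cmulBr; apply: le_trans (nmM _ _) _.
    have := nmM (Tq g)^# (b^# ** b - c0); rewrite nm_adj; have := Tp_nm1 HA g.
    have := nm_ge0 (Tq g); have := nm_ge0 (b^# ** b - c0); have := nm_ge0 ((Tq g)^# ** (b^# ** b - c0)).
    move: (nm (Tq g)) (nm (b^# ** b - c0)) (nm _) c0d => p q r *; nra.
  have kg g : katsura X ((Tq g)^# ** (b^# ** b) ** Tq g).
    by apply: (ideal_mulr KI); apply: (ideal_mull KI).
  have scal g y1 lam : src (lval g) = rng y1 -> y = comp (lval g) y1 -> Y y1 ->
      nm ((Tq g)^# ** (b^# ** b) ** Tq g - lam *: T (src g)) <= d ->
      nm (inner (dvec X y) (lact (b^# ** b) (dvec X y))) <= 20 * d.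
    move=> gy yE y1a h; rewrite (compressed g y1)//.
    apply: (scalar_case (u := src g) (lam := lam) (kg g)) => //; first exact: src_vertex.
      by rewrite lval_src.
    by apply: irr; exists y1.
  have [[c [ca cmax]]|lim] := pselect (exists c, olt c a /\ forall d, olt d a -> ole d c).
    have [g [y1 [gy yE y1a [s [sP sE]]]]] := settle_succ ca cmax ya c0p.
    have [allv|nv] := pselect (forall k, ploop c y1 k -> is_vertex k).
      left; apply: (scal g y1 (\sum_(t <- s) t.1)) => //.
      have -> : (\sum_(t <- s) t.1) *: T (src g) = (Tq g)^# ** c0 ** Tq g; last exact: near.
      rewrite sE scaler_suml big_seq [RHS]big_seq; apply: eq_bigr => t ts.
      have pt := sP t ts; have kv := allv _ pt; have [[rk _ _] _] := pt.
      have kE : t.2.1 = src g by apply: lval_inj; rewrite lval_src gy -rk kv.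
      rewrite /lterm /side kE (Tp_v T (src_vertex g)).
      by case: (t.2.2); rewrite ?(Tv_adj HA (src_vertex g)).
    have [k0 /not_implyP[pk0 nk0]] := (existsNP _).2 nv.
    have [[rk0 sk0 [m0 wk0]] _] := pk0.
    (* A followed loop [l] of least positive length generates the others: a longer one starts with
       [l], the quotient is again followed by [y1], and induction on the length makes it a power of
       [l]. *)
    have ex : exists n, (0 < n)%N && `[< exists2 k : M, ploop c y1 k & word c n k >].
      exists m0; apply/andP; split; last by apply/asboolP; exists k0.
      by rewrite lt0n; apply/eqP => m00; apply: nk0; rewrite m00 in wk0; exact: word0 wk0.
    case: (ex_minnP ex) => n0 /andP[n00 /asboolP[l pl wl]] n0min.
    have [[rl sl _] perl] := pl.
    have ll : src l = rng l by apply: lval_inj; rewrite rl sl.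
    have lu : rng l = src g by apply: lval_inj; rewrite rl lval_src gy.
    have y1u : rng y1 = lval (rng l) by rewrite rl.
    have lp k : ploop c y1 k -> exists i, k = lpow l i.
      move=> [[rk sk [n wk]] perk]; have [N] := ubnP n; elim: N n k rk sk wk perk => // N IH n k rk sk wk perk nN.
      have [n_0|n1] := posnP n.
        exists 0%N; apply: lval_inj; rewrite rl -rk; congr lval.
        by rewrite n_0 in wk; rewrite (word0 wk).
      have n0n : (n0 <= n)%N.
        by apply: n0min; rewrite n1; apply/asboolP; exists k => //; split=> //; split=> //; exists n.
      (* A followed loop, continued by a word prefix of [y1], is itself a prefix of every
         sufficiently long word prefix [h'] of [y1]. So [l] and [k] are prefixes of one word and
         hence comparable. *)
      have pre q m : word c m q -> lval (rng q) = rng y1 -> lval (src q) = rng y1 ->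
          (forall j h, word c j h -> extensions (lval h) y1 -> cmp (comp q h) h) ->
          forall j h J h', word c j h -> extensions (lval h) y1 -> word c J h' ->
          extensions (lval h') y1 -> (m + j <= J)%N -> extensions (comp q h) h'.
        move=> wq rq sq perq j h J h' wh hy wh' hy' mjJ.
        have hr x : extensions (lval x) y1 -> src q = rng x.
          by move=> /ext_rng xy; apply: lval_inj; rewrite sq lval_rng xy.
        apply: (word_ext (word_comp wq wh (hr _ hy)) wh' mjJ).
        apply: cmp_shorter (perq J h' wh' hy'); apply/ext_compl; [exact: hr|exact: hr|].
        apply: (word_prefix_le wh wh' _ hy hy'); exact: leq_trans (leq_addl _ _) mjJ.
      have vx : word c 0 (end_of a (rng y1)) by left; exact: end_vertex.
      have vy : extensions (lval (end_of a (rng y1))) y1.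
        by exists y1; rewrite /lval /= ?src_src// src_rng ?comp_rng.
      have kv q : lval (src q) = rng y1 -> comp q (end_of a (rng y1)) = q.
        move=> sq; have -> : end_of a (rng y1) = src q; last exact: comp_src.
        by apply: lval_inj; rewrite sq /lval /= src_rng.
      have [h' [y2 [wh' hy' y1E _]]] := word_prefix_exists ca n y1a.
      have hy1 : extensions (lval h') y1 by exists y2.
      have kh : extensions k h' by rewrite -(kv k sk); apply: (pre k n wk rk sk perk 0%N _ n h') => //; rewrite addn0.
      have lh : extensions l h' by rewrite -(kv l sl); apply: (pre l n0 wl rl sl perl 0%N _ n h') => //; rewrite addn0.
      have [k2 [lk2 kE wk2]] := word_cmp wl wk n0n (ext_cmp lh kh).
      have rk2 : lval (rng k2) = rng y1 by rewrite -lk2.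
      have sk2 : lval (src k2) = rng y1 by rewrite -sk kE src_comp.
      have [j h wh hy||i k2E] := IH (n - n0)%N k2 rk2 sk2 wk2.
      - have kx x : extensions (lval x) y1 -> src k2 = rng x.
          by move=> /ext_rng xy; apply: lval_inj; rewrite sk2 lval_rng xy.
        have lx x : extensions (lval x) y1 -> src l = rng x.
          by move=> /ext_rng xy; apply: lval_inj; rewrite sl lval_rng xy.
        have [H [y3 [wH Hy y1E3 _]]] := word_prefix_exists ca (n + j) y1a.
        have Hy1 : extensions (lval H) y1 by exists y3.
        apply/(@cmp_compl M l); [by rewrite rng_comp//; exact: kx|exact: lx|].
        rewrite compA//; last exact: kx.
        rewrite -kE.
        apply: (@ext_cmp M H); first exact: (pre k n wk rk sk perk j h _ H wh hy wH Hy1).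
        apply: (pre l n0 wl rl sl perl j h _ H wh hy wH Hy1).
        by rewrite leq_add2r.
      - by apply: (@leq_trans n); [rewrite ltn_subrL n00 n1|rewrite -ltnS].
      exists i.+1; rewrite kE k2E; exact.
    have pwr t : t \in s -> exists i, t.2.1 = lpow l i by move=> ts; exact/lp/sP.
    have /choice[ix ixP] : forall t, exists i, t \in s -> t.2.1 = lpow l i.
      by move=> t; have [/pwr[i E]|nt] := boolP (t \in s); [exists i|exists 0%N].
    pose s' := [seq (t.1, (ix t, t.2.2)) | t <- s].
    have s'E : spoly (fun n => Tq (lpow l n)) s' = (Tq g)^# ** c0 ** Tq g.
      rewrite /spoly big_map sE big_seq [RHS]big_seq; apply: eq_bigr => t ts.
      by rewrite /sterm /lterm /side /= -(ixP t ts).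
    have nr : ~ areg (rng l) by rewrite lu; apply: irr; exists y1.
    have nr' := near g; rewrite -s'E in nr'.
    have [h|[n n1 fx]] := loop_case cmax ll wl n00 y1u y1a (kg g) d0 nr' nr.
      by left; rewrite (compressed g y1).
    right; have kbg : katsura X (b ** Tq g) by exact: ideal_mulr.
    have := gauge_case cmax ll wl n00 kbg y1u y1a n1 fx.
    by rewrite lactM lact_dvec// -yE.
  left; have lim' c : olt c a -> exists2 d, olt c d & olt d a.
    move=> ca; apply: contrapT => h; apply: lim; exists c; split => // e ea.
    by have [//|ce] := ole_total e c; case: h; exists e.
  have [g [y1 [gy yE y1a [s [sP sE]]]]] := settle_limit lim' ya c0p.
  apply: (scal g y1 (\sum_(t <- s) t.1)) => //.
  have -> : (\sum_(t <- s) t.1) *: T (src g) = (Tq g)^# ** c0 ** Tq g; last exact: near.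
  rewrite sE scaler_suml big_seq [RHS]big_seq; apply: eq_bigr => t ts.
  have [kv rk] := sP t ts.
  have kE : t.2.1 = src g by apply: lval_inj; rewrite lval_src gy -rk.
  rewrite /lterm /side kE (Tp_v T (src_vertex g)).
  by case: (t.2.2); rewrite ?(Tv_adj HA (src_vertex g)).
have [//|nz] := pselect (lact b (dvec X y) = 0).
apply: inner_eq0; rewrite lact_adj -lactM; apply: nm_le_eps => d d0.
have [|h|//] := small (d / 20); first lra.
by apply: le_trans h _; lra.
Qed.

End Irregular.

(** * The Katsura ideal is generated by the regular vertices *)

(** If [e < t], then [t / e] exceeds 1, and by Bernoulli its [2 ^ n]-th powers grow at least
    linearly in [n], past any [K]. The case [e = 0] is settled by [n = 0]. *)
Lemma root_le (R : realType) (t e K : R) : 0 <= t -> 0 <= e ->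
  (forall n, t ^+ (2 ^ n) <= K * e ^+ (2 ^ n)) -> t <= e.
Proof.
move=> t0 e0 h; have [//|et] := leP t e; exfalso.
have [e_0|en] := eqVneq e 0.
  by have := h 0%N; rewrite e_0 !expr1 mulr0; lra.
have ep : 0 < e by rewrite lt_def en.
pose r := t / e; have r1 : 1 < r by rewrite ltr_pdivlMr ?mul1r.
have bern m : 1 + m%:R * (r - 1) <= r ^+ m.
  elim: m => [|m IH]; first by rewrite mul0r addr0 expr0.
  rewrite exprS -addn1 natrD; have m0 : 0 <= m%:R :> R by [].
  have h0 : r * (1 + m%:R * (r - 1)) <= r * r ^+ m by rewrite ler_wpM2l// ltW// (lt_trans ltr01).
  apply: le_trans h0; have : 0 <= m%:R * (r - 1) ^+ 2 by rewrite mulr_ge0// sqr_ge0.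
  rewrite expr2; move: (m%:R : R) => M; nra.
have [m hm] := @archi R ((r - 1) / (`|K| + 1)) ltac:(by rewrite divr_gt0 ?subr_gt0 ?ltr_wpDl).
have := h m.+1; rewrite -ler_pdivrMr ?exprn_gt0// -expr_div_n -/r => hK.
have := bern (2 ^ m.+1)%N; have lt2 : (m.+1 <= 2 ^ m.+1)%N by exact/ltnW/ltn_expl.
have : m.+1%:R <= (2 ^ m.+1)%:R :> R by rewrite ler_nat.
have M0 : 0 < m.+1%:R :> R by rewrite ltr0n.
move: hm; rewrite ler_pdivlMr ?ltr_wpDl// ler_pdivrMl//.
have := ler_norm K; have := normr_ge0 K.
move: (m.+1%:R : R) ((2 ^ m.+1)%:R : R) (`|K|) (r ^+ _) M0 hK => M N k x *; nra.
Qed.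

Lemma adjoint_bound (R : realType) (A : cstar_alg R) (X : hilbert_module A) (s t : X -> X)
  (e : R) : (forall x y, inner (s x) y = inner x (t y)) -> 0 <= e ->
  (forall z, nm (s z) <= e * nm z) -> forall z, nm (t z) <= 4 * e * nm z.
Proof.
move=> st e0 h z; set w := t z.
have E : nm w ^+ 2 <= 4 * (nm z * (e * nm w)).
  rewrite -nm_inner {2}/w -st -inner_adj nm_adj; apply: le_trans (inner_CS _ _) _.
  by rewrite ler_pM2l// ler_wpM2l ?nm_ge0.
have := nm_ge0 w; have := nm_ge0 z; move: (nm w) (nm z) E => p q E q0 p0.
have [->|pn] := eqVneq p 0; first by rewrite !mulr_ge0.
have pp : 0 < p by rewrite lt_def pn.
rewrite -(ler_pM2r pp); nra.
Qed.

Section AdjointBound.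
Variables (R : realType) (A : cstar_alg R) (X : correspondence A).

Lemma lact_adj_bound (x : A) (e : R) : 0 <= e -> (forall z : X, nm (lact x z) <= e * nm z) ->
  forall z : X, nm (lact x^# z) <= 4 * e * nm z.
Proof. by apply: adjoint_bound => y z; exact: lact_adj. Qed.

Lemma lact_iter (x : A) (e : R) n : 0 <= e -> (forall z : X, nm (lact x z) <= e * nm z) ->
  forall z : X, nm (lact (iter n (fun y : A => y ** y) x) z) <= e ^+ (2 ^ n) * nm z.
Proof.
move=> e0 h; elim: n => [|n IH] z /=; first by rewrite expr1.
rewrite lactM; apply: le_trans (IH _) _.
by rewrite expnS mul2n -addnn exprD -mulrA ler_wpM2l ?exprn_ge0.
Qed.

End AdjointBound.

Section KatsuraRegular.
Variables (R : realType) (L : ograph) (HC : condition_C L) (a : ord).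
Variable A : graph_alg R (lower L a).
Variable X : edge_corr A.
Notation M := (lower L a).
Notation T := (gen A).
Notation Tq := (Tp (gen A)).
Notation Y := (pow_edges L a).

Let HA := gen_family A.

Lemma aunit_lact l (z : X) : antichain l -> nm (lact (aunit A l) z) <= nm z.
Proof.
by move=> al; apply: lact_sa_contr; [exact: aunit_adj|exact: aunit_nm1].
Qed.

Let Tq_bound (g : M) (z : X) : nm (lact (Tq g) z) <= 2 * nm z /\ nm (lact (Tq g)^# z) <= 2 * nm z.
Proof.
have h := Tp_nm1 HA g; have z0 := nm_ge0 z.
have : nm (Tq g) * nm z <= nm z by rewrite ler_piMl.
have := lact_bound (Tq g) z; have := lact_bound (Tq g)^# z; rewrite nm_adj; lra.
Qed.

Let iter_aunit (x : A) l n : antichain l -> aunit A l ** x = x -> x ** aunit A l = x ->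
  aunit A l ** iter n (fun y : A => y ** y) x = iter n (fun y : A => y ** y) x /\
  iter n (fun y : A => y ** y) x ** aunit A l = iter n (fun y : A => y ** y) x.
Proof.
move=> al px xp; elim: n => [//|n [IH1 IH2]] /=.
by rewrite cmulA IH1 -cmulA IH2.
Qed.

Let good_dvec (w : M) : good w -> exists2 y, Y y & rng y = lval w.
Proof.
move=> [[wv sr _] _]; have [f [fw fa]] := sr (lval w) wv (lval_below w).
by exists f => //; rewrite fw vertex_src.
Qed.

(* Compressions of [D^# D] to a good vertex are scalars, on which the left action
   is isometric. *)
Let corner_bound (D : A) (w : M) (e : R) : good w -> 0 <= e -> D ** T w = D ->
  (forall z : X, nm (lact D z) <= e * nm z) -> nm D <= 2 * e.
Proof.
move=> gw e0 Dw hD; have ww := areg_v gw.1.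
rewrite -(@ler_pXn2r _ 2) ?nnegrE ?nm_ge0 ?mulr_ge0// -nm_star.
apply/ler_addgt0Pr => d d0; have d40 : 0 < d / 4 by lra.
have [c hc] := corner HC (D^# ** D) gw d40.
have E : T w ** (D^# ** D) ** T w = D^# ** D.
  by rewrite cmulA -{1}(Tv_adj HA ww) -cadjM Dw -cmulA Dw.
rewrite E in hc; have [y ya yw] := good_dvec gw.
have cT : lact (c *: T w) (dvec X y) = c *: dvec X y.
  rewrite lactZl -(Tp_v T ww) lact_dvec ?(vertex_src ((lval_vertex w).1 ww))//.
  by rewrite -yw comp_rng.
have h1 := lact_bound (D^# ** D - c *: T w) (dvec X y).
rewrite nm_dvec// mulr1 lactBl cT lactM in h1.
have h2 := lact_adj_bound e0 hD (lact D (dvec X y)); have h3 := hD (dvec X y).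
rewrite nm_dvec// mulr1 in h3.
have h4 := nm_le_dist (c *: dvec X y) (lact D^# (lact D (dvec X y))).
rewrite nmZ nm_dvec// mulr1 nmB in h4.
have h5 := nm_le_dist (D^# ** D) (c *: T w); rewrite nmZ in h5.
have w1 : nm (T w) <= 1 by rewrite -(Tp_v T ww); exact: Tp_nm1.
have h6 : cn c * nm (T w) <= cn c by rewrite ler_piMr ?cn_ge0.
have h7 : e * nm (lact D (dvec X y)) <= e * e by rewrite ler_wpM2l.
rewrite exprMn expr2 (expr2 e); lra.
Qed.

(** Cut [x] by a projection of the approximate unit. The power [2 ^ n] of the result is a finite sum
    of corners between good vertices, each at most [8 * E] by [corner_bound] and the bounds 2 for
    the two outer factors. The number of corners does not depend on [n], so [root_le] removes the
    constant. *)
Lemma regideal_sa_bound (x : A) (e : R) : regideal x -> x^# = x -> 0 <= e ->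
  (forall z : X, nm (lact x z) <= e * nm z) -> nm x <= e.
Proof.
move=> rx xs e0 hx; apply/ler_addgt0Pr => d d0; have d20 : 0 < d / 2 by lra.
have [l gl hl] := aunit_approx rx d20; have [al gdl] := gl.
have ps := aunit_adj A l; have pp := aunit_idem A al; have p1 := aunit_nm1 A al.
set p := aunit A l in hl ps pp p1; pose x' := p ** x ** p.
have x's : x'^# = x' by rewrite /x' !cadjM ps xs cmulA.
have hx' (z : X) : nm (lact x' z) <= e * nm z.
  rewrite /x' !lactM; apply: le_trans (aunit_lact _ al) _; apply: le_trans (hx _) _.
  by rewrite ler_wpM2l//; exact: aunit_lact.
have near : nm (x - x') <= d.
  have -> : x - x' = (x - p ** x) + p ** (x - p ** x)^#.
    by rewrite cadjB cadjM ps xs cmulBr cmulA -/x'; zmod.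
  apply: le_trans (nmD _ _) _; have := nmM p (x - p ** x)^#; rewrite !nm_adj => h.
  have := nm_ge0 p.
  have := nm_ge0 (x - p ** x); move: (nm (x - p ** x)) (nm _) (nm _) hl p1 h => u v w *; nra.
suff : nm x' <= e by have := nm_le_dist x x'; lra.
pose K := \sum_(g <- l) \sum_(f <- l) (8 : R).
apply: (@root_le R _ _ K) => // [|n]; first exact: nm_ge0.
rewrite -nm_sa//; set z := iter n _ x'; set E := e ^+ (2 ^ n).
have E0 : 0 <= E by exact: exprn_ge0.
have [pz zp] : p ** z = z /\ z ** p = z.
  by apply: iter_aunit => //; rewrite /x' ?cmulA ?pp// -!cmulA pp.
have hz (w : X) : nm (lact z w) <= E * nm w by exact: lact_iter.
have zE : z = \sum_(g <- l) \sum_(f <- l) Tq g ** ((Tq g)^# ** z ** Tq f) ** (Tq f)^#.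
  rewrite -{1}pz -{1}zp /p {1}/aunit cmul_suml; apply: eq_bigr => g _.
  by rewrite /aunit !cmul_sumr; apply: eq_bigr => f _; rewrite !cmulA.
rewrite {1}zE /K mulr_suml; apply: le_trans (nm_sum _ _ _) _.
rewrite big_seq [leRHS]big_seq; apply: ler_sum => g gl'; rewrite mulr_suml.
apply: le_trans (nm_sum _ _ _) _; rewrite big_seq [leRHS]big_seq; apply: ler_sum => f fl.
have D1 : nm ((Tq g)^# ** z ** Tq f) <= 2 * (4 * E).
  apply: (@corner_bound _ (src f)); [exact: gdl|by rewrite mulr_ge0| |].
    by rewrite -cmulA (Tp_src HA).
  move=> w; rewrite !lactM; have [_ h1] := Tq_bound g (lact z (lact (Tq f) w)).
  have [h2 _] := Tq_bound f w; have h3 := hz (lact (Tq f) w).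
  have : E * nm (lact (Tq f) w) <= E * (2 * nm w) by rewrite ler_wpM2l.
  move: h3 h1; move: (nm (lact z _)) (nm (lact (Tq f) w)) (nm (lact (Tq g)^# _)) (nm w) => r1 r2 r3 r4.
  lra.
have h1 := nmM (Tq g ** ((Tq g)^# ** z ** Tq f)) (Tq f)^#.
have h2 := nmM (Tq g) ((Tq g)^# ** z ** Tq f); rewrite nm_adj in h1.
have := Tp_nm1 HA g; have := Tp_nm1 HA f; have := nm_ge0 (Tq g); have := nm_ge0 (Tq f).
have := nm_ge0 ((Tq g)^# ** z ** Tq f); have := nm_ge0 (Tq g ** ((Tq g)^# ** z ** Tq f)).
move: (nm (_ ** (Tq f)^#)) h1; move: (nm (Tq g ** ((Tq g)^# ** z ** Tq f))) h2 => s h2 t h1.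
move: (nm (Tq g)) (nm (Tq f)) (nm ((Tq g)^# ** z ** Tq f)) D1 h1 h2.
move=> u v w D1 h1 h2 s0 w0 v0 u0 v1 u1.
have : t <= s by apply: le_trans h1 _; rewrite ler_piMr.
have : s <= w by apply: le_trans h2 _; rewrite ler_piMl.
lra.
Qed.

Lemma regideal_bound (x : A) (e : R) : regideal x -> 0 <= e ->
  (forall z : X, nm (lact x z) <= e * nm z) -> nm x <= 2 * e.
Proof.
move=> rx e0 hx; rewrite -(@ler_pXn2r _ 2) ?nnegrE ?nm_ge0 ?mulr_ge0// -nm_star.
have -> : (2 * e) ^+ 2 = 4 * e * e by rewrite exprMn expr2 expr2; ring.
apply: regideal_sa_bound; first exact: regideal_mull.
- by rewrite cadjM cadjK.
- by rewrite !mulr_ge0.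
move=> z; rewrite lactM; apply: le_trans (lact_adj_bound e0 hx _) _.
by rewrite -(mulrA (4 * e)) ler_wpM2l ?mulr_ge0//; exact: hx.
Qed.

Lemma regideal_ker (x : A) : regideal x -> (forall z : X, lact x z = 0) -> x = 0.
Proof.
move=> rx hx; apply: nm_le0; rewrite -(mulr0 2); apply: regideal_bound => // z.
by rewrite hx nm0 mul0r.
Qed.

(** Relation (iv) at level [a], realized on [X]. Both sides have the same inner product with every
    [dvec X y], which determines them. *)
Lemma areg_lact_sum (v : M) : areg v -> exists s : seq L, [/\ uniq s,
  forall f : L, f \in s <-> rng f = lval v /\ Y f &
  forall z : X, lact (T v) z = \sum_(f <- s) theta (dvec X f) (dvec X f) z].
Proof.
move=> rv; have vv := areg_v rv; have [_ _ fin] := rv.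
pose s : seq L := fset_set [set f | rng f = lval v /\ Y f].
have sP (f : L) : f \in s <-> rng f = lval v /\ Y f.
  by rewrite /s in_fset_set//; split=> [/set_mem|h]//; exact: mem_set.
exists s; split=> [|//|z]; first exact: fset_uniq.
 apply/eqP; rewrite -subr_eq0; apply/eqP.
apply: (@dvec_orth_eq0 R L a A X) => y ya.
rewrite innerDl innerNl lact_adj (Tv_adj HA vv) inner_suml.
have tE (f : L) : f \in s -> inner (theta (dvec X f) (dvec X f) z) (dvec X y) =
    if f == y then inner z (dvec X y) else 0.
  move=> /sP[_ fa]; rewrite /theta inner_actl inner_dvec// inner_adj.
  case: eqP => [->|_]; last exact: cmul0r.
  by rewrite -inner_act act_dvec.
rewrite (eq_big_seq _ tE).
have vs : src (lval v) = lval v by apply: vertex_src; exact/lval_vertex.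
have [yv|yv] := pselect (rng y = lval v); last first.
  rewrite -(Tp_v T vv) lact_dvec0 ?inner0r ?sub0r; last by rewrite vs => /esym.
  rewrite big_seq big1 ?oppr0// => f /sP[fv _]; case: eqP => // fy.
  by case: yv; rewrite -fy.
have ys : y \in s by apply/sP.
rewrite (bigD1_seq y)//=; last exact: fset_uniq.
rewrite eqxx big1 ?addr0; last by move=> f /negPf ->.
rewrite -(Tp_v T vv) lact_dvec//; last by rewrite vs.
by rewrite -{1}yv comp_rng subrr.
Qed.

Lemma areg_katsura (v : M) : areg v -> katsura X (T v).
Proof.
move=> rv; split=> [k hk|].
  apply: regideal_ker; first by apply: regideal_mulr; exact: regideal_areg.
  by move=> z; rewrite lactM hk lact0.
have [s [_ _ sE]] := areg_lact_sum rv; apply/compactsP => e e0.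
exists [seq (dvec X f, dvec X f) | f <- s] => z; rewrite sE big_map /= subrr nm0.
by rewrite mulr_ge0 ?nm_ge0// ltW.
Qed.

Lemma regideal_katsura : @regideal R L a A `<=` katsura X.
Proof.
rewrite (regideal_smallest A); apply: smallest_sub; first exact: katsura_closed_ideal.
by move=> _ [v rv <-]; exact: areg_katsura.
Qed.

(** [T (src g)] fixes [dvec X y1] and is a sum of range projections of paths that end at good
    vertices. One of these does not kill [dvec X y1], so its path is a prefix of [y1]. *)
Lemma regular_good (y : L) : Y y -> (exists2 g : M, extensions (lval g) y & areg (src g)) ->
  exists2 e : M, good (src e) & extensions (lval e) y.
Proof.
move=> ya [g [y1 gy yE] rg]; have y1a : Y y1 by apply: (tail_edge gy); rewrite -yE.
have [s [hs sE]] := areg_decomposed A rg.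
have [e es ey] : exists2 e, e \in s & extensions (lval e) y1.
  apply: contrapT => h; have : dvec X y1 = 0.
    have <- : lact (T (src g)) (dvec X y1) = dvec X y1.
      rewrite -(Tp_v T (src_vertex g)) lact_dvec ?lval_src ?src_src//.
      by rewrite gy comp_rng.
    rewrite sE lact_suml big_seq big1// => e es; rewrite lactM lactA_dvec0 ?lact0//.
    by move=> ey; apply: h; exists e.
  by move=> /(congr1 (@nm R X)); rewrite nm0 nm_dvec// => /eqP; rewrite oner_eq0.
have [eg ge] := hs e es; exists (comp g e); first by rewrite src_comp.
by rewrite lval_comp// yE; apply/ext_compl => //; apply/lval_composable.
Qed.

Lemma aunit_dvec l (e : M) (y : L) : aunit A l ** Tq e = Tq e -> Y y -> extensions (lval e) y ->
  lact (aunit A l) (dvec X y) = dvec X y.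
Proof.
move=> le ya [y1 ey yE]; have y1a : Y y1 by apply: (tail_edge ey); rewrite -yE.
by rewrite yE -lact_dvec// -lactM le.
Qed.

(** Take a finite set [F] of edges off which [b] is small. An edge of [F] either has a prefix ending
    at a good vertex, and the antichain is chosen so that its projection fixes the vector of the
    edge, or that vector is killed by [b] through [irregular_kills]. After cutting by the
    complementary projection the components along [F] therefore contribute nothing. *)
Lemma katsura_aunit (b : A) (d : R) : katsura X b -> 0 < d -> exists2 l, gantichain l &
  forall z : X, nm (lact (b - b ** aunit A l) z) <= d * nm z.
Proof.
(* The 8 compensates the factor 2 from [z] to [z'] and the factor 4 from [z'] to [z'']. *)
move=> kb d0; have d80 : 0 < d / 8 by lra.
have [F0 hF0] := compacts_off_finite kb.2 d80.
pose F := undup [seq f <- F0 | `[< Y f >]].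
have FY (f : L) : f \in F -> Y f by rewrite mem_undup mem_filter => /andP[/asboolP].
have hF (z : X) : (forall f : L, f \in F -> inner (dvec X f) z = 0) -> nm (lact b z) <= d / 8 * nm z.
  move=> h; apply: hF0 => f fF; have [fa|nf] := pselect (Y f).
    by apply: h; rewrite mem_undup mem_filter fF andbT; exact/asboolP.
  by rewrite dvec_out// inner0l.
have : forall f : L, exists e : M, Y f -> (exists2 g : M, extensions (lval g) f & areg (src g)) ->
    good (src e) /\ extensions (lval e) f.
  move=> f; have [fa|nf] := pselect (Y f); last by exists (end_of a f).
  have [rf|nr] := pselect (exists2 g : M, extensions (lval g) f & areg (src g)).
    by have [e ge ef] := regular_good fa rf; exists e.
  by exists (end_of a f).
move=> /choice[t tP].
pose reg (f : L) := `[< exists2 g : M, extensions (lval g) f & areg (src g) >].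
have [l gl hl] := @gantichain_add R L a A [::] [seq t f | f <- F & reg f] (gantichain_nil _ _) ltac:(
  by move=> e /mapP[f]; rewrite mem_filter => /andP[/asboolP rf fF] ->; have [] := tP f (FY f fF) rf).
exists l => // z; set p := aunit A l in hl *; pose z' := z - lact p z.
have -> : lact (b - b ** p) z = lact b z' by rewrite lactBl lactM /z' lactB.
have pz : nm (lact p z) <= nm z by apply: aunit_lact; case: gl.
have z'z : nm z' <= 2 * nm z by rewrite /z'; have := nmD z (- lact p z); rewrite nmN; lra.
pose q := \sum_(f <- F) theta (dvec X f) (dvec X f) z'; pose z'' := z' - q.
have ort (f : L) : f \in F -> inner (dvec X f) z'' = 0.
  move=> fF; rewrite /z'' innerDr innerNr /q inner_sumr (bigD1_seq f)//=; last exact: undup_uniq.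
  rewrite big_seq_cond big1 ?addr0 => [|g /andP[gF gf]]; last first.
    rewrite /theta inner_act inner_dvec; [|exact: FY|exact: FY].
    by move: gf; rewrite eq_sym => /negPf ->; rewrite cmul0l.
  rewrite /theta inner_act inner_dvec; [|exact: FY|exact: FY].
  rewrite eqxx -{1}(act_dvec X f) inner_actl.
  by rewrite (Tv_adj HA) ?subrr//; exact: end_vertex.
have z''z' : nm z'' <= 4 * nm z'.
  have E : nm z'' ^+ 2 <= 4 * (nm z' * nm z'').
    rewrite -nm_inner {1}/z'' innerDl innerNl /q inner_suml big_seq big1 ?subr0.
      exact: inner_CS.
    by move=> f fF; rewrite /theta inner_actl ort ?cmul0r.
  have := nm_ge0 z''; have := nm_ge0 z'; move: (nm z'') (nm z') E => u v E v0 u0.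
  have [->|un] := eqVneq u 0; first by rewrite mulr_ge0.
  by have up : 0 < u; [rewrite lt_def un|rewrite -(ler_pM2r up); nra].
have -> : lact b z' = lact b z''.
  rewrite /z'' lactB /q lact_sum big_seq big1 ?subr0// => f fF; have fa := FY f fF.
  rewrite /theta lact_act; have [rf|nr] := pselect (exists2 g : M, extensions (lval g) f & areg (src g)).
    have [_ ef] := tP f fa rf.
    have pf : lact p (dvec X f) = dvec X f.
      by apply: (aunit_dvec _ fa ef); apply: hl; rewrite map_f// mem_filter fF andbT; exact/asboolP.
    have -> : inner (dvec X f) z' = 0.
      rewrite /z' innerDr innerNr lact_adjr aunit_adj -/p pf subrr//.
    exact: act0r.
  rewrite (irregular_kills kb fa) ?act0l// => g gf rg; apply: nr.
  by exists g.
apply: le_trans (hF z'' ort) _; have z0 := nm_ge0 z; nra.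
Qed.

(** The elements [b ** aunit A (l n)] lie in the ideal and form a Cauchy sequence, because on the
    ideal the norm is controlled by the left action. Their limit [w] acts like [b], so [(b - w)^#]
    is in the kernel of the action, which [b - w] annihilates as an element of the Katsura ideal.
    Hence [(b - w) ** (b - w)^# = 0]. *)
Lemma katsura_regideal : katsura X `<=` @regideal R L a A.
Proof.
move=> b kb; have /choice[l hl] : forall n : nat, exists l, gantichain l /\
    forall z : X, nm (lact (b - b ** aunit A l) z) <= n.+1%:R^-1 * nm z.
  by move=> n; have [|l gl h] := @katsura_aunit b n.+1%:R^-1 kb; [rewrite invr_gt0 ltr0n|exists l].
pose x n := b ** aunit A (l n).
have rx n : regideal (x n) by apply: regideal_mull; apply: aunit_regideal; case: (hl n).
have dist n m : nm (x n - x m) <= 2 * (n.+1%:R^-1 + m.+1%:R^-1).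
  apply: regideal_bound.
  - by rewrite addrC -scaleN1r; exact: regideal_lin.
  - by rewrite addr_ge0 ?invr_ge0.
  move=> z; have -> : x n - x m = (b - x m) - (b - x n) by zmod.
  rewrite lactBl; apply: le_trans (nmD _ _) _; rewrite nmN mulrDl addrC.
  by apply: lerD; [case: (hl n) => _; apply|case: (hl m) => _; apply].
have [w xw] : exists w, tends x w.
  apply: complete_seq => e e0; have [|N hN] := @archi R (e / 4); first by lra.
  exists N => n m Nn Nm; apply: le_trans (dist n m) _.
  have := le_invS R Nn; have := le_invS R Nm; move: hN.
  by move: (n.+1%:R^-1) (m.+1%:R^-1) (N.+1%:R^-1) => r1 r2 r3; lra.
have rw : regideal w by apply: regideal_closed; exact: tends_adh rx xw.
have ker (z : X) : lact (b - w) z = 0.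
  apply: nm_le_eps => e e0; pose q := e / (4 * (nm z + 1)).
  have z0 := nm_ge0 z; have q0 : 0 < q by rewrite divr_gt0//; lra.
  have [N hN] := archi q0; have [K hK] := xw q q0; pose n := maxn N K.
  have -> : b - w = (b - x n) + (x n - w) by zmod.
  rewrite lactDl; apply: le_trans (nmD _ _) _.
  have h1 : nm (lact (b - x n) z) <= n.+1%:R^-1 * nm z by case: (hl n) => _; apply.
  have h2 := lact_bound (x n - w) z.
  have h3 : nm (x n - w) <= q by apply: hK; exact: leq_maxr.
  have h4 : n.+1%:R^-1 <= q.
    by apply: le_trans hN; apply: le_invS; exact: leq_maxl.
  have qE : q * (4 * (nm z + 1)) = e by rewrite divfK// lt0r_neq0//; lra.
  have : n.+1%:R^-1 * nm z <= q * nm z by rewrite ler_wpM2r.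
  have : nm (x n - w) * nm z <= q * nm z by rewrite ler_wpM2r.
  have := mulr_ge0 (ltW q0) z0; move: h1 h2 qE; move: (n.+1%:R^-1 : R) => r.
  by move: (nm (x n - w)) (nm (lact _ z)) (nm (lact _ z)) (nm z) => r1 r2 r3 r4; lra.
have kw : katsura X (b - w).
  rewrite addrC -scaleN1r; apply: (ideal_lin (katsura_closed_ideal X)) => //.
  exact: regideal_katsura.
have bw : (b - w)^# = 0.
  apply: star_eq0; rewrite cadjK; apply: kw.1 => z; apply: inner_eq0.
  by rewrite lact_adj cadjK ker inner0r.
have : b - w = 0 by rewrite -[b - w]cadjK bw cadj0.
by move=> /eqP; rewrite subr_eq0 => /eqP ->.
Qed.

Lemma katsuraE : katsura X = @regideal R L a A.
Proof. by apply/seteqP; split; [exact: katsura_regideal|exact: regideal_katsura]. Qed.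

End KatsuraRegular.

(** * Covariance *)

Section FiniteRank.
Variables (R : realType) (A B : cstar_alg R) (X : correspondence A).
Variables (psi : X -> B) (pi : A -> B).
Hypothesis HR : representation psi pi.

Definition franks (s : seq (X * X)) (z : X) : X := \sum_(p <- s) theta p.1 p.2 z.
Definition psis (s : seq (X * X)) : B := \sum_(p <- s) psi p.1 ** (psi p.2)^#.
Let swap (s : seq (X * X)) := [seq (p.2, p.1) | p <- s].

Lemma repD x y : psi (x + y) = psi x + psi y.
Proof. by rewrite -[x]scale1r (rep_lin HR) !scale1r. Qed.

Lemma rep0 : psi 0 = 0.
Proof. by have /(congr1 (fun x => x - psi 0)) := repD 0 0; rewrite addr0 subrr addrK. Qed.

Lemma repB x y : psi (x - y) = psi x - psi y.
Proof. by apply/esym/eqP; rewrite subr_eq -repD subrK. Qed.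

Let psiZ c x : psi (c *: x) = c *: psi x.
Proof. by rewrite -[c *: x]addr0 (rep_lin HR) rep0 addr0. Qed.

Let psi_sum I (s : seq I) (F : I -> X) : psi (\sum_(i <- s) F i) = \sum_(i <- s) psi (F i).
Proof. exact: (big_morph psi repD rep0). Qed.

Lemma rep_nm x : nm (psi x) <= nm x.
Proof.
rewrite -(@ler_pXn2r _ 2) ?nnegrE ?nm_ge0// -nm_star (rep_inner HR) -nm_inner.
exact: (hom_contr (rep_hom HR)).
Qed.

Lemma psis_psi s z : psis s ** psi z = psi (franks s z).
Proof.
rewrite cmul_suml psi_sum; apply: eq_bigr => p _.
by rewrite -cmulA (rep_inner HR) (rep_act HR).
Qed.

Lemma franks_swap s x y : inner (franks s x) y = inner x (franks (swap s) y).
Proof.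
rewrite inner_suml inner_sumr big_map; apply: eq_bigr => p _.
by rewrite /theta /= inner_actl inner_adj inner_act.
Qed.

Lemma psis_swap s : psis (swap s) = (psis s)^#.
Proof.
by rewrite /psis cadj_sum big_map; apply: eq_bigr => p _; rewrite cadjM cadjK.
Qed.

Lemma franks_comb c s t : exists r, psis r = c *: psis s + psis t /\
  forall z, franks r z = c *: franks s z + franks t z.
Proof.
exists ([seq (c *: p.1, p.2) | p <- s] ++ t); rewrite /psis /franks big_cat big_map /=.
split=> [|z].
  by congr (_ + _); rewrite scaler_sumr; apply: eq_bigr => p _; rewrite psiZ cmulZl.
rewrite big_cat big_map /=; congr (_ + _); rewrite scaler_sumr; apply: eq_bigr => p _.
by rewrite /theta actZl.
Qed.

Lemma franksB s x y : franks s (x - y) = franks s x - franks s y.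
Proof.
rewrite -sumrB; apply: eq_bigr => p _.
by rewrite /theta innerDr innerNr actDr -scaleN1r actZr scaleN1r.
Qed.

Lemma franks_bounded s : exists2 K : R, 0 <= K & forall z, nm (franks s z) <= K * nm z.
Proof.
exists (\sum_(p <- s) 4 * (nm p.1 * nm p.2)) => [|z].
  by apply: sumr_ge0 => p _; rewrite !mulr_ge0 ?nm_ge0.
rewrite mulr_suml; apply: le_trans (nm_sum _ _ _) _; apply: ler_sum => p _.
apply: le_trans (nm_act _ _) _; have h := inner_CS p.2 z.
have : nm p.1 * nm (inner p.2 z) <= nm p.1 * (4 * (nm p.2 * nm z)) by rewrite ler_wpM2l ?nm_ge0.
by rewrite /theta; move: (nm p.1) (nm p.2) (nm z) (nm (inner _ _)) h => r1 r2 r3 r4 *; lra.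
Qed.

Let impl (w : B) (E : R) := forall z, exists2 z', w ** psi z = psi z' & nm z' <= E * nm z.

Let impl_mul v w E F : 0 <= E -> impl v E -> impl w F -> impl (v ** w) (E * F).
Proof.
move=> E0 hv hw z; have [z1 e1 b1] := hw z; have [z2 e2 b2] := hv z1.
exists z2; first by rewrite -cmulA e1.
by apply: le_trans b2 _; rewrite -mulrA ler_wpM2l.
Qed.

(* The powers of [psis s ^# ** psis s] are again of the form [u ** psis s], where [u] acts
   on the range of [psi] through operators whose norms are powers of the given bound; the
   constant lost in estimating the last factor disappears under [2 ^ n]-th roots. *)
Lemma psis_bound s (e : R) : 0 < e -> (forall z, nm (franks s z) <= e * nm z) ->
  nm (psis s) <= 2 * e.
Proof.
move=> e0 hs; set k := psis s; set S := k^# ** k.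
have Ssa : S^# = S by rewrite cadjM cadjK.
pose E := 4 * e * e; have E0 : 0 < E by rewrite !mulr_gt0.
have iS : impl S E.
  move=> z; exists (franks (swap s) (franks s z)).
    by rewrite -cmulA psis_psi -psis_swap psis_psi.
  apply: le_trans (adjoint_bound (franks_swap s) (ltW e0) hs _) _.
  by rewrite /E -(mulrA (4 * e)) ler_wpM2l ?mulr_ge0// ltW.
suff SE : nm S <= E.
  rewrite -(@ler_pXn2r _ 2) ?nnegrE ?nm_ge0 ?(mulr_ge0 _ (ltW e0))// -nm_star.
  by apply: le_trans SE _; rewrite exprMn !expr2 /E; lra.
rewrite -(@ler_pXn2r _ 2) ?nnegrE ?nm_ge0 ?(ltW E0)//.
pose K1 := \sum_(p <- s) nm p.2 * nm p.1.
apply: (@root_le R _ _ (K1 * nm k / E)) => [||n].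
- by rewrite exprn_ge0 ?nm_ge0.
- by rewrite exprn_ge0 ?ltW.
rewrite -nm_star -nm_sa; last by rewrite !cadjM !cadjK.
rewrite Ssa; set G := (E ^+ 2) ^+ (2 ^ n).
have [u [zu iu _]] : exists u, [/\ iter n (fun y : B => y ** y) (S ** S) = u ** S,
    impl u (G / E) & impl (iter n (fun y : B => y ** y) (S ** S)) G].
  rewrite /G; elim: (n) => {G n} [|n [u [zu iu iz]]] /=.
    exists S; split=> //; first by rewrite expn0 expr1 expr2 mulfK// lt0r_neq0.
    by rewrite expn0 expr1 expr2; apply: impl_mul => //; exact: ltW.
  have G0 : 0 <= (E ^+ 2) ^+ (2 ^ n) by rewrite !exprn_ge0 ?ltW.
  rewrite expnS mul2n -addnn exprD; exists (iter n (fun y : B => y ** y) (S ** S) ** u); split.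
  - by rewrite {2}zu cmulA.
  - by rewrite -mulrA; exact: impl_mul.
  - exact: impl_mul.
rewrite zu /S cmulA; apply: le_trans (nmM _ _) _.
have -> : K1 * nm k / E * G = (G / E * K1) * nm k by rewrite -!mulrA; ring.
rewrite ler_wpM2r ?nm_ge0// -psis_swap /psis big_map cmul_sumr /K1 mulr_sumr.
apply: le_trans (nm_sum _ _ _) _; apply: ler_sum => p _ /=; rewrite cmulA mulrA.
apply: le_trans (nmM _ _) _; rewrite nm_adj.
have [z' -> bz] := iu p.2.
by apply: ler_pM; rewrite ?nm_ge0 ?rep_nm//; apply: le_trans (rep_nm _) bz.
Qed.

Lemma compacts_hom_franks (P : (X -> X) -> B) s : compacts_hom psi P -> P (franks s) = psis s.
Proof.
move=> hP; elim: s => [|[x y] s IH].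
  rewrite /psis big_nil; have := compacts_hom_theta hP 0 0; rewrite rep0 cmul0l => <-.
  by congr P; apply/funext => z; rewrite /franks big_nil /theta act0l.
have cs : compacts (franks s).
  apply/compactsP => e e0; exists s => z.
  by rewrite subrr nm0 mulr_ge0 ?nm_ge0// ltW.
rewrite /psis big_cons -/(psis s) -IH -(compacts_hom_theta hP) -[P (theta x y)]scale1r.
rewrite -(compacts_hom_lin hP)//; last exact: compacts_theta.
by congr P; apply/funext => z; rewrite /franks big_cons scale1r.
Qed.

(** The graph of [(psi, pi)^(1)]: simultaneous approximation of an operator and of its image by
    finite ranks. [psis_bound] makes it single-valued and completeness makes it defined on all
    compact operators, so the algebraic properties need no choice of approximants. *)
Definition is_phi (t : X -> X) (b : B) := forall e : R, 0 < e -> exists s,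
  (forall z, nm (t z - franks s z) <= e * nm z) /\ nm (b - psis s) <= e.

Let close_psis (t : X -> X) s s' (e e' : R) : 0 < e -> 0 < e' ->
  (forall z, nm (t z - franks s z) <= e * nm z) ->
  (forall z, nm (t z - franks s' z) <= e' * nm z) -> nm (psis s - psis s') <= 2 * (e + e').
Proof.
move=> e0 e'0 h h'; have [r [rE rf]] := franks_comb (-1) s' s.
rewrite scaleN1r addrC in rE; rewrite -rE; apply: psis_bound => [|z]; first exact: addr_gt0.
rewrite rf scaleN1r; have -> : - franks s' z + franks s z = (t z - franks s' z) - (t z - franks s z).
  by zmod.
apply: le_trans (nmD _ _) _; rewrite nmN; have := h z; have := h' z; lra.
Qed.

Lemma is_phi_exists t : compacts t -> exists b, is_phi t b.
Proof.
move=> /compactsP ct.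
have /choice[s hs] : forall n : nat, exists s, forall z, nm (t z - franks s z) <= n.+1%:R^-1 * nm z.
  by move=> n; apply: ct; rewrite invr_gt0.
have [b xb] : exists b, tends (fun n => psis (s n)) b.
  apply: complete_seq => e e0; have [|N hN] := @archi R (e / 4); first by lra.
  exists N => n m Nn Nm; apply: le_trans (close_psis _ _ (hs n) (hs m)) _; rewrite ?invr_gt0//.
  have := le_invS R Nn; have := le_invS R Nm; move: hN.
  by move: (n.+1%:R^-1) (m.+1%:R^-1) (N.+1%:R^-1) => r1 r2 r3; lra.
exists b => e e0; have [N hN] := archi e0; have [K hK] := xb e e0.
exists (s (maxn N K)); split=> [z|]; last by rewrite nmB; apply: hK; exact: leq_maxr.
apply: le_trans (hs _ _) _; rewrite ler_wpM2r ?nm_ge0//; apply: le_trans hN.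
by apply: le_invS; exact: leq_maxl.
Qed.

Lemma is_phi_unique t b b' : is_phi t b -> is_phi t b' -> b = b'.
Proof.
move=> h h'; apply: nm_eq_eps => e e0; have e60 : 0 < e / 6 by lra.
have [s [s1 s2]] := h _ e60; have [s' [s1' s2']] := h' _ e60.
have := close_psis e60 e60 s1 s1'; have := nm_distD (psis s) b b'.
have := nm_distD (psis s') (psis s) b'; rewrite (nmB (psis s') b'); lra.
Qed.

Lemma is_phi_ext t t' b : t =1 t' -> is_phi t b -> is_phi t' b.
Proof.
by move=> tt h e /h[s [hs bs]]; exists s; split=> // z; rewrite -tt.
Qed.

Lemma is_phi_franks s : is_phi (franks s) (psis s).
Proof.
move=> e e0; exists s; split=> [z|]; rewrite subrr nm0 ?mulr_ge0 ?nm_ge0//; exact: ltW.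
Qed.

Lemma is_phi_lin (c : R[i]) s t b d : is_phi s b -> is_phi t d ->
  is_phi (fun x => c *: s x + t x) (c *: b + d).
Proof.
move=> hs ht e e0; have c0 := cn_ge0 c; pose q := e / (cn c + 1).
have q0 : 0 < q by rewrite divr_gt0//; lra.
have qE : q * (cn c + 1) = e by rewrite divfK// lt0r_neq0//; lra.
have [s1 [f1 b1]] := hs q q0; have [s2 [f2 b2]] := ht q q0.
have [r [rE rf]] := franks_comb c s1 s2; exists r; split=> [z|].
  rewrite rf; have -> : c *: s z + t z - (c *: franks s1 z + franks s2 z) =
      c *: (s z - franks s1 z) + (t z - franks s2 z) by rewrite scalerBr opprD addrACA.
  apply: le_trans (nmD _ _) _; rewrite nmZ -qE mulrDr mulr1 mulrDl; apply: lerD; last exact: f2.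
  by rewrite (mulrC q) -mulrA ler_wpM2l.
rewrite rE; have -> : c *: b + d - (c *: psis s1 + psis s2) =
    c *: (b - psis s1) + (d - psis s2) by rewrite scalerBr opprD addrACA.
apply: le_trans (nmD _ _) _; rewrite nmZ -qE mulrDr mulr1; apply: lerD => //.
by rewrite mulrC ler_wpM2r.
Qed.

Lemma is_phi_comp s t b d : is_phi s b -> is_phi t d -> is_phi (s \o t) (b ** d).
Proof.
move=> hs ht e e0; have d0 := nm_ge0 d.
have [M M0 hM] : exists2 M : R, 0 <= M & forall z, nm (t z) <= M * nm z.
  have [r [fr _]] := ht 1 ltr01; have [K K0 hK] := franks_bounded r.
  exists (K + 1) => [|z]; first by lra.
  by have := nm_le_dist (t z) (franks r z); have := fr z; have := hK z; lra.
pose q := e / (2 * (M + nm d + 1)).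
have qE : q * (2 * (M + nm d + 1)) = e by rewrite divfK// lt0r_neq0//; lra.
have q0 : 0 < q by rewrite divr_gt0//; lra.
have [s1 [f1 b1]] := hs q q0; have [K K0 hK] := franks_bounded s1.
have k0 := nm_ge0 (psis s1); pose p := e / (2 * (K + nm (psis s1) + 1)).
have pE : p * (2 * (K + nm (psis s1) + 1)) = e by rewrite divfK// lt0r_neq0//; lra.
have p0 : 0 < p by rewrite divr_gt0//; lra.
have [s2 [f2 b2]] := ht p p0; pose r := [seq (franks s1 u.1, u.2) | u <- s2].
have rE : psis r = psis s1 ** psis s2.
  by rewrite {1}/psis big_map cmul_sumr; apply: eq_bigr => u _; rewrite -psis_psi cmulA.
have rf z : franks r z = franks s1 (franks s2 z).
  rewrite /franks big_map /=.
  transitivity (\sum_(u <- s2) franks s1 (theta u.1 u.2 z)).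
    apply: eq_bigr => u _; rewrite {1}/theta /franks.
    rewrite (big_morph (fun x => act x (inner u.2 z)) (fun x y => actDl x y _) (act0l X _)).
    by apply: eq_bigr => v _; rewrite /theta inner_act actM.
  rewrite /franks exchange_big /=; apply: eq_bigr => v _.
  by rewrite /theta inner_sumr (big_morph _ (actDr v.1) (act0r v.1)).
have qd : 0 <= q * nm d by rewrite mulr_ge0// ltW.
have pK : 0 <= p * K by rewrite mulr_ge0// ltW.
have qM : 0 <= q * M by rewrite mulr_ge0// ltW.
have pk : 0 <= p * nm (psis s1) by rewrite mulr_ge0// ltW.
exists r; split=> [z|].
  rewrite rf /=; have -> : s (t z) - franks s1 (franks s2 z) =
    (s (t z) - franks s1 (t z)) + franks s1 (t z - franks s2 z) by rewrite franksB; zmod.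
  apply: le_trans (nmD _ _) _.
  have h1 : nm (s (t z) - franks s1 (t z)) <= q * (M * nm z).
    by apply: le_trans (f1 _) _; rewrite ler_wpM2l// ltW.
  have h2 : nm (franks s1 (t z - franks s2 z)) <= K * (p * nm z).
    by apply: le_trans (hK _) _; rewrite ler_wpM2l.
  have z0 := nm_ge0 z; have h3 : (q * M + p * K) * nm z <= e * nm z by rewrite ler_wpM2r//; lra.
  by apply: le_trans (lerD h1 h2) _; apply: le_trans h3; rewrite mulrDl mulrA (mulrCA K) mulrA.
rewrite rE; have -> : b ** d - psis s1 ** psis s2 =
    (b - psis s1) ** d + psis s1 ** (d - psis s2) by rewrite cmulBl cmulBr; zmod.
apply: le_trans (nmD _ _) _.
have h1 : nm ((b - psis s1) ** d) <= q * nm d by apply: le_trans (nmM _ _) _; rewrite ler_wpM2r.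
have h2 : nm (psis s1 ** (d - psis s2)) <= p * nm (psis s1).
  by apply: le_trans (nmM _ _) _; rewrite mulrC ler_wpM2r.
lra.
Qed.

Lemma is_phi_adj s t b : (forall x y, inner (s x) y = inner x (t y)) ->
  is_phi s b -> is_phi t b^#.
Proof.
move=> st hs e e0; have e40 : 0 < e / 4 by lra.
have [s1 [f1 b1]] := hs _ e40; exists (swap s1); split=> [z|]; last first.
  by rewrite psis_swap -cadjB nm_adj; lra.
have -> : e = 4 * (e / 4) by lra.
apply: (@adjoint_bound R A X (fun x => s x - franks s1 x) (fun x => t x - franks (swap s1) x)).
- by move=> x y; rewrite innerDl innerNl innerDr innerNr st franks_swap.
- exact: ltW.
- exact: f1.
Qed.

Lemma is_phi_lact a t b : is_phi t b -> is_phi (@lact R A X a \o t) (pi a ** b).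
Proof.
move=> ht e e0; have a0 := nm_ge0 a; pose q := e / (2 * nm a + nm (pi a) + 1).
have p0 := nm_ge0 (pi a).
have qE : q * (2 * nm a + nm (pi a) + 1) = e by rewrite divfK// lt0r_neq0//; lra.
have q0 : 0 < q by rewrite divr_gt0//; lra.
have h1 : 0 <= q * nm a by rewrite mulr_ge0// ltW.
have h2 : 0 <= q * nm (pi a) by rewrite mulr_ge0// ltW.
have [s [f1 b1]] := ht q q0; exists [seq (lact a p.1, p.2) | p <- s]; split=> [z|].
  have -> : franks [seq (lact a p.1, p.2) | p <- s] z = lact a (franks s z).
    by rewrite /franks big_map lact_sum; apply: eq_bigr => u _; rewrite /theta lact_act.
  rewrite /= -lactB; apply: le_trans (lact_bound _ _) _; have z0 := nm_ge0 z.
  have h3 : nm a * nm (t z - franks s z) <= nm a * (q * nm z) by rewrite ler_wpM2l.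
  have h4 : (2 * (q * nm a)) * nm z <= e * nm z by rewrite ler_wpM2r//; lra.
  by move: h3 h4; move: (nm a) (nm (_ - _)) (nm z) => r1 r2 r3; lra.
have -> : psis [seq (lact a p.1, p.2) | p <- s] = pi a ** psis s.
  by rewrite /psis big_map cmul_sumr; apply: eq_bigr => u _; rewrite -(rep_lact HR) cmulA.
rewrite -cmulBr; apply: le_trans (nmM _ _) _.
have : nm (pi a) * nm (b - psis s) <= nm (pi a) * q by rewrite ler_wpM2l.
lra.
Qed.

Definition Phi (t : X -> X) : B := xget 0 [set b | is_phi t b].

Lemma PhiE t b : is_phi t b -> Phi t = b.
Proof. move=> h; apply: is_phi_unique (h); exact: (@xgetPex _ 0 [set b | is_phi t b] (ex_intro _ b h)). Qed.

Lemma is_phi_Phi t : compacts t -> is_phi t (Phi t).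
Proof. by move=> /is_phi_exists[b h]; rewrite (PhiE h). Qed.

Lemma Phi_compacts_hom : compacts_hom psi Phi.
Proof.
split=> [x y|c s t cs ct|s t cs ct|s t cs ct st]; apply: PhiE.
- have := is_phi_franks [:: (x, y)]; rewrite /psis big_seq1 /=; apply: is_phi_ext => z.
  by rewrite /franks big_seq1.
- by apply: is_phi_lin; exact: is_phi_Phi.
- by apply: is_phi_comp; exact: is_phi_Phi.
- by apply: is_phi_adj st _; exact: is_phi_Phi.
Qed.

Definition covariant_at : set A := [set x | is_phi (@lact R A X x) (pi x)].

(** The covariance identity cuts out a closed ideal, so it has to be checked only on generators of
    the Katsura ideal. Left multiplication is [is_phi_lact], and right multiplication follows by
    adjoints. *)
Lemma covariant_ideal : closed_ideal covariant_at.
Proof.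
have piH := rep_hom HR.
have adjc x : covariant_at x -> covariant_at x^#.
  by rewrite /covariant_at /= (star_hom_adj piH); apply: is_phi_adj => y z; exact: lact_adj.
have mulc y x : covariant_at x -> covariant_at (y ** x).
  move=> hx; rewrite /covariant_at /= (star_homM piH).
  by apply: is_phi_ext (is_phi_lact y hx) => z /=; rewrite lactM.
split=> //.
- rewrite /covariant_at /= (hom0 piH) => e e0; exists [::].
  rewrite /psis big_nil subrr nm0; split; last exact: ltW.
  by move=> z; rewrite lact0l /franks big_nil subrr nm0 mulr_ge0 ?nm_ge0// ltW.
- move=> c x y hx hy; rewrite /covariant_at /= (star_hom_lin piH).
  by apply: is_phi_ext (is_phi_lin c hx hy) => z; rewrite lact_lin.
- by move=> y x hx; rewrite -[x ** y]cadjK cadjM; apply/adjc/mulc/adjc.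
apply/closed_adh => x hx e e0; have e30 : 0 < e / 3 by lra.
have [y hy xy] := hx _ e30; have [s [fs bs]] := hy _ e30; exists s; split=> [z|].
  have -> : lact x z - franks s z = lact (x - y) z + (lact y z - franks s z).
    by rewrite lactBl; zmod.
  apply: le_trans (nmD _ _) _; have := lact_bound (x - y) z; have := fs z.
  have : nm (x - y) * nm z <= e / 3 * nm z by rewrite ler_wpM2r ?nm_ge0.
  by move: (nm (x - y)) (nm z) (nm (lact _ _)) (nm (lact _ _ - _)) => r1 r2 r3 r4; lra.
have := nm_distD (pi y) (pi x) (psis s); have := hom_contr piH (x - y).
by rewrite (homB piH); lra.
Qed.

Lemma covariant_sub : katsura X `<=` covariant_at -> covariant_representation psi pi.
Proof.
by move=> h; split=> //; exists Phi; split; [exact: Phi_compacts_hom|move=> a /h/PhiE].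
Qed.

End FiniteRank.

(** * The representation of [X_a] at the next level *)

Section SuccRepresentation.
Variables (R : realType) (L : ograph) (HC : condition_C L) (a : ord).
Variables (A : graph_alg R (lower L a)) (X : edge_corr A).
Notation M := (lower L a).
Notation N := (lower L (osucc a)).
Notation Y := (pow_edges L a).

Let HA := gen_family A.

Lemma ole_succ : ole a (osucc a).
Proof. by apply/oltW/olt_osucc; exact: ole_refl. Qed.

Definition up (g : M) : N := lmk (below_lt ole_succ (lval_below g)).

Lemma lval_up g : lval (up g) = lval g.
Proof. exact: lval_mk. Qed.

Lemma up_generator g : generator g -> generator (up g).
Proof. by move=> gg; apply: generator_lval; rewrite lval_up; exact: lval_generator. Qed.

Lemma pow_below_succ y : Y y -> below L (osucc a) y.
Proof. by apply: pow_below; apply/olt_osucc; exact: ole_refl. Qed.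

Lemma up_end (e : N) : up (end_of a (lval e)) = src e.
Proof. by apply: lval_inj; rewrite lval_up lval_src. Qed.

Lemma succ_edges_sum (V : nmodType) (G : L -> V) (v : M) (s : seq L) : uniq s ->
  (forall f : L, f \in s <-> rng f = lval v /\ Y f) ->
  \sum_(e \in [set f : N | rng f = up v /\ pow_edges N a f]) G (lval e) = \sum_(f <- s) G f.
Proof.
move=> us sP; pose t := [seq insubd (up v) f | f <- s].
have tE f : f \in s -> lval (insubd (up v) f) = f.
  move=> /sP[_ fa]; rewrite /lval val_insubd ifT//; apply/mem_set; exact: pow_below_succ.
have ut : uniq t.
  by rewrite map_inj_in_uniq// => f g fs gs /(congr1 (@lval L _)); rewrite !tE.
have -> : [set f | rng f = up v /\ pow_edges N a f] = [set` t].
  apply/seteqP; split=> e.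
    move=> [ev ea]; have fs : lval e \in s.
      by apply/sP; split=> //; rewrite -lval_rng ev lval_up.
    by apply/mapP; exists (lval e) => //; apply: lval_inj; rewrite tE.
  move=> /= /mapP[f fs ->]; have [fv fa] := (sP f).1 fs; split.
    by apply: lval_inj; rewrite -[LHS]/(lval (rng _)) lval_rng tE// lval_up.
  by rewrite /pow_edges /= -/(lval _) tE.
by rewrite -fsbig_seq// big_map; apply: eq_big_seq => f fs; rewrite tE.
Qed.

(** The identities for [psi] are all checked on the vectors [act (dvec X y) b], whose span is dense.
    The proof divides by the absolute value of [K] plus 1, as no sign of [K] is assumed. *)
Lemma dvec_additive_eq0 (V : normedModType R[i]) (F : X -> V) (K : R) :
  (forall x y, F (x - y) = F x - F y) -> (forall x, nm (F x) <= K * nm x) ->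
  (forall y b, F (act (dvec X y) b) = 0) -> forall x, F x = 0.
Proof.
move=> FB Fb F0 x; apply: nm_le_eps => e e0; pose q := e / (`|K| + 1).
have K0 := normr_ge0 K; have q0 : 0 < q by rewrite divr_gt0//; lra.
have [_ [s ->] h] := dvec_span x q0; set z := \sum_(p <- s) _ in h.
have FN u : F (- u) = - F u.
  have F00 : F 0 = 0 by rewrite -[X in F X](subrr (0 : X)) FB subrr.
  by rewrite -sub0r FB F00 sub0r.
have Fz : F z = 0.
  rewrite /z; elim: s {z h} => [|p s IH]; first by rewrite big_nil -(subrr (0 : X)) FB subrr.
  by rewrite big_cons -[X in _ + X]opprK FB FN IH F0 oppr0 subr0.
have -> : F x = F (x - z) by rewrite FB Fz subr0.
have qE : q * (`|K| + 1) = e by rewrite divfK// lt0r_neq0//; lra.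
apply: le_trans (Fb _) _; have := nm_ge0 (x - z); have := ler_norm K; nra.
Qed.

Variables (B : graph_alg R N) (rho : A -> B) (psi : X -> B).
Hypothesis Hrho : lower_hom2 rho.
Hypothesis Hpsi : is_psi rho psi.
Notation S := (Tp (gen B)).

Let HB := gen_family B.
Let rhoH := Hrho.1.

Lemma rho_gen g : generator g -> rho (gen A g) = S (up g).
Proof.
by move=> gg; rewrite (Hrho.2 g (up g)) ?lval_up// Tp_gen//; exact: up_generator.
Qed.

Let psiD x y : psi (x + y) = psi x + psi y.
Proof. by have [h _ _] := Hpsi; rewrite -[x]scale1r h !scale1r. Qed.

Let psiB x y : psi (x - y) = psi x - psi y.
Proof. by apply/esym/eqP; rewrite subr_eq -psiD subrK. Qed.

Let psi0 : psi 0 = 0.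
Proof. by rewrite -(subrr (0 : X)) psiB subrr. Qed.

Let psi_act_edge (e : edge L a) b : psi (act (dvec X (val e)) b) =
  gen B (edge_up e) ** rho (gen A (edge_src e) ** b).
Proof.
rewrite dvec_edge -(iota_act X b (delta_cc A e)); have [_ _ ->] := Hpsi; last first.
  have [fd Td] := delta_cc A e; split; last by move=> f; rewrite cmulA Td.
  by apply: sub_finite_set fd => f /= h d0; apply: h; rewrite d0 cmul0l.
rewrite -(@fsbig_widen _ _ _ _ [set e] setT)//=; last first.
  by move=> g [_] /= /eqP/negPf ge; rewrite /delta ge cmul0l (hom0 rhoH) cmul0r.
by rewrite fsbig_set1 /delta eqxx.
Qed.

Let psi_act_dvec1 (e : N) b : Y (lval e) -> psi (act (dvec X (lval e)) b) = S e ** rho b.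
Proof.
move=> ya; pose ee : edge L a := exist _ (lval e) (mem_set ya).
have eg : generator e by apply: generator_lval; right; exists a.
rewrite (psi_act_edge ee) (star_homM rhoH) cmulA; congr (_ ** _).
have -> : edge_up ee = e by exact: lval_inj.
rewrite edge_end rho_gen ?up_end; last by left; exact: end_vertex.
by rewrite -Tp_gen// (Tp_v _ (src_vertex e)) (Tp_src HB).
Qed.

Lemma psi_dvec (e : N) : Y (lval e) -> psi (dvec X (lval e)) = S e.
Proof.
move=> ya; rewrite -act_dvec psi_act_dvec1// rho_gen; last by left; exact: end_vertex.
by rewrite up_end (Tp_v _ (src_vertex e)) (Tp_src HB).
Qed.

Let psi_act_dvec y b : psi (act (dvec X y) b) = psi (dvec X y) ** rho b.
Proof.
have [ya|ny] := pselect (Y y); last by rewrite dvec_out// act0l psi0 cmul0l.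
rewrite -(lval_mk (pow_below_succ ya)) psi_act_dvec1 ?psi_dvec ?lval_mk//.
Qed.

Let inner_dvec_rho y f : (psi (dvec X y))^# ** psi (dvec X f) = rho (inner (dvec X y) (dvec X f)).
Proof.
have [ya|ny] := pselect (Y y); last by rewrite dvec_out// inner0l psi0 cadj0 cmul0l (hom0 rhoH).
have [fa|nf] := pselect (Y f); last by rewrite (dvec_out _ nf) inner0r psi0 cmul0r (hom0 rhoH).
rewrite inner_dvec// -{1}(lval_mk (pow_below_succ ya)) -{1}(lval_mk (pow_below_succ fa)).
set u := lmk _; set v := lmk _.
have uE : lval u = y by exact: lval_mk.
have vE : lval v = f by exact: lval_mk.
rewrite !psi_dvec ?uE ?vE//; case: eqP => [yf|yf].
  have -> : v = u by apply: lval_inj; rewrite uE vE.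
  rewrite (Tp_star HB) rho_gen; last by left; exact: end_vertex.
  by rewrite -uE up_end Tp_v//; exact: src_vertex.
rewrite (hom0 rhoH) (Tp_orth HB)// => /lval_cmp; rewrite uE vE => yfc.
apply: yf; apply: cmp_eq yfc _; exact: oeq_trans ya (oeq_sym fa).
Qed.

Let psi_sum (s : seq (L * A)) : psi (\sum_(p <- s) act (dvec X p.1) p.2) =
  \sum_(p <- s) psi (dvec X p.1) ** rho p.2.
Proof. by rewrite (big_morph psi psiD psi0); apply: eq_bigr => p _. Qed.

Let inner_span (s t : seq (L * A)) :
  let x := \sum_(p <- s) act (dvec X p.1) p.2 in let y := \sum_(p <- t) act (dvec X p.1) p.2 in
  (psi x)^# ** psi y = rho (inner x y).
Proof.
rewrite /= !psi_sum cadj_sum cmul_suml inner_suml (hom_sum rhoH); apply: eq_bigr => p _.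
rewrite cmul_sumr inner_sumr (hom_sum rhoH); apply: eq_bigr => q _.
rewrite inner_act inner_actl !(star_homM rhoH) (star_hom_adj rhoH) -inner_dvec_rho cadjM.
by rewrite !cmulA.
Qed.

(** What is given is continuity of [psi]. On the span, [inner_span] makes it norm decreasing, and
    continuity transfers this to the closure. *)
Let psi_nm x : nm (psi x) <= nm x.
Proof.
apply/ler_addgt0Pr => e e0; have e20 : 0 < e / 2 by lra.
have /nbhs_nm[d d0 hd] : nbhs x (psi @^-1` ball (psi x) (e / 2)%:C).
  have [_ cpsi _] := Hpsi; apply: cpsi; apply: nbhsx_ballx.
  by rewrite ltcR.
pose q := Num.min (d / 2) (e / 2).
have q0 : 0 < q by rewrite lt_min; apply/andP; split; lra.
have [_ [s ->] h] := dvec_span x q0; set z := \sum_(p <- s) _ in h.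
have [h1 h2] : nm (x - z) <= d / 2 /\ nm (x - z) <= e / 2.
  by move: h; rewrite le_min => /andP[].
have h3 : nm (psi x - psi z) < e / 2.
  by apply/ball_nm; apply: hd; apply: le_lt_trans h1 _; lra.
have h4 : nm (psi z) <= nm z.
  rewrite -(@ler_pXn2r _ 2) ?nnegrE ?nm_ge0// -nm_star inner_span -nm_inner.
  exact: hom_contr.
have := nm_le_dist (psi x) (psi z); have := nm_le_dist z x; rewrite (nmB z x); lra.
Qed.

Let psi_act x b : psi x ** rho b = psi (act x b).
Proof.
apply/eqP; rewrite -subr_eq0; apply/eqP.
apply: (@dvec_additive_eq0 B (fun x => psi x ** rho b - psi (act x b)) (2 * nm b)).
- move=> y z; rewrite psiB cmulBl actDl -(scaleN1r z) actZl scaleN1r psiB; zmod.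
- move=> y; apply: le_trans (nmD _ _) _; rewrite nmN.
  have h1 := nmM (psi y) (rho b); have h2 := psi_nm (act y b); have h3 := nm_act y b.
  have h4 : nm (psi y) * nm (rho b) <= nm y * nm b.
    by apply: ler_pM; rewrite ?nm_ge0 ?psi_nm// (hom_contr rhoH).
  lra.
by move=> y c; rewrite -actM !psi_act_dvec (star_homM rhoH) cmulA subrr.
Qed.

Let psi_inner x y : (psi x)^# ** psi y = rho (inner x y).
Proof.
have bound u v : nm ((psi u)^# ** psi v - rho (inner u v)) <= 5 * (nm u * nm v).
  apply: le_trans (nmD _ _) _; rewrite nmN.
  have h1 := nmM (psi u)^# (psi v); rewrite nm_adj in h1.
  have h2 := hom_contr rhoH (inner u v); have h3 := inner_CS u v.
  have h4 : nm (psi u) * nm (psi v) <= nm u * nm v by apply: ler_pM; rewrite ?nm_ge0 ?psi_nm.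
  lra.
have step f b v : (psi (act (dvec X f) b))^# ** psi v = rho (inner (act (dvec X f) b) v).
  apply/eqP; rewrite -subr_eq0; apply/eqP; set w := act _ b.
  apply: (@dvec_additive_eq0 B (fun v => (psi w)^# ** psi v - rho (inner w v)) (5 * nm w)).
  - by move=> y' z; rewrite psiB cmulBr innerDr innerNr (homB rhoH); zmod.
  - by move=> z; rewrite -mulrA; exact: bound.
  move=> f' b'; have := inner_span [:: (f, b)] [:: (f', b')].
  by rewrite /= !big_seq1 /= => ->; rewrite subrr.
apply/eqP; rewrite -subr_eq0; apply/eqP.
apply: (@dvec_additive_eq0 B (fun x => (psi x)^# ** psi y - rho (inner x y)) (5 * nm y)).
- by move=> y' z; rewrite psiB cadjB cmulBl innerDl innerNl (homB rhoH); zmod.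
- by move=> z; rewrite -mulrA (mulrC (nm y)); exact: bound.
by move=> f b; rewrite step subrr.
Qed.

Let intertwines (b : A) := forall x, rho b ** psi x = psi (lact b x).

Let intertwines_dvec b : (forall y, Y y -> rho b ** psi (dvec X y) = psi (lact b (dvec X y))) ->
  intertwines b.
Proof.
move=> h x; apply/eqP; rewrite -subr_eq0; apply/eqP.
apply: (@dvec_additive_eq0 B (fun x => rho b ** psi x - psi (lact b x)) (3 * nm b)).
- by move=> y z; rewrite psiB cmulBr lactB psiB; zmod.
- move=> y; apply: le_trans (nmD _ _) _; rewrite nmN.
  have h1 := nmM (rho b) (psi y); have h2 := psi_nm (lact b y); have h3 := lact_bound b y.
  have h4 : nm (rho b) * nm (psi y) <= nm b * nm y.
    by apply: ler_pM; rewrite ?nm_ge0 ?psi_nm// (hom_contr rhoH).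
  lra.
move=> y c; have [ya|ny] := pselect (Y y); last first.
  by rewrite dvec_out// act0l lact0 psi0 cmul0r subrr.
by rewrite lact_act -!psi_act -h// cmulA subrr.
Qed.

Let intertwines_gen g : generator g -> intertwines (gen A g).
Proof.
move=> gg; apply: intertwines_dvec => y ya; rewrite rho_gen// -(Tp_gen HA gg).
have yE := lval_mk (pow_below_succ ya); set v := lmk _ in yE; rewrite -yE psi_dvec ?yE//.
have [gy|gy] := pselect (src (lval g) = rng y).
  have uv : src (up g) = rng v by apply/lval_composable; rewrite lval_up yE.
  rewrite lact_dvec// -(TpM HB)// -psi_dvec lval_comp// lval_up yE//.
  by apply: pow_edges_comp => //; exact: lval_below.
rewrite lact_dvec0// psi0 -(Tp_src HB) -(Tp_rng HB v) !cmulA -(cmulA (S (up g))).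
rewrite (@Torth R L (osucc a) B) ?cmul0r ?cmul0l//; [exact: src_vertex|exact: rng_vertex|].
by move=> /lval_composable; rewrite lval_up yE.
Qed.

Let intertwines_adj_gen g : generator g -> intertwines (gen A g)^#.
Proof.
move=> gg; apply: intertwines_dvec => y ya; rewrite (star_hom_adj rhoH) rho_gen// -(Tp_gen HA gg).
have yE := lval_mk (pow_below_succ ya); set v := lmk _ in yE; rewrite -yE psi_dvec ?yE//.
have [gv|gv] := pselect (extensions (up g) v).
  have [w gw vE] := gv; have wE : comp (lval g) (lval w) = y by rewrite -(lval_up g) -lval_comp// -vE.
  have gwl : src (lval g) = rng (lval w) by rewrite -(lval_up g); apply/lval_composable.
  have wa : Y (lval w) by apply: (pow_edges_tail gwl (lval_below g)); rewrite wE.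
  by rewrite -wE lactA_dvec// psi_dvec// vE (Tp_ext HB).
rewrite lactA_dvec0 ?psi0//; last by rewrite -(lval_up g) -yE; move=> /lval_ext.
apply: (Tp_orth HB) => -[//|[w vw gE]]; apply: (@olt_irr (opow a)).
have := lval_below g; apply: ole_olt_trans; apply: ole_trans ya.2 _; rewrite -yE -(lval_up g).
by apply: ext_deg; apply/lval_ext; exists w.
Qed.

(** [graph_alg_ind] asks for closure under [^#], so the property is proved for [b] and [b^#]
    together. *)
Let psi_lact b x : rho b ** psi x = psi (lact b x).
Proof.
suff [//] : intertwines b /\ intertwines b^#.
move: b {x}; apply: graph_alg_ind.
- by rewrite cadj0; split=> x; rewrite (hom0 rhoH) cmul0l lact0l psi0.
- have lin (c : R[i]) u v : intertwines u -> intertwines v -> intertwines (c *: u + v).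
    have [plin _ _] := Hpsi.
    by move=> hu hv x; rewrite (star_hom_lin rhoH) cmul_linl hu hv lact_lin plin.
  by move=> c u v [hu hu'] [hv hv']; rewrite cadj_lin; split; exact: lin.
- have mul u v : intertwines u -> intertwines v -> intertwines (u ** v).
    by move=> hu hv x; rewrite (star_homM rhoH) -cmulA hv hu lactM.
  by move=> u v [hu hu'] [hv hv']; rewrite cadjM; split; exact: mul.
- by move=> u [hu hu']; rewrite cadjK.
- have lim u : adh intertwines u -> intertwines u.
    move=> hu x; apply: nm_eq_eps => e e0; pose q := e / (3 * (nm x + 1)); have x0 := nm_ge0 x.
    have qE : q * (3 * (nm x + 1)) = e by rewrite divfK// lt0r_neq0//; lra.
    have q0 : 0 < q by rewrite divr_gt0//; lra.
    have [v hv uv] := hu q q0.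
    have -> : rho u ** psi x - psi (lact u x) = rho (u - v) ** psi x - psi (lact (u - v) x).
      by rewrite (homB rhoH) cmulBl hv lactBl psiB; zmod.
    apply: le_trans (nmD _ _) _; rewrite nmN.
    have h1 := nmM (rho (u - v)) (psi x); have h2 := psi_nm (lact (u - v) x).
    have h3 := lact_bound (u - v) x.
    have h4 : nm (rho (u - v)) * nm (psi x) <= nm (u - v) * nm x.
      by apply: ler_pM; rewrite ?nm_ge0 ?psi_nm// (hom_contr rhoH).
    have h5 : nm (u - v) * nm x <= q * nm x by rewrite ler_wpM2r.
    lra.
  move=> u hu; split; apply: lim.
    by move=> e /hu[v [hv _] uv]; exists v.
  by move=> e /hu[v [_ hv] uv]; exists v^# => //; rewrite -cadjB nm_adj.
- by move=> g gg; split; [exact: intertwines_gen|exact: intertwines_adj_gen].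
Qed.

Lemma psi_representation : representation psi rho.
Proof. by split=> //; have [plin _ _] := Hpsi. Qed.

Lemma areg_sum (v : M) (s : seq L) : areg v -> uniq s ->
  (forall f : L, f \in s <-> rng f = lval v /\ Y f) ->
  rho (gen A v) = \sum_(f <- s) psi (dvec X f) ** (psi (dvec X f))^#.
Proof.
move=> rv us sP; have vv := areg_v rv; rewrite (rho_gen (or_introl vv)) Tp_v; last first.
  by apply/lval_vertex; rewrite lval_up; apply/lval_vertex.
rewrite (family_sum HB (a := a)); last first.
  by apply/lval_regular; [apply/olt_osucc; exact: ole_refl|rewrite lval_up].
rewrite -(succ_edges_sum (fun f => psi (dvec X f) ** (psi (dvec X f))^#) us sP).
apply: eq_fsbigr => e; rewrite inE => -[_ ea].
by rewrite psi_dvec// Tp_gen//; apply: generator_lval; right; exists a.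
Qed.

Lemma psi_covariant : covariant_representation psi rho.
Proof.
apply: (covariant_sub psi_representation); rewrite (katsuraE HC X) (regideal_smallest A).
apply: smallest_sub; first exact: (covariant_ideal psi_representation).
move=> _ [v rv <-]; have [s [us sP sE]] := areg_lact_sum X rv.
rewrite /covariant_at /= (areg_sum rv us sP).
have := is_phi_franks psi [seq (dvec X f, dvec X f) | f <- s].
rewrite /psis big_map; apply: is_phi_ext => z.
by rewrite /franks big_map sE.
Qed.

End SuccRepresentation.

(** * The Cuntz-Pimsner algebra of [X_a] *)

Section CuntzPimsner.
Variables (R : realType) (L : ograph) (HC : condition_C L) (a : ord).
Variables (A : graph_alg R (lower L a)) (X : edge_corr A) (OX : cuntz_pimsner X).
Notation M := (lower L a).
Notation N := (lower L (osucc a)).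
Notation Y := (pow_edges L a).
Notation T := (gen A).
Notation p := (@cp_mod R A X OX).
Notation q := (@cp_coef R A X OX).

Let HA := gen_family A.
Let HR : representation p q := (cp_covariant OX).1.
Let qH : star_hom q := rep_hom HR.

(** By [gen_cases] a generator of the next lower graph has degree [omega ^ a] or a smaller one, so
    the two branches, module and coefficient algebra, cover all generators. *)
Definition cp_gen (e : N) : OX :=
  if `[< Y (lval e) >] then p (dvec X (lval e)) else q (T (low a (lval e))).

Let U_Y e : Y (lval e) -> cp_gen e = p (dvec X (lval e)).
Proof. by move=> ya; rewrite /cp_gen asboolT. Qed.

Let below_nY y : below L a y -> ~ Y y.
Proof. by move=> yb [_ ya]; apply: (@olt_irr (opow a)); exact: ole_olt_trans ya yb. Qed.

Let U_below e : below L a (lval e) -> cp_gen e = q (T (low a (lval e))).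
Proof. by move=> /below_nY ny; rewrite /cp_gen asboolF. Qed.

Let gen_cases (e : N) : generator e -> Y (lval e) \/ below L a (lval e) /\ generator (low a (lval e)).
Proof.
move=> /lval_generator gl.
suff : Y (lval e) \/ below L a (lval e).
  by move=> [?|eb]; [left|right; split=> //; exact: low_generator].
case: (gl) => [vv|[b eb]]; first by right; exact: vertex_below.
have ba : ole b a.
  apply/olt_osucc; apply: opow_lt_inv; apply: ole_olt_trans eb.2 _; exact: lval_below.
have [ab|ba'] := ole_total a b; last by right; exact: pow_below eb.
by left; apply: pow_edges_eq eb.
Qed.

Let U_src e : cp_gen (src e) = q (T (end_of a (lval e))).
Proof. by rewrite U_below lval_src ?low_src//; apply: vertex_below; exact: src_vertex. Qed.

Let U_star e : generator e -> (cp_gen e)^# ** cp_gen e = cp_gen (src e).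
Proof.
move=> /gen_cases[ya|[eb ge]]; rewrite U_src.
  by rewrite U_Y// (rep_inner HR) inner_dvec// eqxx.
by rewrite U_below// -(star_hom_adj qH) -(star_homM qH) (family_src HA ge) src_low.
Qed.

Let U_pisom e : generator e -> cp_gen e ** (cp_gen e)^# ** cp_gen e = cp_gen e.
Proof.
move=> ge; rewrite -cmulA U_star// U_src; have [ya|[eb ge']] := gen_cases ge.
  by rewrite U_Y// (rep_act HR) act_dvec.
by rewrite U_below// -(star_homM qH) -(src_low eb) (Tg_src HA ge').
Qed.

Let U_comp e f : generator e -> generator f -> src e = rng f -> olt (deg e) (deg f) ->
  cp_gen e ** cp_gen f = cp_gen (comp e f).
Proof.
move=> ge gf ef df; have efl : src (lval e) = rng (lval f) by exact/lval_composable.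
have [ya|[eb ge']] := gen_cases ge.
  have [fa|[fb _]] := gen_cases gf; exfalso.
    by apply: (@olt_le_false _ _ df); exact: ole_trans fa.1 ya.2.
  apply: (@olt_irr (opow a)); apply: ole_olt_trans ya.2 _; exact: olt_trans df fb.
have [fa|[fb gf']] := gen_cases gf.
  have lE := low_val eb; have cY : Y (lval (comp e f)).
    by rewrite lval_comp//; apply: pow_edges_comp.
  rewrite U_below// !U_Y// (rep_lact HR) -(Tp_gen HA ge') lact_dvec ?lE//.
  by rewrite lval_comp.
have cb : below L a (lval (comp e f)) by rewrite lval_comp//; apply: below_comp.
have ll : src (low a (lval e)) = rng (low a (lval f)).
  by apply/lval_composable; rewrite !low_val.
rewrite !U_below// -(star_homM qH) (family_comp HA ge' gf')//.
  by congr (q (T _)); apply: lval_inj; rewrite lval_comp// !low_val// lval_comp.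
by rewrite -[deg _]/(deg (lval (low a (lval e)))) -[deg (low a (lval f))]/(deg (lval (low a (lval f)))) !low_val.
Qed.

Let U_orth1 e f : generator (low a (lval e)) -> below L a (lval e) -> Y (lval f) -> ~ cmp e f ->
  (cp_gen e)^# ** cp_gen f = 0.
Proof.
move=> ge eb fa ef; rewrite U_below// U_Y// -(star_hom_adj qH) (rep_lact HR) -(Tp_gen HA ge).
rewrite lactA_dvec0 ?(rep0 HR)//.
by move=> efx; apply: ef; left; apply/lval_ext; rewrite low_val in efx.
Qed.

Let U_orth e f : generator e -> generator f -> extensions e `&` extensions f = set0 ->
  (cp_gen e)^# ** cp_gen f = 0.
Proof.
move=> ge gf ef; have ncmp : ~ cmp e f by move=> /cmp_exts[x]; rewrite ef.
have [ya|[eb ge']] := gen_cases ge; have [fa|[fb gf']] := gen_cases gf.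
- rewrite !U_Y// (rep_inner HR) inner_dvec//; case: eqP => [yf|_]; last by rewrite (hom0 qH).
  by case: ncmp; rewrite (lval_inj yf); left; exact: ext_refl.
- rewrite -[LHS]cadjK cadjM cadjK U_orth1 ?cadj0//; first by move=> /cmp_sym.
- exact: U_orth1.
rewrite !U_below// -(star_hom_adj qH) -(star_homM qH) (family_orth HA)// ?(hom0 qH)//.
by apply: lower_disjoint; rewrite !low_val//; exact: lower_disjoint'.
Qed.

(** For [b = a] this is covariance at the vertex element, which acts as a finite sum of [theta]
    operators by [areg_lact_sum]; for [b < a] it is the image under [q] of the relation in
    [O(L_a)]. *)
Let U_sum b v : regular b v ->
  cp_gen v = \sum_(e \in [set f | rng f = v /\ pow_edges N b f]) cp_gen e ** (cp_gen e)^#.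
Proof.
move=> rv; have vv : is_vertex v by case: rv.
have bs := lower_regular rv; have rl := (lval_regular v bs).1 rv.
have vb : below L a (lval v) by apply: vertex_below; exact/lval_vertex.
have vE : up (low a (lval v)) = v by apply: lval_inj; rewrite lval_up low_val.
have [ab|ba] := ole_total a b.
  have Eab : oeq a b by split=> //; exact/olt_osucc.
  have ra : areg (low a (lval v)) by rewrite /areg low_val//; exact: regular_le rl.
  have [s [us sP sE]] := areg_lact_sum X ra.
  have -> : [set f | rng f = v /\ pow_edges N b f] =
      [set f | rng f = up (low a (lval v)) /\ pow_edges N a f].
    by rewrite vE; apply/seteqP; split=> f [fv fb]; split=> //; apply: pow_edges_eq fb => //; exact: oeq_sym.
  rewrite (eq_fsbigr (fun f => p (dvec X (lval f)) ** (p (dvec X (lval f)))^#)); last first.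
    by move=> f; rewrite inE => -[_ fa]; rewrite U_Y.
  rewrite (succ_edges_sum (fun f => p (dvec X f) ** (p (dvec X f))^#) us sP) U_below//.
  have [P [Phom Pk]] := (cp_covariant OX).2; rewrite -Pk; last exact: areg_katsura.
  have -> : lact (T (low a (lval v))) = franks [seq (dvec X f, dvec X f) | f <- s].
    by apply/funext => z; rewrite sE /franks big_map.
  by rewrite (compacts_hom_franks HR _ Phom) /psis big_map.
have rA : regular b (low a (lval v)) by apply/(lval_regular _ ba); rewrite low_val.
rewrite U_below// (family_sum HA rA) hom_fsum//; last by case: rA.
rewrite [RHS](reindex_fsbig (@up L a) [set f | rng f = low a (lval v) /\ pow_edges M b f]); last first.
  split=> [f [fv fb]|f g _ _ /(congr1 (@lval L _))|e [ev eb]].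
  - split; last by rewrite -[pow_edges _ _ _]/(pow_edges L b (lval (up f))) lval_up.
    by apply: lval_inj; rewrite lval_rng lval_up -lval_rng fv low_val.
  - by rewrite !lval_up; exact: lval_inj.
  have bel : below L a (lval e) by exact: pow_below eb.
  exists (low a (lval e)); last by apply: lval_inj; rewrite lval_up low_val.
  split; first by apply: lval_inj; rewrite lval_rng !low_val// -lval_rng ev.
  by rewrite -[pow_edges _ _ _]/(pow_edges L b (lval (low a (lval e)))) low_val.
apply: eq_fsbigr => f _; rewrite (star_homM qH) (star_hom_adj qH) U_below lval_up; last exact: lval_below.
by have -> : low a (lval f) = f by apply: lval_inj; rewrite low_val//; exact: lval_below.
Qed.

Lemma cp_gen_family : graph_family cp_gen.
Proof. by split; [exact: U_pisom|move=> e /U_star|exact: U_comp|exact: U_orth|exact: U_sum]. Qed.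

Variables (B : graph_alg R N) (rho : A -> B) (psi : X -> B).
Hypothesis Hrho : lower_hom2 rho.
Hypothesis Hpsi : is_psi rho psi.

(** The inverse [k] comes from [cp_gen_family], and both composites are the identity by uniqueness
    in the universal properties. For [k] after [h] this needs [k (psi x) = p x], which is checked on
    the vectors [act (dvec X y) b] and extended by boundedness. *)
Lemma induced_hom_bijective : exists h : OX -> B, induced_hom psi rho h /\ bijective h.
Proof.
have psicov := psi_covariant HC Hrho Hpsi; have HP := psicov.1; have rhoH := Hrho.1.
have HB := gen_family B; have [h [[hH hp hq] _]] := cp_universal OX psicov.
have [k [[kH kg] _]] := gen_universal B cp_gen_family.
exists h; split=> //.
have idH (C : cstar_alg R) : star_hom (fun x : C => x) by [].
have compH (C D E : cstar_alg R) (f : C -> D) (g : D -> E) : star_hom f -> star_hom g ->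
    star_hom (fun x => g (f x)).
  move=> fH gH; split=> [c x y|x y|x].
  - by rewrite (star_hom_lin fH) (star_hom_lin gH).
  - by rewrite (star_homM fH) (star_homM gH).
  - by rewrite (star_hom_adj fH) (star_hom_adj gH).
have hk : (fun x => h (k x)) = (fun x => x).
  apply: graph_hom_eq; [exact: compH|exact: idH|move=> e ge; rewrite kg//].
  have [ya|[eb ge']] := gen_cases ge; first by rewrite U_Y// hp (psi_dvec Hrho Hpsi)// (Tp_gen HB ge).
  rewrite U_below// hq (rho_gen Hrho)//.
  by have -> : up (low a (lval e)) = e; [apply: lval_inj; rewrite lval_up low_val|rewrite (Tp_gen HB ge)].
have krho x : k (rho x) = q x.
  suff h0 : (fun x => k (rho x)) = q by rewrite -h0.
  apply: graph_hom_eq => //; first exact: compH.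
  move=> g gg; rewrite (rho_gen Hrho gg) (Tp_gen HB); last exact: up_generator.
  rewrite kg; last exact: up_generator.
  rewrite U_below lval_up; last exact: lval_below.
  by have -> : low a (lval g) = g by apply: lval_inj; rewrite low_val//; exact: lval_below.
have kpsi x : k (psi x) = p x.
  apply/eqP; rewrite -subr_eq0; apply/eqP.
  apply: (@dvec_additive_eq0 R L a A X OX (fun x => k (psi x) - p x) 2).
  - by move=> y z; rewrite (repB HP) (homB kH) (repB HR); zmod.
  - move=> y; apply: le_trans (nmD _ _) _; rewrite nmN.
    by have := hom_contr kH (psi y); have := rep_nm HP y; have := rep_nm HR y; lra.
  move=> y b; have [ya|ny] := pselect (Y y); last first.
    by rewrite dvec_out// act0l (rep0 HP) (rep0 HR) (hom0 kH) subrr.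
  rewrite -(rep_act HP) -(rep_act HR) (star_homM kH) krho.
  have yE := lval_mk (pow_below_succ ya); set v := lmk _ in yE.
  have gv : generator v by apply: generator_lval; right; exists a; rewrite yE.
  by rewrite -yE (psi_dvec Hrho Hpsi) ?yE// (Tp_gen HB gv) kg// U_Y yE// subrr.
have kh : (fun x => k (h x)) = (fun x => x).
  have [g [_ gU]] := cp_universal OX (cp_covariant OX).
  rewrite -(gU (fun x => k (h x))) -1?(gU (fun x => x))//; split=> //; first exact: compH.
    by move=> x; rewrite hp kpsi.
  by move=> x; rewrite hq krho.
by exists k => x; [exact: (congr1 (@^~ x) kh)|exact: (congr1 (@^~ x) hk)].
Qed.

End CuntzPimsner.

Theorem theorem5p3 (R : realType) (L : ograph) (HC : condition_C L)
  (OL : graph_alg R L)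
  (O : forall a : ord, graph_alg R (lower L a))
  (rho : forall a : ord, O a -> OL)
  (Hrho : forall a : ord, lower_hom (rho a))
  (rho2 : forall a b : ord, O a -> O b)
  (Hrho2 : forall a b : ord, ole a b -> lower_hom2 (rho2 a b))
  (X : forall a : ord, edge_corr (O a))
  (psi : forall a : ord, X a -> O (osucc a))
  (Hpsi : forall a : ord, is_psi (rho2 a (osucc a)) (psi a))
  (OX : forall a : ord, cuntz_pimsner (X a))
  (a : ord) :
  [/\ injective (rho a),
      katsura (X a) =
        smallest (@closed_ideal R (O a))
          [set gen (O a) v | v in [set v : lower L a | regular a (lval v)]],
      covariant_representation (psi a) (rho2 a (osucc a))
    & exists h : OX a -> O (osucc a),
        induced_hom (psi a) (rho2 a (osucc a)) h /\ bijective h].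
Proof.
have H2 := Hrho2 a (osucc a) (ole_succ a); split.
- exact: (rho_inj HC (Hrho a)).
- by rewrite (katsuraE HC (X a)) (regideal_smallest (O a)).
- exact: (psi_covariant HC H2 (Hpsi a)).
- exact: (induced_hom_bijective HC (OX a) H2 (Hpsi a)).
Qed.
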